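(* Suppose $\kappa$ is weakly compact and ${\rm GCH}$ holds. Then there is a cofinality-preserving forcing extension in which $\kappa$ has the strict Levinski property and remains weakly compact.
   Context: A cardinal $\kappa$ has the Levinski property if $\kappa$ is the least regular cardinal such that $2^\kappa=\kappa^+$. It has the strict Levinski property if it has the Levinski property and moreover $2^\delta=\delta^{++}$ for each regular cardinal $\delta<\kappa$ and $2^\delta=\delta^+$ for each regular cardinal $\delta\ge\kappa$. *)

(* Defs.v *)
(* Set theory is treated over an arbitrary structure [(M, E)], [E] being the
   membership relation, that satisfies the first-order axioms of ZFC. *)

(* An interpretation of the language {∈, =}: a domain, a type of truth values
   and the meaning of the logical symbols.  A set-theoretic notion written
   polymorphically in [I : interp] can be read both as truth in [(M, E)]
   ([truth]) and as "the set of conditions forcing it" ([forcing]). *)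
Record interp := Interp {
  dom : Type;
  tv : Type;
  vmem : dom -> dom -> tv;
  veq : dom -> dom -> tv;
  vfalse : tv;
  vimp : tv -> tv -> tv;
  vand : tv -> tv -> tv;
  vor : tv -> tv -> tv;
  vall : (dom -> tv) -> tv;
  vex : (dom -> tv) -> tv
}.

Arguments vmem {_} _ _.
Arguments veq {_} _ _.
Arguments vfalse {_}.
Arguments vimp {_} _ _.
Arguments vand {_} _ _.
Arguments vor {_} _ _.
Arguments vall {_} _.
Arguments vex {_} _.

Declare Scope set_scope.
Delimit Scope set_scope with st.

Notation "x ∈ y" := (vmem x y) (at level 70) : set_scope.
Notation "x ≐ y" := (veq x y) (at level 70) : set_scope.
Notation "f ⇒ g" := (vimp f g) (at level 99, right associativity) : set_scope.
Notation "f ∧ g" := (vand f g) (at level 80, right associativity) : set_scope.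
Notation "f ∨ g" := (vor f g) (at level 85, right associativity) : set_scope.
Notation "¬ f" := (vimp f vfalse) (at level 75, right associativity) : set_scope.
Notation "f ⇔ g" := (vand (vimp f g) (vimp g f)) (at level 95) : set_scope.
Notation "∀ x .. y , f" := (vall (fun x => .. (vall (fun y => f)) ..))
  (at level 200, x binder, y binder, right associativity) : set_scope.
Notation "∃ x .. y , f" := (vex (fun x => .. (vex (fun y => f)) ..))
  (at level 200, x binder, y binder, right associativity) : set_scope.

Open Scope set_scope.

Definition subset {I : interp} (x y : dom I) : tv I :=
  ∀ z, z ∈ x ⇒ z ∈ y.

Definition is_empty {I : interp} (x : dom I) : tv I :=
  ∀ z, ¬ z ∈ x.

(* z = {x, y} *)
Definition is_upair {I : interp} (z x y : dom I) : tv I :=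
  ∀ w, w ∈ z ⇔ (w ≐ x ∨ w ≐ y).

(* z = (x, y), Kuratowski *)
Definition is_opair {I : interp} (z x y : dom I) : tv I :=
  ∃ a b, is_upair a x x ∧ is_upair b x y ∧ is_upair z a b.

(* (x, y) ∈ f *)
Definition opair_in {I : interp} (x y f : dom I) : tv I :=
  ∃ z, is_opair z x y ∧ z ∈ f.

(* (x, (y, z)) ∈ f *)
Definition triple_in {I : interp} (x y z f : dom I) : tv I :=
  ∃ u, is_opair u y z ∧ opair_in x u f.

(* s = x ∪ {x} *)
Definition is_succ {I : interp} (s x : dom I) : tv I :=
  ∀ w, w ∈ s ⇔ (w ∈ x ∨ w ≐ x).

Definition is_powerset {I : interp} (p x : dom I) : tv I :=
  ∀ z, z ∈ p ⇔ subset z x.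

Definition is_function {I : interp} (f a b : dom I) : tv I :=
  (∀ z, z ∈ f ⇒ ∃ x y, x ∈ a ∧ y ∈ b ∧ is_opair z x y) ∧
  (∀ x, x ∈ a ⇒ ∃ y, opair_in x y f ∧ ∀ y', opair_in x y' f ⇒ y' ≐ y).

Definition is_bijection {I : interp} (f a b : dom I) : tv I :=
  is_function f a b ∧
  (∀ x x' y, opair_in x y f ⇒ opair_in x' y f ⇒ x ≐ x') ∧
  (∀ y, y ∈ b ⇒ ∃ x, opair_in x y f).

Definition equinumerous {I : interp} (a b : dom I) : tv I :=
  ∃ f, is_bijection f a b.

Definition transitive {I : interp} (x : dom I) : tv I :=
  ∀ y, y ∈ x ⇒ subset y x.

Definition ordinal {I : interp} (x : dom I) : tv I :=
  transitive x ∧ ∀ y, y ∈ x ⇒ transitive y.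

Definition limit_ordinal {I : interp} (x : dom I) : tv I :=
  ordinal x ∧ (∃ y, y ∈ x) ∧ (∀ y, y ∈ x ⇒ ∃ z, z ∈ x ∧ y ∈ z).

(* w = ω *)
Definition is_omega {I : interp} (w : dom I) : tv I :=
  limit_ordinal w ∧ ∀ y, y ∈ w ⇒ ¬ limit_ordinal y.

Definition cardinal {I : interp} (k : dom I) : tv I :=
  ordinal k ∧ ∀ a, a ∈ k ⇒ ¬ equinumerous a k.

Definition infinite_cardinal {I : interp} (k : dom I) : tv I :=
  cardinal k ∧ ∃ w, is_omega w ∧ (w ≐ k ∨ w ∈ k).

Definition uncountable_cardinal {I : interp} (k : dom I) : tv I :=
  cardinal k ∧ ∃ w, is_omega w ∧ w ∈ k.

(* m = k^+ *)
Definition is_card_succ {I : interp} (m k : dom I) : tv I :=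
  cardinal m ∧ k ∈ m ∧ ∀ n, cardinal n ⇒ k ∈ n ⇒ subset m n.

(* m = 2^k *)
Definition is_card_pow2 {I : interp} (m k : dom I) : tv I :=
  cardinal m ∧ ∃ p, is_powerset p k ∧ equinumerous p m.

Definition is_cofinal_map {I : interp} (f l a : dom I) : tv I :=
  is_function f l a ∧
  ∀ x, x ∈ a ⇒ ∃ y z, opair_in y z f ∧ (x ≐ z ∨ x ∈ z).

(* l = cf(a) *)
Definition is_cof {I : interp} (l a : dom I) : tv I :=
  ordinal l ∧ (∃ f, is_cofinal_map f l a) ∧
  (∀ b, b ∈ l ⇒ ¬ ∃ f, is_cofinal_map f b a).

Definition regular_cardinal {I : interp} (k : dom I) : tv I :=
  infinite_cardinal k ∧ is_cof k k.

(* 2^k = k^+ *)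
Definition gch_at {I : interp} (k : dom I) : tv I :=
  ∃ m, is_card_succ m k ∧ is_card_pow2 m k.

Definition GCH {I : interp} : tv I :=
  ∀ k, infinite_cardinal k ⇒ gch_at k.

(* s = [k]^2 *)
Definition is_doubletons {I : interp} (s k : dom I) : tv I :=
  ∀ z, z ∈ s ⇔ ∃ a b, a ∈ k ∧ b ∈ k ∧ (¬ a ≐ b) ∧ is_upair z a b.

(* t = 2 = {0, 1} *)
Definition is_two {I : interp} (t : dom I) : tv I :=
  ∃ e o, is_empty e ∧ is_succ o e ∧ is_succ t o.

(* k is uncountable and k → (k)^2_2 *)
Definition weakly_compact {I : interp} (k : dom I) : tv I :=
  uncountable_cardinal k ∧
  ∀ s t f, is_doubletons s k ⇒ is_two t ⇒ is_function f s t ⇒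
    ∃ h, subset h k ∧ equinumerous h k ∧
      ∃ i, i ∈ t ∧
        ∀ a b z, a ∈ h ⇒ b ∈ h ⇒ (¬ a ≐ b) ⇒ is_upair z a b ⇒ opair_in z i f.

Definition levinski {I : interp} (k : dom I) : tv I :=
  regular_cardinal k ∧ gch_at k ∧
  ∀ d, d ∈ k ⇒ regular_cardinal d ⇒ ¬ gch_at d.

Definition strict_levinski {I : interp} (k : dom I) : tv I :=
  levinski k ∧
  (∀ d, d ∈ k ⇒ regular_cardinal d ⇒
     ∃ m n, is_card_succ m d ∧ is_card_succ n m ∧ is_card_pow2 n d) ∧
  (∀ d, (d ≐ k ∨ k ∈ d) ⇒ regular_cardinal d ⇒ gch_at d).

Definition truth {M : Type} (E : M -> M -> Prop) : interp := {|
  dom := M;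
  tv := Prop;
  vmem := E;
  veq := fun x y => x = y;
  vfalse := False;
  vimp := fun f g => f -> g;
  vand := fun f g => f /\ g;
  vor := fun f g => f \/ g;
  vall := fun f => forall x, f x;
  vex := fun f => exists x, f x
|}.

(* Syntactic formulas (de Bruijn), needed for the axiom schemes. *)
Inductive formula : Type :=
  | fmem (i j : nat)
  | feq (i j : nat)
  | ffalse
  | fimp (f g : formula)
  | fall (f : formula).

Definition push {M : Type} (x : M) (v : nat -> M) (n : nat) : M :=
  match n with O => x | S m => v m end.

Fixpoint sat {M : Type} (E : M -> M -> Prop) (v : nat -> M) (f : formula) : Prop :=
  match f with
  | fmem i j => E (v i) (v j)
  | feq i j => v i = v j
  | ffalse => False
  | fimp g h => sat E v g -> sat E v h
  | fall g => forall x, sat E (push x v) g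
  end.

Record ZFC {M : Type} (E : M -> M -> Prop) : Prop := {
  extensionality : forall x y, (forall z, E z x <-> E z y) -> x = y;
  foundation : forall x, (exists y, E y x) ->
    exists y, E y x /\ forall z, E z y -> ~ E z x;
  pairing : forall x y, exists z, forall w, E w z <-> w = x \/ w = y;
  union : forall x, exists u, forall z, E z u <-> exists y, E z y /\ E y x;
  power_set : forall x, exists p, forall z, E z p <-> forall w, E w z -> E w x;
  infinity : exists w, @is_omega (truth E) w;
  separation : forall (f : formula) (v : nat -> M) a,
    exists b, forall x, E x b <-> E x a /\ sat E (push x v) f;
  replacement : forall (f : formula) (v : nat -> M) a,
    (forall x, E x a -> exists! y, sat E (push x (push y v)) f) ->
    exists b, forall y, E y b <-> exists x, E x a /\ sat E (push x (push y v)) f;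
  choice : forall a,
    (forall x, E x a -> exists y, E y x) ->
    (forall x y z, E x a -> E y a -> E z x -> E z y -> x = y) ->
    exists c, forall x, E x a -> exists! y, E y x /\ E y c
}.

(* A forcing notion (P, le, one) in M: a preorder with greatest element. *)
Definition forcing_notion {M : Type} (E : M -> M -> Prop) (P le one : M) : Prop :=
  E one P /\
  (forall p, E p P -> @opair_in (truth E) p p le) /\
  (forall p q r, E p P -> E q P -> E r P ->
     @opair_in (truth E) p q le -> @opair_in (truth E) q r le ->
     @opair_in (truth E) p r le) /\
  (forall p, E p P -> @opair_in (truth E) p one le).

Definition extends {M : Type} (E : M -> M -> Prop) (P le p q : M) : Prop :=
  E p P /\ E q P /\ @opair_in (truth E) p q le.

Definition dense_below {M : Type} (E : M -> M -> Prop) (P le p : M)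
    (D : M -> Prop) : Prop :=
  forall q, extends E P le q p -> exists r, extends E P le r q /\ D r.

(* Every set is a P-name; only its elements (s, p) with p ∈ P matter. *)
Definition name_elem {M : Type} (E : M -> M -> Prop) (P s p t : M) : Prop :=
  E p P /\ @opair_in (truth E) s p t.

Definition forces_covers {M : Type} (E : M -> M -> Prop) (P le e p s t : M) : Prop :=
  forall s' c, name_elem E P s' c s ->
    dense_below E P le p (fun q => extends E P le q c ->
      exists t' d, name_elem E P t' d t /\ extends E P le q d /\
        @triple_in (truth E) q s' t' e).

(* "p ⊩ s = t" is defined in M by recursion on the names s, t.  The set e of M
   is the graph {(p, s, t) | p ⊩ s = t} of the recursion on a set T of names
   closed under passing to the names occurring in them. *)
Definition forces_eq_graph {M : Type} (E : M -> M -> Prop) (P le T e : M) : Prop :=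
  (forall t s c, E t T -> name_elem E P s c t -> E s T) /\
  (forall p s t, E p P -> E s T -> E t T ->
    (@triple_in (truth E) p s t e <->
     forces_covers E P le e p s t /\ forces_covers E P le e p t s)).

Definition forces_eq {M : Type} (E : M -> M -> Prop) (P le s t p : M) : Prop :=
  exists T e, forces_eq_graph E P le T e /\ E s T /\ E t T /\
    @triple_in (truth E) p s t e.

Definition forces_mem {M : Type} (E : M -> M -> Prop) (P le s t p : M) : Prop :=
  dense_below E P le p (fun q =>
    exists t' d, name_elem E P t' d t /\ extends E P le q d /\
      forces_eq E P le s t' q).

(* The forcing relation: the truth value of a statement about names is the
   predicate of the conditions that force it. *)
Definition forcing {M : Type} (E : M -> M -> Prop) (P le : M) : interp := {|
  dom := M;
  tv := M -> Prop;
  vmem := forces_mem E P le;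
  veq := forces_eq E P le;
  vfalse := fun _ => False;
  vimp := fun f g p => forall q, extends E P le q p -> f q -> g q;
  vand := fun f g p => f p /\ g p;
  vor := fun f g p => dense_below E P le p (fun q => f q \/ g q);
  vall := fun f p => forall x, f x p;
  vex := fun f p => dense_below E P le p (fun q => exists x, f x q)
|}.

(* n is the canonical name of x, {(name of y, one) | y ∈ x}; the set c of M is
   the graph of the recursion on a transitive set T containing x. *)
Definition is_check {M : Type} (E : M -> M -> Prop) (one n x : M) : Prop :=
  exists T c, @transitive (truth E) T /\ E x T /\ @opair_in (truth E) x n c /\
    (forall y, E y T -> exists m, @opair_in (truth E) y m c) /\
    (forall y m, E y T -> @opair_in (truth E) y m c ->
       forall z, E z m <->
         exists u v, E u y /\ @opair_in (truth E) u v c /\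
           @is_opair (truth E) z v one).

(* cf(a) is the same in M and in the extension, for every limit ordinal a. *)
Definition cofinality_preserving {M : Type} (E : M -> M -> Prop)
    (P le one : M) : Prop :=
  forall a l, @limit_ordinal (truth E) a -> @is_cof (truth E) l a ->
    exists a' l', is_check E one a' a /\ is_check E one l' l /\
      @is_cof (forcing E P le) l' a' one.

(* Main.v *)
(* By Löwenheim-Skolem and the definability of forcing we may assume that the ground model is
   countable, so that generic filters exist and a statement is forced as soon as it holds in
   every generic extension.  The forcing is the Easton product that adds [δ^++] subsets to each
   regular [δ < κ].

   For regular [μ] split a condition into its part up to [μ] and its part above [μ].  A
   bookkeeping of length [μ], which uses GCH, shows that given [μ] dense open sets one part above
   [μ] can be chosen so that every set is met by [μ] many parts up to [μ], predense among the
   latter.  Hence a function on [μ] in the extension has for each argument at most [μ] candidate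
   values in the ground model: regular cardinals are preserved and nice names bound [2^δ].

   For weak compactness no elementary embedding is used.  Colouring pairs by the lexicographic
   order of their traces on [κ] many subsets of [κ], the partition property yields an unbounded
   set that eventually decides all of them, and iterating regressive functions along it gives a
   normality principle.  Given a name for a colouring, choose for each regular [β] a sequence of
   conditions deciding the colours of [(α, β)], [α < β]; by normality their parts below [β]
   stabilise.  In the extension the stabilised parts lying in the generic filter define a map [d]
   with [c(α, β) = d(α)] for all [α < a] and some [β >= a], for every [a < κ], from which a
   homogeneous set is built by recursion. *)

From Stdlib Require Import Classical ClassicalEpsilon FunctionalExtensionality PropExtensionality ProofIrrelevance Arith Lia.
From Stdlib Require Cantor.
Require Import Defs.

Set Implicit Arguments.

(** The structure may be ill-founded, also after the passage to a countable one. Induction and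
    recursion therefore work only for classes definable inside it, which is why definability is
    tracked throughout, and names cannot be evaluated from outside: the extension is a quotient of
    the class of names by forced equality, and the filter, a predicate outside the model, meets the
    dense classes definable in it. No antichain is counted. Handling the lower factor together with
    the closed upper one gives a predense family of size [m] directly. Regular cardinals suffice for
    all cofinalities: a cofinality is regular, and an ordinal regular in the extension is regular in
    the ground model. Weak compactness enters in two ways. It makes [kap] a regular strong limit, so
    that the double successors of smaller cardinals stay below [kap] and few conditions live below a
    given coordinate; and it takes the place of an ultrafilter on the sets that matter. Without an
    ultrapower there is no least ordinal above the constants to reflect at; a search along sequences
    of length ω finds a function that plays this role. *)

(** * Renaming of variables, and models of ZF *)

Definition up (r : nat -> nat) (n : nat) : nat :=
  match n with O => O | S m => S (r m) end.

Fixpoint ren (r : nat -> nat) (f : formula) : formula :=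
  match f with
  | fmem i j => fmem (r i) (r j)
  | feq i j => feq (r i) (r j)
  | ffalse => ffalse
  | fimp g h => fimp (ren r g) (ren r h)
  | fall g => fall (ren (up r) g)
  end.

Lemma push_up M (x : M) v r : (fun n => push x v (up r n)) = push x (fun n => v (r n)).
Proof. extensionality n; destruct n; reflexivity. Qed.

Lemma sat_ren M (E : M -> M -> Prop) f :
  forall r v, sat E v (ren r f) <-> sat E (fun n => v (r n)) f.
Proof.
  induction f as [| | | |f IH]; intros r v; simpl; try tauto.
  - rewrite IHf1, IHf2; tauto.
  - split; intros H x; specialize (H x).
    + apply IH in H. rewrite push_up in H. exact H.
    + apply IH. rewrite push_up. exact H.
Qed.

(** Choice is split off as the class [AC], so that the elementary theory is already available in a
    generic extension when choice is proved there. *)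
Record ZF {M : Type} (E : M -> M -> Prop) : Prop := {
  zf_ext : forall x y, (forall z, E z x <-> E z y) -> x = y;
  zf_found : forall x, (exists y, E y x) ->
    exists y, E y x /\ forall z, E z y -> ~ E z x;
  zf_pair : forall x y, exists z, forall w, E w z <-> w = x \/ w = y;
  zf_union : forall x, exists u, forall z, E z u <-> exists y, E z y /\ E y x;
  zf_pow : forall x, exists p, forall z, E z p <-> forall w, E w z -> E w x;
  zf_inf : exists w, @is_omega (truth E) w;
  zf_sep : forall (f : formula) (v : nat -> M) a,
    exists b, forall x, E x b <-> E x a /\ sat E (push x v) f;
  zf_repl : forall (f : formula) (v : nat -> M) a,
    (forall x, E x a -> exists! y, sat E (push x (push y v)) f) ->
    exists b, forall y, E y b <-> exists x, E x a /\ sat E (push x (push y v)) f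
}.

Record model := Model {
  carrier :> Type;
  mem : carrier -> carrier -> Prop;
  model_ZF : ZF mem
}.
Arguments mem {m} _ _.
Notation "x ∊ y" := (mem x y) (at level 70).

Definition tl {T : Type} (v : nat -> T) : nat -> T := fun n => v (S n).

(** * Definable classes *)

Section Definability.
Context {V : model}.
Implicit Types (v : nat -> V).

Definition slot v (t : nat + V) : V := match t with inl i => v i | inr c => c end.

(* [phi] is first-order definable with parameters: [s] says which formula
   variables are read off the environment and which are constants of [V]. *)
Definition Df (phi : (nat -> V) -> Prop) : Prop :=
  exists (f : formula) (s : nat -> nat + V),
    forall v, phi v <-> sat mem (fun n => slot v (s n)) f.

(** A term is definable when its graph is, with the value at position 0. This covers operations
    picked by [epsilon], for which the language has no symbols. *)
Definition DT (t : (nat -> V) -> V) : Prop := Df (fun v => v 0 = t (tl v)).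

Lemma Df_iff phi psi : (forall v, phi v <-> psi v) -> Df phi -> Df psi.
Proof.
  intros H (f & s & Hf). exists f, s. intros v. rewrite <- H. apply Hf.
Qed.

Lemma Df_ren phi (r : nat -> nat) : Df phi -> Df (fun v => phi (fun n => v (r n))).
Proof.
  intros (f & s & Hf).
  exists f, (fun n => match s n with inl i => inl (r i) | inr c => inr c end).
  intros v. rewrite Hf.
  replace (fun n => slot (fun n0 => v (r n0)) (s n)) with
    (fun n => slot v (match s n with inl i => inl (r i) | inr c => inr c end)).
  tauto. extensionality n; destruct (s n); reflexivity.
Qed.

Lemma Df_false : Df (fun _ => False).
Proof. exists ffalse, (fun n => inl n). intros v; simpl; tauto. Qed.

Lemma Df_imp phi psi : Df phi -> Df psi -> Df (fun v => phi v -> psi v).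
Proof.
  intros (f & s & Hf) (g & t & Hg).
  (* Even variables carry the slots of [f], odd ones those of [g]. *)
  set (m := fun n => if Nat.even n then s (Nat.div2 n) else t (Nat.div2 n)).
  assert (m1 : forall n, m (2 * n) = s n).
  { intros n. unfold m. rewrite Nat.even_mul, Nat.div2_double. reflexivity. }
  assert (m2 : forall n, m (S (2 * n)) = t n).
  { intros n. unfold m. rewrite Nat.even_succ, Nat.odd_mul, Nat.div2_succ_double.
    reflexivity. }
  exists (fimp (ren (fun n => 2 * n) f) (ren (fun n => S (2 * n)) g)), m.
  intros v. cbn [sat]. rewrite !sat_ren, Hf, Hg.
  replace (fun n => slot v (m (2 * n))) with (fun n => slot v (s n))
    by (extensionality n; rewrite m1; reflexivity).
  replace (fun n => slot v (m (S (2 * n)))) with (fun n => slot v (t n))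
    by (extensionality n; rewrite m2; reflexivity).
  tauto.
Qed.

Lemma Df_all (phi : V -> (nat -> V) -> Prop) :
  Df (fun v => phi (v 0) (tl v)) -> Df (fun v => forall x, phi x v).
Proof.
  intros (f & s & Hf).
  (* Several formula variables may read entry 0 of the environment; all of them are merged into the
     bound one, and the others are shifted past it. *)
  set (r := fun n => match s n with inl O => O | _ => S n end).
  set (s' := fun n => match s n with inl (S i) => inl i | t => t end).
  exists (fall (ren r f)), s'. intros v. cbn [sat].
  assert (H : forall x, sat mem (push x (fun n => slot v (s' n))) (ren r f) <-> phi x v).
  { intros x. rewrite sat_ren.
    specialize (Hf (push x v)). unfold tl in Hf; simpl in Hf. rewrite Hf.
    replace (fun n => push x (fun n0 => slot v (s' n0)) (r n)) with
      (fun n => slot (push x v) (s n)). tauto.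
    extensionality n. unfold r, s'.
    destruct (s n) as [[|i]|c] eqn:Es; simpl; rewrite ?Es; reflexivity. }
  split; intros K x; specialize (K x); apply H; auto.
Qed.

Lemma Df_not phi : Df phi -> Df (fun v => ~ phi v).
Proof. intros H. apply Df_imp; [exact H | apply Df_false]. Qed.

Lemma Df_and phi psi : Df phi -> Df psi -> Df (fun v => phi v /\ psi v).
Proof.
  intros H K. apply Df_iff with (fun v => ~ (phi v -> ~ psi v)).
  intros v; tauto. apply Df_not, Df_imp, Df_not; auto.
Qed.

Lemma Df_or phi psi : Df phi -> Df psi -> Df (fun v => phi v \/ psi v).
Proof.
  intros H K. apply Df_iff with (fun v => ~ phi v -> psi v).
  intros v; tauto. apply Df_imp; [apply Df_not|]; auto.
Qed.

Lemma Df_equiv phi psi : Df phi -> Df psi -> Df (fun v => phi v <-> psi v).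
Proof. intros H K. apply Df_and; apply Df_imp; auto. Qed.

Lemma Df_ex (phi : V -> (nat -> V) -> Prop) :
  Df (fun v => phi (v 0) (tl v)) -> Df (fun v => exists x, phi x v).
Proof.
  intros H. apply Df_iff with (fun v => ~ forall x, ~ phi x v).
  - intros v. split; [apply not_all_not_ex | firstorder].
  - apply Df_not, Df_all, Df_not, H.
Qed.

Lemma Df_exu (phi : V -> (nat -> V) -> Prop) :
  Df (fun v => phi (v 0) (tl v)) -> Df (fun v => exists! x, phi x v).
Proof.
  intros H. unfold unique. apply Df_ex, Df_and; [exact H|]. apply Df_all, Df_imp.
  - apply (Df_ren (fun n => match n with O => 0 | S n => S (S n) end) H).
  - exists (feq 1 0), inl. intros v; simpl; reflexivity.
Qed.

Lemma DT_var k : DT (fun v => v k).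
Proof. exists (feq 0 (S k)), inl. intros v; simpl; tauto. Qed.

Lemma DT_cst c : DT (fun _ => c).
Proof.
  exists (feq 0 1), (fun n => match n with O => inl 0 | _ => inr c end).
  intros v; simpl; tauto.
Qed.

Lemma DT_ren t (r : nat -> nat) : DT t -> DT (fun v => t (fun n => v (r n))).
Proof. intros H. apply (Df_ren (up r) H). Qed.

Lemma DT_tl t : DT t -> DT (fun v => t (tl v)).
Proof. apply (@DT_ren t S). Qed.

Lemma Df_subst (phi : V -> (nat -> V) -> Prop) t :
  Df (fun v => phi (v 0) (tl v)) -> DT t -> Df (fun v => phi (t v) v).
Proof.
  intros H K. apply Df_iff with (fun v => exists y, y = t v /\ phi y v).
  - intros v. split; [intros (y & -> & Hy); exact Hy | eauto].
  - apply Df_ex, Df_and; auto.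
Qed.

Lemma Df_rel1 (R : V -> Prop) s :
  Df (fun v => R (v 0)) -> DT s -> Df (fun v => R (s v)).
Proof. intros H K. apply (Df_subst (fun x _ => R x)); auto. Qed.

Lemma Df_rel2 (R : V -> V -> Prop) s t :
  Df (fun v => R (v 0) (v 1)) -> DT s -> DT t -> Df (fun v => R (s v) (t v)).
Proof.
  intros H K L. apply (Df_subst (fun x v => R x (t v))); auto.
  apply (Df_subst (fun x v => R (v 0) x)).
  - apply (Df_ren (fun n => match n with O => 1 | _ => 0 end) H).
  - apply DT_tl, L.
Qed.

Lemma Df_rel3 (R : V -> V -> V -> Prop) s t u :
  Df (fun v => R (v 0) (v 1) (v 2)) -> DT s -> DT t -> DT u ->
  Df (fun v => R (s v) (t v) (u v)).
Proof.
  intros H K L J. apply (Df_subst (fun x v => R x (t v) (u v))); auto.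
  apply (Df_subst (fun x v => R (v 0) x (u (tl v)))).
  - apply (Df_subst (fun x v => R (v 1) (v 0) x)).
    + apply (Df_ren (fun n => match n with O => 2 | 1 => 1 | _ => 0 end) H).
    + apply (DT_tl (t := fun v => u (tl v))), DT_tl, J.
  - apply DT_tl, L.
Qed.

Lemma Df_mem s t : DT s -> DT t -> Df (fun v => s v ∊ t v).
Proof. apply (Df_rel2 mem). exists (fmem 0 1), inl. intros v; simpl; tauto. Qed.

Lemma Df_eq s t : DT s -> DT t -> Df (fun v => s v = t v).
Proof. apply (Df_rel2 eq). exists (feq 0 1), inl. intros v; simpl; tauto. Qed.

Lemma DT_fun1 (F : V -> V) s :
  Df (fun v => v 0 = F (v 1)) -> DT s -> DT (fun v => F (s v)).
Proof.
  intros H K. unfold DT. apply (Df_rel2 (fun y x => y = F x)); auto.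
  apply DT_var. apply DT_tl, K.
Qed.

Lemma DT_fun2 (F : V -> V -> V) s t :
  Df (fun v => v 0 = F (v 1) (v 2)) -> DT s -> DT t -> DT (fun v => F (s v) (t v)).
Proof.
  intros H K L. unfold DT. apply (Df_rel3 (fun y x z => y = F x z)); auto.
  apply DT_var. apply DT_tl, K. apply DT_tl, L.
Qed.

Lemma DT_app1 (F : V -> V) s : DT (fun v => F (v 0)) -> DT s -> DT (fun v => F (s v)).
Proof. intros H. apply DT_fun1, H. Qed.

Lemma DT_app2 (F : V -> V -> V) s t :
  DT (fun v => F (v 0) (v 1)) -> DT s -> DT t -> DT (fun v => F (s v) (t v)).
Proof. intros H. apply DT_fun2, H. Qed.

Lemma DT_char (t : (nat -> V) -> V) (phi : V -> (nat -> V) -> Prop) :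
  (forall v y, y = t v <-> phi y v) -> Df (fun v => phi (v 0) (tl v)) -> DT t.
Proof. intros H K. unfold DT. apply Df_iff with (2 := K). intros v. symmetry; apply H. Qed.

(** Freezing an environment turns its entries into parameters, so that separation can be applied to
    a property with further free variables. *)
Lemma Df_at phi v : Df phi -> Df (fun u => phi (push (u 0) v)).
Proof.
  intros (f & s & Hf).
  exists f, (fun n => match s n with inl 0 => inl 0 | inl (S i) => inr (v i) | inr c => inr c end).
  intros u. rewrite Hf.
  replace (fun n => slot (push (u 0) v) (s n)) with
    (fun n => slot u (match s n with inl 0 => inl 0 | inl (S i) => inr (v i) | inr c => inr c end)).
  tauto. extensionality n; destruct (s n) as [[|i]|c]; reflexivity.
Qed.

Lemma Df_at2 phi v : Df phi -> Df (fun u => phi (push (u 0) (push (u 1) v))).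
Proof.
  intros (f & s & Hf).
  exists f, (fun n => match s n with inl (S (S i)) => inr (v i) | t => t end).
  intros u. rewrite Hf.
  replace (fun n => slot (push (u 0) (push (u 1) v)) (s n)) with
    (fun n => slot u (match s n with inl (S (S i)) => inr (v i) | t => t end)).
  tauto. extensionality n; destruct (s n) as [[|[|i]]|c]; reflexivity.
Qed.

End Definability.

(* Automatic proofs of definability *)
Create HintDb df.
#[global] Hint Resolve Df_false Df_imp Df_all Df_not Df_and Df_or Df_equiv Df_ex Df_exu
  DT_cst Df_mem Df_eq : df.
#[global] Hint Extern 0 (DT (fun v => _)) => cbv beta delta [tl]; simple apply DT_var : df.
#[global] Hint Extern 4 (Df _) =>
  match goal with
  | H : Df (fun v => ?R (v 0)) |- Df (fun v => ?R _) => apply (Df_rel1 R H)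
  | H : Df (fun v => ?R (v 0) (v 1)) |- Df (fun v => ?R _ _) => apply (Df_rel2 R H)
  | H : Df (fun v => ?R (v 0) (v 1) (v 2)) |- Df (fun v => ?R _ _ _) => apply (Df_rel3 R H)
  end : df.
#[global] Hint Extern 4 (DT _) =>
  match goal with
  | H : DT (fun v => ?F (v 0)) |- DT (fun v => ?F _) => apply (DT_app1 F H)
  | H : DT (fun v => ?F (v 0) (v 1)) |- DT (fun v => ?F _ _) => apply (DT_app2 F H)
  end : df.
Ltac df := solve [cbv beta; auto 200 with df nocore].

Unset Strict Implicit.

(** * Elementary set theory in a model *)

Definition sub {V : model} (x y : V) : Prop := forall z, z ∊ x -> z ∊ y.
Notation "x ⊆ y" := (sub x y) (at level 70).

Section Basics.
Context {V : model}.
Implicit Types (a b c f g x y z : V).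

Lemma set_ext x y : (forall z, z ∊ x <-> z ∊ y) -> x = y.
Proof. apply (zf_ext (model_ZF V)). Qed.

Lemma sub_antisym x y : x ⊆ y -> y ⊆ x -> x = y.
Proof. intros H K. apply set_ext. intros z; split; auto. Qed.

(** Brings the variables into the order that the axiom schemes expect: first [x] and [y], then the
    parameters. *)
Lemma Df_two (phi : V -> V -> Prop) : Df (fun v => phi (v 0) (v 1)) ->
  exists (f : formula) w, forall x y, phi x y <-> sat mem (push x (push y w)) f.
Proof.
  intros (f & s & Hf).
  set (r := fun n => match s n with inl 0 => 0 | inl _ => 1 | inr _ => S (S n) end).
  destruct (zf_inf (model_ZF V)) as [o _].
  set (w := fun n => match s n with inr c => c | _ => o end).
  exists (ren r f), w. intros x y. rewrite sat_ren.
  specialize (Hf (push x (fun _ => y))). simpl in Hf. rewrite Hf.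
  replace (fun n => push x (push y w) (r n)) with
    (fun n => slot (push x (fun _ => y)) (s n)). tauto.
  extensionality n. unfold r, w. destruct (s n) as [[|i]|c] eqn:E; simpl; rewrite ?E; auto.
Qed.

Lemma sep_exists a (phi : V -> Prop) : Df (fun v => phi (v 0)) ->
  exists b, forall x, x ∊ b <-> x ∊ a /\ phi x.
Proof.
  intros H. destruct (@Df_two (fun x _ => phi x) H) as (f & w & Hf).
  destruct (zf_sep (model_ZF V) f (push a w) a) as [b Hb].
  exists b. intros x. rewrite Hb, <- Hf. tauto.
Qed.

(** A total operation: definability of [phi] is asked for only when membership is computed, so terms
    contain no proofs. *)
Definition sep a (phi : V -> Prop) : V :=
  epsilon (inhabits a) (fun b => forall x, x ∊ b <-> x ∊ a /\ phi x).

Lemma in_sep a phi x : Df (fun v => phi (v 0)) -> (x ∊ sep a phi <-> x ∊ a /\ phi x).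
Proof. intros H. exact (epsilon_spec (inhabits a) _ (sep_exists a H) x). Qed.

Lemma empty_exists : exists e : V, forall z, ~ z ∊ e.
Proof.
  destruct (zf_inf (model_ZF V)) as [o _].
  exists (sep o (fun _ => False)). intros z. rewrite in_sep by df. tauto.
Qed.

Definition emp : V := proj1_sig (constructive_indefinite_description _ empty_exists).

Lemma in_emp z : ~ z ∊ emp.
Proof. unfold emp. destruct constructive_indefinite_description; simpl; auto. Qed.

Lemma emp_or x : x = emp \/ exists y, y ∊ x.
Proof.
  destruct (classic (exists y, y ∊ x)); [auto|left].
  apply set_ext. intros z. split; intros K; [exfalso; eauto | destruct (in_emp K)].
Qed.

Lemma repl_exists a (F : V -> V) : DT (fun v => F (v 0)) ->
  exists b, forall y, y ∊ b <-> exists x, x ∊ a /\ y = F x.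
Proof.
  intros H. destruct (@Df_two (fun x y => y = F x)) as (f & w & Hf).
  { apply (Df_ren (fun n => match n with O => 1 | _ => 0 end) H). }
  destruct (zf_repl (model_ZF V) f w a) as [b Hb].
  - intros x _. exists (F x). split; [apply Hf; auto|].
    intros y Hy. apply Hf in Hy. auto.
  - exists b. intros y. rewrite Hb. split; intros (x & K & L); exists x; split; auto;
    apply Hf; auto.
Qed.

Definition repl a (F : V -> V) : V :=
  epsilon (inhabits a) (fun b => forall y, y ∊ b <-> exists x, x ∊ a /\ y = F x).

Lemma in_repl a F y : DT (fun v => F (v 0)) -> (y ∊ repl a F <-> exists x, x ∊ a /\ y = F x).
Proof. intros H. exact (epsilon_spec (inhabits a) _ (repl_exists a H) y). Qed.

Definition upair a b : V :=
  proj1_sig (constructive_indefinite_description _ (zf_pair (model_ZF V) a b)).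
Lemma in_upair a b x : x ∊ upair a b <-> x = a \/ x = b.
Proof. unfold upair. destruct constructive_indefinite_description; simpl; auto. Qed.

Definition union a : V :=
  proj1_sig (constructive_indefinite_description _ (zf_union (model_ZF V) a)).
Lemma in_union a x : x ∊ union a <-> exists y, x ∊ y /\ y ∊ a.
Proof. unfold union. destruct constructive_indefinite_description; simpl; auto. Qed.

Definition pow a : V :=
  proj1_sig (constructive_indefinite_description _ (zf_pow (model_ZF V) a)).
Lemma in_pow a x : x ∊ pow a <-> x ⊆ a.
Proof. unfold pow. destruct constructive_indefinite_description; simpl; auto. Qed.

(** Without a unique witness the value is [emp]. With this default the graph stays first-order
    ([the_char]), whereas a bare [epsilon] could pick an undefinable value. *)
Definition the (phi : V -> Prop) : V :=
  epsilon (inhabits emp) (fun y => (exists! x, phi x) /\ phi y \/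
                                   ~ (exists! x, phi x) /\ y = emp).
Lemma the_char phi y : y = the phi <->
  ((exists! x, phi x) /\ phi y \/ ~ (exists! x, phi x) /\ y = emp).
Proof.
  assert (K : (exists! x, phi x) /\ phi (the phi) \/ ~ (exists! x, phi x) /\ (the phi) = emp).
  { refine (epsilon_spec (inhabits emp) (fun y => (exists! x, phi x) /\ phi y \/
                                   ~ (exists! x, phi x) /\ y = emp) _).
    destruct (classic (exists! x, phi x)) as [(x & H & U)|H]; [exists x|]; eauto.
    left; split; auto. exists x; split; auto. }
  split; [intros ->; exact K|].
  intros [[(x & H & U) L]|[H L]]; destruct K as [[N K]|[N K]]; try tauto.
  - rewrite <- (U _ L). apply U, K.
  - exfalso; apply N; exists x; split; auto.
  - congruence.
Qed.
Lemma the_eq (phi : V -> Prop) y : phi y -> (forall z, phi z -> z = y) -> the phi = y.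
Proof.
  intros H K. symmetry. apply the_char. left; split; auto.
  exists y; split; auto. intros z Hz; symmetry; auto.
Qed.

Definition ite (Q : Prop) a b : V := if excluded_middle_informative Q then a else b.
Lemma ite_true (Q : Prop) a b : Q -> ite Q a b = a.
Proof. unfold ite; destruct excluded_middle_informative; tauto. Qed.
Lemma ite_false (Q : Prop) a b : ~ Q -> ite Q a b = b.
Proof. unfold ite; destruct excluded_middle_informative; tauto. Qed.

Definition opair a b := upair (upair a a) (upair a b).
Definition cup a b := union (upair a b).
Definition sing a := upair a a.
Definition succ a := cup a (sing a).
Definition diff a b := sep a (fun x => ~ x ∊ b).
Definition prod a b := union (repl a (fun x => repl b (fun y => opair x y))).
Definition lam a (F : V -> V) := repl a (fun x => opair x (F x)).
Definition app f x := the (fun y => opair x y ∊ f).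
Definition fst z := the (fun x => exists y, z = opair x y).
Definition snd z := the (fun y => exists x, z = opair x y).

Lemma in_sing a x : x ∊ sing a <-> x = a.
Proof. unfold sing; rewrite in_upair; tauto. Qed.
Lemma in_cup a b x : x ∊ cup a b <-> x ∊ a \/ x ∊ b.
Proof.
  unfold cup; rewrite in_union. split.
  - intros (y & H & K). apply in_upair in K as [->| ->]; auto.
  - intros [H|H]; [exists a|exists b]; rewrite in_upair; auto.
Qed.
Lemma in_succ a x : x ∊ succ a <-> x ∊ a \/ x = a.
Proof. unfold succ; rewrite in_cup, in_sing; tauto. Qed.

Lemma upair_inj a b c d : upair a b = upair c d -> a = c /\ b = d \/ a = d /\ b = c.
Proof.
  intros H.
  assert (K : forall x, (x = a \/ x = b) <-> (x = c \/ x = d)).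
  { intros x. rewrite <- !in_upair, H; tauto. }
  destruct (proj1 (K a)), (proj1 (K b)); auto; subst; auto.
  - destruct (proj2 (K d)); auto.
  - destruct (proj2 (K c)); auto.
Qed.
Lemma opair_inj a b c d : opair a b = opair c d -> a = c /\ b = d.
Proof.
  intros H. apply upair_inj in H as [[H K]|[H K]];
    apply upair_inj in H; apply upair_inj in K; intuition congruence.
Qed.
Lemma fst_opair a b : fst (opair a b) = a.
Proof.
  apply the_eq; eauto. intros z (y & H). apply opair_inj in H as [-> _]; auto.
Qed.
Lemma snd_opair a b : snd (opair a b) = b.
Proof.
  apply the_eq; eauto. intros z (y & H). apply opair_inj in H as [_ ->]; auto.
Qed.
End Basics.

(** * Definability of the set operations *)

Section DefOps.
Context {V : model}.

Lemma DT_sep (a : (nat -> V) -> V) phi : DT a -> Df (fun v => phi (v 0) (tl v)) ->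
  DT (fun v => sep (a v) (fun x => phi x v)).
Proof.
  intros H K.
  assert (Sp : forall v x, x ∊ sep (a v) (fun x => phi x v) <-> x ∊ a v /\ phi x v).
  { intros v x. exact (@in_sep V (a v) (fun x => phi x v) x (Df_at v K)). }
  apply DT_char with (fun y v => forall x, x ∊ y <-> x ∊ a v /\ phi x v).
  - intros v y. split; [intros ->; auto|]. intros L. apply set_ext. intros z.
    rewrite Sp; auto.
  - apply Df_all, Df_equiv; [df|]. apply Df_and.
    + apply Df_mem; [df|]. apply (DT_tl (t := fun v => a (tl v))), DT_tl, H.
    + apply (Df_ren (fun n => match n with O => 0 | S n => S (S n) end) K).
Qed.

Lemma DT_repl (a : (nat -> V) -> V) F : DT a -> DT (fun v => F (v 0) (tl v)) ->
  DT (fun v => repl (a v) (fun x => F x v)).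
Proof.
  intros H K.
  assert (Sp : forall v y, y ∊ repl (a v) (fun x => F x v) <-> exists x, x ∊ a v /\ y = F x v).
  { intros v x. exact (@in_repl V (a v) (fun x => F x v) x (Df_at2 v K)). }
  apply DT_char with (fun y v => forall z, z ∊ y <-> exists x, x ∊ a v /\ z = F x v).
  - intros v y. split; [intros ->; auto|]. intros L. apply set_ext. intros z.
    rewrite Sp; auto.
  - apply Df_all, Df_equiv; [df|]. apply Df_ex, Df_and.
    + apply Df_mem; [df|]. apply (DT_ren (fun n => S (S (S n))) H).
    + apply (Df_ren (fun n => match n with O => 1 | 1 => 0 | S (S n) => S (S (S n)) end) K).
Qed.

Lemma DT_the (phi : V -> (nat -> V) -> Prop) : Df (fun v => phi (v 0) (tl v)) ->
  DT (fun v => the (fun x => phi x v)).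
Proof.
  intros K. eapply DT_char.
  - intros v y. apply the_char.
  - assert (L : Df (fun v => exists! x, phi x (tl v))).
    { apply Df_exu. apply (Df_ren (fun n => match n with O => 0 | S n => S (S n) end) K). }
    apply Df_or; apply Df_and; auto. apply Df_not; auto. df.
Qed.

Lemma DT_ite (Q : (nat -> V) -> Prop) a b : Df Q -> DT a -> DT b ->
  DT (fun v => ite (Q v) (a v) (b v)).
Proof.
  intros H K L. eapply DT_char with (phi := fun y v => (Q v /\ y = a v) \/ (~ Q v /\ y = b v)).
  - intros v y. destruct (classic (Q v)); [rewrite ite_true|rewrite ite_false]; tauto.
  - assert (J : Df (fun v => Q (tl v))) by (apply (Df_ren S H)).
    apply Df_or; apply Df_and; auto. apply Df_not; auto.
Qed.

Lemma DT_upair (a b : (nat -> V) -> V) : DT a -> DT b -> DT (fun v => upair (a v) (b v)).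
Proof.
  apply DT_fun2. apply Df_iff with (fun v => forall x, x ∊ v 0 <-> x = v 1 \/ x = v 2); [|df].
  intros v. split; [|intros ->; apply in_upair].
  intros H; apply set_ext; intros z; rewrite in_upair; auto.
Qed.

Lemma DT_union (a : (nat -> V) -> V) : DT a -> DT (fun v => union (a v)).
Proof.
  apply DT_fun1. apply Df_iff with (fun v => forall x, x ∊ v 0 <-> exists y, x ∊ y /\ y ∊ v 1); [|df].
  intros v. split; [|intros ->; apply in_union].
  intros H; apply set_ext; intros z; rewrite in_union; auto.
Qed.

Lemma Df_sub (a b : (nat -> V) -> V) : DT a -> DT b -> Df (fun v => a v ⊆ b v).
Proof. apply (Df_rel2 sub). unfold sub. df. Qed.

Lemma DT_pow (a : (nat -> V) -> V) : DT a -> DT (fun v => pow (a v)).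
Proof.
  apply DT_fun1. apply Df_iff with (fun v => forall x, x ∊ v 0 <-> x ⊆ v 1); [|unfold sub; df].
  intros v. split; [|intros ->; apply in_pow].
  intros H; apply set_ext; intros z; rewrite in_pow; auto.
Qed.
End DefOps.
#[global] Hint Resolve DT_sep DT_repl DT_the DT_ite DT_upair DT_union DT_pow Df_sub : df.

Section DefOps2.
Context {V : model}.
Implicit Types (a b : (nat -> V) -> V).
Lemma DT_opair a b : DT a -> DT b -> DT (fun v => opair (a v) (b v)).
Proof. apply DT_fun2. unfold opair. change (DT (fun v : nat -> V => upair (upair (v 0) (v 0)) (upair (v 0) (v 1)))). df. Qed.
Lemma DT_cup a b : DT a -> DT b -> DT (fun v => cup (a v) (b v)).
Proof. intros; unfold cup; df. Qed.
Lemma DT_sing a : DT a -> DT (fun v => sing (a v)).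
Proof. intros; unfold sing; df. Qed.
Hint Resolve DT_opair DT_cup DT_sing : df.
Lemma DT_succ a : DT a -> DT (fun v => succ (a v)).
Proof. intros; unfold succ; df. Qed.
Lemma DT_diff a b : DT a -> DT b -> DT (fun v => diff (a v) (b v)).
Proof. apply DT_fun2. change (DT (fun v : nat -> V => diff (v 0) (v 1))). unfold diff. df. Qed.
Lemma DT_prod a b : DT a -> DT b -> DT (fun v => prod (a v) (b v)).
Proof. apply DT_fun2. change (DT (fun v : nat -> V => prod (v 0) (v 1))). unfold prod. df. Qed.
Lemma DT_lam a F : DT a -> DT (fun v => F (v 0) (tl v)) -> DT (fun v => lam (a v) (fun x => F x v)).
Proof.
  intros H K. unfold lam. apply DT_repl with (F := fun x v => opair x (F x v)); auto. df.
Qed.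
Lemma DT_app a b : DT a -> DT b -> DT (fun v => app (a v) (b v)).
Proof. apply DT_fun2. change (DT (fun v : nat -> V => app (v 0) (v 1))). unfold app. df. Qed.
Lemma DT_fst a : DT a -> DT (fun v => fst (a v)).
Proof. apply DT_fun1. change (DT (fun v : nat -> V => fst (v 0))). unfold fst. df. Qed.
Lemma DT_snd a : DT a -> DT (fun v => snd (a v)).
Proof. apply DT_fun1. change (DT (fun v : nat -> V => snd (v 0))). unfold snd. df. Qed.
End DefOps2.
#[global] Hint Resolve DT_opair DT_cup DT_sing DT_succ DT_diff DT_prod DT_lam DT_app DT_fst DT_snd : df.

(** * Functions as sets of pairs, and foundation *)

Section Functions.
Context {V : model}.
Implicit Types (a b c f g x y z : V).

Lemma in_diff a b x : x ∊ diff a b <-> x ∊ a /\ ~ x ∊ b.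
Proof. unfold diff. rewrite in_sep by df. tauto. Qed.

Lemma in_prod a b z : z ∊ prod a b <-> exists x y, x ∊ a /\ y ∊ b /\ z = opair x y.
Proof.
  unfold prod. rewrite in_union. split.
  - intros (w & Hz & Hw). rewrite in_repl in Hw by df. destruct Hw as (x & Hx & ->).
    rewrite in_repl in Hz by df. firstorder.
  - intros (x & y & Hx & Hy & ->). exists (repl b (fun y => opair x y)).
    rewrite !in_repl by df. split; [exists y | exists x]; auto.
Qed.

Lemma opair_in_prod a b x y : opair x y ∊ prod a b <-> x ∊ a /\ y ∊ b.
Proof.
  rewrite in_prod. split; [|firstorder].
  intros (x' & y' & H & K & L). apply opair_inj in L as [-> ->]. auto.
Qed.

Lemma in_lam a F z : DT (fun v => F (v 0)) -> (z ∊ lam a F <-> exists x, x ∊ a /\ z = opair x (F x)).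
Proof. intros H. unfold lam. rewrite in_repl by df. tauto. Qed.

Lemma opair_in_lam a F x y : DT (fun v => F (v 0)) -> (opair x y ∊ lam a F <-> x ∊ a /\ y = F x).
Proof.
  intros H. rewrite in_lam by auto. split.
  - intros (z & K & L). apply opair_inj in L as [-> ->]; auto.
  - intros [K ->]; eauto.
Qed.

Lemma app_lam a F x : DT (fun v => F (v 0)) -> x ∊ a -> app (lam a F) x = F x.
Proof.
  intros H K. apply the_eq; [apply opair_in_lam; auto|].
  intros z L. apply opair_in_lam in L as [_ L]; auto.
Qed.

Lemma lam_ext a F G : DT (fun v => F (v 0)) -> DT (fun v => G (v 0)) ->
  (forall x, x ∊ a -> F x = G x) -> lam a F = lam a G.
Proof.
  intros H K L. apply set_ext. intros z. rewrite !in_lam by auto.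
  split; intros (x & J & ->); exists x; rewrite L; auto.
Qed.

(** One equation says that [f] consists of pairs, is single-valued and has domain exactly [a]. *)
Definition Fn f a : Prop := f = lam a (app f).

Lemma Fn_lam a F : DT (fun v => F (v 0)) -> Fn (lam a F) a.
Proof. intros H. apply lam_ext; auto. df. intros x K. rewrite app_lam; auto. Qed.

Lemma Fn_in f a z : Fn f a -> (z ∊ f <-> exists x, x ∊ a /\ z = opair x (app f x)).
Proof. intros H. unfold Fn in H. rewrite H at 1. apply in_lam. df. Qed.

Lemma Fn_opair f a x y : Fn f a -> (opair x y ∊ f <-> x ∊ a /\ y = app f x).
Proof. intros H. unfold Fn in H. rewrite H at 1. apply opair_in_lam. df. Qed.

Lemma Fn_intro f a : (forall z, z ∊ f -> exists x y, x ∊ a /\ z = opair x y) ->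
  (forall x, x ∊ a -> exists! y, opair x y ∊ f) -> Fn f a.
Proof.
  intros H K.
  assert (L : forall x y, x ∊ a -> opair x y ∊ f -> app f x = y).
  { intros x y Hx Hy. apply the_eq; auto. intros z Hz.
    destruct (K x Hx) as (w & _ & U). rewrite <- (U z), <- (U y); auto. }
  apply set_ext. intros z. rewrite in_lam by df. split.
  - intros Hz. destruct (H z Hz) as (x & y & Hx & ->). exists x; split; auto.
    rewrite (L x y); auto.
  - intros (x & Hx & ->). destruct (K x Hx) as (y & Hy & _). rewrite (L x y); auto.
Qed.

Lemma app_eq f a x y : Fn f a -> opair x y ∊ f -> app f x = y.
Proof. intros H K. apply (Fn_opair x y H) in K as [_ K]; auto. Qed.

Definition Maps f a b : Prop := Fn f a /\ forall x, x ∊ a -> app f x ∊ b.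

Lemma Maps_lam a b F : DT (fun v => F (v 0)) -> (forall x, x ∊ a -> F x ∊ b) -> Maps (lam a F) a b.
Proof. intros H K. split; [apply Fn_lam; auto|]. intros x L. rewrite app_lam; auto. Qed.

Definition ran f a := repl a (app f).
Lemma in_ran f a y : y ∊ ran f a <-> exists x, x ∊ a /\ y = app f x.
Proof. unfold ran. apply in_repl. df. Qed.

Lemma Df_Fn (s t : (nat -> V) -> V) : DT s -> DT t -> Df (fun v => Fn (s v) (t v)).
Proof. apply (Df_rel2 Fn). unfold Fn. apply Df_eq; [df|].
  apply DT_lam with (F := fun x v => app (v 0) x); df. Qed.
Hint Resolve Df_Fn : df.
Lemma Df_Maps (s t u : (nat -> V) -> V) : DT s -> DT t -> DT u -> Df (fun v => Maps (s v) (t v) (u v)).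
Proof. apply (Df_rel3 Maps). unfold Maps. df. Qed.
Lemma DT_ran (s t : (nat -> V) -> V) : DT s -> DT t -> DT (fun v => ran (s v) (t v)).
Proof. apply DT_fun2. change (DT (fun v : nat -> V => ran (v 0) (v 1))). unfold ran.
  apply DT_repl with (F := fun x v => app (v 0) x); df. Qed.

Lemma found x : (exists y, y ∊ x) -> exists y, y ∊ x /\ forall z, z ∊ y -> ~ z ∊ x.
Proof. apply (zf_found (model_ZF V)). Qed.

Lemma min_exists a (phi : V -> Prop) : Df (fun v => phi (v 0)) -> (exists x, x ∊ a /\ phi x) ->
  exists x, x ∊ a /\ phi x /\ forall y, y ∊ x -> y ∊ a -> ~ phi y.
Proof.
  intros D (x & Hx). destruct (@found (sep a phi)) as (y & Hy & K).
  - exists x. apply in_sep; auto.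
  - apply in_sep in Hy as [H1 H2]; auto. exists y. split; [|split]; auto.
    intros z L1 L2 L3. apply (K z); auto. apply in_sep; auto.
Qed.

Lemma not_in_self x : ~ x ∊ x.
Proof.
  intros H. destruct (@found (sing x)) as (y & Hy & K).
  - exists x. apply in_sing; auto.
  - apply in_sing in Hy as ->. apply (K x); auto. apply in_sing; auto.
Qed.

Lemma not_in_2 x y : x ∊ y -> ~ y ∊ x.
Proof.
  intros H K. destruct (@found (upair x y)) as (z & Hz & L).
  - exists x. apply in_upair; auto.
  - apply in_upair in Hz as [->| ->]; [apply (L y)|apply (L x)]; auto; apply in_upair; auto.
Qed.
End Functions.
#[global] Hint Resolve Df_Fn Df_Maps DT_ran : df.

(** * Ordinals, induction and recursion *)

Section Ordinals.
Context {V : model}.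
Implicit Types (a b c f g x y z : V).

Definition Trans x : Prop := forall y, y ∊ x -> y ⊆ x.
Definition Ord x : Prop := Trans x /\ forall y, y ∊ x -> Trans y.
Definition Limit x : Prop := Ord x /\ (exists y, y ∊ x) /\ forall y, y ∊ x -> exists z, z ∊ x /\ y ∊ z.

Lemma Df_Trans (s : (nat -> V) -> V) : DT s -> Df (fun v => Trans (s v)).
Proof. apply (Df_rel1 Trans). unfold Trans. df. Qed.
Hint Resolve Df_Trans : df.
Lemma Df_Ord (s : (nat -> V) -> V) : DT s -> Df (fun v => Ord (s v)).
Proof. apply (Df_rel1 Ord). unfold Ord. df. Qed.
Hint Resolve Df_Ord : df.
Lemma Df_Limit (s : (nat -> V) -> V) : DT s -> Df (fun v => Limit (s v)).
Proof. apply (Df_rel1 Limit). unfold Limit. df. Qed.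
Hint Resolve Df_Limit : df.

Lemma Ord_in x y : Ord x -> y ∊ x -> Ord y.
Proof.
  intros [T H] K. split; auto. intros z L. apply H. apply (T y); auto.
Qed.

Lemma Ord_trans x y z : Ord z -> x ∊ y -> y ∊ z -> x ∊ z.
Proof. intros [T _] H K. apply (T y); auto. Qed.

Lemma Ord_emp : Ord (emp : V).
Proof. split; intros y H; destruct (in_emp H). Qed.

Lemma Ord_succ x : Ord x -> Ord (succ x).
Proof.
  intros [T H]. split.
  - intros y K z L. apply in_succ. apply in_succ in K as [K| ->]; left; auto. apply (T y); auto.
  - intros y K. apply in_succ in K as [K| ->]; auto.
Qed.

(** Take [u] minimal among those incomparable with some [w], then such a [w] minimal. Elements of
    either one are comparable with the other, and this forces [u] and [w] to have the same
    elements. *)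
Lemma Ord_trich x y : Ord x -> Ord y -> x ∊ y \/ x = y \/ y ∊ x.
Proof.
  intros Hx Hy. apply NNPP. intros N.
  set (cmp := fun u w : V => u ∊ w \/ u = w \/ w ∊ u).
  assert (Dc : Df (fun v : nat -> V => cmp (v 0) (v 1))) by (unfold cmp; df).
  destruct (@min_exists V (succ x) (fun u => exists w, w ∊ succ y /\ ~ cmp u w)) as (u & U1 & (w' & W0) & U3).
  { df. }
  { exists x. rewrite in_succ. split; auto. exists y. rewrite in_succ. auto. }
  destruct (@min_exists V (succ y) (fun w => ~ cmp u w)) as (w & W1 & W2 & W3).
  { df. }
  { exists w'. tauto. }
  assert (Ox : Ord (succ x)) by (apply Ord_succ; auto).
  assert (Oy : Ord (succ y)) by (apply Ord_succ; auto).
  apply W2. right; left. apply set_ext. intros z. split; intros L.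
  - assert (C : cmp z w).
    { apply NNPP. intros Q. apply (U3 z); auto. apply (@Ord_trans z u); auto. eauto. }
    destruct C as [C|[->|C]]; auto; exfalso; apply W2; right; right; auto.
    apply (@Ord_trans w z); auto. apply (@Ord_in (succ x)); auto.
  - assert (C : cmp u z).
    { apply NNPP. apply W3; auto. apply (@Ord_trans z w); auto. }
    destruct C as [C|[->|C]]; auto; exfalso; apply W2; left; auto.
    apply (@Ord_trans u z); auto. apply (@Ord_in (succ y)); auto.
Qed.

Lemma Ord_sub x y : Ord x -> Ord y -> (x ⊆ y <-> x ∊ y \/ x = y).
Proof.
  intros Hx Hy. split.
  - intros H. destruct (Ord_trich Hx Hy) as [K|[K|K]]; auto. destruct (not_in_self (H _ K)).
  - intros [H| ->]; [|intros z; auto]. exact (proj1 Hy x H).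
Qed.

Lemma Ord_le x y : Ord x -> Ord y -> x ⊆ y \/ y ∊ x.
Proof.
  intros Hx Hy. destruct (Ord_trich Hx Hy) as [K|[K|K]]; auto; left; apply Ord_sub; auto.
Qed.

Lemma Ord_not_in x y : Ord x -> Ord y -> ~ x ∊ y -> y ⊆ x.
Proof. intros Hx Hy H. destruct (Ord_le Hy Hx); tauto. Qed.

Lemma Ord_sub_in x y z : Ord x -> Ord z -> x ⊆ y -> y ∊ z -> x ∊ z.
Proof.
  intros Hx Hz H K. assert (Hy : Ord y) by (apply (Ord_in Hz K)).
  apply Ord_sub in H as [H|H]; auto. apply (Ord_trans Hz H K). congruence.
Qed.

Lemma succ_sub x y : Ord y -> x ∊ y -> succ x ⊆ y.
Proof. intros Hy H z K. apply in_succ in K as [K| ->]; auto. apply (Ord_trans Hy K H). Qed.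

Lemma Ord_union a : (forall x, x ∊ a -> Ord x) -> Ord (union a).
Proof.
  intros H. split.
  - intros y K z L. apply in_union in K as (w & K1 & K2). apply in_union. exists w; split; auto.
    apply (Ord_trans (H _ K2) L K1).
  - intros y K. apply in_union in K as (w & K1 & K2). apply (proj2 (H _ K2) y K1).
Qed.

Lemma Limit_succ x y : Limit x -> y ∊ x -> succ y ∊ x.
Proof.
  intros (O & _ & L) H. destruct (L y H) as (z & Hz & K).
  apply Ord_sub_in with z; auto. apply Ord_succ, (Ord_in O H).
  apply succ_sub; auto. apply (Ord_in O Hz).
Qed.

Lemma succ_inj x y : succ x = succ y -> x = y.
Proof.
  intros H. assert (K : x ∊ succ y) by (rewrite <- H, in_succ; auto).
  assert (L : y ∊ succ x) by (rewrite H, in_succ; auto).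
  rewrite in_succ in K, L. destruct K as [K|K], L as [L|L]; auto. destruct (not_in_2 K L).
Qed.

Lemma Ord_cases x : Ord x -> x = emp \/ (exists y, y ∊ x /\ x = succ y) \/ Limit x.
Proof.
  intros O. destruct (emp_or x) as [H|H]; auto. right.
  destruct (classic (exists y, y ∊ x /\ forall z, z ∊ x -> ~ y ∊ z)) as [(y & Hy & K)|N].
  - left. exists y; split; auto. apply sub_antisym.
    + intros z Hz. apply in_succ. assert (Oz : Ord z) by apply (Ord_in O Hz).
      assert (Oy : Ord y) by apply (Ord_in O Hy).
      destruct (Ord_trich Oz Oy) as [L|[L|L]]; auto. destruct (K z Hz L).
    + apply succ_sub; auto.
  - right. split; [|split]; auto. intros y Hy. apply NNPP. intros Q. apply N.
    exists y; split; auto. intros z Hz L. apply Q; eauto.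
Qed.

Lemma omega_exists : exists w : V, Limit w /\ forall y, y ∊ w -> ~ Limit y.
Proof. exact (zf_inf (model_ZF V)). Qed.
Definition om : V := proj1_sig (constructive_indefinite_description _ omega_exists).
Lemma om_spec : Limit om /\ forall y, y ∊ om -> ~ Limit y.
Proof. unfold om; destruct constructive_indefinite_description; auto. Qed.
Lemma Limit_om : Limit om.
Proof. apply om_spec. Qed.
Lemma Ord_om : Ord om.
Proof. apply Limit_om. Qed.
Lemma om_least x : Limit x -> om ⊆ x.
Proof.
  intros H. apply Ord_not_in. apply H. apply Ord_om. intros K. destruct om_spec as [_ N].
  apply (N x); auto.
Qed.
Lemma Limit_emp x : Limit x -> emp ∊ x.
Proof.
  intros (O & (y & Hy) & _). destruct (Ord_trich Ord_emp O) as [H|[H|H]]; auto.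
  subst. destruct (in_emp Hy). destruct (in_emp H).
Qed.

(** Restricted to definable [phi], since [om] may have nonstandard elements. *)
Lemma om_ind (phi : V -> Prop) : Df (fun v => phi (v 0)) ->
  phi emp -> (forall n, n ∊ om -> phi n -> phi (succ n)) -> forall n, n ∊ om -> phi n.
Proof.
  intros D H0 HS n Hn. apply NNPP. intros N.
  destruct (@min_exists V om (fun x => ~ phi x)) as (x & Hx & K & L). df. eauto.
  assert (O : Ord x) by apply (Ord_in Ord_om Hx).
  destruct (Ord_cases O) as [->|[(y & Hy & ->)|Lx]]; auto.
  - assert (Yo : y ∊ om) by apply (Ord_trans Ord_om Hy Hx).
    apply K, HS; auto. apply NNPP, L; auto.
  - destruct om_spec as [_ Q]. apply (Q x); auto.
Qed.

Lemma least_Ord (phi : V -> Prop) : Df (fun v => phi (v 0)) ->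
  (exists x, Ord x /\ phi x) -> exists x, Ord x /\ phi x /\ forall y, y ∊ x -> ~ phi y.
Proof.
  intros D (x & Ox & Hx). destruct (@min_exists V (succ x) phi D) as (y & Hy & K & L).
  - exists x; split; auto. apply in_succ; auto.
  - assert (Oy : Ord y) by apply (Ord_in (Ord_succ Ox) Hy).
    exists y; split; [|split]; auto. intros z Hz. apply L; auto.
    apply (Ord_trans (Ord_succ Ox) Hz Hy).
Qed.

(* The finite iterates [x, ⋃x, ⋃⋃x, ...] are collected along [om]. *)
Lemma tc_exists x : exists T, Trans T /\ x ⊆ T.
Proof.
  set (att := fun n g => Fn g (succ n) /\ app g emp = x /\
                forall k, k ∊ n -> app g (succ k) = union (app g k)).
  assert (Da : Df (fun v : nat -> V => att (v 0) (v 1))) by (unfold att; df).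
  assert (H0 : forall n, Ord n -> emp ∊ succ n).
  { intros n O. destruct (Ord_trich Ord_emp (Ord_succ O)) as [H|[H|H]]; auto.
    assert (K : n ∊ emp) by (rewrite H; apply in_succ; auto). destruct (in_emp K).
    destruct (in_emp H). }
  assert (ex : forall n, n ∊ om -> exists g, att n g).
  { apply om_ind. df.
    - exists (lam (succ emp) (fun _ => x)). split; [|split].
      + apply Fn_lam. df.
      + rewrite app_lam; auto. df. apply H0, Ord_emp.
      + intros k K. destruct (in_emp K).
    - intros n Hn (g & G1 & G2 & G3).
      assert (On : Ord n) by apply (Ord_in Ord_om Hn).
      exists (lam (succ (succ n)) (fun k => ite (k ∊ succ n) (app g k) (union (app g n)))).
      split; [|split].
      + apply Fn_lam. df.
      + rewrite app_lam; [|df|apply H0, Ord_succ; auto]. rewrite ite_true; auto.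
      + intros k K. rewrite !app_lam; try df.
        * rewrite (ite_true (Q := k ∊ succ n)) by auto. apply in_succ in K as [K| ->].
          -- rewrite ite_true; auto.
             apply Ord_sub_in with n. apply Ord_succ, (Ord_in On K). apply Ord_succ; auto.
             apply succ_sub; auto. apply in_succ; auto.
          -- rewrite ite_false; auto. apply not_in_self.
        * apply in_succ; auto.
        * apply Ord_sub_in with (succ n). apply Ord_succ, (Ord_in (Ord_succ On) K).
          apply Ord_succ, Ord_succ; auto. apply succ_sub; auto. apply Ord_succ; auto.
          apply in_succ; auto. }
  assert (un : forall n, n ∊ om -> forall g m h, m ∊ om -> att n g -> att m h ->
                 n ⊆ m -> app g n = app h n).
  { intros n Hn g m h Hm (G1 & G2 & G3) (K1 & K2 & K3) S.
    assert (L : forall k, k ∊ om -> k ∊ succ n -> app g k = app h k).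
    { apply (@om_ind (fun k => k ∊ succ n -> app g k = app h k)). df.
      - intros _; congruence.
      - intros k Hk IH Sk. assert (kn : k ∊ n).
        { assert (On : Ord n) by apply (Ord_in Ord_om Hn).
          apply in_succ in Sk as [Sk|Sk].
          - apply Ord_trans with (succ k); auto. apply in_succ; auto.
          - rewrite <- Sk. apply in_succ; auto. }
        rewrite G3, K3, IH; auto. apply in_succ; auto. }
    apply L; auto. apply in_succ; auto. }
  set (It := fun n => the (fun y => exists g, att n g /\ y = app g n)).
  assert (DI : DT (fun v : nat -> V => It (v 0))) by (unfold It; df).
  assert (IE : forall n g, n ∊ om -> att n g -> It n = app g n).
  { intros n g Hn Hg. apply the_eq; eauto. intros z (h & Hh & ->).
    apply (un n) with n; auto. intros w; auto. }
  exists (union (repl om It)). split.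
  - intros y Hy z Hz. apply in_union in Hy as (w & K1 & K2).
    rewrite in_repl in K2 by df. destruct K2 as (n & Hn & ->).
    assert (Sn : succ n ∊ om) by (apply (Limit_succ Limit_om Hn)).
    apply in_union. exists (It (succ n)). split.
    + destruct (ex _ Sn) as (g & Hg). rewrite (IE _ _ Sn Hg).
      destruct (ex _ Hn) as (h & Hh). rewrite (IE _ _ Hn Hh) in K1.
      rewrite (un n Hn h (succ n) g) in K1; auto.
      * destruct Hg as (G1 & G2 & G3). rewrite G3; [|apply in_succ; auto].
        apply in_union; eauto.
      * intros u Hu; apply in_succ; auto.
    + rewrite in_repl by df. eauto.
  - intros z Hz. apply in_union. exists (It emp). assert (E0 : emp ∊ om) by apply (Limit_emp Limit_om).
    split. destruct (ex _ E0) as (g & Hg). rewrite (IE _ _ E0 Hg).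
    destruct Hg as (_ & -> & _); auto. rewrite in_repl by df; eauto.
Qed.

Definition tc x := the (fun T => Trans T /\ x ⊆ T /\ forall S, Trans S -> x ⊆ S -> T ⊆ S).
Lemma tc_spec x : Trans (tc x) /\ x ⊆ tc x /\ forall S, Trans S -> x ⊆ S -> tc x ⊆ S.
Proof.
  destruct (tc_exists x) as (T & HT & Hx).
  set (phi := fun T => Trans T /\ x ⊆ T /\ forall S, Trans S -> x ⊆ S -> T ⊆ S).
  assert (K : exists! y, phi y).
  { set (C := fun y => forall S, Trans S -> x ⊆ S -> y ∊ S).
    assert (Dc : Df (fun v => C (v 0))) by (unfold C; df).
    exists (sep T C). split; [split; [|split]|].
    - intros y Hy z Hz. rewrite in_sep in * by df. destruct Hy as [Hy H]. split. apply (HT y); auto.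
      intros S HS Sx. apply (HS y); auto.
    - intros z Hz. rewrite in_sep by df. split; auto. intros S _ Sx; auto.
    - intros S HS Sx z Hz. rewrite in_sep in Hz by df. apply Hz; auto.
    - intros y (Y1 & Y2 & Y3). apply sub_antisym.
      + intros z Hz. rewrite in_sep in Hz by df. apply Hz; auto.
      + intros z Hz. rewrite in_sep by df. split. apply (Y3 T); auto.
        intros S HS Sx. apply (Y3 S); auto. }
  destruct (proj1 (the_char phi (the phi)) eq_refl) as [[_ H]|[H _]]; [exact H|tauto].
Qed.

Lemma DT_tc (s : (nat -> V) -> V) : DT s -> DT (fun v => tc (s v)).
Proof. apply DT_fun1. change (DT (fun v : nat -> V => tc (v 0))). unfold tc. df. Qed.
Hint Resolve DT_tc : df.

Lemma mem_ind (phi : V -> Prop) : Df (fun v => phi (v 0)) ->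
  (forall x, (forall y, y ∊ x -> phi y) -> phi x) -> forall x, phi x.
Proof.
  intros D H x. apply NNPP. intros N.
  destruct (tc_spec (sing x)) as (T1 & T2 & _).
  destruct (@min_exists V (tc (sing x)) (fun x => ~ phi x)) as (y & Hy & K & L). df.
  - exists x; split; auto. apply T2, in_sing; auto.
  - apply K, H. intros z Hz. apply NNPP, L; auto. apply (T1 y); auto.
Qed.

Section Recursion.
Variable F : V -> V -> V.
Hypothesis DF : DT (fun v => F (v 0) (v 1)).

(** A partial solution on a transitive domain. Any two agree on the common part, so [rec] may use
    whichever covers its argument. *)
Definition attempt T g : Prop :=
  Trans T /\ Fn g T /\ forall y, y ∊ T -> app g y = F y (lam y (app g)).

Definition rec x : V :=
  the (fun z => exists T g, x ⊆ T /\ attempt T g /\ z = F x (lam x (app g))).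

Lemma Df_attempt : Df (fun v => attempt (v 0) (v 1)).
Proof.
  unfold attempt. repeat apply Df_and; [df|df|]. apply Df_all, Df_imp; [df|].
  apply Df_eq; [df|]. apply (DT_app2 F); auto. df. apply DT_lam with (F := fun x v => app (v 2) x); df.
Qed.

Lemma attempt_agree T g T' g' : attempt T g -> attempt T' g' ->
  forall y, y ∊ T -> y ∊ T' -> app g y = app g' y.
Proof.
  intros (A1 & A2 & A3) (B1 & B2 & B3) y Hy Hy'. apply NNPP; intros N.
  destruct (@min_exists V T (fun y => y ∊ T' /\ app g y <> app g' y)) as (z & Z1 & (Z2 & Z3) & Z4).
  df. eauto. apply Z3. rewrite A3, B3; auto. f_equal.
  apply lam_ext; try df. intros w Hw. apply NNPP. intros Q.
  apply (Z4 w); auto. apply (A1 z); auto. split; auto. apply (B1 z); auto.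
Qed.

Lemma rec_attempt T g x : attempt T g -> x ⊆ T -> rec x = F x (lam x (app g)).
Proof.
  intros A S. apply the_eq; [exists T, g; auto|].
  intros z (T' & g' & S' & A' & ->). f_equal. apply lam_ext; try df.
  intros w Hw. apply (attempt_agree A' A); auto.
Qed.

Lemma Df_lam_rec_prim : DT (fun v => rec (v 0)).
Proof.
  unfold rec. apply DT_the with (phi := fun z v => exists T g, v 0 ⊆ T /\ attempt T g /\ z = F (v 0) (lam (v 0) (app g))).
  pose proof Df_attempt as Da.
  apply Df_ex, Df_ex, Df_and; [df|]. apply Df_and; [df|]. apply Df_eq; [df|]. apply (DT_app2 F); auto. df.
  apply DT_lam with (F := fun x v => app (v 0) x); df.
Qed.

Lemma rec_eq x : rec x = F x (lam x rec).
Proof.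
  pose proof Df_lam_rec_prim as Dr.
  assert (Deq : Df (fun v => rec (v 0) = F (v 0) (lam (v 0) rec))).
  { apply Df_eq; [df|]. apply (DT_app2 F); auto. df. apply DT_lam with (F := fun x v => rec x); df. }
  (* Once the equation holds throughout [tc x], the restriction of [rec] to [tc x] is itself an
     attempt, and this gives the equation at [x]. *)
  set (Q := fun x => forall y, y ∊ tc x -> rec y = F y (lam y rec)).
  assert (DQ : Df (fun v => Q (v 0))).
  { unfold Q. apply Df_all, Df_imp. df. apply (Df_rel1 (fun y => rec y = F y (lam y rec))); auto. df. }
  assert (att : forall x, Q x -> attempt (tc x) (lam (tc x) rec)).
  { intros y Hy. destruct (tc_spec y) as (T1 & T2 & T3). split; [|split]; auto. apply Fn_lam; df.
    intros z Hz. rewrite app_lam by (auto; df). rewrite Hy; auto. f_equal. apply lam_ext; try df.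
    intros w Hw. rewrite app_lam; auto. apply (T1 z); auto. }
  assert (one : forall x, Q x -> rec x = F x (lam x rec)).
  { intros y Hy. destruct (tc_spec y) as (T1 & T2 & T3).
    rewrite (rec_attempt (att y Hy) T2). f_equal. apply lam_ext; try df.
    intros z Hz. rewrite app_lam; auto. }
  apply one. revert x. apply mem_ind; auto. intros x IH y Hy.
  destruct (tc_spec x) as (T1 & T2 & T3).
  assert (L : tc x ⊆ cup x (union (repl x tc))).
  { apply T3.
    - intros z Hz w Hw. apply in_cup in Hz as [Hz|Hz]; apply in_cup; right; apply in_union.
      + exists (tc z). split. destruct (tc_spec z) as (_ & S2 & _); auto. rewrite in_repl by df; eauto.
      + apply in_union in Hz as (u & Hu & K). exists u; split; auto.
        rewrite in_repl in K by df. destruct K as (t & Ht & ->). apply (proj1 (tc_spec t) z); auto.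
    - intros z Hz; apply in_cup; auto. }
  apply L in Hy. apply in_cup in Hy as [Hy|Hy].
  - apply one, IH; auto.
  - apply in_union in Hy as (u & Hu & K). rewrite in_repl in K by df. destruct K as (t & Ht & ->).
    apply (IH t Ht); auto.
Qed.
End Recursion.
End Ordinals.
#[global] Hint Resolve Df_Trans Df_Ord Df_Limit DT_tc : df.

(** * Recursion with parameters, and least ordinals *)

Section Recursion2.
Context {V : model}.
Implicit Types (a b c f g x y z : V).

Lemma DT_subst2 (F : V -> V -> (nat -> V) -> V) s t :
  DT (fun v => F (v 0) (v 1) (tl (tl v))) -> DT s -> DT t -> DT (fun v => F (s v) (t v) v).
Proof.
  intros H K L. unfold DT.
  apply (Df_subst (fun x v => v 0 = F x (t (tl v)) (tl v)) (t := fun v => s (tl v))); [|apply DT_tl, K].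
  apply (Df_subst (fun y v => v 1 = F (v 0) y (tl (tl v))) (t := fun v => t (tl (tl v)))).
  - apply (Df_ren (fun n => match n with 0 => 2 | 1 => 1 | 2 => 0 | S (S (S n)) => S (S (S n)) end) H).
  - apply (DT_ren (fun n => S (S n)) L).
Qed.

Lemma DT_rec (F : V -> V -> (nat -> V) -> V) t :
  DT (fun v => F (v 0) (v 1) (tl (tl v))) -> DT t ->
  DT (fun v => rec (fun x g => F x g v) (t v)).
Proof.
  intros H K. unfold rec.
  apply DT_the with (phi := fun z v => exists T g, t v ⊆ T /\ attempt (fun x g => F x g v) T g /\
     z = F (t v) (lam (t v) (app g)) v).
  assert (K3 : DT (fun v => t (fun n => v (S (S (S n)))))) by (apply (DT_ren (fun n => S (S (S n))) K)).
  apply Df_ex, Df_ex, Df_and; [|apply Df_and].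
  - apply Df_sub; [exact K3|df].
  - unfold attempt. apply Df_and; [df|]. apply Df_and; [df|].
    apply Df_all, Df_imp; [df|]. apply Df_eq; [df|].
    apply (DT_subst2 (F := fun x g v => F x g (fun n => v (S (S (S (S n))))))).
    + apply (DT_ren (fun n => match n with 0 => 0 | 1 => 1 | S (S n) => S (S (S (S (S (S n))))) end) H).
    + df.
    + apply DT_lam with (F := fun x v => app (v 1) x); df.
  - apply Df_eq; [df|].
    apply (DT_subst2 (F := fun x g v => F x g (fun n => v (S (S (S n)))))).
    + apply (DT_ren (fun n => match n with 0 => 0 | 1 => 1 | S (S n) => S (S (S (S (S n)))) end) H).
    + exact K3.
    + apply DT_lam with (F := fun x v => app (v 0) x); [exact K3|df].
Qed.

(** Taking least ordinals as a definable term replaces many appeals to choice below. *)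
Definition mu (phi : V -> Prop) := the (fun x => Ord x /\ phi x /\ forall y, y ∊ x -> ~ phi y).
Lemma mu_spec (phi : V -> Prop) : Df (fun v => phi (v 0)) -> (exists x, Ord x /\ phi x) ->
  Ord (mu phi) /\ phi (mu phi) /\ (forall y, y ∊ mu phi -> ~ phi y).
Proof.
  intros D H. destruct (least_Ord D H) as (x & O & P & L).
  assert (E : mu phi = x).
  { apply the_eq; auto. intros z (Oz & Pz & Lz).
    destruct (Ord_trich Oz O) as [K|[K|K]]; auto. destruct (L z K Pz). destruct (Lz x K P). }
  rewrite E; auto.
Qed.
Lemma DT_mu (phi : V -> (nat -> V) -> Prop) : Df (fun v => phi (v 0) (tl v)) ->
  DT (fun v => mu (fun x => phi x v)).
Proof.
  intros H. unfold mu. apply DT_the with (phi := fun x v => Ord x /\ phi x v /\ forall y, y ∊ x -> ~ phi y v).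
  apply Df_and; [df|]. apply Df_and; auto. apply Df_all, Df_imp; [df|]. apply Df_not.
  apply (Df_ren (fun n => match n with 0 => 0 | S n => S (S n) end) H).
Qed.
End Recursion2.
#[global] Hint Resolve DT_rec DT_mu : df.

(** * The cumulative hierarchy and collection *)

Section Collection.
Context {V : model}.
Implicit Types (a b c f g x y z : V).

Definition rk x : V := rec (fun x g => union (repl x (fun y => succ (app g y)))) x.
Definition Vh x : V := rec (fun x g => union (repl x (fun y => pow (app g y)))) x.
Lemma DT_rk (s : (nat -> V) -> V) : DT s -> DT (fun v => rk (s v)).
Proof. intros; unfold rk; df. Qed.
Lemma DT_Vh (s : (nat -> V) -> V) : DT s -> DT (fun v => Vh (s v)).
Proof. intros; unfold Vh; df. Qed.
Hint Resolve DT_rk DT_Vh : df.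

Lemma repl_ext a (F G : V -> V) : DT (fun v => F (v 0)) -> DT (fun v => G (v 0)) ->
  (forall x, x ∊ a -> F x = G x) -> repl a F = repl a G.
Proof.
  intros H K L. apply set_ext; intros z. rewrite !in_repl by auto.
  split; intros (x & X & ->); exists x; rewrite L; auto.
Qed.

Lemma in_rk x z : z ∊ rk x <-> exists y, y ∊ x /\ z ∊ succ (rk y).
Proof.
  unfold rk at 1. rewrite rec_eq by df. rewrite in_union. split.
  - intros (w & H & K). rewrite in_repl in K by df. destruct K as (y & Hy & ->).
    exists y; split; auto. rewrite app_lam in H; auto. df.
  - intros (y & Hy & K). exists (succ (rk y)). split; auto. rewrite in_repl by df.
    exists y; split; auto. rewrite app_lam; auto. df.
Qed.

Lemma in_Vh x z : z ∊ Vh x <-> exists y, y ∊ x /\ z ⊆ Vh y.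
Proof.
  unfold Vh at 1. rewrite rec_eq by df. rewrite in_union. split.
  - intros (w & H & K). rewrite in_repl in K by df. destruct K as (y & Hy & ->).
    exists y; split; auto. rewrite app_lam in H; auto. apply in_pow; auto. df.
  - intros (y & Hy & K). exists (pow (Vh y)). split; auto. apply in_pow; auto. rewrite in_repl by df.
    exists y; split; auto. rewrite app_lam; auto. df.
Qed.

Lemma Ord_rk x : Ord (rk x).
Proof.
  revert x. apply mem_ind; [df|]. intros x IH. split.
  - intros z Hz w Hw. apply in_rk in Hz as (y & Hy & K). apply in_rk. exists y; split; auto.
    apply (Ord_trans (Ord_succ (IH y Hy)) Hw K).
  - intros z Hz. apply in_rk in Hz as (y & Hy & K). apply (proj1 (Ord_in (Ord_succ (IH y Hy)) K)).
Qed.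

Lemma in_Vh_rk x : x ∊ Vh (succ (rk x)).
Proof.
  apply in_Vh. exists (rk x); split. apply in_succ; auto.
  revert x. apply mem_ind; [df|]. intros x IH z Hz. apply in_Vh. exists (rk z). split; auto.
  apply in_rk. exists z; split; auto. apply in_succ; auto.
Qed.

(** Replacement is applied to the least level of the hierarchy that contains a witness, as in
    Scott's trick. *)
Lemma collection a (R : V -> V -> Prop) : Df (fun v => R (v 0) (v 1)) ->
  exists Y, forall x, x ∊ a -> (exists y, R x y) -> exists y, y ∊ Y /\ R x y.
Proof.
  intros D. set (L := fun x => mu (fun al => exists y, y ∊ Vh al /\ R x y)).
  assert (DL : DT (fun v => L (v 0))) by (unfold L; df).
  exists (union (repl a (fun x => Vh (L x)))). intros x Hx (y & Hy).
  destruct (@mu_spec V (fun al => exists y, y ∊ Vh al /\ R x y)) as (_ & (u & U1 & U2) & _). df.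
  - exists (succ (rk y)). split. apply Ord_succ, Ord_rk. exists y; split; auto. apply in_Vh_rk.
  - exists u. split; auto. apply in_union. exists (Vh (L x)). split; auto.
    rewrite in_repl by df. eauto.
Qed.
End Collection.
#[global] Hint Resolve DT_rk DT_Vh : df.

(** * Choice *)

Class AC (V : model) : Prop := ac_axiom : forall a : V,
    (forall x, x ∊ a -> exists y, y ∊ x) ->
    (forall x y z, x ∊ a -> y ∊ a -> z ∊ x -> z ∊ y -> x = y) ->
    exists c, forall x, x ∊ a -> exists! y, y ∊ x /\ y ∊ c.

Section Choice.
Context {V : model} {ac : AC V}.
Implicit Types (a b c f g x y z : V).

(** Tagging each witness with its argument makes the family disjoint, so that a choice set is
    essentially the graph of the function. *)
Lemma ac_maps a X (R : V -> V -> Prop) : Df (fun v => R (v 0) (v 1)) ->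
  (forall x, x ∊ a -> exists y, y ∊ X /\ R x y) ->
  exists f, Maps f a X /\ forall x, x ∊ a -> R x (app f x).
Proof.
  intros D H.
  set (B := fun x => sep (prod a X) (fun z => exists y, R x y /\ z = opair x y)).
  assert (DB : DT (fun v => B (v 0))) by (unfold B; df).
  assert (inB : forall x z, z ∊ B x <-> x ∊ a /\ exists y, y ∊ X /\ R x y /\ z = opair x y).
  { intros x z. unfold B. rewrite in_sep by df. split.
    - intros (K & y & L & ->). apply opair_in_prod in K as [K1 K2]; eauto.
    - intros (K & y & L1 & L2 & ->). split; eauto. apply opair_in_prod; auto. }
  destruct (ac_axiom (a := repl a B)) as (c & Hc).
  - intros x Hx. rewrite in_repl in Hx by df. destruct Hx as (u & Hu & ->).
    destruct (H u Hu) as (y & Hy & K). exists (opair u y). apply inB; eauto.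
  - intros x y z Hx Hy Zx Zy. rewrite in_repl in Hx, Hy by df.
    destruct Hx as (u & Hu & ->), Hy as (w & Hw & ->).
    apply inB in Zx as (_ & y1 & _ & _ & ->). apply inB in Zy as (_ & y2 & _ & _ & Q).
    apply opair_inj in Q as [-> _]; auto.
  - set (f := sep c (fun z => exists x, x ∊ a /\ z ∊ B x)).
    assert (K : forall x, x ∊ a -> exists! y, opair x y ∊ f).
    { intros x Hx. destruct (Hc (B x)) as (z & (Z1 & Z2) & U). rewrite in_repl by df; eauto.
      pose proof Z1 as Z3. apply inB in Z3 as (_ & y & Y1 & Y2 & ->).
      exists y. split. unfold f. rewrite in_sep by df. eauto.
      intros y' Hy'. unfold f in Hy'. rewrite in_sep in Hy' by df. destruct Hy' as (J1 & x' & J2 & J3).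
      apply inB in J3 as (_ & y2 & Y3 & Y4 & Q). pose proof Q as Q'. apply opair_inj in Q as [<- <-].
      assert (E : opair x y = opair x y'). { apply U. split; auto. apply inB; eauto. }
      apply opair_inj in E as [_ E]; auto. }
    assert (F : Fn f a).
    { apply Fn_intro; auto. intros z Hz. unfold f in Hz. rewrite in_sep in Hz by df.
      destruct Hz as (_ & x & Hx & Z). apply inB in Z as (_ & y & _ & _ & ->); eauto. }
    assert (W : forall x, x ∊ a -> app f x ∊ X /\ R x (app f x)).
    { intros x Hx. destruct (K x Hx) as (y & Hy & _). rewrite (app_eq F Hy).
      unfold f in Hy. rewrite in_sep in Hy by df. destruct Hy as (_ & x' & _ & J).
      apply inB in J as (_ & y2 & Y3 & Y4 & Q). apply opair_inj in Q as [-> ->]; auto. }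
    exists f. split; [split; auto|]; intros x Hx; apply W; auto.
Qed.

Lemma ac_fn a (R : V -> V -> Prop) : Df (fun v => R (v 0) (v 1)) ->
  (forall x, x ∊ a -> exists y, R x y) ->
  exists f, Fn f a /\ forall x, x ∊ a -> R x (app f x).
Proof.
  intros D H. destruct (collection a D) as (Y & HY).
  destruct (@ac_maps a Y R D) as (f & (F & _) & K); eauto.
Qed.

(** Transfinite dependent choice: a recursion driven by a choice function on [pow X], with [emp] as
    a dummy value at the empty set. Limit stages are part of the hypothesis, which speaks of all
    [xi] below [th]. *)
Lemma dep_choice th X (Phi : V -> V -> V -> Prop) : Df (fun v => Phi (v 0) (v 1) (v 2)) -> Ord th ->
  (forall xi s, xi ∊ th -> Maps s xi X -> (forall eta, eta ∊ xi -> Phi eta (lam eta (app s)) (app s eta)) ->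
      exists x, x ∊ X /\ Phi xi s x) ->
  exists s, Maps s th X /\ forall eta, eta ∊ th -> Phi eta (lam eta (app s)) (app s eta).
Proof.
  intros D O H.
  destruct (@ac_fn (pow X) (fun u y => u = emp \/ y ∊ u)) as (c & _ & Hc). df.
  { intros u Hu. destruct (emp_or u) as [->|(y & Hy)]; [exists emp|exists y]; auto. }
  set (F := fun (xi g : V) => app c (sep X (fun x => Phi xi g x))).
  assert (DF : DT (fun v => F (v 0) (v 1))) by (unfold F; df).
  pose proof (Df_lam_rec_prim DF) as DR.
  assert (K : forall xi, xi ∊ th -> rec F xi ∊ X /\ Phi xi (lam xi (rec F)) (rec F xi)).
  { intros xi. revert xi. apply (@mem_ind V (fun xi => xi ∊ th -> rec F xi ∊ X /\ Phi xi (lam xi (rec F)) (rec F xi))).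
    { apply Df_imp; [df|]. apply Df_and; [df|]. apply (Df_rel3 Phi D); [df| |df].
      apply DT_lam with (F := fun x v => rec F x); df. }
    intros xi IH Hxi.
    assert (J : forall eta, eta ∊ xi -> eta ∊ th) by (intros eta Q; apply (Ord_trans O Q Hxi)).
    assert (ne : exists x, x ∊ X /\ Phi xi (lam xi (rec F)) x).
    { apply (H xi); auto.
      - apply Maps_lam; auto. intros eta Q. apply IH; auto.
      - intros eta Q. rewrite app_lam by auto.
        replace (lam eta (app (lam xi (rec F)))) with (lam eta (rec F)). apply IH; auto.
        apply lam_ext; try df. intros z Hz. rewrite app_lam; auto.
        apply (Ord_trans (Ord_in O Hxi) Hz Q). }
    rewrite (rec_eq DF xi). unfold F at 1 3.
    destruct (Hc (sep X (fun x => Phi xi (lam xi (rec F)) x))) as [E|E].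
    - apply in_pow. intros z Hz. rewrite in_sep in Hz by df. tauto.
    - destruct ne as (x & Hx). exfalso. apply (@in_emp V x). rewrite <- E. rewrite in_sep by df. auto.
    - rewrite in_sep in E by df. exact E. }
  exists (lam th (rec F)). split.
  - apply Maps_lam; auto. intros; apply K; auto.
  - intros eta Q. rewrite app_lam by auto.
    replace (lam eta (app (lam th (rec F)))) with (lam eta (rec F)). apply K; auto.
    apply lam_ext; try df. intros z Hz. rewrite app_lam; auto. apply (Ord_trans O Hz Q).
Qed.

Lemma no_set_of_Ord a : exists x, Ord x /\ ~ x ∊ a.
Proof.
  set (b := sep a Ord).
  exists (succ (union b)). assert (O : Ord (union b)).
  { apply Ord_union. intros x Hx. unfold b in Hx. rewrite in_sep in Hx by df. tauto. }
  split. apply Ord_succ; auto. intros K. apply (@not_in_self V (union b)).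
  apply in_union. exists (succ (union b)). split. apply in_succ; auto.
  unfold b. rewrite in_sep by df. split; auto. apply Ord_succ; auto.
Qed.

Definition Inj f a b : Prop := Maps f a b /\
  forall x y, x ∊ a -> y ∊ a -> app f x = app f y -> x = y.
Definition Bij f a b : Prop := Inj f a b /\ forall y, y ∊ b -> exists x, x ∊ a /\ app f x = y.
Definition inj a b : Prop := exists f, Inj f a b.

Lemma Df_Inj (s t u : (nat -> V) -> V) : DT s -> DT t -> DT u -> Df (fun v => Inj (s v) (t v) (u v)).
Proof. apply (Df_rel3 Inj). unfold Inj. df. Qed.
Hint Resolve Df_Inj : df.
Lemma Df_inj (s t : (nat -> V) -> V) : DT s -> DT t -> Df (fun v => inj (s v) (t v)).
Proof. apply (Df_rel2 inj). unfold inj. df. Qed.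

(** Zermelo's recursion, always taking an element of least rank among those not yet listed. The
    monotone enumeration is what the proof of [pairing] needs. *)
Lemma well_order_rank x (r : V -> V) : DT (fun v => r (v 0)) -> (forall y, y ∊ x -> Ord (r y)) ->
  exists th h, Ord th /\ Bij h th x /\
    forall eta xi, eta ∊ xi -> xi ∊ th -> r (app h eta) ⊆ r (app h xi).
Proof.
  intros Dr Or.
  destruct (@ac_fn (pow x) (fun u y => u = emp \/ (y ∊ u /\ forall w, w ∊ u -> r y ⊆ r w))) as (c & _ & Hc). df.
  { intros u Hu. apply in_pow in Hu. destruct (emp_or u) as [->|(y & Hy)]; [exists emp; auto|].
    destruct (@mu_spec V (fun al => exists y, y ∊ u /\ r y = al)) as (_ & (z & Z1 & Z2) & M). df.
    { exists (r y); split; eauto. } exists z. right; split; auto. intros w Hw. apply Ord_not_in; auto.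
    intros Q. apply (M (r w)). rewrite <- Z2; auto. eauto. }
  set (F := fun xi g => app c (diff x (ran g xi))).
  assert (DF : DT (fun v => F (v 0) (v 1))) by (unfold F; df).
  pose proof (Df_lam_rec_prim DF) as DR.
  set (rest := fun xi => diff x (repl xi (rec F))).
  assert (Drest : DT (fun v => rest (v 0))).
  { unfold rest. apply (DT_diff); [df|]. apply DT_repl with (F := fun x v => rec F x); df. }
  assert (E : forall xi, rec F xi = app c (rest xi)).
  { intros xi. rewrite (rec_eq DF xi). unfold F at 1, rest. f_equal. f_equal. unfold ran.
    apply repl_ext; try df. intros z Hz. rewrite app_lam; auto. }
  assert (S0 : forall xi, rest xi <> emp -> rec F xi ∊ rest xi /\
                  forall w, w ∊ rest xi -> r (rec F xi) ⊆ r w).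
  { intros xi K. rewrite E. destruct (Hc (rest xi)) as [Q|Q]; auto; [|tauto].
    apply in_pow. intros z Hz. unfold rest in Hz. apply in_diff in Hz; tauto. }
  assert (S1 : forall xi, rest xi <> emp -> rec F xi ∊ rest xi) by (intros xi K; apply S0; auto).
  assert (S2 : forall xi eta, eta ∊ xi -> rest xi <> emp -> rec F xi <> rec F eta).
  { intros xi eta K N Q. pose proof (S1 xi N) as L. unfold rest in L. apply in_diff in L as [_ L].
    apply L. rewrite in_repl by df. eauto. }
  (* Otherwise the first indices of the elements of [x] would be all ordinals, and these form no
     set. *)
  assert (ex : exists xi, Ord xi /\ rest xi = emp).
  { apply NNPP. intros N.
    assert (N' : forall xi, Ord xi -> rest xi <> emp) by (intros xi O Q; apply N; eauto).
    destruct (no_set_of_Ord (repl x (fun y => mu (fun xi => rec F xi = y)))) as (xi & O & Q).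
    apply Q. rewrite in_repl by df. exists (rec F xi). split.
    - pose proof (S1 xi (N' xi O)) as L. unfold rest in L. apply in_diff in L; tauto.
    - destruct (@mu_spec V (fun z => rec F z = rec F xi)) as (M1 & M2 & _). df. eauto.
      destruct (Ord_trich M1 O) as [K|[K|K]]; auto.
      + destruct (S2 _ _ K (N' _ O)); auto.
      + destruct (S2 _ _ K (N' _ M1)); auto. }
  destruct (@least_Ord V (fun xi => rest xi = emp)) as (th & O & H0 & H1); auto. df.
  exists th, (lam th (rec F)). split; auto.
  assert (inx : forall xi, xi ∊ th -> rec F xi ∊ x).
  { intros xi K. pose proof (S1 xi (H1 xi K)) as L. unfold rest in L. apply in_diff in L; tauto. }
  split; [split; [split|]|].
  - apply Maps_lam; auto.
  - intros u w Hu Hw. rewrite !app_lam by auto. intros Q.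
    destruct (Ord_trich (Ord_in O Hu) (Ord_in O Hw)) as [K|[K|K]]; auto.
    + destruct (S2 _ _ K (H1 _ Hw)); auto.
    + destruct (S2 _ _ K (H1 _ Hu)); auto.
  - intros y Hy. apply NNPP. intros N. apply (@in_emp V y). rewrite <- H0. unfold rest. apply in_diff.
    split; auto. rewrite in_repl by df. intros (xi & K & ->). apply N. exists xi. rewrite app_lam; auto.
  - intros eta xi K1 K2. assert (K3 : eta ∊ th) by apply (Ord_trans O K1 K2).
    rewrite !app_lam by auto. apply S0; auto.
    pose proof (S1 xi (H1 xi K2)) as L. unfold rest in L |- *. apply in_diff in L as [L1 L2].
    apply in_diff. split; auto. rewrite in_repl in L2 |- * by df.
    intros (z & Z & Q). apply L2. exists z; split; auto. apply (Ord_trans (Ord_in O K2) Z K1).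
Qed.

Lemma well_order x : exists th h, Ord th /\ Bij h th x.
Proof.
  destruct (@well_order_rank x (fun _ => emp)) as (th & h & H1 & H2 & _); eauto. df.
  intros; apply Ord_emp.
Qed.
End Choice.
#[global] Hint Resolve Df_Inj Df_inj : df.

(** * Cardinals *)

Section Cardinals.
Context {V : model}.
Implicit Types (a b c f g h k x y z : V).

Lemma inj_intro a b (F : V -> V) : DT (fun v => F (v 0)) -> (forall x, x ∊ a -> F x ∊ b) ->
  (forall x y, x ∊ a -> y ∊ a -> F x = F y -> x = y) -> inj a b.
Proof.
  intros D H K. exists (lam a F). split. apply Maps_lam; auto.
  intros x y Hx Hy. rewrite !app_lam by auto. auto.
Qed.

Lemma inj_sub a b : a ⊆ b -> inj a b.
Proof. intros H. apply inj_intro with (fun x => x); auto. df. Qed.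

Lemma inj_trans a b c : inj a b -> inj b c -> inj a c.
Proof.
  intros (f & (F1 & F2) & F3) (g & (G1 & G2) & G3).
  apply inj_intro with (fun x => app g (app f x)); auto. df.
Qed.

Definition pre f a y := the (fun x => x ∊ a /\ app f x = y).
Lemma DT_pre (s t u : (nat -> V) -> V) : DT s -> DT t -> DT u -> DT (fun v => pre (s v) (t v) (u v)).
Proof.
  intros H K L. unfold pre. apply DT_the with (phi := fun x v => x ∊ t v /\ app (s v) x = u v).
  apply DT_tl in H, K, L. df.
Qed.
Hint Resolve DT_pre : df.

Lemma pre_app f a b x : Inj f a b -> x ∊ a -> pre f a (app f x) = x.
Proof. intros (_ & H) K. apply the_eq; auto. intros z (Z1 & Z2). auto. Qed.

(** [A] is the Knaster-Tarski fixed point of the monotone [Phi]: the bijection is [f] on [A] and the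
    inverse of [g] elsewhere. *)
Lemma cantor_bernstein a b : inj a b -> inj b a -> exists h, Bij h a b.
Proof.
  intros (f & (F1 & F2) & F3) (g & Hg). pose proof Hg as ((G1 & G2) & G3).
  set (Phi := fun S => diff a (ran g (diff b (ran f S)))).
  assert (DP : DT (fun v => Phi (v 0))) by (unfold Phi; df).
  assert (mon : forall S T, S ⊆ T -> Phi S ⊆ Phi T).
  { intros S T H z Hz. apply in_diff in Hz as [Z1 Z2]. apply in_diff. split; auto. intros Q. apply Z2.
    apply in_ran in Q as (y & Hy & ->). apply in_ran. exists y. split; auto.
    apply in_diff in Hy as [Y1 Y2]. apply in_diff. split; auto. intros Q. apply Y2.
    apply in_ran in Q as (u & Hu & ->). apply in_ran; eauto. }
  set (A := union (sep (pow a) (fun S => S ⊆ Phi S))).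
  assert (Aa : A ⊆ a).
  { intros z Hz. apply in_union in Hz as (S & S1 & S2). rewrite in_sep in S2 by df.
    destruct S2 as [S2 _]. apply in_pow in S2. auto. }
  assert (A1 : A ⊆ Phi A).
  { intros z Hz. pose proof Hz as Hz'. apply in_union in Hz as (S & S1 & S2).
    rewrite in_sep in S2 by df. apply mon with S. 2: apply S2; auto.
    intros w Hw. apply in_union. exists S; split; auto. rewrite in_sep by df; auto. }
  assert (A2 : Phi A ⊆ A).
  { intros z Hz. apply in_union. exists (Phi A). split; auto. rewrite in_sep by df. split; auto.
    apply in_pow. intros w Hw. apply in_diff in Hw; tauto. }
  set (H := fun x => ite (x ∊ A) (app f x) (pre g b x)).
  assert (DH : DT (fun v => H (v 0))) by (unfold H; df).
  assert (out : forall x, x ∊ a -> ~ x ∊ A -> exists y, y ∊ b /\ ~ y ∊ ran f A /\ x = app g y /\ H x = y).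
  { intros x Hx N. assert (Q : x ∊ ran g (diff b (ran f A))).
    { apply NNPP. intros Q. apply N, A2, in_diff; auto. }
    apply in_ran in Q as (y & Hy & ->). apply in_diff in Hy as [Y1 Y2]. exists y.
    split; [|split; [|split]]; auto. unfold H. rewrite ite_false by auto. apply (pre_app Hg Y1). }
  assert (inn : forall x, x ∊ A -> H x = app f x) by (intros x Hx; unfold H; rewrite ite_true; auto).
  exists (lam a H). split; [split|].
  - apply Maps_lam; auto. intros x Hx. destruct (classic (x ∊ A)) as [Q|Q].
    rewrite inn; auto. destruct (out x Hx Q) as (y & Y1 & _ & _ & ->); auto.
  - intros x y Hx Hy. rewrite !app_lam by auto.
    destruct (classic (x ∊ A)) as [Qx|Qx], (classic (y ∊ A)) as [Qy|Qy].
    + rewrite !inn; auto.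
    + destruct (out y Hy Qy) as (w & W1 & W2 & W3 & ->). rewrite inn; auto. intros E.
      destruct W2. apply in_ran; eauto.
    + destruct (out x Hx Qx) as (w & W1 & W2 & W3 & ->). rewrite inn; auto. intros E.
      destruct W2. apply in_ran; eauto.
    + destruct (out x Hx Qx) as (w & W1 & W2 & W3 & ->), (out y Hy Qy) as (w' & _ & _ & W3' & ->). congruence.
  - intros y Hy. destruct (classic (y ∊ ran f A)) as [Q|Q].
    + apply in_ran in Q as (x & Hx & ->). exists x. split; auto. rewrite app_lam; auto.
    + assert (Ga : app g y ∊ a) by auto.
      assert (Q' : ~ app g y ∊ A).
      { intros K. apply A1, in_diff in K as [_ K]. apply K, in_ran. exists y; split; auto. apply in_diff; auto. }
      exists (app g y). split; auto. rewrite app_lam by auto. unfold H. rewrite ite_false by auto. apply (pre_app Hg Hy).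
Qed.

Definition Card k : Prop := Ord k /\ forall a, a ∊ k -> ~ inj k a.
Lemma Df_Card (s : (nat -> V) -> V) : DT s -> Df (fun v => Card (s v)).
Proof. apply (Df_rel1 Card). unfold Card. df. Qed.
Hint Resolve Df_Card : df.

Lemma Card_le k b : Card k -> Ord b -> inj k b -> k ⊆ b.
Proof. intros [O H] Ob K. apply Ord_not_in; auto. intros L. apply (H b L K). Qed.

Lemma cantor a : ~ inj (pow a) a.
Proof.
  intros (f & Hf). pose proof Hf as ((F1 & F2) & F3).
  set (d := sep a (fun x => exists S, S ⊆ a /\ app f S = x /\ ~ x ∊ S)).
  assert (Dp : d ∊ pow a) by (apply in_pow; intros z Hz; unfold d in Hz; rewrite in_sep in Hz by df; tauto).
  assert (Da := F2 _ Dp).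
  assert (K : app f d ∊ d -> ~ app f d ∊ d).
  { intros K. unfold d at 2 in K. rewrite in_sep in K by df. destruct K as (_ & S & S1 & S2 & S3).
    apply F3 in S2; auto. subst S; auto. apply in_pow; auto. }
  apply K; auto; apply NNPP; intros N; apply N; unfold d at 2; rewrite in_sep by df; split; auto;
   exists d; rewrite in_pow in Dp; auto.
Qed.

Lemma prod_inj a b c d : inj a b -> inj c d -> inj (prod a c) (prod b d).
Proof.
  intros (f & (F1 & F2) & F3) (g & (G1 & G2) & G3).
  apply inj_intro with (fun z => opair (app f (fst z)) (app g (snd z))). df.
  - intros z Hz. apply in_prod in Hz as (x & y & Hx & Hy & ->). rewrite fst_opair, snd_opair.
    apply opair_in_prod; auto.
  - intros z w Hz Hw. apply in_prod in Hz as (x & y & Hx & Hy & ->). apply in_prod in Hw as (x' & y' & Hx' & Hy' & ->).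
    rewrite !fst_opair, !snd_opair. intros E. apply opair_inj in E as [E1 E2]. f_equal; auto.
Qed.

Lemma pow_inj a b : inj a b -> inj (pow a) (pow b).
Proof.
  intros (f & (F1 & F2) & F3). apply inj_intro with (fun S => ran f S). df.
  - intros S HS. apply in_pow in HS. apply in_pow. intros z Hz. apply in_ran in Hz as (x & Hx & ->). auto.
  - intros S T HS HT E. apply in_pow in HS, HT.
    assert (K : forall S T, S ⊆ a -> T ⊆ a -> ran f S = ran f T -> S ⊆ T).
    { clear S T HS HT E. intros S T H H0 H1 x Hx. assert (Q : app f x ∊ ran f T) by (rewrite <- H1; apply in_ran; eauto).
      apply in_ran in Q as (y & Hy & Q). apply F3 in Q; auto. subst; auto. }
    apply sub_antisym; apply K; auto.
Qed.

(** * Smallness and regularity *)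

(* For regular [nu] this says that [a] has fewer than [nu] elements, without mentioning cardinality. *)
Definition small nu a : Prop := forall f, Maps f a nu -> exists b, b ∊ nu /\ forall x, x ∊ a -> app f x ∊ b.
Definition Reg nu : Prop := Limit nu /\ forall a, a ∊ nu -> small nu a.

Lemma Df_small (s t : (nat -> V) -> V) : DT s -> DT t -> Df (fun v => small (s v) (t v)).
Proof. apply (Df_rel2 small). unfold small. df. Qed.
Hint Resolve Df_small : df.
Lemma Df_Reg (s : (nat -> V) -> V) : DT s -> Df (fun v => Reg (s v)).
Proof. apply (Df_rel1 Reg). unfold Reg. df. Qed.
Hint Resolve Df_Reg : df.

Lemma Reg_Limit nu : Reg nu -> Limit nu.
Proof. intros H; apply H. Qed.
Lemma Reg_Ord nu : Reg nu -> Ord nu.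
Proof. intros H; apply H. Qed.

Lemma small_class nu a (F : V -> V) : DT (fun v => F (v 0)) -> small nu a ->
  (forall x, x ∊ a -> F x ∊ nu) -> exists b, b ∊ nu /\ forall x, x ∊ a -> F x ∊ b.
Proof.
  intros D H K. destruct (H (lam a F)) as (b & B1 & B2). apply Maps_lam; auto.
  exists b; split; auto. intros x Hx. specialize (B2 x Hx). rewrite app_lam in B2; auto.
Qed.

Lemma small_inj nu a b : Limit nu -> inj a b -> small nu b -> small nu a.
Proof.
  intros L (h & Hh) H f (F1 & F2). pose proof Hh as ((H1 & H2) & H3).
  destruct (@small_class nu b (fun y => ite (exists x, x ∊ a /\ app h x = y) (app f (pre h a y)) emp)) as (c & C1 & C2); auto. df.
  - intros y Hy. destruct (classic (exists x, x ∊ a /\ app h x = y)) as [Q|Q].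
    + rewrite ite_true by auto. destruct Q as (x & Hx & <-). rewrite (pre_app Hh Hx). auto.
    + rewrite ite_false by auto. apply Limit_emp; auto.
  - exists c; split; auto. intros x Hx. specialize (C2 (app h x) (H2 x Hx)).
    rewrite ite_true in C2 by eauto. rewrite (pre_app Hh Hx) in C2; auto.
Qed.

Lemma small_sub nu a b : Limit nu -> a ⊆ b -> small nu b -> small nu a.
Proof. intros L H. apply small_inj; auto. apply inj_sub; auto. Qed.

Lemma small_repl nu a (F : V -> V) : DT (fun v => F (v 0)) -> small nu a -> small nu (repl a F).
Proof.
  intros D H f (F1 & F2). destruct (@small_class nu a (fun x => app f (F x))) as (c & C1 & C2); auto. df.
  intros x Hx. apply F2. rewrite in_repl by df; eauto.
  exists c; split; auto. intros y Hy. rewrite in_repl in Hy by df. destruct Hy as (x & Hx & ->); auto.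
Qed.

(** Each piece has a least bound [G i], and smallness of the index set bounds these bounds. *)
Lemma small_union nu a (F : V -> V) : DT (fun v => F (v 0)) -> Ord nu -> small nu a ->
  (forall x, x ∊ a -> small nu (F x)) -> small nu (union (repl a F)).
Proof.
  intros D O H K f (F1 & F2).
  set (G := fun i => mu (fun b => b ∊ nu /\ forall x, x ∊ F i -> app f x ∊ b)).
  assert (DG : DT (fun v => G (v 0))) by (unfold G; df).
  assert (inU : forall i x, i ∊ a -> x ∊ F i -> x ∊ union (repl a F)).
  { intros i x Hi Hx. apply in_union. exists (F i); split; auto. rewrite in_repl by df; eauto. }
  assert (sp : forall i, i ∊ a -> G i ∊ nu /\ forall x, x ∊ F i -> app f x ∊ G i).
  { intros i Hi. destruct (@mu_spec V (fun b => b ∊ nu /\ forall x, x ∊ F i -> app f x ∊ b)) as (_ & M & _); auto. df.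
    destruct (K i Hi (lam (F i) (app f))) as (b & B1 & B2).
    - apply Maps_lam. df. eauto.
    - exists b. split. apply (Ord_in O B1). split; auto. intros x Hx. specialize (B2 x Hx).
      rewrite app_lam in B2; auto. df. }
  destruct (@small_class nu a G) as (c & C1 & C2); auto. intros; apply sp; auto.
  exists c; split; auto. intros x Hx. apply in_union in Hx as (y & Y1 & Y2). rewrite in_repl in Y2 by df.
  destruct Y2 as (i & Hi & ->). apply Ord_trans with (G i); auto. apply (Ord_in O C1). apply sp; auto.
Qed.

Lemma small_cup nu a b : Limit nu -> small nu a -> small nu b -> small nu (cup a b).
Proof.
  intros L H K f (F1 & F2). pose proof (proj1 L) as O.
  destruct (@small_class nu a (app f)) as (c & C1 & C2); auto. df.
  { intros; apply F2, in_cup; auto. }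
  destruct (@small_class nu b (app f)) as (d & D1 & D2); auto. df.
  { intros; apply F2, in_cup; auto. }
  destruct (Ord_le (Ord_in O C1) (Ord_in O D1)) as [Q|Q].
  - exists d. split; auto. intros x Hx. apply in_cup in Hx as [Hx|Hx]; auto.
  - exists c. split; auto. intros x Hx. apply in_cup in Hx as [Hx|Hx]; auto.
    apply (Ord_trans (Ord_in O C1) (D2 x Hx) Q).
Qed.

Lemma small_emp nu : Limit nu -> small nu emp.
Proof. intros L f _. exists emp. split. apply Limit_emp; auto. intros x Hx; destruct (in_emp Hx). Qed.

Lemma small_sing nu a : Limit nu -> small nu (sing a).
Proof.
  intros L f (F1 & F2). exists (succ (app f a)). split.
  apply Limit_succ; auto. apply F2, in_sing; auto.
  intros x Hx. apply in_sing in Hx as ->. apply in_succ; auto.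
Qed.

Lemma small_prod nu a b : Ord nu -> small nu a -> small nu b -> small nu (prod a b).
Proof.
  intros L H K. unfold prod. apply small_union; auto. df. intros x Hx. apply small_repl; auto. df.
Qed.

Lemma small_not_inj nu a : Limit nu -> small nu a -> ~ inj nu a.
Proof.
  intros L H K. assert (S : small nu nu) by (apply (small_inj L K H)).
  destruct (@small_class nu nu (fun x => x)) as (b & B1 & B2); auto. df.
  apply (not_in_self (B2 b B1)).
Qed.

Lemma Reg_Card nu : Reg nu -> Card nu.
Proof. intros [L H]. split. apply L. intros a Ha. apply small_not_inj; auto. Qed.

Lemma om_small nu n : Limit nu -> n ∊ om -> small nu n.
Proof.
  intros L. revert n. apply om_ind. df. apply small_emp; auto.
  intros n Hn IH. apply small_cup; auto. apply small_sing; auto.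
Qed.

Lemma Reg_om : Reg (om : V).
Proof. split. apply Limit_om. intros a. apply om_small, Limit_om. Qed.

Lemma Reg_om_sub nu : Reg nu -> om ⊆ nu.
Proof. intros [L _]. apply om_least; auto. Qed.

(** Hilbert's hotel: [y] goes to [emp], the elements of [om] move up by one, all others stay. *)
Lemma inj_succ y : Ord y -> om ⊆ y -> inj (succ y) y.
Proof.
  intros O H. apply inj_intro with (fun x => ite (x = y) emp (ite (x ∊ om) (succ x) x)). df.
  - intros x Hx. destruct (classic (x = y)) as [->|N].
    + rewrite ite_true by auto. apply H, Limit_emp, Limit_om.
    + rewrite ite_false by auto. destruct (classic (x ∊ om)).
      * rewrite ite_true by auto. apply H, Limit_succ; auto. apply Limit_om.
      * rewrite ite_false by auto. apply in_succ in Hx as [Hx|Hx]; tauto.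
  - assert (S0 : forall x, emp <> succ x).
    { intros x E. apply (@in_emp V x). rewrite E. apply in_succ; auto. }
    assert (Sm : forall x, x ∊ om -> succ x ∊ om) by (intros; apply Limit_succ; auto; apply Limit_om).
    assert (E0 : (emp : V) ∊ om) by apply (Limit_emp Limit_om).
    intros x z Hx Hz. unfold ite. repeat destruct excluded_middle_informative; intros E; subst; auto;
      try (destruct (S0 _ E); fail); try (symmetry in E; destruct (S0 _ E); fail);
      try (apply succ_inj in E; auto); try (exfalso; auto; fail).
    all: match goal with N : ~ ?z ∊ om |- _ => exfalso; apply N; rewrite <- ?E; auto end.
Qed.

Lemma Card_Limit k : Card k -> om ⊆ k -> Limit k.
Proof.
  intros [O H] K. destruct (Ord_cases O) as [->|[(y & Hy & ->)|L]]; auto; exfalso.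
  - apply (@in_emp V emp). apply K. apply Limit_emp, Limit_om.
  - apply (H y Hy). apply inj_succ. apply (Ord_in O Hy).
    apply Ord_not_in. apply (Ord_in O Hy). apply Ord_om. intros Q.
    assert (E : succ y ∊ om) by (apply Limit_succ; auto; apply Limit_om). apply (not_in_self (K _ E)).
Qed.
End Cardinals.
#[global] Hint Resolve DT_pre Df_Card Df_small Df_Reg : df.

(** * Cardinal arithmetic under choice and GCH *)

Section CardinalsAC.
Context {V : model} {ac : AC V}.
Implicit Types (a b c f g h k x y z : V).

Lemma inj_of_surj a b (F : V -> V) : DT (fun v => F (v 0)) ->
  (forall y, y ∊ b -> exists x, x ∊ a /\ F x = y) -> inj b a.
Proof.
  intros D H. destruct (@ac_maps V ac b a (fun y x => F x = y)) as (f & F1 & F2); auto. df.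
  exists f; split; auto. intros x y Hx Hy E. rewrite <- (F2 x), <- (F2 y); auto. congruence.
Qed.

Lemma card_exists x : exists k, Card k /\ inj x k /\ inj k x.
Proof.
  destruct (@well_order V ac x) as (th & h & O & ((H1 & H2) & H3)).
  destruct (@least_Ord V (fun al => inj x al /\ inj al x)) as (k & Ok & (K1 & K2) & K3). df.
  - exists th. split; auto. split.
    + apply inj_of_surj with (app h). df. auto.
    + exists h; split; auto.
  - exists k. split; auto. split; auto. intros a Ha Q. apply (K3 a Ha). split.
    apply (inj_trans K1 Q). apply inj_trans with k; auto. apply inj_sub. apply (proj1 Ok a Ha).
Qed.

Lemma small_lt nu a : Limit nu -> small nu a -> exists k, k ∊ nu /\ inj a k.
Proof.
  intros L H. destruct (card_exists a) as (k & C & K1 & K2). exists k; split; auto.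
  apply NNPP; intros N. apply (small_not_inj L H). apply inj_trans with k; auto.
  apply inj_sub, Ord_not_in; auto. apply C. apply L.
Qed.

Lemma infinite_card x : Ord x -> om ⊆ x -> exists k, Card k /\ om ⊆ k /\ k ⊆ x /\ inj x k.
Proof.
  intros O H. destruct (card_exists x) as (k & C & K1 & K2). exists k. split; auto. split; [|split]; auto.
  - apply Card_le. apply Reg_Card, Reg_om. apply C. apply inj_trans with x; auto. apply inj_sub; auto.
  - apply Card_le; auto.
Qed.

(** Hessenberg's argument at the least counterexample [ka]. The square is enumerated by increasing
    maximum of the coordinates, so an initial segment lies in [prod (succ m) (succ m)] for some [m]
    below [ka], which has no room for [ka]. *)
Lemma pairing k : Card k -> om ⊆ k -> inj (prod k k) k.
Proof.
  intros C0 I0. apply NNPP. intros N0.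
  destruct (@least_Ord V (fun k => Card k /\ om ⊆ k /\ ~ inj (prod k k) k)) as (ka & O & (C & I & N) & M).
  df. exists k; split; auto. apply C0. clear k C0 I0 N0.
  pose proof (Card_Limit C I) as L.
  (* On ordinals [cup] is the maximum. *)
  set (r := fun z => cup (fst z) (snd z)).
  assert (Dr : DT (fun v => r (v 0))) by (unfold r; df).
  assert (rE : forall x y, r (opair x y) = cup x y) by (intros; unfold r; rewrite fst_opair, snd_opair; auto).
  assert (cupo : forall x y z, Ord z -> x ∊ z -> y ∊ z -> cup x y ∊ z /\ Ord (cup x y)).
  { intros x y z Oz Hx Hy. pose proof (Ord_in Oz Hx) as Ox. pose proof (Ord_in Oz Hy) as Oy.
    destruct (Ord_le Ox Oy) as [Q|Q].
    - replace (cup x y) with y; auto. apply set_ext. intros w. rewrite in_cup. split; auto. intros [W|W]; auto.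
    - replace (cup x y) with x; auto. apply set_ext. intros w. rewrite in_cup. split; auto. intros [W|W]; auto.
      apply (Ord_trans Ox W Q). }
  assert (seg : forall m, m ∊ ka -> ~ inj ka (prod (succ m) (succ m))).
  { intros m Hm Q. apply Ord_sub in I; auto using Ord_om. destruct I as [I|I].
    - assert (Hs : succ m ∊ ka) by (apply Limit_succ; auto).
      destruct (cupo (succ m) om ka O Hs I) as [M1 M2].
      destruct (@infinite_card (cup (succ m) om)) as (k & K1 & K2 & K3 & K4); auto.
      { intros z Z; apply in_cup; auto. }
      assert (Kk : k ∊ ka) by (apply Ord_sub_in with (cup (succ m) om); auto; apply K1).
      apply (M k Kk). split; auto. split; auto. intros P.
      apply (proj2 C k Kk). apply (inj_trans Q). apply inj_trans with (prod k k); auto.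
      assert (J : inj (succ m) k).
      { apply inj_trans with (cup (succ m) om); auto. apply inj_sub. intros z Z; apply in_cup; auto. }
      apply prod_inj; auto.
    - subst ka. revert Q. apply small_not_inj; auto. assert (Sm : small om (succ m)).
      { apply om_small; auto. apply Limit_succ; auto. }
      apply small_prod; auto. }
  destruct (@well_order_rank V ac (prod ka ka) r Dr) as (th & h & Ot & (((H1 & H2) & H3) & H4) & H5).
  { intros z Hz. apply in_prod in Hz as (x & y & Hx & Hy & ->). rewrite rE. apply (cupo x y ka); auto. }
  assert (T : forall xi, xi ∊ th -> xi ∊ ka).
  { intros xi Hxi. apply NNPP. intros Q. apply Ord_not_in in Q; auto; [|apply (Ord_in Ot Hxi)].
    pose proof (H2 xi Hxi) as R. apply in_prod in R as (x & y & Hx & Hy & E).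
    destruct (cupo x y ka) as [M1 M2]; auto. apply (seg (cup x y) M1).
    apply inj_trans with xi. apply inj_sub; auto.
    exists (lam xi (app h)). split.
    - apply Maps_lam. df. intros eta He. assert (Ht : eta ∊ th) by apply (Ord_trans Ot He Hxi).
      pose proof (H5 eta xi He Hxi) as LE. rewrite E, rE in LE.
      pose proof (H2 eta Ht) as R. apply in_prod in R as (x' & y' & Hx' & Hy' & E'). rewrite E', rE in LE.
      rewrite E'. apply opair_in_prod.
      assert (G : forall w, Ord w -> w ⊆ cup x y -> w ∊ succ (cup x y)).
      { intros w Ow W. apply Ord_sub in W; auto. apply in_succ; auto. }
      split; apply G; [apply (Ord_in O Hx')| |apply (Ord_in O Hy')|]; intros w W; apply LE, in_cup; auto.
    - intros u w Hu Hw. rewrite !app_lam by (auto; df). apply H3.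
      apply (Ord_trans Ot Hu Hxi). apply (Ord_trans Ot Hw Hxi). }
  apply N. apply inj_trans with th.
  - apply inj_of_surj with (app h). df. auto.
  - apply inj_sub. exact T.
Qed.

Definition cs k := mu (fun m => Card m /\ k ∊ m).
Lemma DT_cs (s : (nat -> V) -> V) : DT s -> DT (fun v => cs (s v)).
Proof. apply DT_fun1. change (DT (fun v : nat -> V => cs (v 0))). unfold cs. df. Qed.
Hint Resolve DT_cs : df.

Lemma cs_spec k : Ord k -> Card (cs k) /\ k ∊ cs k /\ forall n, Card n -> k ∊ n -> cs k ⊆ n.
Proof.
  intros O. destruct (@mu_spec V (fun m => Card m /\ k ∊ m)) as (M1 & (M2 & M3) & M4). df.
  - destruct (card_exists (pow k)) as (m & C & K1 & K2). exists m. split. apply C. split; auto.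
    apply NNPP. intros Q. apply (@cantor V k). apply (inj_trans K1), inj_sub, Ord_not_in; auto. apply C.
  - split; auto. split; auto. intros n Cn Kn. apply Ord_not_in; auto. apply Cn.
    intros Q. apply (M4 n Q); auto.
Qed.

Lemma cs_unique k m : Card m -> k ∊ m -> (forall n, Card n -> k ∊ n -> m ⊆ n) -> m = cs k.
Proof.
  intros C K H. destruct (@cs_spec k) as (C1 & C2 & C3). apply (Ord_in (proj1 C) K).
  apply sub_antisym; auto.
Qed.

Lemma in_cs k x : Card k -> x ∊ cs k -> inj x k.
Proof.
  intros C H. destruct (@cs_spec k) as (C1 & C2 & C3). apply C.
  destruct (card_exists x) as (n & Cn & N1 & N2). apply (inj_trans N1).
  assert (Ox : Ord x) by apply (Ord_in (proj1 C1) H).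
  apply inj_sub, Ord_not_in. apply C. apply Cn. intros Q. apply (@not_in_self V x).
  apply (Card_le Cn Ox N2). apply (C3 n); auto.
Qed.

(** An unbounded map from a smaller [a] would cover [cs k] by [a] many sets of size at most [k], and
    so inject it into [prod k k]. *)
Lemma Reg_cs k : Card k -> om ⊆ k -> Reg (cs k).
Proof.
  intros C I. destruct (@cs_spec k) as (C1 & C2 & C3). apply C.
  pose proof (proj1 C1) as O.
  assert (Ik : om ⊆ cs k). { intros z Z. apply (Ord_trans O (I z Z) C2). }
  pose proof (Card_Limit C1 Ik) as L. split; auto.
  intros a Ha f (F1 & F2). apply NNPP. intros N.
  assert (N' : forall be, be ∊ cs k -> exists i, i ∊ a /\ be ∊ app f i).
  { intros be Hb. apply NNPP. intros Q. apply N. exists (succ be). split. apply Limit_succ; auto.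
    intros i Hi. pose proof (Ord_in O (F2 i Hi)) as Oi. pose proof (Ord_in O Hb) as Ob.
    destruct (Ord_trich Oi (Ord_succ Ob)) as [W|[W|W]]; auto; exfalso; apply Q; exists i; split; auto.
    rewrite W; apply in_succ; auto. apply Ord_trans with (succ be); auto. apply in_succ; auto. }
  destruct (@ac_fn V ac a (fun i e => Inj e (app f i) k)) as (e & E1 & E2). df.
  { intros i Hi. apply (in_cs C (F2 i Hi)). }
  set (ix := fun be => mu (fun i => i ∊ a /\ be ∊ app f i)).
  assert (Di : DT (fun v => ix (v 0))) by (unfold ix; df).
  assert (ixs : forall be, be ∊ cs k -> ix be ∊ a /\ be ∊ app f (ix be)).
  { intros be Hb. destruct (@mu_spec V (fun i => i ∊ a /\ be ∊ app f i)) as (_ & M & _); auto. df.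
    destruct (N' be Hb) as (i & Hi & K). exists i; split; auto. apply (Ord_in (Ord_in O Ha) Hi). }
  apply (proj2 C1 k C2). apply inj_trans with (prod a k).
  - apply inj_intro with (fun be => opair (ix be) (app (app e (ix be)) be)). df.
    + intros be Hb. destruct (ixs be Hb) as [X1 X2]. apply opair_in_prod; split; auto. apply E2; auto.
    + intros u w Hu Hw E. apply opair_inj in E as [Ea Eb].
      destruct (ixs u Hu) as [X1 X2], (ixs w Hw) as [Y1 Y2]. rewrite <- Ea in *.
      destruct (E2 _ X1) as (_ & J). apply J; auto.
  - apply inj_trans with (prod k k); [|apply pairing; auto]. apply prod_inj. apply (in_cs C Ha).
    apply inj_sub; intros z; auto.
Qed.

Definition GCHm : Prop := forall k : V, Card k -> om ⊆ k -> inj (pow k) (cs k).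

(** For uncountable [mu'] GCH bounds the power set of [a] by a cardinal successor that is at most
    [mu']; for [om] the power sets of its elements are shown small by induction. *)
Lemma pow_small_inj mu' a : GCHm -> Reg mu' -> a ∊ mu' -> inj (pow a) mu'.
Proof.
  intros G R Ha. pose proof (Reg_om_sub R) as I. pose proof (Reg_Ord R) as O.
  apply Ord_sub in I; auto using Ord_om. destruct I as [I|<-].
  - assert (Oa : Ord a) by apply (Ord_in O Ha).
    (* [a] may be finite, so it is enlarged to an infinite ordinal before GCH applies. *)
    assert (M : exists b, b ∊ mu' /\ a ⊆ b /\ om ⊆ b).
    { destruct (Ord_le Oa Ord_om). exists om; split; auto. split; auto. intros z; auto.
      exists a; split; auto. split. intros z; auto. apply (proj1 Oa); auto. }
    destruct M as (b & B1 & B2 & B3).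
    destruct (@infinite_card b) as (k & K1 & K2 & K3 & K4); auto. apply (Ord_in O B1).
    assert (Kk : k ∊ mu') by (apply Ord_sub_in with b; auto; apply K1).
    apply inj_trans with (pow k). apply pow_inj. apply inj_trans with b; auto. apply inj_sub; auto.
    apply inj_trans with (cs k); auto. apply inj_sub. destruct (@cs_spec k) as (_ & _ & C3). apply K1.
    apply C3; auto. apply Reg_Card; auto.
  - assert (S : forall n : V, n ∊ om -> small om (pow n)).
    { apply om_ind. df.
      - apply small_sub with (sing emp). apply Limit_om. 2: apply small_sing, Limit_om.
        intros z Z. apply in_pow in Z. apply in_sing. apply sub_antisym; auto. intros w W; destruct (in_emp W).
      - intros n Hn IH. apply small_sub with (cup (pow n) (repl (pow n) (fun x => cup x (sing n)))).
        apply Limit_om. 2:{ apply small_cup; auto. apply Limit_om. apply small_repl; auto. df. }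
        intros z Z. apply in_pow in Z. apply in_cup. destruct (classic (n ∊ z)) as [Q|Q].
        + right. rewrite in_repl by df. exists (diff z (sing n)). split.
          * apply in_pow. intros w W. apply in_diff in W as [W1 W2]. apply Z, in_succ in W1 as [W1| ->]; auto.
            destruct W2; apply in_sing; auto.
          * apply set_ext. intros w. rewrite in_cup, in_diff, in_sing. split.
            -- intros W. destruct (classic (w = n)); auto.
            -- intros [W| ->]; tauto.
        + left. apply in_pow. intros w W. pose proof (Z w W) as W1. apply in_succ in W1 as [W1| ->]; tauto. }
    destruct (small_lt Limit_om (S a Ha)) as (k & K1 & K2). apply (inj_trans K2), inj_sub. apply (proj1 Ord_om k K1).
Qed.

(** This is μ^{<μ} = μ for regular μ. A small subset of [mu'] is bounded; it is coded by its least
    bound and its index in a fixed enumeration of the subsets of that bound. *)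
Lemma small_subsets_inj mu' Z : GCHm -> Reg mu' -> inj Z mu' -> inj (sep (pow Z) (fun x => small mu' x)) mu'.
Proof.
  intros G R HZ. pose proof (Reg_Ord R) as O. pose proof (Reg_Limit R) as L.
  apply inj_trans with (sep (pow mu') (fun x => small mu' x)).
  - destruct HZ as (f & (F1 & F2) & F3). apply inj_intro with (fun S => ran f S). df.
    + intros S HS. rewrite in_sep in HS by df. destruct HS as [H1 H2]. apply in_pow in H1.
      rewrite in_sep by df. split. apply in_pow. intros z Hz. apply in_ran in Hz as (x & Hx & ->). auto.
      apply small_repl; auto. df.
    + intros S T HS HT E. rewrite in_sep in HS, HT by df. destruct HS as [HS _], HT as [HT _]. apply in_pow in HS, HT.
      assert (K : forall S T, S ⊆ Z -> T ⊆ Z -> ran f S = ran f T -> S ⊆ T).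
      { intros S' T' A B E' x Hx. assert (Q : app f x ∊ ran f T') by (rewrite <- E'; apply in_ran; eauto).
        apply in_ran in Q as (y & Hy & Q). apply F3 in Q; auto. subst; auto. }
      apply sub_antisym; apply K; auto.
  - destruct (@ac_fn V ac mu' (fun b e => Inj e (pow b) mu')) as (e & E1 & E2). df.
    { intros b Hb. apply (pow_small_inj G R Hb). }
    set (bd := fun x => mu (fun b => b ∊ mu' /\ x ⊆ b)).
    assert (Db : DT (fun v => bd (v 0))) by (unfold bd; df).
    assert (bds : forall x, x ∊ sep (pow mu') (fun x => small mu' x) -> bd x ∊ mu' /\ x ∊ pow (bd x)).
    { intros x Hx. rewrite in_sep in Hx by df. destruct Hx as [H1 H2]. apply in_pow in H1.
      destruct (@mu_spec V (fun b => b ∊ mu' /\ x ⊆ b)) as (_ & M & _). df.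
      - destruct (@small_class V mu' x (fun y => y)) as (b & B1 & B2); auto. df.
        exists b; split; auto. apply (Ord_in O B1).
      - rewrite in_pow; auto. }
    apply inj_trans with (prod mu' mu'); [|apply pairing; [apply Reg_Card|apply Reg_om_sub]; auto].
    apply inj_intro with (fun x => opair (bd x) (app (app e (bd x)) x)). df.
    + intros x Hx. destruct (bds x Hx) as [X1 X2]. apply opair_in_prod; split; auto. apply E2; auto.
    + intros x y Hx Hy E. apply opair_inj in E as [Ea Eb].
      destruct (bds x Hx) as [X1 X2], (bds y Hy) as [Y1 Y2]. rewrite <- Ea in *.
      destruct (E2 _ X1) as (_ & J). apply J; auto.
Qed.
End CardinalsAC.
#[global] Hint Resolve DT_cs : df.

(** * Pairs and triples read in a model *)

Section Bridge.
Context {V : model}.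
Implicit Types (a b c f g h k x y z : V).
Let T := truth (@mem V).

Lemma upair_iff z x y : @is_upair T z x y <-> z = upair x y.
Proof.
  split.
  - intros H. apply set_ext. intros w. rewrite in_upair. apply H.
  - intros ->. intros w. simpl. rewrite in_upair. tauto.
Qed.
Lemma opair_iff z x y : @is_opair T z x y <-> z = opair x y.
Proof.
  split.
  - intros (a & b & A & B & C). apply upair_iff in A, B, C. subst. reflexivity.
  - intros ->. exists (upair x x), (upair x y). rewrite !upair_iff. simpl. auto.
Qed.
Lemma opair_in_iff x y f : @opair_in T x y f <-> opair x y ∊ f.
Proof.
  split.
  - intros (z & A & B). apply opair_iff in A. subst; auto.
  - intros H. exists (opair x y). rewrite opair_iff. simpl; auto.
Qed.
Lemma triple_in_iff x y z f : @triple_in T x y z f <-> opair x (opair y z) ∊ f.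
Proof.
  split.
  - intros (u & A & B). apply opair_iff in A. apply opair_in_iff in B. subst; auto.
  - intros H. exists (opair y z). rewrite opair_iff, opair_in_iff. simpl; auto.
Qed.
Lemma Df_opair_in (s t u : (nat -> V) -> V) : DT s -> DT t -> DT u ->
  Df (fun v => @opair_in T (s v) (t v) (u v)).
Proof.
  apply (Df_rel3 (@opair_in T)). apply Df_iff with (fun v => opair (v 0) (v 1) ∊ v 2).
  intros; symmetry; apply opair_in_iff. df.
Qed.
Lemma Df_triple_in (s t u w : (nat -> V) -> V) : DT s -> DT t -> DT u -> DT w ->
  Df (fun v => @triple_in T (s v) (t v) (u v) (w v)).
Proof.
  intros. apply Df_iff with (fun v => opair (s v) (opair (t v) (u v)) ∊ w v).
  intros; symmetry; apply triple_in_iff. df.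
Qed.
End Bridge.
#[global] Hint Resolve Df_opair_in Df_triple_in : df.

(** * Recursion along the transitive closure *)

Section TcRecursion.
Context {V : model}.
Implicit Types (a b c f g h k x y z : V).

Lemma tc_step x y : y ∊ tc x <-> y ∊ x \/ exists z, z ∊ x /\ y ∊ tc z.
Proof.
  destruct (tc_spec x) as (T1 & T2 & T3). split.
  - assert (L : tc x ⊆ cup x (union (repl x tc))).
    { apply T3.
      - intros z Hz w Hw. apply in_cup in Hz as [Hz|Hz]; apply in_cup; right; apply in_union.
        + exists (tc z). split. destruct (tc_spec z) as (_ & S2 & _); auto. rewrite in_repl by df; eauto.
        + apply in_union in Hz as (u & Hu & K). exists u; split; auto.
          rewrite in_repl in K by df. destruct K as (t & Ht & ->). apply (proj1 (tc_spec t) z); auto.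
      - intros z Hz; apply in_cup; auto. }
    intros H. apply L in H. apply in_cup in H as [H|H]; auto. right.
    apply in_union in H as (u & Hu & K). rewrite in_repl in K by df. destruct K as (t & Ht & ->); eauto.
  - intros [H|(z & Hz & H)]; auto. apply (proj2 (proj2 (tc_spec z)) (tc x)); auto.
Qed.

Lemma tc_ind (phi : V -> Prop) : Df (fun v => phi (v 0)) ->
  (forall x, (forall y, y ∊ tc x -> phi y) -> phi x) -> forall x, phi x.
Proof.
  intros D H. assert (K : forall x y, y ∊ tc x -> phi y).
  { apply (@mem_ind V (fun x => forall y, y ∊ tc x -> phi y)). df. intros x IH y Hy.
    apply tc_step in Hy as [Hy|(z & Hz & Hy)]; eauto. }
  intros x. apply H. apply K.
Qed.

Lemma tc_sub T x : Trans T -> x ⊆ T -> tc x ⊆ T.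
Proof. apply tc_spec. Qed.
Lemma tc_in T x w : Trans T -> x ∊ T -> w ∊ tc x -> w ∊ T.
Proof. intros H K. apply tc_sub; auto. Qed.

Variable F : V -> V -> V.
Hypothesis DF : DT (fun v => F (v 0) (v 1)).

(** The recursion sees all of [tc y], because the names occurring in a name are elements of elements
    of its elements, too deep for recursion along membership. *)
Definition tattempt T g : Prop :=
  Trans T /\ Fn g T /\ forall y, y ∊ T -> app g y = F y (lam (tc y) (app g)).
Definition trec x : V :=
  the (fun z => exists T g, x ⊆ T /\ tattempt T g /\ z = F x (lam (tc x) (app g))).

Lemma Df_tattempt : Df (fun v => tattempt (v 0) (v 1)).
Proof.
  unfold tattempt. repeat apply Df_and; [df|df|]. apply Df_all, Df_imp; [df|].
  apply Df_eq; [df|]. apply (DT_app2 F); auto. df. apply DT_lam with (F := fun x v => app (v 2) x); df.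
Qed.

Lemma tattempt_agree T g T' g' : tattempt T g -> tattempt T' g' ->
  forall y, y ∊ T -> y ∊ T' -> app g y = app g' y.
Proof.
  intros (A1 & A2 & A3) (B1 & B2 & B3).
  apply (@tc_ind (fun y => y ∊ T -> y ∊ T' -> app g y = app g' y)). df.
  intros y IH H K. rewrite A3, B3; auto. f_equal. apply lam_ext; try df.
  intros w Hw. apply IH; auto. apply (tc_in A1 H Hw). apply (tc_in B1 K Hw).
Qed.

Lemma trec_attempt T g x : tattempt T g -> x ⊆ T -> trec x = F x (lam (tc x) (app g)).
Proof.
  intros A S. apply the_eq; [exists T, g; auto|].
  intros z (T' & g' & S' & A' & ->). f_equal. apply lam_ext; try df.
  intros w Hw. apply (tattempt_agree A' A). apply (tc_sub (proj1 A') S'); auto. apply (tc_sub (proj1 A) S); auto.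
Qed.

Lemma DT_trec : DT (fun v => trec (v 0)).
Proof.
  unfold trec. apply DT_the with (phi := fun z v => exists T g, v 0 ⊆ T /\ tattempt T g /\ z = F (v 0) (lam (tc (v 0)) (app g))).
  pose proof Df_tattempt as Da.
  apply Df_ex, Df_ex, Df_and; [df|]. apply Df_and; [df|]. apply Df_eq; [df|]. apply (DT_app2 F); auto. df.
  apply DT_lam with (F := fun x v => app (v 0) x); df.
Qed.

Lemma trec_eq x : trec x = F x (lam (tc x) trec).
Proof.
  pose proof DT_trec as Dr.
  revert x. apply tc_ind.
  { apply Df_eq; [df|]. apply (DT_app2 F); auto. df. apply DT_lam with (F := fun x v => trec x); df. }
  intros x IH. destruct (tc_spec x) as (T1 & T2 & T3).
  assert (A : tattempt (tc x) (lam (tc x) trec)).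
  { split; [|split]; auto. apply Fn_lam; df. intros y Hy. rewrite app_lam by (auto; df). rewrite IH; auto. f_equal.
    apply lam_ext; try df. intros w Hw. rewrite app_lam; auto. apply (tc_in T1 Hy Hw). }
  rewrite (trec_attempt A T2). f_equal. apply lam_ext; try df. intros w Hw. rewrite app_lam; auto.
Qed.
End TcRecursion.

(** * The forcing relation *)

Section Forcing.
Context {V : model}.
Variables P le one : V.
Hypothesis FN : forcing_notion (@mem V) P le one.
Implicit Types (a b c d e f g h k p q r s t u x y z : V).

Notation ext := (extends (@mem V) P le).
Notation nm := (name_elem (@mem V) P).
Notation dense := (dense_below (@mem V) P le).
Notation Feq := (forces_eq (@mem V) P le).
Notation Fmem := (forces_mem (@mem V) P le).

Lemma ext_refl p : p ∊ P -> ext p p.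
Proof. intros H. split; [|split]; auto. exact (proj1 (proj2 FN) p H). Qed.
Lemma ext_trans p q r : ext p q -> ext q r -> ext p r.
Proof.
  intros (A & B & C) (A' & B' & C'). split; [|split]; auto.
  destruct FN as (_ & _ & F & _). apply (F p q r); auto.
Qed.
Lemma ext_one p : p ∊ P -> ext p one.
Proof. intros H. split; [|split]; auto. exact (proj1 FN). exact (proj2 (proj2 (proj2 FN)) p H). Qed.

Lemma Df_ext (s t : (nat -> V) -> V) : DT s -> DT t -> Df (fun v => ext (s v) (t v)).
Proof. intros; unfold extends; df. Qed.
Lemma Df_nm (s t u : (nat -> V) -> V) : DT s -> DT t -> DT u -> Df (fun v => nm (s v) (t v) (u v)).
Proof. intros; unfold name_elem; df. Qed.
Hint Resolve Df_ext Df_nm : df.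
Lemma Df_Feq (s t u : (nat -> V) -> V) : DT s -> DT t -> DT u -> Df (fun v => Feq (s v) (t v) (u v)).
Proof.
  apply (Df_rel3 Feq). unfold forces_eq, forces_eq_graph, forces_covers, dense_below. df.
Qed.
Hint Resolve Df_Feq : df.
Lemma Df_Fmem (s t u : (nat -> V) -> V) : DT s -> DT t -> DT u -> Df (fun v => Fmem (s v) (t v) (u v)).
Proof. apply (Df_rel3 Fmem). unfold forces_mem, dense_below. df. Qed.
Hint Resolve Df_Fmem : df.

Lemma nm_tc s c t : nm s c t -> s ∊ tc t.
Proof.
  intros [H K]. apply opair_in_iff in K. destruct (tc_spec t) as (T1 & T2 & _).
  apply T2 in K. assert (L : upair s s ∊ tc t).
  { apply (T1 _ K). unfold opair; rewrite in_upair; auto. }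
  apply (T1 _ L). rewrite in_upair; auto.
Qed.

Lemma nm_Trans T s c t : Trans T -> t ∊ T -> nm s c t -> s ∊ T.
Proof.
  intros H K L. apply nm_tc in L. apply (tc_in H K L).
Qed.

Lemma dense_impl p (Q R : V -> Prop) : (forall q, ext q p -> Q q -> R q) -> dense p Q -> dense p R.
Proof.
  intros H K q Hq. destruct (K q Hq) as (r & R1 & R2). exists r; split; auto.
  apply H; auto. apply ext_trans with q; auto.
Qed.

(** Forced equality recurs on both names at once, but the recursion here runs on the first one:
    [trec F s] collects all pairs (t, p). Both halves of [law] therefore mention [Q s' t'], and the
    symmetry [sym] turns the second half into the one that [forces_eq_graph] demands. *)
Lemma graph_exists T : Trans T -> exists e, forces_eq_graph mem P le T e.
Proof.
  intros HT.
  set (cond := fun s g t p =>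
    (forall s' c, nm s' c s -> dense p (fun q => ext q c -> exists t' d, nm t' d t /\ ext q d /\ opair t' q ∊ app g s')) /\
    (forall t' d, nm t' d t -> dense p (fun q => ext q d -> exists s' c, nm s' c s /\ ext q c /\ opair t' q ∊ app g s'))).
  set (F := fun s g => sep (prod T P) (fun z => exists t p, z = opair t p /\ cond s g t p)).
  assert (DF : DT (fun v => F (v 0) (v 1))) by (unfold F, cond, dense_below; df).
  set (Q := fun s t p => opair t p ∊ trec F s). pose proof (DT_trec DF) as DR.
  assert (DQ : Df (fun v => Q (v 0) (v 1) (v 2))) by (unfold Q; df).
  assert (law : forall s t p, t ∊ T -> p ∊ P -> (Q s t p <->
     (forall s' c, nm s' c s -> dense p (fun q => ext q c -> exists t' d, nm t' d t /\ ext q d /\ Q s' t' q)) /\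
     (forall t' d, nm t' d t -> dense p (fun q => ext q d -> exists s' c, nm s' c s /\ ext q c /\ Q s' t' q)))).
  { intros s t p Ht Hp. unfold Q at 1. rewrite (trec_eq DF). unfold F at 1. rewrite in_sep by (unfold cond, dense_below; df).
    assert (E : forall s' c, nm s' c s -> app (lam (tc s) (trec F)) s' = trec F s').
    { intros s' c H. rewrite app_lam; auto. apply (nm_tc H). }
    unfold cond. split.
    - intros (_ & t1 & p1 & E1 & A & B). apply opair_inj in E1 as [<- <-]. split.
      + intros s' c H. eapply dense_impl; [|apply (A s' c H)]. intros q _ K L.
        destruct (K L) as (t' & d & K1 & K2 & K3). exists t', d. rewrite (E _ _ H) in K3. auto.
      + intros t' d H. eapply dense_impl; [|apply (B t' d H)]. intros q _ K L.
        destruct (K L) as (s' & c & K1 & K2 & K3). exists s', c. rewrite (E _ _ K1) in K3. auto.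
    - intros (A & B). split. apply opair_in_prod; auto. exists t, p. split; auto. split.
      + intros s' c H. eapply dense_impl; [|apply (A s' c H)]. intros q _ K L.
        destruct (K L) as (t' & d & K1 & K2 & K3). exists t', d. rewrite (E _ _ H). auto.
      + intros t' d H. eapply dense_impl; [|apply (B t' d H)]. intros q _ K L.
        destruct (K L) as (s' & c & K1 & K2 & K3). exists s', c. rewrite (E _ _ K1). auto. }
  assert (sym : forall s, s ∊ T -> forall t p, t ∊ T -> p ∊ P -> (Q s t p <-> Q t s p)).
  { apply (@tc_ind V (fun s => s ∊ T -> forall t p, t ∊ T -> p ∊ P -> (Q s t p <-> Q t s p))). df.
    intros s IH Hs t p Ht Hp.
    assert (J : forall s' t' c d q, nm s' c s -> nm t' d t -> ext q d -> (Q s' t' q <-> Q t' s' q)).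
    { intros s' t' c d q A B C. apply IH. apply (nm_tc A). apply (nm_Trans HT Hs A). apply (nm_Trans HT Ht B). apply C. }
    rewrite (law s t p), (law t s p) by auto. split; intros (A & B); split.
    - intros s' c H. eapply dense_impl; [|apply (B s' c H)]. intros q _ K L.
      destruct (K L) as (t' & d & K1 & K2 & K3). exists t', d. split; auto. split; auto. apply (J t' s' d c q); auto.
    - intros s' c H. eapply dense_impl; [|apply (A s' c H)]. intros q _ K L.
      destruct (K L) as (t' & d & K1 & K2 & K3). exists t', d. split; auto. split; auto. apply (J s' t' c d q); auto.
    - intros s' c H. eapply dense_impl; [|apply (B s' c H)]. intros q _ K L.
      destruct (K L) as (t' & d & K1 & K2 & K3). exists t', d. split; auto. split; auto. apply (J s' t' c d q); auto.
    - intros s' c H. eapply dense_impl; [|apply (A s' c H)]. intros q _ K L.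
      destruct (K L) as (t' & d & K1 & K2 & K3). exists t', d. split; auto. split; auto. apply (J t' s' d c q); auto. }
  set (e := sep (prod P (prod T T)) (fun z => exists p s t, z = opair p (opair s t) /\ Q s t p)).
  assert (inE : forall p s t, p ∊ P -> s ∊ T -> t ∊ T -> (@triple_in (truth mem) p s t e <-> Q s t p)).
  { intros p s t Hp Hs Ht. rewrite triple_in_iff. unfold e. rewrite in_sep by df. split.
    - intros (_ & p' & s' & t' & E & K). apply opair_inj in E as [-> E]. apply opair_inj in E as [-> ->]. auto.
    - intros K. split; eauto 6. rewrite !opair_in_prod. auto. }
  exists e. split. intros t s c A B. apply (nm_Trans HT A B).
  intros p s t Hp Hs Ht. rewrite inE by auto. rewrite law by auto. unfold forces_covers.
  split; intros (A & B); split.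
  - intros s' c H. eapply dense_impl; [|apply (A s' c H)]. intros q _ K L.
    destruct (K L) as (t' & d & K1 & K2 & K3). exists t', d. split; auto. split; auto.
    apply inE; auto. apply K2. apply (nm_Trans HT Hs H). apply (nm_Trans HT Ht K1).
  - intros s' c H. eapply dense_impl; [|apply (B s' c H)]. intros q _ K L.
    destruct (K L) as (t' & d & K1 & K2 & K3). exists t', d. split; auto. split; auto.
    apply inE; auto. apply K2. apply (nm_Trans HT Ht H). apply (nm_Trans HT Hs K1).
    apply sym; auto. apply (nm_Trans HT Ht H). apply (nm_Trans HT Hs K1). apply K2.
  - intros s' c H. eapply dense_impl; [|apply (A s' c H)]. intros q _ K L.
    destruct (K L) as (t' & d & K1 & K2 & K3). exists t', d. split; auto. split; auto.
    apply inE; auto. apply K2. apply (nm_Trans HT Hs H). apply (nm_Trans HT Ht K1).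
  - intros s' c H. eapply dense_impl; [|apply (B s' c H)]. intros q _ K L.
    destruct (K L) as (t' & d & K1 & K2 & K3). exists t', d. split; auto. split; auto.
    pose proof (nm_Trans HT Ht H) as J1. pose proof (nm_Trans HT Hs K1) as J2. pose proof (proj1 K2) as J3.
    apply inE in K3; auto. apply sym; auto.
Qed.

Lemma graph_agree T e T' e' : forces_eq_graph mem P le T e -> forces_eq_graph mem P le T' e' ->
  forall s t p, p ∊ P -> s ∊ T -> t ∊ T -> s ∊ T' -> t ∊ T' ->
   @triple_in (truth mem) p s t e -> @triple_in (truth mem) p s t e'.
Proof.
  intros (A1 & A2) (B1 & B2).
  (* Both orders of the two names are carried along, since the two covering conditions exchange
     their roles. *)
  assert (K : forall s t p, p ∊ P -> s ∊ T -> t ∊ T -> s ∊ T' -> t ∊ T' ->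
   (@triple_in (truth mem) p s t e <-> @triple_in (truth mem) p s t e') /\
   (@triple_in (truth mem) p t s e <-> @triple_in (truth mem) p t s e')).
  2:{ intros s t p X1 X2 X3 X4 X5. exact (proj1 (proj1 (K s t p X1 X2 X3 X4 X5))). }
  apply (@tc_ind V (fun s => forall t p, p ∊ P -> s ∊ T -> t ∊ T -> s ∊ T' -> t ∊ T' ->
   (@triple_in (truth mem) p s t e <-> @triple_in (truth mem) p s t e') /\
   (@triple_in (truth mem) p t s e <-> @triple_in (truth mem) p t s e'))). df.
  intros s IH t p Hp S1 T1 S2 T2.
  assert (C1 : forces_covers mem P le e p s t <-> forces_covers mem P le e' p s t).
  { split; intros H s' c Hs; (eapply dense_impl; [|apply (H s' c Hs)]); intros q _ K L;
    destruct (K L) as (t' & d & K1 & K2 & K3); exists t', d; (split; [auto|split; auto]);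
    pose proof (A1 _ _ _ S1 Hs) as J1; pose proof (A1 _ _ _ T1 K1) as J2;
    pose proof (B1 _ _ _ S2 Hs) as J3; pose proof (B1 _ _ _ T2 K1) as J4; pose proof (proj1 K2) as J5;
    destruct (IH s' (nm_tc Hs) t' q J5 J1 J2 J3 J4) as [[X1 X2] _]; auto. }
  assert (C2 : forces_covers mem P le e p t s <-> forces_covers mem P le e' p t s).
  { split; intros H s' c Hs; (eapply dense_impl; [|apply (H s' c Hs)]); intros q _ K L;
    destruct (K L) as (t' & d & K1 & K2 & K3); exists t', d; (split; [auto|split; auto]);
    pose proof (A1 _ _ _ T1 Hs) as J1; pose proof (A1 _ _ _ S1 K1) as J2;
    pose proof (B1 _ _ _ T2 Hs) as J3; pose proof (B1 _ _ _ S2 K1) as J4; pose proof (proj1 K2) as J5;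
    destruct (IH t' (nm_tc K1) s' q J5 J2 J1 J4 J3) as [_ [X1 X2]]; auto. }
  rewrite !A2, !B2 by auto. tauto.
Qed.

(** Existence and agreement of the graphs eliminate them: from here on forced equality and
    membership are handled through this mutual characterisation only. *)
Lemma Feq_law s t p : p ∊ P -> (Feq s t p <->
  (forall s' c, nm s' c s -> forall q, ext q p -> ext q c -> Fmem s' t q) /\
  (forall t' d, nm t' d t -> forall q, ext q p -> ext q d -> Fmem t' s q)).
Proof.
  intros Hp.
  assert (G : forall T e u w, forces_eq_graph mem P le T e -> u ∊ T -> w ∊ T ->
    (forces_covers mem P le e p u w <-> (forall s' c, nm s' c u -> forall q, ext q p -> ext q c -> Fmem s' w q))).
  { intros T e u w He Hu Hw. pose proof He as (A1 & A2). split.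
    - intros H s' c Hs q Q1 Q2 r Hr. destruct (H s' c Hs r) as (r1 & R1 & R2). apply ext_trans with q; auto.
      exists r1. split; auto. destruct R2 as (t' & d & K1 & K2 & K3).
      apply ext_trans with r; auto. apply ext_trans with q; auto.
      exists t', d. split; auto. split; auto. exists T, e. pose proof (A1 _ _ _ Hu Hs). pose proof (A1 _ _ _ Hw K1). auto.
    - intros H s' c Hs q Hq. destruct (classic (ext q c)) as [Qc|Qc].
      + destruct (H s' c Hs q Hq Qc q) as (r & R1 & t' & d & K1 & K2 & T' & e' & He' & K4 & K5 & K6).
        apply ext_refl; apply Hq. exists r. split; auto. intros _. exists t', d. split; auto. split; auto.
        pose proof (A1 _ _ _ Hu Hs). pose proof (A1 _ _ _ Hw K1).
        apply (graph_agree He' He); auto. apply K2.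
      + exists q. split. apply ext_refl, Hq. tauto. }
  split.
  - intros (T & e & He & Hs & Ht & K). pose proof He as (A1 & A2). apply A2 in K as (K1 & K2); auto.
    rewrite (G T e) in K1, K2 by auto. auto.
  - intros (K1 & K2). destruct (tc_spec (upair s t)) as (T1 & T2 & _).
    destruct (graph_exists T1) as (e & He). exists (tc (upair s t)), e.
    assert (S : s ∊ tc (upair s t)) by (apply T2, in_upair; auto).
    assert (S' : t ∊ tc (upair s t)) by (apply T2, in_upair; auto).
    split; [|split; [|split]]; auto. pose proof He as (A1 & A2). apply A2; auto.
    rewrite !(G (tc (upair s t)) e) by auto. auto.
Qed.

Lemma Fmem_mono s t p q : ext q p -> Fmem s t p -> Fmem s t q.
Proof. intros H K r Hr. apply K. apply ext_trans with q; auto. Qed.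
Lemma Fmem_dense s t p : p ∊ P -> dense p (Fmem s t) -> Fmem s t p.
Proof.
  intros Hp H q Hq. destruct (H q Hq) as (r & R1 & R2).
  destruct (R2 r) as (r' & R3 & R4). apply ext_refl, R1. exists r'. split; auto. apply ext_trans with r; auto.
Qed.
Lemma Feq_mono s t p q : ext q p -> Feq s t p -> Feq s t q.
Proof.
  intros H K. rewrite Feq_law in K |- * by apply H. destruct K as (A & B). split.
  - intros s' c Hs r R1 R2. apply (A s' c); auto. apply ext_trans with q; auto.
  - intros s' c Hs r R1 R2. apply (B s' c); auto. apply ext_trans with q; auto.
Qed.
Lemma Feq_dense s t p : p ∊ P -> dense p (Feq s t) -> Feq s t p.
Proof.
  intros Hp H. apply Feq_law; auto. split; intros s' c Hs q Q1 Q2; apply Fmem_dense; try apply Q1; intros r Hr;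
  destruct (H r) as (r1 & R1 & R2); [apply ext_trans with q; auto| |apply ext_trans with q; auto|];
  exists r1; (split; [auto|]); apply Feq_law in R2; try apply R1; destruct R2 as (A & B);
  [apply (A s' c)|apply (B s' c)]; auto; try (apply ext_refl, R1); apply ext_trans with r; auto; apply ext_trans with q; auto.
Qed.
Lemma Feq_sym s t p : p ∊ P -> Feq s t p -> Feq t s p.
Proof. intros Hp. rewrite !Feq_law by auto. tauto. Qed.
Lemma Feq_refl s p : p ∊ P -> Feq s s p.
Proof.
  revert s p. apply (@tc_ind V (fun s => forall p, p ∊ P -> Feq s s p)). df. intros s IH p Hp.
  apply Feq_law; auto. assert (K : forall s' c, nm s' c s -> forall q, ext q p -> ext q c -> Fmem s' s q).
  { intros s' c Hs q Q1 Q2 r Hr. exists r. split. apply ext_refl, Hr. exists s', c. split; auto. split.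
    apply ext_trans with q; auto. apply IH. apply (nm_tc Hs). apply Hr. }
  auto.
Qed.
Lemma Feq_trans s t u p : p ∊ P -> Feq s t p -> Feq t u p -> Feq s u p.
Proof.
  revert s t u p. apply (@tc_ind V (fun s => forall t u p, p ∊ P -> Feq s t p -> Feq t u p -> Feq s u p)). df.
  intros s IH t u p Hp H K. apply Feq_law in H as (H1 & H2); auto. apply Feq_law in K as (K1 & K2); auto.
  apply Feq_law; auto. split.
  - intros s' c Hs q Q1 Q2 q1 Hq1. destruct (H1 s' c Hs q Q1 Q2 q1 Hq1) as (r & R1 & t' & d & T1 & T2 & T3).
    assert (Rp : ext r p) by (apply ext_trans with q1; auto; apply ext_trans with q; auto).
    destruct (K1 t' d T1 r Rp T2 r) as (r2 & R2 & u' & d' & U1 & U2 & U3). apply ext_refl, R1.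
    exists r2. split. apply ext_trans with r; auto. exists u', d'. split; auto. split; auto.
    apply (IH s' (nm_tc Hs) t' u'); auto. apply R2. apply (Feq_mono R2); auto.
  - intros u' d Hu q Q1 Q2 q1 Hq1. destruct (K2 u' d Hu q Q1 Q2 q1 Hq1) as (r & R1 & t' & d' & T1 & T2 & T3).
    assert (Rp : ext r p) by (apply ext_trans with q1; auto; apply ext_trans with q; auto).
    destruct (H2 t' d' T1 r Rp T2 r) as (r2 & R2 & s' & c & S1 & S2 & S3). apply ext_refl, R1.
    exists r2. split. apply ext_trans with r; auto. exists s', c. split; auto. split; auto.
    apply Feq_sym. apply R2. apply (IH s' (nm_tc S1) t' u'). apply R2. apply Feq_sym; auto. apply R2.
    apply Feq_sym. apply R2. apply (Feq_mono R2); auto.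
Qed.
Lemma Fmem_eq_l s s' t p : p ∊ P -> Feq s s' p -> Fmem s t p -> Fmem s' t p.
Proof.
  intros Hp H K q Hq. destruct (K q Hq) as (r & R1 & t' & d & T1 & T2 & T3). exists r. split; auto.
  exists t', d. split; auto. split; auto. apply (@Feq_trans s' s t'); auto. apply R1. apply Feq_sym. apply R1.
  apply (Feq_mono (p := p)); auto. apply ext_trans with q; auto.
Qed.
Lemma Fmem_eq_r s t t' p : p ∊ P -> Feq t t' p -> Fmem s t p -> Fmem s t' p.
Proof.
  intros Hp H K. apply Feq_law in H as (H & _); auto.
  intros q Hq. destruct (K q Hq) as (r & R1 & x & d & T1 & T2 & T3).
  assert (L : Fmem s t' r).
  { apply (@Fmem_eq_l x). apply R1. apply Feq_sym; auto. apply R1. apply (H x d); auto. apply ext_trans with q; auto. }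
  destruct (L r) as (r2 & R2 & L2). apply ext_refl, R1. exists r2. split; auto. apply ext_trans with r; auto.
Qed.
Lemma Fmem_nm s c t p : nm s c t -> ext p c -> Fmem s t p.
Proof.
  intros H K q Hq. exists q. split. apply ext_refl, Hq. exists s, c. split; auto. split. apply ext_trans with p; auto.
  apply Feq_refl, Hq.
Qed.

(** The fragment of ⇒, ∀ and falsity: on it a statement forced densely is forced ([fs_dense]),
    without double negations. *)
Fixpoint fs (v : nat -> V) (f : formula) (p : V) : Prop :=
  match f with
  | fmem i j => Fmem (v i) (v j) p
  | feq i j => Feq (v i) (v j) p
  | ffalse => False
  | fimp g h => forall q, ext q p -> fs v g q -> fs v h q
  | fall g => forall x, fs (push x v) g p
  end.

Lemma fs_mono (f : formula) : forall v p q, ext q p -> fs v f p -> fs v f q.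
Proof.
  induction f; intros v p q H; simpl; auto.
  - apply Fmem_mono; auto.
  - apply Feq_mono; auto.
  - intros K r Hr. apply K. apply ext_trans with q; auto.
  - intros K x. apply IHf with p; auto.
Qed.

Lemma fs_dense (f : formula) : forall v p, p ∊ P -> dense p (fs v f) -> fs v f p.
Proof.
  induction f; intros v p Hp H; simpl in *.
  - apply Fmem_dense; auto.
  - apply Feq_dense; auto.
  - destruct (H p) as (r & _ & []). apply ext_refl; auto.
  - intros q Hq K. apply IHf2. apply Hq. intros r Hr. destruct (H r) as (r' & R1 & R2). apply ext_trans with q; auto.
    exists r'. split; auto. apply R2. apply ext_refl, R1. apply fs_mono with q; auto. apply ext_trans with r; auto.
  - intros x. apply IHf; auto. eapply dense_impl; [|apply H]. intros; simpl; auto.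
Qed.

Lemma Df_fs (f : formula) : Df (fun v => fs (tl v) f (v 0)).
Proof.
  induction f; simpl.
  - unfold tl. df.
  - unfold tl. df.
  - df.
  - apply Df_all, Df_imp; [df|]. apply Df_imp.
    apply (Df_ren (fun n => match n with 0 => 0 | S n => S (S n) end) IHf1).
    apply (Df_ren (fun n => match n with 0 => 0 | S n => S (S n) end) IHf2).
  - apply Df_all. eapply Df_iff; [|apply (Df_ren (fun n => match n with 0 => 1 | 1 => 0 | n => n end) IHf)].
    intros v. unfold tl. simpl.
    replace (fun n => v match n with 0 => 0 | S _ => S n end) with (push (v 0) (fun n => v (S (S n)))). tauto.
    extensionality n; destruct n; reflexivity.
Qed.
End Forcing.

#[global] Hint Resolve Df_ext Df_nm Df_Feq Df_Fmem : df.

(** * Generic filters over countable models *)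

Section GenericFilter.
Context {V : model}.
Variables P le one : V.
Hypothesis FN : forcing_notion (@mem V) P le one.
Notation ext := (extends (@mem V) P le).
Notation dense := (dense_below (@mem V) P le).

(** [G] lies outside the model. It has to meet the dense classes definable with parameters, and
    relative to any of its members, which is the form needed in the truth lemma. *)
Record is_generic (G : V -> Prop) : Prop := {
  gen_P : forall p, G p -> p ∊ P;
  gen_one : G one;
  gen_up : forall p q, G p -> ext p q -> G q;
  gen_dir : forall p q, G p -> G q -> exists r, G r /\ ext r p /\ ext r q;
  gen_meet : forall (D : V -> Prop) p, Df (fun v => D (v 0)) -> G p -> dense p D ->
    exists q, G q /\ ext q p /\ D q
}.

Variable en : nat -> V.
Hypothesis en_surj : forall x, exists n, en n = x.
Variable p0 : V.
Hypothesis Hp0 : p0 ∊ P.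

Definition pick (D p : V) : V :=
  epsilon (inhabits p) (fun q => ext q p /\ ((exists q', ext q' p /\ q' ∊ D) -> q ∊ D)).
Lemma pick_spec D p : p ∊ P -> ext (pick D p) p /\ ((exists q', ext q' p /\ q' ∊ D) -> pick D p ∊ D).
Proof.
  intros Hp. apply (epsilon_spec (inhabits p) (fun q => ext q p /\ ((exists q', ext q' p /\ q' ∊ D) -> q ∊ D))).
  destruct (classic (exists q', ext q' p /\ q' ∊ D)) as [(q & A & B)|N].
  - exists q. auto.
  - exists p. split. apply (ext_refl FN Hp). tauto.
Qed.

Fixpoint chain (n : nat) : V := match n with O => p0 | S m => pick (en m) (chain m) end.

Lemma chain_P n : chain n ∊ P.
Proof. induction n; simpl; auto. apply (pick_spec (en n) IHn). Qed.
Lemma chain_le n m : n <= m -> ext (chain m) (chain n).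
Proof.
  induction 1. apply (ext_refl FN), chain_P. apply (ext_trans FN) with (chain m); auto.
  apply pick_spec, chain_P.
Qed.

Lemma generic_exists : exists G, is_generic G /\ G p0.
Proof.
  exists (fun q => exists n, ext (chain n) q).
  assert (dir : forall p q, (exists n, ext (chain n) p) -> (exists n, ext (chain n) q) ->
     exists n, ext (chain n) p /\ ext (chain n) q).
  { intros p q (n & A) (m & B). exists (max n m). split.
    apply (ext_trans FN) with (chain n); auto. apply chain_le; lia.
    apply (ext_trans FN) with (chain m); auto. apply chain_le; lia. }
  split; [|exists 0; apply (ext_refl FN Hp0)]. split.
  - intros p (n & H). apply H.
  - exists 0. apply (ext_one FN Hp0).
  - intros p q (n & H) K. exists n. apply (ext_trans FN H K).
  - intros p q A B. destruct (dir p q A B) as (n & N1 & N2). exists (chain n). split; auto.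
    exists n. apply (ext_refl FN), chain_P.
  - intros D p DD Gp H.
    (* Adding the conditions incompatible with [p] makes [D] dense everywhere; as a set of the
       model, [D'] appears in the enumeration [en]. *)
    set (D' := sep P (fun q => (ext q p /\ D q) \/ ~ exists r, ext r q /\ ext r p)).
    destruct (en_surj D') as (n & En).
    assert (I : chain (S n) ∊ D').
    { simpl. rewrite En. apply pick_spec. apply chain_P.
      destruct (classic (exists r, ext r (chain n) /\ ext r p)) as [(r & R1 & R2)|N].
      - destruct (H r R2) as (q & Q1 & Q2). exists q. split. apply (ext_trans FN Q1 R1).
        unfold D'. rewrite in_sep by df. split. apply Q1. left. split; auto. apply (ext_trans FN Q1 R2).
      - exists (chain n). split. apply (ext_refl FN), chain_P. unfold D'. rewrite in_sep by df.
        split; auto. apply chain_P. }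
    unfold D' in I. rewrite in_sep in I by df. destruct I as [I1 [I2|I2]].
    + exists (chain (S n)). split; auto. exists (S n). apply (ext_refl FN I1).
    + exfalso. apply I2. destruct (dir (chain (S n)) p) as (m & M1 & M2); auto.
      exists (S n). apply (ext_refl FN I1). eauto.
Qed.
End GenericFilter.

(** * The generic extension *)

Section Extension.
Context {V : model} {ac : AC V}.
Variables P le one : V.
Hypothesis FN : forcing_notion (@mem V) P le one.
Variable G : V -> Prop.
Hypothesis HG : is_generic P le one G.
Notation ext := (extends (@mem V) P le).
Notation nm := (name_elem (@mem V) P).
Notation dense := (dense_below (@mem V) P le).
Notation Feq := (forces_eq (@mem V) P le).
Notation Fmem := (forces_mem (@mem V) P le).

Definition eqG (x y : V) : Prop := exists p, G p /\ Feq x y p.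

Lemma eqG_refl x : eqG x x.
Proof. exists one. split. apply HG. apply (Feq_refl FN). apply (gen_P HG), HG. Qed.
Lemma eqG_sym x y : eqG x y -> eqG y x.
Proof. intros (p & A & B). exists p. split; auto. apply (Feq_sym FN); auto. apply (gen_P HG A). Qed.
Lemma eqG_trans x y z : eqG x y -> eqG y z -> eqG x z.
Proof.
  intros (p & A & B) (q & C & D). destruct (gen_dir HG A C) as (r & R1 & R2 & R3). exists r. split; auto.
  apply (Feq_trans FN) with y. apply (gen_P HG R1). apply (Feq_mono FN R2 B). apply (Feq_mono FN R3 D).
Qed.

Definition rep (x : V) : V := epsilon (inhabits x) (eqG x).
Lemma rep_eq x : eqG x (rep x).
Proof. apply (epsilon_spec (inhabits x) (eqG x)). exists x. apply eqG_refl. Qed.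
Lemma rep_class x y : eqG x y -> rep x = rep y.
Proof.
  intros H. assert (E : eqG x = eqG y).
  { extensionality z. apply propositional_extensionality. split; intros K.
    apply eqG_trans with x; auto. apply eqG_sym; auto. apply eqG_trans with y; auto. }
  unfold rep. rewrite E. apply epsilon_inh_irrelevance. exists y. apply eqG_refl.
Qed.

(** The quotient by [eqG], realised by canonical representatives, so that forced equality becomes
    equality in Rocq as extensionality requires. *)
Definition Nc : Type := {x : V | rep x = x}.
Definition vl (x : V) : Nc := exist _ (rep x) (eq_sym (rep_class (rep_eq x))).
Definition nmem (a b : Nc) : Prop := exists p, G p /\ Fmem (proj1_sig a) (proj1_sig b) p.

Lemma vl_surj (a : Nc) : vl (proj1_sig a) = a.
Proof.
  destruct a as [x Hx]. unfold vl. simpl. apply eq_sig_hprop. intros; apply proof_irrelevance. exact Hx.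
Qed.
Lemma vl_eq x y : vl x = vl y <-> eqG x y.
Proof.
  split.
  - intros H. apply (f_equal (@proj1_sig _ _)) in H. simpl in H.
    apply eqG_trans with (rep x). apply rep_eq. rewrite H. apply eqG_sym, rep_eq.
  - intros H. unfold vl. apply eq_sig_hprop. intros; apply proof_irrelevance. apply rep_class, H.
Qed.
Lemma vl_mem x y : nmem (vl x) (vl y) <-> exists p, G p /\ Fmem x y p.
Proof.
  assert (K : forall x y x' y', eqG x x' -> eqG y y' -> (exists p, G p /\ Fmem x y p) -> exists p, G p /\ Fmem x' y' p).
  { clear x y. intros x y x' y' (p & A & B) (q & C & D) (r & E & F).
    destruct (gen_dir HG A C) as (s & S1 & S2 & S3). destruct (gen_dir HG S1 E) as (t & T1 & T2 & T3).
    pose proof (gen_P HG T1) as Tp.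
    exists t. split; auto. apply (Fmem_eq_l FN (s := x)); auto. apply (Feq_mono FN) with p; auto. apply (ext_trans FN T2 S2).
    apply (Fmem_eq_r FN (t := y)); auto. apply (Feq_mono FN) with q; auto. apply (ext_trans FN T2 S3).
    apply (Fmem_mono FN) with r; auto. }
  unfold nmem, vl; simpl. split; apply K; try apply rep_eq; apply eqG_sym, rep_eq.
Qed.

(** The evaluation law for names: genericity replaces a name forced to belong to [t] by one that
    occurs in [t] with a condition of [G]. *)
Lemma vl_in x t : nmem (vl x) (vl t) <-> exists s c, nm s c t /\ G c /\ vl x = vl s.
Proof.
  rewrite vl_mem. split.
  - intros (p & A & B). destruct (@gen_meet _ _ _ _ _ HG (fun q => exists s c, nm s c t /\ ext q c /\ Feq x s q) p) as (q & Q1 & Q2 & s & c & S1 & S2 & S3); auto. df.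
    exists s, c. split; auto. split. apply (gen_up HG Q1 S2). apply vl_eq. exists q; auto.
  - intros (s & c & A & B & C). apply vl_mem. rewrite C. apply vl_mem. exists c. split; auto.
    apply (Fmem_nm FN A). apply (ext_refl FN), (gen_P HG B).
Qed.

(** For ⇒ and ∀, [G] meets the class of conditions that either force the statement or carry evidence
    against it: a forced premise whose conclusion is never forced below, or an instance never forced
    below. *)
Theorem truth_lemma (f : formula) : forall v : nat -> V,
  sat nmem (fun n => vl (v n)) f <-> exists p, G p /\ fs P le v f p.
Proof.
  induction f; intros v; simpl.
  - apply vl_mem.
  - apply vl_eq.
  - split; [tauto|]. intros (p & _ & []).
  - rewrite IHf1, IHf2. split.
    + intros H. pose proof (Df_fs P le f1) as D1. pose proof (Df_fs P le f2) as D2.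
      assert (E1 : Df (fun u => fs P le v f1 (u 0))) by apply (Df_at v D1).
      assert (E2 : Df (fun u => fs P le v f2 (u 0))) by apply (Df_at v D2).
      destruct (@gen_meet _ _ _ _ _ HG (fun p => fs P le v f2 p \/ (forall q, ext q p -> ~ fs P le v f1 q) \/ (fs P le v f1 p /\ forall q, ext q p -> ~ fs P le v f2 q)) one) as (q & Q1 & Q2 & Q3).
      * apply Df_or; auto. apply Df_or. apply Df_all, Df_imp; [df|]. apply Df_not, (Df_rel1 (fs P le v f1) E1); df.
        apply Df_and; auto. apply Df_all, Df_imp; [df|]. apply Df_not, (Df_rel1 (fs P le v f2) E2); df.
      * apply HG.
      * intros q Hq. destruct (classic (exists r, ext r q /\ fs P le v f1 r)) as [(r & R1 & R2)|N].
        -- destruct (classic (exists r', ext r' r /\ fs P le v f2 r')) as [(r' & R3 & R4)|N].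
           ++ exists r'. split; auto. apply (ext_trans FN R3 R1).
           ++ exists r. split; auto. right; right. split; auto. intros r' A B. apply N; eauto.
        -- exists q. split. apply (ext_refl FN), Hq. right; left. intros r A B. apply N; eauto.
      * exists q. split; auto. intros r Hr K. destruct Q3 as [Q3|[Q3|[Q3 Q4]]].
        -- apply (fs_mono FN Hr Q3).
        -- destruct (Q3 r Hr K).
        -- exfalso. destruct H as (p & A & B). eauto. destruct (gen_dir HG Q1 A) as (t & T1 & T2 & T3).
           apply (Q4 t T2). apply (fs_mono FN T3 B).
    + intros (p & A & B) (q & C & D). destruct (gen_dir HG A C) as (t & T1 & T2 & T3). exists t. split; auto.
      apply B; auto. apply (fs_mono FN T3 D).
  - assert (PE : forall x, (fun n => vl (push x v n)) = push (vl x) (fun n => vl (v n))).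
    { intros x. extensionality n; destruct n; reflexivity. }
    split.
    + intros H. pose proof (Df_fs P le f) as D1.
      assert (E1 : Df (fun u => fs P le (push (u 1) v) f (u 0))) by apply (Df_at2 v D1).
      assert (E2 : Df (fun u => fs P le (push (u 0) v) f (u 1))) by apply (Df_ren (fun n => match n with 0 => 1 | _ => 0 end) E1).
      destruct (@gen_meet _ _ _ _ _ HG (fun p => (forall x, fs P le (push x v) f p) \/ (exists x, forall q, ext q p -> ~ fs P le (push x v) f q)) one) as (q & Q1 & Q2 & Q3).
      * apply Df_or. apply Df_all. exact E2. apply Df_ex, Df_all, Df_imp; [df|]. apply Df_not.
        apply (Df_rel2 (fun p x => fs P le (push x v) f p) E1); df.
      * apply HG.
      * intros q Hq. destruct (classic (exists x r, ext r q /\ forall r', ext r' r -> ~ fs P le (push x v) f r')) as [(x & r & R1 & R2)|N].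
        -- exists r. split; auto. right. eauto.
        -- exists q. split. apply (ext_refl FN), Hq. left. intros x. apply (fs_dense FN). apply Hq.
           intros r Hr. apply NNPP. intros Q. apply N. exists x, r. split; auto. intros r' A B. apply Q; eauto.
      * destruct Q3 as [Q3|(x & Q3)]; eauto. exfalso.
        specialize (H (vl x)). rewrite <- PE, IHf in H. destruct H as (p & A & B).
        destruct (gen_dir HG Q1 A) as (t & T1 & T2 & T3). apply (Q3 t T2). apply (fs_mono FN T3 B).
    + intros (p & A & B) a. rewrite <- (vl_surj a), <- PE. apply IHf. eauto.
Qed.

Definition ck (x : V) : V := rec (fun x g => repl x (fun y => opair (app g y) one)) x.
Lemma DT_ck (s : (nat -> V) -> V) : DT s -> DT (fun v => ck (s v)).
Proof. intros; unfold ck; df. Qed.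
Hint Resolve DT_ck : df.
Lemma in_ck x z : z ∊ ck x <-> exists y, y ∊ x /\ z = opair (ck y) one.
Proof.
  unfold ck at 1. rewrite rec_eq by df. rewrite in_repl by df.
  split; intros (y & A & B); exists y; split; auto; [rewrite B|subst z]; rewrite app_lam; auto; df.
Qed.
Lemma nm_ck s c x : nm s c (ck x) <-> c = one /\ exists y, y ∊ x /\ s = ck y.
Proof.
  unfold name_elem. rewrite opair_in_iff, in_ck. split.
  - intros (A & y & B & C). apply opair_inj in C as [-> ->]. eauto.
  - intros (-> & y & A & ->). split. apply (gen_P HG), HG. eauto.
Qed.
Definition jj (x : V) : Nc := vl (ck x).
Lemma jj_in a x : nmem a (jj x) <-> exists y, y ∊ x /\ a = jj y.
Proof.
  rewrite <- (vl_surj a). unfold jj. rewrite vl_in. split.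
  - intros (s & c & A & B & C). apply nm_ck in A as (-> & y & Hy & ->). eauto.
  - intros (y & A & B). exists (ck y), one. rewrite nm_ck. split; eauto. split; auto. apply HG.
Qed.
Lemma ck_inj x : forall y p, p ∊ P -> Feq (ck x) (ck y) p -> x = y.
Proof.
  revert x. apply (@mem_ind V (fun x => forall y p, p ∊ P -> Feq (ck x) (ck y) p -> x = y)). df.
  intros x IH y p Hp H. apply (Feq_law FN) in H as (A & B); auto.
  pose proof (ext_refl FN Hp) as E. apply set_ext. intros z. split; intros Hz.
  - assert (K : nm (ck z) one (ck x)) by (apply nm_ck; eauto).
    destruct (A _ _ K p E (ext_one FN Hp) p E) as (r & R1 & t & d & T1 & T2 & T3). apply nm_ck in T1 as (-> & y' & Hy & ->).
    apply IH in T3; auto. subst; auto. apply R1.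
  - assert (K : nm (ck z) one (ck y)) by (apply nm_ck; eauto).
    destruct (B _ _ K p E (ext_one FN Hp) p E) as (r & R1 & t & d & T1 & T2 & T3). apply nm_ck in T1 as (-> & y' & Hy & ->).
    apply (Feq_sym FN) in T3; [|apply R1]. apply IH in T3; auto. subst; auto. apply R1.
Qed.
Lemma jj_inj x y : jj x = jj y -> x = y.
Proof. intros H. apply vl_eq in H as (p & A & B). apply (ck_inj (gen_P HG A) B). Qed.

(** Agreement of elements is a statement about infinitely many names; the truth lemma compresses it
    into a single condition, which then forces equality by [Feq_law]. *)
Lemma N_ext (x y : Nc) : (forall z, nmem z x <-> nmem z y) -> x = y.
Proof.
  intros H. set (v := push (proj1_sig x) (fun _ => proj1_sig y)).
  assert (K : forall a b, (forall z, nmem z a -> nmem z b) -> exists p, G p /\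
     forall z q, ext q p -> Fmem z (proj1_sig a) q -> Fmem z (proj1_sig b) q).
  { intros a b Hab. destruct (proj1 (truth_lemma (fall (fimp (fmem 0 1) (fmem 0 2))) (push (proj1_sig a) (fun _ => proj1_sig b)))) as (p & A & B).
    - simpl. rewrite !vl_surj. auto.
    - exists p; split; auto. }
  destruct (K x y) as (p & A & B); [intros; apply H; auto|].
  destruct (K y x) as (q & C & D); [intros; apply H; auto|].
  destruct (gen_dir HG A C) as (r & R1 & R2 & R3).
  rewrite <- (vl_surj x), <- (vl_surj y). apply vl_eq. exists r. split; auto. apply (Feq_law FN). apply (gen_P HG R1).
  split; intros s c Hs u U1 U2; [apply B|apply D]; try (apply (Fmem_nm FN Hs U2)).
  apply (ext_trans FN U1 R2). apply (ext_trans FN U1 R3).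
Qed.

(** A failure is forced by some [p] in [G]. Induction on names in the ground model then shows that
    no extension of [p] forces any name into [X], so [x] is empty. *)
Lemma N_found (x : Nc) : (exists y, nmem y x) -> exists y, nmem y x /\ forall z, nmem z y -> ~ nmem z x.
Proof.
  intros (y0 & Hy0). apply NNPP. intros N. set (X := proj1_sig x).
  destruct (proj1 (truth_lemma (fall (fimp (fmem 0 1) (fimp (fall (fimp (fmem 0 1) (fimp (fmem 0 2) ffalse))) ffalse))) (fun _ => X))) as (p & A & B).
  { simpl. unfold X. rewrite vl_surj. intros y Hy K. apply N. exists y; auto. }
  simpl in B.
  assert (K : forall t q, ext q p -> ~ Fmem t X q).
  { apply (@tc_ind V (fun t => forall q, ext q p -> ~ Fmem t X q)). df. intros t IH q Hq Q.
    apply (B t q Hq Q q). apply (ext_refl FN), Hq. intros z q3 Q3 Z q4 Q4 W.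
    destruct (Z q4 Q4) as (r & R1 & t' & d & T1 & T2 & T3).
    assert (Rp : ext r p) by (apply (ext_trans FN R1), (ext_trans FN Q4), (ext_trans FN Q3 Hq)).
    apply (IH t' (nm_tc T1) r Rp). apply (Fmem_eq_l FN (s := z)); auto. apply R1. apply (Fmem_mono FN R1 W). }
  rewrite <- (vl_surj y0), <- (vl_surj x), vl_mem in Hy0. destruct Hy0 as (q & Q1 & Q2).
  destruct (gen_dir HG A Q1) as (r & R1 & R2 & R3). apply (K (proj1_sig y0) r R2). apply (Fmem_mono FN R3 Q2).
Qed.

Lemma N_pair (x y : Nc) : exists z, forall w, nmem w z <-> w = x \/ w = y.
Proof.
  exists (vl (upair (opair (proj1_sig x) one) (opair (proj1_sig y) one))). intros w.
  rewrite <- (vl_surj w). rewrite vl_in. unfold name_elem. split.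
  - intros (s & c & (A & B) & C & ->). apply opair_in_iff, in_upair in B as [B|B]; apply opair_inj in B as [-> _];
    rewrite vl_surj; auto.
  - assert (O : G one) by apply HG.
    rewrite vl_surj. intros [-> | ->]; [exists (proj1_sig x), one|exists (proj1_sig y), one];
    rewrite opair_in_iff, in_upair, vl_surj; (split; [split; [apply (gen_P HG O)|auto]|auto]).
Qed.

Lemma N_union (x : Nc) : exists u, forall z, nmem z u <-> exists y, nmem z y /\ nmem y x.
Proof.
  set (X := proj1_sig x).
  exists (vl (sep (prod (tc X) P) (fun w => exists s r t c d, w = opair s r /\ nm t c X /\ nm s d t /\ ext r c /\ ext r d))).
  intros z. rewrite <- (vl_surj z), vl_in. split.
  - intros (s & r & (A & B) & C & E). apply opair_in_iff in B. rewrite in_sep in B by df.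
    destruct B as (_ & s' & r' & t & c & d & W & T1 & T2 & T3 & T4). apply opair_inj in W as [<- <-].
    exists (vl t). rewrite E, <- (vl_surj x), !vl_in. split.
    + exists s, d. split; auto. split; auto. apply (gen_up HG C T4).
    + exists t, c. split; auto. split; auto. apply (gen_up HG C T3).
  - intros (y & A & B). rewrite <- (vl_surj y), <- (vl_surj x), vl_in in B. destruct B as (t & c & B1 & B2 & B3).
    rewrite <- (vl_surj y), B3, vl_in in A. destruct A as (s & d & A1 & A2 & A3).
    destruct (gen_dir HG B2 A2) as (r & R1 & R2 & R3). exists s, r. split; auto.
    pose proof (gen_P HG R1) as Rp. split; auto.
    rewrite opair_in_iff, in_sep by df. split.
    + apply opair_in_prod; split; auto. apply (tc_in (proj1 (tc_spec X)) (nm_tc B1) (nm_tc A1)).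
    + exists s, r, t, c, d. auto.
Qed.

Lemma N_sep (f : formula) (v : nat -> Nc) (a : Nc) :
  exists b, forall x, nmem x b <-> nmem x a /\ sat nmem (push x v) f.
Proof.
  set (w := fun n => proj1_sig (v n)). set (A := proj1_sig a).
  assert (PE : forall x, push (vl x) v = (fun n => vl (push x w n))).
  { intros x. extensionality n; destruct n; simpl; auto. unfold w. rewrite vl_surj; auto. }
  pose proof (Df_fs P le f) as D1.
  assert (E1 : Df (fun u => fs P le (push (u 1) w) f (u 0))) by apply (Df_at2 w D1).
  set (R := fun p s => fs P le (push s w) f p). change (Df (fun u => R (u 0) (u 1))) in E1.
  exists (vl (sep (prod (tc A) P) (fun z => exists s p c, z = opair s p /\ nm s c A /\ ext p c /\ R p s))).
  intros x. rewrite <- (vl_surj x), vl_in. split.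
  - intros (s & r & (B1 & B2) & C & E). apply opair_in_iff in B2. rewrite in_sep in B2 by df.
    destruct B2 as (_ & s' & r' & c & W & T1 & T2 & T3). apply opair_inj in W as [<- <-].
    rewrite E, <- (vl_surj a), vl_in, PE, truth_lemma. split.
    + exists s, c. split; auto. split; auto. apply (gen_up HG C T2).
    + exists r; auto.
  - intros (K & L). rewrite <- (vl_surj a), vl_in in K. destruct K as (s & c & K1 & K2 & K3).
    rewrite K3, PE, truth_lemma in L. destruct L as (p & L1 & L2).
    destruct (gen_dir HG K2 L1) as (r & R1 & R2 & R3). exists s, r. split; auto.
    pose proof (gen_P HG R1) as Rp. split; auto. rewrite opair_in_iff, in_sep by df. split.
    + apply opair_in_prod; split; auto. apply (nm_tc K1).
    + exists s, r, c. split; auto. split; auto. split; auto. apply (fs_mono FN R3 L2).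
Qed.

(** Each subset of [x] has a name contained in the set [S], so [pow S] supplies names for all of
    them; separation removes the rest. *)
Lemma N_pow (x : Nc) : exists p, forall z, nmem z p <-> forall w, nmem w z -> nmem w x.
Proof.
  set (X := proj1_sig x). set (S := prod (tc X) P).
  assert (K : exists q, forall z, (forall w, nmem w z -> nmem w x) -> nmem z q).
  { exists (vl (prod (pow S) (sing one))). intros z Hz.
    set (Z := sep S (fun u => exists s p c, u = opair s p /\ Fmem s (proj1_sig z) p /\ nm s c X /\ ext p c)).
    assert (E : z = vl Z).
    { apply N_ext. intros w. rewrite <- (vl_surj w), vl_in. split.
      - intros W. pose proof (Hz _ W) as W'. rewrite <- (vl_surj x), vl_in in W'. destruct W' as (s & c & S1 & S2 & S3).
        rewrite S3, <- (vl_surj z), vl_mem in W. destruct W as (p & W1 & W2).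
        destruct (gen_dir HG S2 W1) as (r & R1 & R2 & R3). exists s, r. pose proof (gen_P HG R1) as Rp. split; auto.
        split; auto. rewrite opair_in_iff. unfold Z. rewrite in_sep by df. split.
        + apply opair_in_prod. split; auto. apply (nm_tc S1).
        + exists s, r, c. split; auto. split; auto. apply (Fmem_mono FN R3 W2).
      - intros (s & p & (A & B) & C & ->). apply opair_in_iff in B. unfold Z in B. rewrite in_sep in B by df.
        destruct B as (_ & s' & p' & c & W & T1 & T2 & T3). apply opair_inj in W as [<- <-].
        rewrite <- (vl_surj z), vl_mem. eauto. }
    rewrite E, vl_in. exists Z, one. assert (O : G one) by apply HG. split; auto. split. apply (gen_P HG O).
    apply opair_in_iff, opair_in_prod. rewrite in_sing, in_pow. split; auto.
    intros u Hu. unfold Z in Hu. rewrite in_sep in Hu by df. tauto. }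
  destruct K as (q & Hq).
  destruct (N_sep (fall (fimp (fmem 0 1) (fmem 0 2))) (fun _ => x) q) as (b & Hb). simpl in Hb.
  exists b. intros z. rewrite Hb. split; [tauto|auto].
Qed.

(** Collection in the ground model, applied to the forcing relation, bounds the names of the values;
    separation in the extension cuts the bound down. *)
Lemma N_repl (f : formula) (v : nat -> Nc) (a : Nc) :
  (forall x, nmem x a -> exists! y, sat nmem (push x (push y v)) f) ->
  exists b, forall y, nmem y b <-> exists x, nmem x a /\ sat nmem (push x (push y v)) f.
Proof.
  intros H. set (w := fun n => proj1_sig (v n)). set (A := proj1_sig a).
  assert (PE : forall x y, push (vl x) (push (vl y) v) = (fun n => vl (push x (push y w) n))).
  { intros x y. extensionality n; destruct n as [|[|n]]; simpl; auto. unfold w. rewrite vl_surj; auto. }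
  assert (E1 : Df (fun u => fs P le (push (u 0) (push (u 1) w)) f (u 2))).
  { pose proof (Df_fs P le f) as (g & s & Hg).
    exists g, (fun n => match s n with inl 0 => inl 2 | inl 1 => inl 0 | inl 2 => inl 1 | inl (Datatypes.S (Datatypes.S (Datatypes.S i))) => inr (w i) | inr c => inr c end).
    intros u. specialize (Hg (push (u 2) (push (u 0) (push (u 1) w)))). simpl in Hg.
    change (fs P le (tl (push (u 2) (push (u 0) (push (u 1) w)))) f (u 2)) with (fs P le (push (u 0) (push (u 1) w)) f (u 2)) in Hg.
    rewrite Hg. match goal with |- sat _ ?A _ <-> sat _ ?B _ => replace A with B; [tauto|] end.
    extensionality n. destruct (s n) as [[|[|[|i]]]|c]; reflexivity. }
  set (R := fun s y p => fs P le (push s (push y w)) f p). change (Df (fun u => R (u 0) (u 1) (u 2))) in E1.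
  destruct (@collection V (prod (tc A) P) (fun z y => exists s p, z = opair s p /\ R s y p)) as (Y & HY). df.
  set (r := fun n => match n with 0 => 0 | 1 => 1 | n => Datatypes.S n end).
  destruct (N_sep (fimp (fall (fimp (fmem 0 2) (fimp (ren r f) ffalse))) ffalse) (push a v) (vl (prod Y (sing one)))) as (b & Hb).
  assert (Hb' : forall y, nmem y b <-> nmem y (vl (prod Y (sing one))) /\ exists x, nmem x a /\ sat nmem (push x (push y v)) f).
  { intros y. rewrite Hb. simpl.
    assert (SR : forall x, sat nmem (push x (push y (push a v))) (ren r f) <-> sat nmem (push x (push y v)) f).
    { intros x. rewrite sat_ren. replace (fun n => push x (push y (push a v)) (r n)) with (push x (push y v)). tauto.
      extensionality n; destruct n as [|[|n]]; reflexivity. }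
    split; intros (K1 & K2); split; auto.
    - apply NNPP. intros N. apply K2. intros x Hx Q. apply N. exists x. split; auto. apply SR; auto.
    - intros Q. destruct K2 as (x & X1 & X2). apply (Q x X1). apply SR; auto. }
  exists b. intros y. rewrite Hb'. split; [tauto|]. intros (x & X1 & X2). split; eauto.
  destruct (H x X1) as (y1 & Y1 & U). assert (E : y1 = y) by auto. subst y1.
  rewrite <- (vl_surj x), <- (vl_surj a), vl_in in X1. destruct X1 as (s & c & S1 & S2 & S3).
  rewrite vl_surj in S3. subst x. rewrite <- (vl_surj y), PE, truth_lemma in X2. destruct X2 as (p & P1 & P2).
  destruct (HY (opair s p)) as (y' & Hy' & s' & p' & W & T).
  - apply opair_in_prod. split. apply (nm_tc S1). apply (gen_P HG P1).
  - exists (proj1_sig y), s, p. auto.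
  - apply opair_inj in W as [<- <-]. assert (E : y = vl y').
    { apply U. rewrite PE, truth_lemma. exists p; auto. }
    rewrite E, vl_in. exists y', one. assert (O : G one) by apply HG. split; auto. split. apply (gen_P HG O).
    apply opair_in_iff, opair_in_prod. rewrite in_sing. auto.
Qed.

Lemma N_inf : exists w, @is_omega (truth nmem) w.
Proof.
  exists (jj om). destruct (@om_spec V) as (L & M).
  assert (T : forall x, Trans x -> @transitive (truth nmem) (jj x)).
  { intros x Hx y Hy z Hz. simpl in *. apply jj_in in Hy as (y' & Y1 & ->). apply jj_in in Hz as (z' & Z1 & ->).
    apply jj_in. exists z'. split; auto. apply (Hx y'); auto. }
  split; [split; [split|split]|].
  - apply T. exact (proj1 (proj1 L)).
  - intros y Hy. apply jj_in in Hy as (y' & Y1 & ->). apply T. exact (proj2 (proj1 L) y' Y1).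
  - exists (jj emp). apply jj_in. exists emp. split; auto. apply Limit_emp, L.
  - intros y Hy. apply jj_in in Hy as (y' & Y1 & ->). exists (jj (succ y')). split; apply jj_in.
    exists (succ y'). split; auto. apply Limit_succ; auto. exists y'. split; auto. apply in_succ; auto.
  - intros y Hy K. simpl in *. apply jj_in in Hy as (y' & Y1 & ->). apply (M y' Y1).
    split. apply (Ord_in (proj1 L) Y1). destruct K as (_ & K1 & K2). split.
    + destruct K1 as (z & Hz). apply jj_in in Hz as (z' & Z1 & ->). eauto.
    + intros z Hz. destruct (K2 (jj z)) as (u & U1 & U2). apply jj_in; eauto.
      apply jj_in in U1 as (u' & U3 & ->). apply jj_in in U2 as (z' & Z1 & E). apply jj_inj in E. subst; eauto.
Qed.

Lemma N_ZF : ZF nmem.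
Proof.
  constructor; [apply N_ext|apply N_found|apply N_pair|apply N_union|apply N_pow|apply N_inf|apply N_sep|apply N_repl].
Qed.
Definition Nm : model := Model N_ZF.

Definition jN (x : V) : Nm := jj x.
Definition vN (x : V) : Nm := vl x.
Lemma vN_surj (a : Nm) : exists x, a = vN x.
Proof. exists (proj1_sig a). symmetry. apply vl_surj. Qed.
Lemma vN_in x t : vN x ∊ vN t <-> exists s c, nm s c t /\ G c /\ vN x = vN s.
Proof. apply vl_in. Qed.
Lemma jN_in (a : Nm) x : a ∊ jN x <-> exists y, y ∊ x /\ a = jN y.
Proof. apply jj_in. Qed.

Definition np (s t : V) : V := upair (opair s one) (opair t one).
Definition opn (s t : V) : V := np (np s s) (np s t).
Lemma DT_opn (s t : (nat -> V) -> V) : DT s -> DT t -> DT (fun v => opn (s v) (t v)).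
Proof. intros; unfold opn, np; df. Qed.
Hint Resolve DT_opn : df.
Lemma vN_np s t : vN (np s t) = upair (vN s) (vN t).
Proof.
  apply set_ext. intros w. rewrite in_upair. destruct (vN_surj w) as (x & ->). rewrite vN_in. unfold name_elem. split.
  - intros (u & c & (A & B) & C & ->). apply opair_in_iff in B. unfold np in B. apply in_upair in B as [B|B]; apply opair_inj in B as [-> _]; auto.
  - assert (O : G one) by apply HG. intros [-> | ->]; [exists s, one|exists t, one]; unfold np; rewrite opair_in_iff, in_upair;
    (split; [split; [apply (gen_P HG O)|auto]|auto]).
Qed.
Lemma vN_opn s t : vN (opn s t) = opair (vN s) (vN t).
Proof. unfold opn, opair. rewrite !vN_np. auto. Qed.

(* The elements of the names below [A], enumerated in the ground model, give an enumeration in the extension. *)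
Lemma N_AC : AC Nm.
Proof.
  intros a ne disj. destruct (vN_surj a) as (A & ->).
  destruct (@well_order V ac (tc A)) as (th & h & Oth & Hh).
  set (F := vN (repl th (fun xi => opair (opn (ck xi) (app h xi)) one))).
  assert (O : G one) by apply HG.
  assert (inF : forall z, z ∊ F <-> exists xi, xi ∊ th /\ z = opair (jN xi) (vN (app h xi))).
  { intros z. destruct (vN_surj z) as (Z & ->). unfold F. rewrite vN_in. unfold name_elem. split.
    - intros (s & c & (B1 & B2) & C & ->). apply opair_in_iff in B2. rewrite in_repl in B2 by df.
      destruct B2 as (xi & X & E). apply opair_inj in E as [-> _]. rewrite vN_opn. eauto.
    - intros (xi & X & E). exists (opn (ck xi) (app h xi)), one. rewrite opair_in_iff, in_repl by df.
      rewrite vN_opn. split; [split; [apply (gen_P HG O)|eauto]|auto]. }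
  assert (funF : forall x z z', opair x z ∊ F -> opair x z' ∊ F -> z = z').
  { intros x z z' B C. apply inF in B as (xi & X & E). apply inF in C as (xi' & X' & E').
    apply opair_inj in E as [-> ->]. apply opair_inj in E' as [E ->]. apply jj_inj in E. subst; auto. }
  assert (OrdN : Ord (jN th)).
  { split.
    - intros y Hy z Hz. apply jN_in in Hy as (y' & Y & ->). apply jN_in in Hz as (z' & Z & ->). apply jN_in.
      exists z'; split; auto. apply (Ord_trans Oth Z Y).
    - intros y Hy z Hz w Hw. apply jN_in in Hy as (y' & Y & ->). apply jN_in in Hz as (z' & Z & ->). apply jN_in in Hw as (w' & W & ->).
      apply jN_in. exists w'; split; auto. apply (Ord_trans (Ord_in Oth Y) W Z). }
  assert (en : forall w z, w ∊ vN A -> z ∊ w -> exists xi, xi ∊ jN th /\ opair xi z ∊ F).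
  { intros w z W Z. destruct (vN_surj w) as (w' & ->). apply vN_in in W as (s & c & S1 & S2 & S3).
    rewrite S3 in Z. destruct (vN_surj z) as (z' & ->). apply vN_in in Z as (t & d & T1 & T2 & T3).
    assert (Ht : t ∊ tc A) by apply (tc_in (proj1 (tc_spec A)) (nm_tc S1) (nm_tc T1)).
    destruct (proj2 Hh t Ht) as (xi & X & <-). exists (jN xi). split. apply jN_in; eauto. apply inF. rewrite T3. eauto. }
  set (ok := fun w x z => z ∊ w /\ x ∊ jN th /\ opair x z ∊ F /\ forall y z', y ∊ x -> opair y z' ∊ F -> ~ z' ∊ w).
  assert (Dok : Df (fun v => ok (v 0) (v 1) (v 2))) by (unfold ok; df).
  exists (sep (union (vN A)) (fun z => exists w x, w ∊ vN A /\ ok w x z)).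
  intros w W.
  destruct (@min_exists Nm (jN th) (fun x => exists z, z ∊ w /\ opair x z ∊ F)) as (x & X1 & (z & Z1 & Z2) & X3). df.
  { destruct (ne w W) as (z & Z). destruct (en w z W Z) as (xi & A1 & A2). eauto. }
  assert (Oz : ok w x z).
  { split; auto. split; auto. split; auto. intros y z' Hy Q1 Q2. apply (X3 y Hy). apply (Ord_trans OrdN Hy X1). eauto. }
  exists z. split.
  - split; auto. rewrite in_sep by df. split. apply in_union; eauto. exists w, x. auto.
  - intros z' (Z'1 & Z'2). rewrite in_sep in Z'2 by df. destruct Z'2 as (_ & w' & x' & W' & K1 & K2 & K3 & K4).
    assert (E : w' = w) by (apply (disj w' w z'); auto). subst w'.
    destruct Oz as (_ & _ & _ & L). assert (E : x = x').
    { destruct (Ord_trich (Ord_in OrdN X1) (Ord_in OrdN K2)) as [Q|[Q|Q]]; auto.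
      destruct (K4 x z Q Z2 Z1). destruct (L x' z' Q K3 K1). }
    subst x'. apply (funF x); auto.
Qed.
End Extension.

#[global] Hint Resolve DT_ck : df.

(** * Transitive embeddings *)

Section Embedding.
Context {V N : model}.
Variable j : V -> N.
Hypothesis j_in : forall a x, a ∊ j x <-> exists y, y ∊ x /\ a = j y.
Hypothesis j_inj : forall x y, j x = j y -> x = y.
Implicit Types (a b c f g h k x y z : V).

Lemma j_mem x y : j x ∊ j y <-> x ∊ y.
Proof. rewrite j_in. split; [intros (z & A & B); apply j_inj in B; subst; auto|eauto]. Qed.
Lemma j_sub x y : j x ⊆ j y <-> x ⊆ y.
Proof.
  split.
  - intros H z Hz. apply j_mem. apply H. apply j_mem, Hz.
  - intros H a Ha. apply j_in in Ha as (z & Hz & ->). apply j_mem; auto.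
Qed.
Lemma j_upair x y : j (upair x y) = upair (j x) (j y).
Proof.
  apply set_ext. intros a. rewrite j_in, in_upair. split.
  - intros (z & Hz & ->). apply in_upair in Hz as [->| ->]; auto.
  - intros [->| ->]; eexists; rewrite in_upair; eauto.
Qed.
Lemma j_opair x y : j (opair x y) = opair (j x) (j y).
Proof. unfold opair. rewrite !j_upair. auto. Qed.
Lemma j_Trans x : Trans x -> Trans (j x).
Proof.
  intros H a Ha. apply j_in in Ha as (y & Hy & ->). apply j_sub, H, Hy.
Qed.
Lemma j_Ord x : Ord x -> Ord (j x).
Proof.
  intros [A B]. split. apply j_Trans, A. intros a Ha. apply j_in in Ha as (y & Hy & ->). apply j_Trans, B, Hy.
Qed.
Lemma j_Ord_inv x : Ord (j x) -> Ord x.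
Proof.
  intros [A B]. split.
  - intros y Hy. apply j_sub. apply A, j_mem, Hy.
  - intros y Hy z Hz. apply j_sub. apply (B (j y)); apply j_mem; auto.
Qed.
Lemma j_Limit x : Limit x -> Limit (j x).
Proof.
  intros L. split. apply j_Ord, L. split.
  - exists (j emp). apply j_mem, Limit_emp, L.
  - intros a Ha. apply j_in in Ha as (y & Hy & ->). exists (j (succ y)). rewrite !j_mem. split.
    apply Limit_succ; auto. apply in_succ; auto.
Qed.
Lemma j_Limit_inv x : Limit (j x) -> Limit x.
Proof.
  intros L. split. apply j_Ord_inv, L. destruct L as (_ & (a & Ha) & L). split.
  - apply j_in in Ha as (y & Hy & _). eauto.
  - intros y Hy. destruct (L (j y)) as (a' & A & B). apply j_mem; auto.
    apply j_in in A as (z & Hz & ->). apply j_mem in B. eauto.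
Qed.
Lemma j_om : j om = om.
Proof.
  apply sub_antisym.
  - apply Ord_not_in. apply Ord_om. apply j_Ord, Ord_om. intros H. apply j_in in H as (y & Hy & E).
    apply (proj2 om_spec y Hy). apply j_Limit_inv. rewrite <- E. apply Limit_om.
  - apply om_least, j_Limit, Limit_om.
Qed.
Lemma j_Fn f a : Fn f a -> Fn (j f) (j a).
Proof.
  intros F. apply Fn_intro.
  - intros z Hz. apply j_in in Hz as (w & W & ->). apply (Fn_in w F) in W as (x & X & ->).
    exists (j x), (j (app f x)). rewrite j_mem, j_opair. auto.
  - intros u U. apply j_in in U as (x & X & ->). exists (j (app f x)). split.
    + rewrite <- j_opair, j_mem. apply (Fn_opair _ _ F). auto.
    + intros b B. apply j_in in B as (w & W & E). apply (Fn_in w F) in W as (x' & X' & ->). rewrite j_opair in E.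
      apply opair_inj in E as [E ->]. apply j_inj in E. subst; auto.
Qed.
Lemma j_app f a x : Fn f a -> x ∊ a -> app (j f) (j x) = j (app f x).
Proof.
  intros F X. apply (app_eq (j_Fn F)). rewrite <- j_opair, j_mem. apply (Fn_opair _ _ F). auto.
Qed.
Lemma j_Maps f a b : Maps f a b -> Maps (j f) (j a) (j b).
Proof.
  intros [F M]. split. apply j_Fn, F. intros u U. apply j_in in U as (x & X & ->). rewrite (j_app F X). apply j_mem; auto.
Qed.
Lemma j_Inj f a b : Inj f a b -> Inj (j f) (j a) (j b).
Proof.
  intros [M I]. split. apply j_Maps, M. intros u w U W. apply j_in in U as (x & X & ->). apply j_in in W as (y & Y & ->).
  rewrite !(j_app (proj1 M)) by auto. intros E. apply j_inj in E. f_equal; auto.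
Qed.
Lemma j_inj_sets a b : inj a b -> inj (j a) (j b).
Proof. intros (f & F). exists (j f). apply j_Inj, F. Qed.
Lemma j_Reg_inv k : Reg (j k) -> Reg k.
Proof.
  intros [L H]. split. apply j_Limit_inv, L. intros a A f F. destruct (H (j a)) with (f := j f) as (b & B & K).
  apply j_mem, A. apply j_Maps, F. apply j_in in B as (b' & B & ->). exists b'. split; auto. intros x X.
  apply j_mem. rewrite <- (j_app (proj1 F) X). apply K. apply j_mem, X.
Qed.
End Embedding.

(** * An interface to generic extensions *)

(** Packages the facts about an extension used later and hides the construction by representatives;
    [gv] evaluates names. *)
Record gext (V : model) (P le one : V) : Type := GExt {
  gN : model;
  gAC : AC gN;
  gG : V -> Prop;
  g_gen : is_generic P le one gG;
  gv : V -> gN;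
  gv_surj : forall a, exists x, a = gv x;
  gv_in : forall x t, gv x ∊ gv t <-> exists s c, name_elem (@mem V) P s c t /\ gG c /\ gv x = gv s;
  gv_mem : forall x t, gv x ∊ gv t <-> exists p, gG p /\ forces_mem (@mem V) P le x t p;
  gj_in : forall a x, a ∊ gv (ck one x) <-> exists y, y ∊ x /\ a = gv (ck one y);
  gj_inj : forall x y, gv (ck one x) = gv (ck one y) -> x = y;
  g_truth : forall (f : formula) (v : nat -> V),
    sat (@mem gN) (fun n => gv (v n)) f <-> exists p, gG p /\ fs P le v f p
}.
#[global] Existing Instance gAC.

Lemma gext_exists (V : model) (ac : AC V) (P le one : V) (en : nat -> V) p0 :
  forcing_notion (@mem V) P le one -> (forall x, exists n, en n = x) -> p0 ∊ P ->
  exists X : gext P le one, gG X p0.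
Proof.
  intros FN Hen H0. destruct (generic_exists FN Hen H0) as (G & HG & G0).
  unshelve eexists (@GExt V P le one (Nm FN HG) (@N_AC V ac P le one FN G HG) G HG (@vN V P le one FN G HG) _ _ _ _ _ _).
  - apply vN_surj.
  - apply vN_in.
  - apply vl_mem.
  - apply jj_in.
  - apply jj_inj.
  - apply truth_lemma.
  - exact G0.
Qed.

Section ExtProps.
Context {V : model} {P le one : V} (FN : forcing_notion (@mem V) P le one) (X : gext P le one).
Notation ext := (extends (@mem V) P le).
Notation nm := (name_elem (@mem V) P).
Notation dense := (dense_below (@mem V) P le).
Notation Feq := (forces_eq (@mem V) P le).
Notation Fmem := (forces_mem (@mem V) P le).

Definition gj (x : V) : gN X := gv X (ck one x).
(** The canonical name of the generic filter: it turns the outer predicate [gG] into a set of the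
    extension. *)
Definition Gam : gN X := gv X (repl P (fun p => opair (ck one p) p)).
Lemma in_Gam a : a ∊ Gam <-> exists p, gG X p /\ a = gj p.
Proof.
  destruct (gv_surj a) as (x & ->). unfold Gam. rewrite gv_in. unfold name_elem. split.
  - intros (s & c & (A & B) & C & ->). apply opair_in_iff in B. rewrite in_repl in B by df.
    destruct B as (p & Hp & E). apply opair_inj in E as [-> ->]. exists p. auto.
  - intros (p & A & ->). exists (ck one p), p. pose proof (gen_P (g_gen X) A) as Hp.
    rewrite opair_in_iff, in_repl by df. split; [|auto]. split; auto. eauto.
Qed.
Lemma gj_Gam p : gj p ∊ Gam <-> gG X p.
Proof.
  rewrite in_Gam. split; [|eauto]. intros (q & A & E). apply gj_inj in E. subst; auto.
Qed.

(* The names in [t] bound the set of ground-model ordinals that can lie in the value of [t]. *)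
Lemma gN_Ord a : Ord a -> exists x, Ord x /\ a = gj x.
Proof.
  intros O. destruct (gv_surj a) as (t & Et).
  set (f := fun z => the (fun x => exists s q, z = opair s q /\ Feq (ck one x) s q)).
  assert (Df' : DT (fun v => f (v 0))) by (unfold f; df).
  destruct (@no_set_of_Ord V (repl (prod (tc t) P) f)) as (x & Ox & N).
  assert (K : ~ gj x ∊ a).
  { rewrite Et. unfold gj. rewrite gv_mem. intros (p & A & B). pose proof (gen_P (g_gen X) A) as Hp.
    destruct (B p (ext_refl FN Hp)) as (r & R & s & d & S1 & S2 & S3). apply N. rewrite in_repl by df.
    exists (opair s r). split. apply opair_in_prod. split. apply (nm_tc S1). apply R. symmetry. apply the_eq; eauto.
    intros y (s' & r' & E & F). apply opair_inj in E as [<- <-].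
    apply (ck_inj FN (g_gen X) (p := r)). apply R. apply (Feq_trans FN) with s; auto. apply R. apply (Feq_sym FN); auto. apply R. }
  assert (Oj : Ord (gj x)) by (apply (j_Ord (@gj_in _ _ _ _ X) (@gj_inj _ _ _ _ X) Ox)).
  destruct (Ord_trich O Oj) as [L|[L|L]]; [|eauto|tauto].
  apply gj_in in L as (y & Y & ->). exists y. split; auto. apply (Ord_in Ox Y).
Qed.
End ExtProps.

(** * The Easton product *)

Section Easton.
Context {V : model} {ac : AC V}.
Variable kap : V.
Implicit Types (a b c d f g h k p q r s t u w x y z : V).

Definition two : V := succ (succ emp).
Lemma in_two b : b ∊ two <-> b = emp \/ b = succ emp.
Proof.
  unfold two. rewrite !in_succ. split; [intros [[H|H]|H]; auto; destruct (in_emp H)|intros [H|H]; auto].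
Qed.

(* An element [(δ, ((ζ, i), b))] says that the [i]-th bit of the [ζ]-th new subset of [δ] is [b]. *)
Definition XX : V := sep (prod kap (prod (prod kap kap) two)) (fun z =>
  exists de ze i b, z = opair de (opair (opair ze i) b) /\ Reg de /\ ze ∊ cs (cs de) /\ i ∊ de).
Definition crd z : V := opair (fst z) (fst (snd z)).
Definition low nu p : V := sep p (fun z => fst z ∊ succ nu).
Definition high nu p : V := sep p (fun z => nu ∊ fst z).
(** The last clause combines Easton support with the size of the factors: for regular [nu] fewer
    than [nu] bits are fixed at coordinates up to and including [nu]. *)
Definition Cond p : Prop := p ⊆ XX /\ (forall z w, z ∊ p -> w ∊ p -> crd z = crd w -> z = w) /\
  forall nu, Reg nu -> small nu (low nu p).
Definition PP : V := sep (pow XX) Cond.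
Definition LE : V := sep (prod PP PP) (fun z => exists p q, z = opair p q /\ q ⊆ p).

Lemma DT_crd (s : (nat -> V) -> V) : DT s -> DT (fun v => crd (s v)).
Proof. intros; unfold crd; df. Qed.
Lemma DT_low (s t : (nat -> V) -> V) : DT s -> DT t -> DT (fun v => low (s v) (t v)).
Proof. apply DT_fun2. change (DT (fun v : nat -> V => low (v 0) (v 1))). unfold low. df. Qed.
Hint Resolve DT_crd DT_low : df.
Lemma Df_Cond (s : (nat -> V) -> V) : DT s -> Df (fun v => Cond (s v)).
Proof. apply (Df_rel1 Cond). unfold Cond. df. Qed.
Hint Resolve Df_Cond : df.

Lemma in_PP p : p ∊ PP <-> Cond p.
Proof.
  unfold PP. rewrite in_sep by df. rewrite in_pow. split; [tauto|]. intros H; split; auto. apply H.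
Qed.
Lemma in_low nu p z : z ∊ low nu p <-> z ∊ p /\ fst z ∊ succ nu.
Proof. unfold low. rewrite in_sep by df. tauto. Qed.
Lemma in_high nu p z : z ∊ high nu p <-> z ∊ p /\ nu ∊ fst z.
Proof. unfold high. rewrite in_sep by df. tauto. Qed.

Notation ext := (extends (@mem V) PP LE).
Lemma ext_iff p q : ext p q <-> p ∊ PP /\ q ∊ PP /\ q ⊆ p.
Proof.
  unfold extends. rewrite opair_in_iff. unfold LE. rewrite in_sep by df. rewrite opair_in_prod. split.
  - intros (A & B & _ & p' & q' & E & H). apply opair_inj in E as [-> ->]. auto.
  - intros (A & B & C). eauto 10.
Qed.

Lemma in_XX z : z ∊ XX <-> exists de ze i b, z = opair de (opair (opair ze i) b) /\
  de ∊ kap /\ ze ∊ kap /\ i ∊ kap /\ b ∊ two /\ Reg de /\ ze ∊ cs (cs de) /\ i ∊ de.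
Proof.
  unfold XX. rewrite in_sep by df. split.
  - intros (A & de & ze & i & b & -> & B & C & D). rewrite !opair_in_prod in A. exists de, ze, i, b. tauto.
  - intros (de & ze & i & b & -> & H). rewrite !opair_in_prod. split; [tauto|]. exists de, ze, i, b. tauto.
Qed.
Lemma crd_opair de u b : crd (opair de (opair u b)) = opair de u.
Proof. unfold crd. rewrite snd_opair, !fst_opair. auto. Qed.

Lemma XX_Ord z : z ∊ XX -> Ord (fst z) /\ fst z ∊ kap /\ Reg (fst z).
Proof.
  intros H. apply in_XX in H as (de & ze & i & b & -> & H). rewrite fst_opair. split; [|tauto]. apply Reg_Ord; tauto.
Qed.

Lemma PP_XX p : p ∊ PP -> p ⊆ XX.
Proof. intros H. apply in_PP in H. apply H. Qed.
Lemma PP_fun p z w : p ∊ PP -> z ∊ p -> w ∊ p -> crd z = crd w -> z = w.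
Proof. intros H. apply in_PP in H as (_ & H & _). apply H. Qed.
Lemma PP_small p nu : p ∊ PP -> Reg nu -> small nu (low nu p).
Proof. intros H. apply in_PP in H. apply H. Qed.

Lemma PP_sub p q : p ∊ PP -> q ⊆ p -> q ∊ PP.
Proof.
  intros H K. apply in_PP. split; [|split].
  - intros z Z. apply (PP_XX H), K, Z.
  - intros z w Z W. apply (PP_fun H); auto.
  - intros nu R. apply small_sub with (low nu p). apply R. intros z Z. apply in_low in Z as [A B]. apply in_low; auto.
    apply PP_small; auto.
Qed.

Lemma PP_cup p q : p ∊ PP -> q ∊ PP -> (forall z w, z ∊ p -> w ∊ q -> crd z = crd w -> z = w) -> cup p q ∊ PP.
Proof.
  intros H K C. apply in_PP. split; [|split].
  - intros z Z. apply in_cup in Z as [Z|Z]; [apply (PP_XX H)|apply (PP_XX K)]; auto.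
  - intros z w Z W E. apply in_cup in Z as [Z|Z], W as [W|W].
    apply (PP_fun H); auto. auto. symmetry. auto. apply (PP_fun K); auto.
  - intros nu R. apply small_sub with (cup (low nu p) (low nu q)). apply R.
    + intros z Z. apply in_low in Z as [A B]. rewrite in_cup, !in_low. apply in_cup in A as [A|A]; auto.
    + apply small_cup. apply R. apply PP_small; auto. apply PP_small; auto.
Qed.

Lemma PP_emp : emp ∊ PP.
Proof.
  apply in_PP. split; [|split].
  - intros z Z; destruct (in_emp Z).
  - intros z w Z; destruct (in_emp Z).
  - intros nu R. apply small_sub with emp. apply R. intros z Z. apply in_low in Z; tauto. apply small_emp, R.
Qed.

(** The closure property of upper factors. At each regular [nu] a chain is harmless when it is short
    compared with [nu], or when it leaves the coordinates up to [nu] untouched. *)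
Lemma PP_union S : S ⊆ PP -> (forall p q, p ∊ S -> q ∊ S -> p ⊆ q \/ q ⊆ p) ->
  (forall nu, Reg nu -> small nu S \/ forall p z, p ∊ S -> z ∊ p -> ~ fst z ∊ succ nu) -> union S ∊ PP.
Proof.
  intros H C K. apply in_PP. split; [|split].
  - intros z Z. apply in_union in Z as (p & A & B). apply (PP_XX (H p B)); auto.
  - intros z w Z W. apply in_union in Z as (p & A & B). apply in_union in W as (q & A' & B').
    destruct (C p q B B') as [Q|Q]; [apply (PP_fun (H q B'))|apply (PP_fun (H p B))]; auto.
  - intros nu R. destruct (K nu R) as [Q|Q].
    + apply small_sub with (union (repl S (low nu))). apply R.
      * intros z Z. apply in_low in Z as [A B]. apply in_union in A as (p & A & A'). apply in_union. exists (low nu p).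
        rewrite in_low, in_repl by df. eauto.
      * apply small_union. df. apply R. auto. intros p Hp. apply PP_small; auto.
    + apply small_sub with emp. apply R. 2: apply small_emp, R.
      intros z Z. apply in_low in Z as [A B]. apply in_union in A as (p & A & A'). destruct (Q p z A' A B).
Qed.

Lemma Easton_forcing : forcing_notion (@mem V) PP LE emp.
Proof.
  assert (E : forall p q, p ∊ PP -> q ∊ PP -> q ⊆ p -> @opair_in (truth mem) p q LE).
  { intros p q A B C. apply (proj2 (proj2 (proj2 (ext_iff p q) (conj A (conj B C))))). }
  assert (E' : forall p q, p ∊ PP -> q ∊ PP -> @opair_in (truth mem) p q LE -> q ⊆ p).
  { intros p q A B C. apply (ext_iff p q). split; auto. }
  split; [|split; [|split]].
  - apply PP_emp.
  - intros p A. apply E; auto. intros z; auto.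
  - intros p q r A B C D F. apply E; auto. intros z Z. apply (E' p q); auto. apply (E' q r); auto.
  - intros p A. apply E; auto. apply PP_emp. intros z Z; destruct (in_emp Z).
Qed.

Section Split.
Variable m : V.
Hypothesis Rm : Reg m.
Definition Lw : V := sep PP (fun p => forall z, z ∊ p -> fst z ∊ succ m).
Definition Hi : V := sep PP (fun p => forall z, z ∊ p -> m ∊ fst z).
Lemma in_Lw p : p ∊ Lw <-> p ∊ PP /\ forall z, z ∊ p -> fst z ∊ succ m.
Proof. unfold Lw. rewrite in_sep by df. tauto. Qed.
Lemma in_Hi p : p ∊ Hi <-> p ∊ PP /\ forall z, z ∊ p -> m ∊ fst z.
Proof. unfold Hi. rewrite in_sep by df. tauto. Qed.
Lemma low_Lw p : p ∊ PP -> low m p ∊ Lw.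
Proof.
  intros H. apply in_Lw. split. apply PP_sub with p; auto. intros z Z; apply in_low in Z; tauto.
  intros z Z; apply in_low in Z; tauto.
Qed.
Lemma high_Hi p : p ∊ PP -> high m p ∊ Hi.
Proof.
  intros H. apply in_Hi. split. apply PP_sub with p; auto. intros z Z; apply in_high in Z; tauto.
  intros z Z; apply in_high in Z; tauto.
Qed.
Lemma low_high p : p ∊ PP -> cup (low m p) (high m p) = p.
Proof.
  intros H. apply set_ext. intros z. rewrite in_cup, in_low, in_high. split; [tauto|]. intros Z.
  destruct (XX_Ord (PP_XX H Z)) as (O & _). destruct (Ord_trich O (Reg_Ord Rm)) as [K|[K|K]]; auto;
  left; split; auto; apply in_succ; auto.
Qed.
Lemma Lw_small a : a ∊ Lw -> small m a.
Proof.
  intros H. apply in_Lw in H as [A B]. apply small_sub with (low m a). apply Rm. intros z Z. apply in_low; auto.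
  apply PP_small; auto.
Qed.
Lemma Lw_Hi a r : a ∊ Lw -> r ∊ Hi -> cup a r ∊ PP.
Proof.
  intros A B. apply in_Lw in A as [A1 A2]. apply in_Hi in B as [B1 B2]. apply PP_cup; auto.
  intros z w Z W E. exfalso. unfold crd in E. apply opair_inj in E as [E _].
  pose proof (A2 z Z) as K. pose proof (B2 w W) as L. rewrite <- E in L. apply in_succ in K as [K|K].
  apply (not_in_2 K L). rewrite K in L. apply (not_in_self L).
Qed.
Lemma Lw_cup a t : a ∊ Lw -> t ∊ PP -> cup a (low m t) ∊ PP -> cup a t ∊ PP.
Proof.
  intros A B C. pose proof A as A'. apply in_Lw in A' as [A1 A2]. apply PP_cup; auto. intros z w Z W E.
  assert (K : fst w ∊ succ m). { unfold crd in E. apply opair_inj in E as [E _]. rewrite <- E. auto. }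
  apply (PP_fun C); auto; apply in_cup; auto. right. apply in_low; auto.
Qed.
End Split.
End Easton.
#[global] Hint Resolve DT_crd DT_low Df_Cond : df.

(** * The covering lemma *)

Section Cover.
Context {V : model} {ac : AC V}.
Variables kap m : V.
Hypothesis Rm : Reg m.
Hypothesis gch : @GCHm V.
Variable D : V -> V -> Prop.
Hypothesis DD : Df (fun v => D (v 0) (v 1)).
Hypothesis Dopen : forall i p q, i ∊ m -> D i p -> p ⊆ q -> q ∊ PP kap -> D i q.
Hypothesis Ddense : forall i p, i ∊ m -> p ∊ PP kap -> exists q, q ∊ PP kap /\ p ⊆ q /\ D i q.
Implicit Types (a b c d f g h k p q r s t u w x y z : V).
Notation P := (PP kap).
Notation L := (Lw kap m).
Notation H := (Hi kap m).

(** A third component gives each task (eta, k) as many codes as [m] has elements. They cannot all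
    lie in [succ eta], so some code comes after [eta]. *)
Lemma bookkeeping : exists rho, forall eta k, eta ∊ m -> k ∊ m ->
  exists xi, xi ∊ m /\ eta ∊ xi /\ app rho xi = opair eta k.
Proof.
  pose proof (Reg_Card Rm) as C. pose proof (Reg_om_sub Rm) as I.
  assert (J : inj (prod m (prod m m)) m).
  { apply inj_trans with (prod m m); [|apply pairing; auto]. apply prod_inj. apply inj_sub; intros z; auto.
    apply pairing; auto. }
  destruct J as (h & Hh). pose proof Hh as ((H1 & H2) & H3).
  exists (lam m (fun xi => opair (fst (pre h (prod m (prod m m)) xi)) (fst (snd (pre h (prod m (prod m m)) xi))))).
  intros eta k He Hk.
  assert (In : forall l, l ∊ m -> opair eta (opair k l) ∊ prod m (prod m m)) by (intros; rewrite !opair_in_prod; auto).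
  destruct (classic (exists l, l ∊ m /\ eta ∊ app h (opair eta (opair k l)))) as [(l & Hl & K)|N].
  - exists (app h (opair eta (opair k l))). split; auto. split; auto.
    rewrite app_lam; [|df|auto]. rewrite (pre_app Hh) by auto. rewrite snd_opair, !fst_opair. auto.
  - exfalso. assert (Se : succ eta ∊ m) by (apply Limit_succ; auto; apply Rm).
    apply (proj2 C _ Se). apply inj_intro with (fun l => app h (opair eta (opair k l))). df.
    + intros l Hl. apply in_succ. pose proof (Ord_in (Reg_Ord Rm) He) as Oe.
      pose proof (Ord_in (Reg_Ord Rm) (H2 _ (In l Hl))) as Oh.
      destruct (Ord_trich Oh Oe) as [Q|[Q|Q]]; auto. destruct N; eauto.
    + intros l l' Hl Hl' E. apply H3 in E; auto. apply opair_inj in E as [_ E]. apply opair_inj in E as [_ E]. auto.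
Qed.

Variable r0 : V.
Hypothesis Hr0 : r0 ∊ H.
Variable rho : V.

Definition xa x := fst (fst x).
Definition xr x := fst (snd x).
Definition xg x := snd (snd x).
(** Both bit values at every coordinate used by [a]: the bits through which another condition can
    conflict with [a]. *)
Definition satc a := sep (XX kap) (fun z => exists w, w ∊ a /\ crd z = crd w).
(** A condition below [m] can conflict with those chosen before stage [xi] only inside this set, so
    only its trace there matters. This keeps the number of tasks at most [m]. *)
Definition WW s xi := union (repl xi (fun eta => satc (xa (app s eta)))).
Definition TT s xi := sep (prod L m) (fun z => fst z ⊆ WW s xi).
Definition RR s xi := union (cup (sing r0) (repl xi (fun eta => xr (app s eta)))).
(* At stage [xi] a condition [a] below [m] and a stronger [r] above [m] are chosen with
   [a ∪ r] in [D i]; [g] enumerates the small conditions met so far as tasks, and if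
   [rho xi] is the task [(q, i')] then [a] extends [q] and [i = i']. *)
Definition Phi xi s x := exists a i r g, x = opair (opair a i) (opair r g) /\ a ∊ L /\ i ∊ m /\ r ∊ H /\
  RR s xi ⊆ r /\ D i (cup a r) /\ Inj g (TT s xi) m /\
  forall eta q i', eta ∊ xi -> opair q i' ∊ TT s eta ->
    app rho xi = opair eta (app (xg (app s eta)) (opair q i')) -> q ⊆ a /\ i = i'.

Lemma DT_xa (s : (nat -> V) -> V) : DT s -> DT (fun v => xa (s v)).
Proof. intros; unfold xa; df. Qed.
Lemma DT_xr (s : (nat -> V) -> V) : DT s -> DT (fun v => xr (s v)).
Proof. intros; unfold xr; df. Qed.
Lemma DT_xg (s : (nat -> V) -> V) : DT s -> DT (fun v => xg (s v)).
Proof. intros; unfold xg; df. Qed.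
Lemma DT_satc (s : (nat -> V) -> V) : DT s -> DT (fun v => satc (s v)).
Proof. apply DT_fun1. change (DT (fun v : nat -> V => satc (v 0))). unfold satc; df. Qed.
Hint Resolve DT_xa DT_xr DT_xg DT_satc : df.
Lemma DT_WW (s t : (nat -> V) -> V) : DT s -> DT t -> DT (fun v => WW (s v) (t v)).
Proof. apply DT_fun2. change (DT (fun v : nat -> V => WW (v 0) (v 1))). unfold WW; df. Qed.
Hint Resolve DT_WW : df.
Lemma DT_TT (s t : (nat -> V) -> V) : DT s -> DT t -> DT (fun v => TT (s v) (t v)).
Proof. apply DT_fun2. change (DT (fun v : nat -> V => TT (v 0) (v 1))). unfold TT; df. Qed.
Lemma DT_RR (s t : (nat -> V) -> V) : DT s -> DT t -> DT (fun v => RR (s v) (t v)).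
Proof. apply DT_fun2. change (DT (fun v : nat -> V => RR (v 0) (v 1))). unfold RR; df. Qed.
Hint Resolve DT_TT DT_RR : df.
Lemma Df_Phi : Df (fun v => Phi (v 0) (v 1) (v 2)).
Proof. unfold Phi. df. Qed.

Lemma in_satc a z : z ∊ satc a <-> z ∊ XX kap /\ exists w, w ∊ a /\ crd z = crd w.
Proof. unfold satc. rewrite in_sep by df. tauto. Qed.
Lemma in_WW s xi z : z ∊ WW s xi <-> exists eta, eta ∊ xi /\ z ∊ satc (xa (app s eta)).
Proof.
  unfold WW. rewrite in_union. split.
  - intros (y & A & B). rewrite in_repl in B by df. destruct B as (eta & E & ->). eauto.
  - intros (eta & E & A). exists (satc (xa (app s eta))). rewrite in_repl by df. eauto.
Qed.
Lemma in_TT s xi q i : opair q i ∊ TT s xi <-> q ∊ L /\ i ∊ m /\ q ⊆ WW s xi.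
Proof. unfold TT. rewrite in_sep by df. rewrite opair_in_prod, fst_opair. tauto. Qed.
Lemma in_RR s xi z : z ∊ RR s xi <-> z ∊ r0 \/ exists eta, eta ∊ xi /\ z ∊ xr (app s eta).
Proof.
  unfold RR. rewrite in_union. split.
  - intros (y & A & B). apply in_cup in B as [B|B]. apply in_sing in B as ->; auto.
    rewrite in_repl in B by df. destruct B as (eta & E & ->). eauto.
  - intros [A|(eta & E & A)]; [exists r0|exists (xr (app s eta))]; rewrite in_cup, in_sing, in_repl by df; eauto.
Qed.

Lemma Phi_ext xi s s' x : Ord xi -> (forall eta, eta ∊ xi -> app s eta = app s' eta) -> Phi xi s x -> Phi xi s' x.
Proof.
  intros O E.
  assert (EW : forall eta, eta ⊆ xi -> WW s eta = WW s' eta).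
  { intros eta Q. apply set_ext. intros z. rewrite !in_WW. split; intros (e & A & B); exists e; split; auto;
    [rewrite <- E|rewrite E]; auto. }
  assert (ET : forall eta, eta ⊆ xi -> TT s eta = TT s' eta) by (intros eta Q; unfold TT; rewrite EW; auto).
  assert (ER : RR s xi = RR s' xi).
  { apply set_ext. intros z. rewrite !in_RR. split; (intros [A|(e & A & B)]; [auto|right; exists e; split; auto]);
    [rewrite <- E|rewrite E]; auto. }
  intros (a & i & r & g & -> & A1 & A2 & A3 & A4 & A5 & A6 & A7). exists a, i, r, g.
  rewrite <- ER, <- ET by (intros z; auto). split; auto. split; auto. split; auto. split; auto. split; auto. split; auto.
  split; auto. intros eta q i' X1 X2 X3. apply (A7 eta q i'); auto. rewrite ET; auto. apply (proj1 O eta X1).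
  rewrite E; auto.
Qed.

Lemma small_satc a : small m a -> small m (satc a).
Proof.
  intros S. apply small_sub with (repl (prod a two) (fun z => opair (fst (fst z)) (opair (fst (snd (fst z))) (snd z)))).
  apply Rm.
  - intros z Z. apply in_satc in Z as (A & w & W & E). rewrite in_repl by df.
    apply in_XX in A as (de & ze & i & b & -> & _ & _ & _ & B & _). rewrite crd_opair in E. unfold crd in E.
    apply opair_inj in E as [E1 E2]. exists (opair w b). rewrite opair_in_prod, !fst_opair, snd_opair, <- E1, <- E2. auto.
  - apply small_repl. df. apply small_prod; auto. apply Rm. apply om_small. apply Rm.
    apply Limit_succ. apply Limit_om. apply Limit_succ. apply Limit_om. apply Limit_emp, Limit_om.
Qed.

Lemma stage_facts th s : th ⊆ m -> Ord th -> (forall eta, eta ∊ th -> Phi eta (lam eta (app s)) (app s eta)) ->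
  (forall eta, eta ∊ th -> Phi eta s (app s eta)) /\ RR s th ∊ H /\ (th ∊ m -> small m (WW s th)).
Proof.
  intros Tm O S.
  assert (S' : forall eta, eta ∊ th -> Phi eta s (app s eta)).
  { intros eta E. apply Phi_ext with (lam eta (app s)); auto. apply (Ord_in O E). intros e Q. rewrite app_lam; auto. df. }
  assert (St : forall eta, eta ∊ th -> xa (app s eta) ∊ L /\ xr (app s eta) ∊ H /\ RR s eta ⊆ xr (app s eta)).
  { intros eta E. destruct (S' eta E) as (a & i & r & g & -> & A). unfold xa, xr. rewrite snd_opair, !fst_opair. tauto. }
  split; auto. split.
  - apply in_Hi.
    assert (hi : forall z, z ∊ RR s th -> m ∊ fst z).
    { intros z Z. apply in_RR in Z as [Z|(eta & E & Z)]. apply in_Hi in Hr0; apply Hr0; auto.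
      destruct (St eta E) as (_ & Q & _). apply in_Hi in Q. apply Q; auto. }
    split; auto. unfold RR. apply PP_union.
    + intros p Hp. apply in_cup in Hp as [Hp|Hp]. apply in_sing in Hp as ->. apply in_Hi in Hr0; apply Hr0.
      rewrite in_repl in Hp by df. destruct Hp as (eta & E & ->). destruct (St eta E) as (_ & Q & _). apply in_Hi in Q. apply Q.
    + assert (low0 : forall eta, eta ∊ th -> r0 ⊆ xr (app s eta)).
      { intros eta E z Z. apply (St eta E). apply in_RR; auto. }
      assert (inc : forall e e', e ∊ e' -> e' ∊ th -> xr (app s e) ⊆ xr (app s e')).
      { intros e e' E E' z Z. apply (St e' E'). apply in_RR; eauto. }
      intros p q Hp Hq. apply in_cup in Hp as [Hp|Hp], Hq as [Hq|Hq];
        rewrite ?in_sing, ?in_repl in Hp by df; rewrite ?in_sing, ?in_repl in Hq by df; subst.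
      * left; intros z; auto.
      * destruct Hq as (e & E & ->). left; auto.
      * destruct Hp as (e & E & ->). right; auto.
      * destruct Hp as (e & E & ->), Hq as (e' & E' & ->).
        destruct (Ord_trich (Ord_in O E) (Ord_in O E')) as [Q|[->|Q]]; auto. left; intros z; auto.
    (* If [nu] is at most [m], the chain has no coordinate up to [nu]; otherwise its length, at most
       [m], is small for [nu]. *)
    + intros nu Rn. destruct (Ord_le (Reg_Ord Rn) (Reg_Ord Rm)) as [Q|Q].
      * right. intros p z Hp Z K. assert (W : m ∊ fst z) by (apply hi, in_union; eauto).
        pose proof (Reg_Ord Rm) as Om. pose proof (Reg_Ord Rn) as On.
        apply in_succ in K as [K|K]. apply (@not_in_self V m). apply Q. apply (Ord_trans On W K).
        rewrite K in W. apply (@not_in_self V m). apply Q, W.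
      * left. apply small_cup. apply Rn. apply small_sing, Rn. apply small_repl. df.
        apply small_sub with m. apply Rn. auto. apply Rn, Q.
  - intros E. unfold WW. apply small_union. df. apply Rm. apply Rm; auto. intros eta Q. apply small_satc.
    apply (Lw_small Rm (kap := kap)). apply St; auto.
Qed.

Theorem covering_sequence : (forall eta k, eta ∊ m -> k ∊ m ->
    exists xi, xi ∊ m /\ eta ∊ xi /\ app rho xi = opair eta k) ->
  exists r A, r ∊ H /\ r0 ⊆ r /\ A ⊆ prod L m /\ inj A m /\
    (forall a i, opair a i ∊ A -> D i (cup a r)) /\
    (forall q i, q ∊ L -> i ∊ m -> exists a, opair a i ∊ A /\ cup a q ∊ P).
Proof.
  intros Hrho. pose proof (Reg_Ord Rm) as Om. pose proof Df_Phi as DP.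
  assert (emL : emp ∊ L) by (apply in_Lw; split; [apply PP_emp|intros z Z; destruct (in_emp Z)]).
  destruct (@dep_choice V ac m (prod (prod L m) (prod H (pow (prod (prod L m) m)))) Phi DP Om) as (s & Ms & Hs).
  { intros xi s Hxi Ms Hs.
    destruct (@stage_facts xi s) as (S1 & S2 & S3); auto. apply (proj1 Om xi Hxi). apply (Ord_in Om Hxi).
    specialize (S3 Hxi).
    (* Stage [xi] has at most one task, because the enumeration stored at stage [eta] is injective.
       When [rho xi] codes none, the empty condition serves. *)
    assert (task : exists q i', q ∊ L /\ i' ∊ m /\ forall eta q' i'', eta ∊ xi -> opair q' i'' ∊ TT s eta ->
       app rho xi = opair eta (app (xg (app s eta)) (opair q' i'')) -> q' = q /\ i' = i'').
    { destruct (classic (exists eta q i', eta ∊ xi /\ opair q i' ∊ TT s eta /\ app rho xi = opair eta (app (xg (app s eta)) (opair q i')))) as [(eta & q & i' & A1 & A2 & A3)|N].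
      - exists q, i'. pose proof A2 as A2'. apply in_TT in A2' as (B1 & B2 & B3). split; auto. split; auto.
        intros eta' q' i'' C1 C2 C3. rewrite A3 in C3. apply opair_inj in C3 as [<- C3].
        destruct (S1 eta A1) as (a & i & r & g & E & _ & _ & _ & _ & _ & (_ & J) & _).
        rewrite E in C3. unfold xg in C3. rewrite !snd_opair in C3. apply J in C3; auto. apply opair_inj in C3 as [-> ->]; auto.
      - exists emp, emp. split; auto. split. apply Limit_emp, Rm. intros eta q' i'' C1 C2 C3. destruct N; eauto 6. }
    destruct task as (q & i & Q1 & Q2 & Q3).
    destruct (@Ddense i (cup q (RR s xi))) as (t & T1 & T2 & T3); auto. apply (Lw_Hi Q1 S2).
    (* Here GCH is used: [WW s xi] has fewer than [m] elements, hence at most [m] subsets. *)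
    assert (gex : inj (TT s xi) m).
    { apply inj_trans with (prod (pow (WW s xi)) m).
      - apply inj_sub. intros z Z. unfold TT in Z. rewrite in_sep in Z by df. destruct Z as [Z1 Z2].
        apply in_prod in Z1 as (x & y & X & Y & ->). rewrite fst_opair in Z2. apply opair_in_prod. rewrite in_pow. auto.
      - apply inj_trans with (prod m m); [|apply pairing; [apply Reg_Card|apply Reg_om_sub]; auto].
        apply prod_inj; [|apply inj_sub; intros z; auto].
        destruct (small_lt (proj1 Rm) S3) as (k & K1 & K2). apply inj_trans with (pow k). apply pow_inj, K2.
        apply (pow_small_inj gch Rm K1). }
    destruct gex as (g & Hg). pose proof (low_Lw m T1) as Lt. pose proof (high_Hi m T1) as Ht.
    exists (opair (opair (low m t) i) (opair (high m t) g)). split.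
    - rewrite !opair_in_prod, in_pow. split; auto. split; auto. intros z Z. destruct Hg as ((G1 & G2) & _).
      apply (Fn_in z G1) in Z as (x & X & ->). apply opair_in_prod. split; auto. unfold TT in X. rewrite in_sep in X by df. tauto.
    - exists (low m t), i, (high m t), g. split; auto. split; auto. split; auto. split; auto. split; [|split; [|split]]; auto.
      + intros z Z. apply in_high. split. apply T2, in_cup; auto. apply in_Hi in S2. apply S2; auto.
      + rewrite (low_high Rm T1); auto.
      + intros eta q' i'' C1 C2 C3. destruct (Q3 eta q' i'' C1 C2 C3) as [-> ->]. split; auto.
        intros z Z. apply in_low. split. apply T2, in_cup; auto. apply in_Lw in Q1. apply Q1; auto. }
  destruct (@stage_facts m s) as (S1 & S2 & _); auto. intros z; auto.
  exists (RR s m), (repl m (fun xi => fst (app s xi))).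
  assert (St : forall xi, xi ∊ m -> exists a i r g, app s xi = opair (opair a i) (opair r g) /\ fst (app s xi) = opair a i /\ xa (app s xi) = a /\ a ∊ L /\ i ∊ m /\ r ⊆ RR s m /\ D i (cup a r)).
  { intros xi X. destruct (S1 xi X) as (a & i & r & g & E & A). exists a, i, r, g. unfold xa. rewrite E, !fst_opair.
    repeat (split; [tauto|]). split; [|tauto]. intros z Z. apply in_RR. right. exists xi. split; auto. rewrite E.
    unfold xr. rewrite snd_opair, fst_opair. auto. }
  split; auto. split; [intros z Z; apply in_RR; auto|]. split; [|split; [|split]].
  - intros z Z. rewrite in_repl in Z by df. destruct Z as (xi & X & ->).
    destruct (St xi X) as (a & i & r & g & _ & -> & _ & A). apply opair_in_prod; tauto.
  - apply inj_of_surj with (fun xi => fst (app s xi)). df. intros y Y. rewrite in_repl in Y by df.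
    destruct Y as (xi & X & ->). eauto.
  - intros a i Z. rewrite in_repl in Z by df. destruct Z as (xi & X & E).
    destruct (St xi X) as (a' & i' & r & g & _ & E' & _ & A1 & A2 & A3 & A4). rewrite E' in E. apply opair_inj in E as [-> ->].
    apply Dopen with (cup a' r); auto. intros z Z. rewrite in_cup in *. intuition. apply (Lw_Hi A1 S2).
  - intros q i Q I. set (q' := sep q (fun z => z ∊ WW s m)).
    assert (Sq : small m q'). { apply small_sub with q. apply Rm. intros z Z. unfold q' in Z. rewrite in_sep in Z by df. tauto. apply (Lw_small Rm Q). }
    destruct (@small_class V m q' (fun z => mu (fun eta => eta ∊ m /\ z ∊ satc (xa (app s eta))))) as (xi0 & X0 & B); auto. df.
    { intros z Z. unfold q' in Z. rewrite in_sep in Z by df. destruct Z as [_ Z]. apply in_WW in Z as (eta & E & Z).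
      apply (@mu_spec V (fun eta => eta ∊ m /\ z ∊ satc (xa (app s eta)))). df. exists eta. split; auto. apply (Ord_in Om E). }
    assert (qW : q' ⊆ WW s xi0).
    { intros z Z. apply in_WW. exists (mu (fun eta => eta ∊ m /\ z ∊ satc (xa (app s eta)))). split; auto.
      unfold q' in Z. rewrite in_sep in Z by df. destruct Z as [_ Z]. apply in_WW in Z as (eta & E & Z).
      apply (@mu_spec V (fun eta => eta ∊ m /\ z ∊ satc (xa (app s eta)))). df. exists eta. split; auto. apply (Ord_in Om E). }
    assert (q'L : q' ∊ L).
    { pose proof Q as Q'. apply in_Lw in Q' as [Q1 Q2]. apply in_Lw. assert (qq : q' ⊆ q).
      { intros z Z. unfold q' in Z. rewrite in_sep in Z by df. tauto. }
      split. apply PP_sub with q; auto. auto. }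
    assert (Tq : opair q' i ∊ TT s xi0) by (apply in_TT; auto).
    destruct (S1 xi0 X0) as (a0 & i0 & r1 & g & E0 & _ & _ & _ & _ & _ & ((G1 & G2) & _) & _).
    destruct (Hrho xi0 (app g (opair q' i)) X0) as (xi & X & X1 & X2); auto.
    destruct (S1 xi X) as (a & i1 & r & g1 & E & A1 & A2 & A3 & A4 & A5 & A6 & A7).
    destruct (A7 xi0 q' i X1 Tq) as (B1 & ->). rewrite X2, E0. unfold xg. rewrite !snd_opair. auto.
    exists a. split. rewrite in_repl by df. exists xi. split; auto. rewrite E, fst_opair; auto.
    pose proof A1 as A1'. apply in_Lw in A1' as [A1' _]. pose proof Q as Q'. apply in_Lw in Q' as [Q' _].
    (* Equal coordinates put [w] into [satc a], hence into the trace, which [a] extends. *)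
    apply PP_cup; auto. intros z w Z W Ec.
    apply (PP_fun A1'); auto. apply B1. unfold q'. rewrite in_sep by df. split; auto.
    apply in_WW. exists xi. split; auto. apply in_satc. split. apply (PP_XX Q' W). exists z. rewrite E. unfold xa.
    rewrite !fst_opair. auto.
Qed.
End Cover.

(** Cofinalities are regular. An unbounded map from some [b] below [a] would present [a] as a small
    union of small sets, against the failure of smallness at [a]. *)
Lemma least_not_small_Reg {V : model} (nu a : V) : Limit nu -> Ord a -> ~ small nu a ->
  (forall b, b ∊ a -> small nu b) -> Reg a.
Proof.
  intros Ln Oa Na M'. pose proof (proj1 Ln) as On.
  assert (La : Limit a).
  { destruct (Ord_cases Oa) as [->|[(y & Y & ->)|L]]; auto; destruct Na.
    apply small_emp; auto. apply small_cup; auto. apply small_sing; auto. }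
  split; auto. intros b B g (G1 & G2). apply NNPP. intros N. apply Na. intros f (F1 & F2).
  assert (U : forall y, y ∊ a -> exists x, x ∊ b /\ y ∊ app g x).
  { intros y Y. apply NNPP. intros Q. apply N. exists (succ y). split. apply Limit_succ; auto. intros x X.
    pose proof (Ord_in Oa (G2 x X)) as Ox. pose proof (Ord_in Oa Y) as Oy.
    destruct (Ord_trich Ox (Ord_succ Oy)) as [K|[K|K]]; auto; destruct Q; exists x; split; auto.
    rewrite K. apply in_succ; auto. apply Ord_trans with (succ y); auto. apply in_succ; auto. }
  set (h := fun x => mu (fun c => c ∊ nu /\ forall y, y ∊ app g x -> app f y ∊ c)).
  assert (Dh : DT (fun v => h (v 0))) by (unfold h; df).
  assert (hs : forall x, x ∊ b -> h x ∊ nu /\ forall y, y ∊ app g x -> app f y ∊ h x).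
  { intros x X. apply (@mu_spec V (fun c => c ∊ nu /\ forall y, y ∊ app g x -> app f y ∊ c)). df.
    destruct (@small_class V nu (app g x) (app f)) as (c & C1 & C2); auto. df.
    intros y Y. apply F2. apply (Ord_trans Oa Y (G2 x X)). exists c. split; auto. apply (Ord_in On C1). }
  destruct (@small_class V nu b h) as (c & C1 & C2); auto. intros x X; apply hs; auto.
  exists c. split; auto. intros y Y. destruct (U y Y) as (x & X & K).
  apply Ord_trans with (h x); auto. apply (Ord_in On C1). apply hs; auto.
Qed.

(** The least failure of smallness is itself regular. In an extension the test thus concerns only
    ordinals that are regular in the ground model, where the covering lemma applies. *)
Lemma Reg_by_Reg {V : model} (nu : V) : Limit nu -> (forall a, a ∊ nu -> Reg a -> small nu a) -> Reg nu.
Proof.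
  intros Ln H. split; auto. intros a0 A0. apply NNPP. intros N0. pose proof (proj1 Ln) as On.
  destruct (@min_exists V nu (fun a => ~ small nu a)) as (a & A & Na & M). df. eauto.
  apply Na, H; auto. apply least_not_small_Reg with nu; auto. apply (Ord_in On A).
  intros b B. apply NNPP. apply M; auto. apply (Ord_trans On B A).
Qed.

(** * Regular cardinals and the continuum function in the extension *)

Section Preserve.
Context {V : model} {ac : AC V}.
Variable kap : V.
Hypothesis gch : @GCHm V.
Variable X : gext (PP kap) (LE kap) emp.
Implicit Types (a b c d f g h k p q r s t u w x y z : V).
Notation P := (PP kap).
Notation G := (gG X).
Notation j := (gj X).
Notation Fmem := (forces_mem (@mem V) (PP kap) (LE kap)).
Let FN := Easton_forcing kap.
Definition jI := @gj_in _ _ _ _ X : forall (a : gN X) x, a ∊ j x <-> exists y, y ∊ x /\ a = j y.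
Definition jJ := @gj_inj _ _ _ _ X : forall x y, j x = j y -> x = y.
Notation jmem := (j_mem jI jJ).
Notation jopair := (j_opair jI).

Lemma G_P p : G p -> p ∊ P.
Proof. apply (gen_P (g_gen X)). Qed.
Lemma G_sub p q : G p -> q ⊆ p -> G q.
Proof. intros A B. apply (gen_up (g_gen X) A). apply ext_iff. pose proof (G_P A). split; auto. split; auto. apply PP_sub with p; auto. Qed.
Lemma G_dir p q : G p -> G q -> exists r, G r /\ p ⊆ r /\ q ⊆ r.
Proof.
  intros A B. destruct (gen_dir (g_gen X) A B) as (r & R1 & R2 & R3). apply ext_iff in R2, R3. exists r. tauto.
Qed.
Lemma G_cup p q : G p -> G q -> G (cup p q).
Proof.
  intros A B. destruct (G_dir A B) as (r & R1 & R2 & R3). apply (G_sub R1). intros z Z. apply in_cup in Z as [Z|Z]; auto.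
Qed.
Lemma G_meet (D : V -> Prop) p : Df (fun v => D (v 0)) -> G p ->
  (forall q, q ∊ P -> p ⊆ q -> exists r, r ∊ P /\ q ⊆ r /\ D r) -> exists r, G r /\ p ⊆ r /\ D r.
Proof.
  intros DD A B. destruct (gen_meet (g_gen X) DD A) as (q & Q1 & Q2 & Q3).
  - intros q Q. apply ext_iff in Q as (Q1 & Q2 & Q3). destruct (B q Q1 Q3) as (r & R1 & R2 & R3).
    exists r. split; auto. apply ext_iff; auto.
  - apply ext_iff in Q2. exists q. tauto.
Qed.
Lemma G_emp : G emp.
Proof. apply (gen_one (g_gen X)). Qed.

(** Two density arguments: conditions extending some good [r] are dense, and for each [i] so are
    those containing some [a] with [opair a i] in [A]. *)
Lemma cover_generic m (D : V -> V -> Prop) : Reg m -> Df (fun v => D (v 0) (v 1)) ->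
  (forall i p q, i ∊ m -> D i p -> p ⊆ q -> q ∊ P -> D i q) ->
  (forall i p, i ∊ m -> p ∊ P -> exists q, q ∊ P /\ p ⊆ q /\ D i q) ->
  exists r A, G r /\ A ⊆ prod (Lw kap m) m /\ inj A m /\ (forall a i, opair a i ∊ A -> D i (cup a r)) /\
    forall i, i ∊ m -> exists a, opair a i ∊ A /\ G a.
Proof.
  intros Rm DD Do Dd. destruct (@bookkeeping V ac m Rm) as (rho & Hrho).
  set (good := fun r A => r ∊ Hi kap m /\ A ⊆ prod (Lw kap m) m /\ inj A m /\ (forall a i, opair a i ∊ A -> D i (cup a r)) /\
    (forall q i, q ∊ Lw kap m -> i ∊ m -> exists a, opair a i ∊ A /\ cup a q ∊ P)).
  assert (Dg : Df (fun v => good (v 0) (v 1))) by (unfold good; df).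
  destruct (@G_meet (fun t => exists r A, r ⊆ t /\ good r A) emp) as (t & T1 & _ & r & A & T2 & T3). df. apply G_emp.
  { intros p Hp _. destruct (@covering_sequence V ac kap m Rm gch D DD Do Dd (high m p) (high_Hi m Hp) rho Hrho) as (r & A & R1 & R2 & R3 & R4 & R5 & R6).
    exists (cup (low m p) r). split. apply (Lw_Hi (low_Lw m Hp) R1). split.
    - intros z Z. rewrite <- (low_high Rm Hp) in Z. apply in_cup in Z as [Z|Z]; apply in_cup; auto.
    - exists r, A. split. intros z Z; apply in_cup; auto. unfold good. auto. }
  exists r, A. destruct T3 as (R1 & R2 & R3 & R4 & R5). assert (Gr : G r) by apply (G_sub T1 T2).
  split; auto. split; auto. split; auto. split; auto. intros i I.
  destruct (@G_meet (fun t => exists a, opair a i ∊ A /\ a ⊆ t) emp) as (t' & T1' & _ & a & A1 & A2). df. apply G_emp.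
  { intros p Hp _. destruct (R5 (low m p) i (low_Lw m Hp) I) as (a & A1 & A2).
    exists (cup a p). pose proof (R2 _ A1) as Q. apply opair_in_prod in Q as [Q _]. split. apply (Lw_cup Q Hp A2).
    split. intros z Z; apply in_cup; auto. exists a. split; auto. intros z Z; apply in_cup; auto. }
  exists a. split; auto. apply (G_sub T1' A2).
Qed.

Definition dec (n t p : V) : Prop := Fmem n t p \/ forall q, q ∊ P -> p ⊆ q -> ~ Fmem n t q.
Lemma Df_dec (s t u : (nat -> V) -> V) : DT s -> DT t -> DT u -> Df (fun v => dec (s v) (t v) (u v)).
Proof. apply (Df_rel3 dec). unfold dec. df. Qed.
Hint Resolve Df_dec : df.
Lemma Fm_up n t p q : p ∊ P -> q ∊ P -> p ⊆ q -> Fmem n t p -> Fmem n t q.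
Proof. intros A B C. apply (Fmem_mono FN). apply ext_iff; auto. Qed.
Lemma dec_up n t p q : p ∊ P -> q ∊ P -> p ⊆ q -> dec n t p -> dec n t q.
Proof.
  intros A B C [K|K]. left; apply (Fm_up A B C K). right. intros r R1 R2. apply K; auto. intros z Z; auto.
Qed.
Lemma dec_dense n t p : p ∊ P -> exists q, q ∊ P /\ p ⊆ q /\ dec n t q.
Proof.
  intros A. destruct (classic (exists q, q ∊ P /\ p ⊆ q /\ Fmem n t q)) as [(q & Q1 & Q2 & Q3)|N].
  - exists q. unfold dec; auto.
  - exists p. split; auto. split. intros z; auto. right. intros q Q1 Q2 Q3. apply N; eauto.
Qed.
Lemma in_gv x t : j x ∊ gv X t <-> exists p, G p /\ Fmem (ck emp x) t p.
Proof. apply gv_mem. Qed.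
Lemma dec_G x t p : G p -> dec (ck emp x) t p -> (j x ∊ gv X t <-> Fmem (ck emp x) t p).
Proof.
  intros A B. rewrite in_gv. split; [|eauto]. intros (q & Q1 & Q2). destruct B as [B|B]; auto. exfalso.
  destruct (G_dir A Q1) as (r & R1 & R2 & R3). apply (B r); auto. apply G_P; auto. apply (@Fm_up _ _ q); auto; apply G_P; auto.
Qed.

(** The values of [f] are among those decided by [cup a r] for the pairs in [A]. There are at most
    [m] of these, so they are bounded in [la] already in the ground model. *)
Lemma Reg_bounded m la : Reg m -> Reg la -> m ∊ la -> small (j la) (j m).
Proof.
  intros Rm Rl Hm f (F1 & F2). destruct (gv_surj f) as (t & Et).
  (* Either [s] decides a value at [i], or no extension of [s] assigns one. The second case is
     included because [t] names a function only in this extension, not by force of every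
     condition. *)
  set (D := fun i s => (exists y, y ∊ la /\ Fmem (ck emp (opair i y)) t s) \/
     forall y q, y ∊ la -> q ∊ P -> s ⊆ q -> ~ Fmem (ck emp (opair i y)) t q).
  assert (DD : Df (fun v => D (v 0) (v 1))) by (unfold D; df).
  destruct (@cover_generic m (fun i s => s ∊ P -> D i s) Rm) as (r & A & Gr & A1 & A2 & A3 & A4). df.
  { intros i p q I K S Q _. assert (Hp : p ∊ P) by (apply PP_sub with q; auto). destruct (K Hp) as [(y & Y1 & Y2)|K'].
    left. exists y. split; auto. apply (Fm_up Hp Q S Y2). right. intros y q' Y Q' S'. apply K'; auto. intros z Z; auto. }
  { intros i p I Hp. destruct (classic (exists y q, y ∊ la /\ q ∊ P /\ p ⊆ q /\ Fmem (ck emp (opair i y)) t q)) as [(y & q & Y & Q1 & Q2 & Q3)|N].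
    - exists q. split; auto. split; auto. intros _. left; eauto.
    - exists p. split; auto. split. intros z; auto. intros _. right. intros y q Y Q1 Q2 Q3. apply N; eauto 6. }
  set (val := fun z => mu (fun y => y ∊ la /\ Fmem (ck emp (opair (snd z) y)) t (cup (fst z) r))).
  set (ok := fun z => exists y, y ∊ la /\ Fmem (ck emp (opair (snd z) y)) t (cup (fst z) r)).
  assert (Dok : Df (fun v => ok (v 0))) by (unfold ok; df).
  assert (vs : forall z, ok z -> val z ∊ la /\ Fmem (ck emp (opair (snd z) (val z))) t (cup (fst z) r)).
  { intros z (y & Y1 & Y2). apply (@mu_spec V (fun y => y ∊ la /\ Fmem (ck emp (opair (snd z) y)) t (cup (fst z) r))). df.
    exists y. split; auto. apply (Ord_in (Reg_Ord Rl) Y1). }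
  destruct (@small_class V la A (fun z => ite (ok z) (val z) emp)) as (ga & C1 & C2).
  { unfold val. df. }
  { apply small_inj with m; auto. apply Rl. apply Rl, Hm. }
  { intros z Z. destruct (classic (ok z)) as [Q|Q]. rewrite ite_true by auto. apply vs; auto. rewrite ite_false by auto. apply Limit_emp, Rl. }
  exists (j ga). split. apply jmem; auto. intros u U. apply jI in U as (i & I & ->).
  destruct (A4 i I) as (a & Aa & Ga). pose proof (G_cup Ga Gr) as Gar.
  pose proof (F2 (j i)) as Fi. apply jI in Fi as (y0 & Y0 & E0); [|apply jmem; auto].
  assert (In : forall y, j (opair i y) ∊ f -> y = y0).
  { intros y K. rewrite jopair in K. apply (Fn_opair _ _ F1) in K as [_ K]. rewrite E0 in K. apply jJ in K. auto. }
  assert (J0 : j (opair i y0) ∊ f). { rewrite jopair. apply (Fn_opair _ _ F1). split; auto. apply jmem; auto. }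
  assert (okz : ok (opair a i)).
  { unfold ok. rewrite fst_opair, snd_opair. destruct (A3 a i Aa (G_P Gar)) as [(y & Y1 & Y2)|K]; eauto. exfalso.
    rewrite Et, in_gv in J0. destruct J0 as (q & Q1 & Q2). destruct (G_dir Gar Q1) as (r' & R1 & R2 & R3).
    apply (K y0 r'); auto. apply G_P; auto. apply (@Fm_up _ _ q); auto; apply G_P; auto. }
  pose proof (C2 (opair a i) Aa) as Q. rewrite ite_true in Q by auto. destruct (vs _ okz) as (V1 & V2).
  rewrite fst_opair, snd_opair in V2. rewrite E0. apply jmem. replace y0 with (val (opair a i)); auto.
  apply In. rewrite Et, in_gv. eauto.
Qed.

Lemma Reg_preserved la : Reg la -> Reg (j la).
Proof.
  intros R. apply Reg_by_Reg. apply (j_Limit jI jJ), R. intros a A Ra. apply jI in A as (m & M & ->).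
  apply Reg_bounded; auto. apply (j_Reg_inv jI jJ Ra).
Qed.

(** The old successor stays a cardinal because it stays regular, and ordinals below it keep their
    injections into [k]. *)
Lemma cs_preserved k : Reg k -> j (cs k) = cs (j k).
Proof.
  intros R. pose proof (Reg_Card R) as C. destruct (cs_spec (Reg_Ord R)) as (C1 & C2 & C3).
  assert (Rc : Reg (cs k)) by (apply Reg_cs; auto; apply Reg_om_sub; auto).
  apply cs_unique. apply Reg_Card, Reg_preserved, Rc. apply jmem; auto.
  intros n Cn K. apply Ord_not_in. apply Cn. apply (j_Ord jI jJ), C1. intros Q. apply jI in Q as (n' & N & ->).
  apply (proj2 Cn (j k) K). apply (j_inj_sets jI jJ). apply (in_cs C N).
Qed.

(** Nice names: a subset of [d] is recovered from the generic filter and a set [T] of at most [d]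
    pairs in [prod (Lw kap d) d]. In the ground model there are at most la^{<la} = la such sets, by
    GCH. *)
Lemma pow_bounded d la : Reg d -> Reg la -> d ∊ la -> inj (low d (XX kap)) la -> inj (pow (j d)) (j la).
Proof.
  intros Rd Rl Hd HX. pose proof (Reg_Ord Rl) as Ol. pose proof (Reg_Limit Rl) as Ll.
  assert (sm : forall x, small d x -> small la x).
  { intros x S. destruct (small_lt (proj1 Rd) S) as (k & K1 & K2). apply small_inj with k; auto. apply Rl. apply (Ord_trans Ol K1 Hd). }
  assert (I1 : inj (Lw kap d) la).
  { apply inj_trans with (sep (pow (low d (XX kap))) (fun x => small la x)); [|apply small_subsets_inj; auto].
    apply inj_sub. intros p Hp. pose proof (Lw_small Rd Hp) as S. apply in_Lw in Hp as [Hp1 Hp2]. rewrite in_sep by df. split; auto.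
    apply in_pow. intros z Z. apply in_low. split; auto. apply (PP_XX Hp1 Z). }
  assert (I2 : inj (prod (Lw kap d) d) la).
  { apply inj_trans with (prod la la); [|apply pairing; [apply Reg_Card|apply Reg_om_sub]; auto].
    apply prod_inj; auto. apply inj_sub. apply (proj1 Ol d Hd). }
  set (TT := sep (pow (prod (Lw kap d) d)) (fun x => small la x)).
  assert (I3 : inj TT la) by (apply small_subsets_inj; auto).
  apply inj_trans with (j TT); [|apply (j_inj_sets jI jJ), I3].
  destruct (@ac_maps (gN X) _ (pow (j d)) (j TT) (fun x T : gN X => forall i : gN X, i ∊ j d -> (i ∊ x <-> exists p : gN X, p ∊ Gam X /\ opair p i ∊ T))) as (f & F1 & F2). df.
  - intros x Hx. apply in_pow in Hx. destruct (gv_surj x) as (t & ->).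
    destruct (@cover_generic d (fun i s => s ∊ P -> dec (ck emp i) t s) Rd) as (r & A & Gr & A1 & A2 & A3 & A4). df.
    { intros i p q I K S Q _. assert (Hp : p ∊ P) by (apply PP_sub with q; auto). apply (dec_up Hp Q S (K Hp)). }
    { intros i p I Hp. destruct (dec_dense (ck emp i) t Hp) as (q & Q1 & Q2 & Q3). eauto. }
    set (T := sep A (fun z => Fmem (ck emp (snd z)) t (cup (fst z) r))).
    assert (TA : T ⊆ A) by (intros z Z; unfold T in Z; rewrite in_sep in Z by df; tauto).
    exists (j T). split.
    + apply jmem. unfold TT. rewrite in_sep by df. split. apply in_pow. intros z Z; auto.
      apply small_inj with d; auto. 2: apply Rl, Hd. apply inj_trans with A; auto. apply inj_sub; auto.
    + intros u U. apply jI in U as (i & I & ->). split.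
      * intros K. destruct (A4 i I) as (a & Aa & Ga). pose proof (G_cup Ga Gr) as Gar.
        exists (j a). rewrite gj_Gam. split; auto. rewrite <- jopair, jmem. unfold T. rewrite in_sep by df.
        rewrite fst_opair, snd_opair. split; auto. apply (dec_G Gar); auto. apply A3; auto. apply G_P; auto.
      * intros (u & U & K). apply in_Gam in U as (p & Gp & ->). rewrite <- jopair, jmem in K. unfold T in K. rewrite in_sep in K by df.
        rewrite fst_opair, snd_opair in K. apply in_gv. exists (cup p r). split. apply (G_cup Gp Gr). tauto.
  - exists f. split; auto. intros x y Hx Hy E. pose proof (F2 x Hx) as Kx. pose proof (F2 y Hy) as Ky. rewrite E in Kx.
    apply in_pow in Hx, Hy. apply set_ext. intros z. split; intros Z.
    + apply Ky; auto. apply Kx; auto.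
    + apply Kx; auto. apply Ky; auto.
Qed.

Lemma PP_sing e : e ∊ XX kap -> sing e ∊ P.
Proof.
  intros H. apply in_PP. split; [|split].
  - intros z Z. apply in_sing in Z as ->; auto.
  - intros z w Z W _. apply in_sing in Z, W. congruence.
  - intros nu R. apply small_sub with (sing e). apply R. intros z Z. apply in_low in Z; tauto. apply small_sing, R.
Qed.

Lemma new_subsets d : Reg d -> d ∊ kap -> Ord kap -> cs (cs d) ⊆ kap -> inj (j (cs (cs d))) (pow (j d)).
Proof.
  intros Rd Hd Ok Hc. set (one := succ (emp : V)).
  set (e := fun ze i b => opair d (opair (opair ze i) b)).
  assert (De : forall s t u : (nat -> V) -> V, DT s -> DT t -> DT u -> DT (fun v => e (s v) (t v) (u v))) by (intros; unfold e; df).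
  assert (eX : forall ze i b, ze ∊ cs (cs d) -> i ∊ d -> b ∊ two -> e ze i b ∊ XX kap).
  { intros ze i b Z I B. apply in_XX. exists d, ze, i, b. split; auto. split; auto. split; auto. split. apply (Ord_trans Ok I Hd). auto. }
  assert (je : forall ze i b, j (e ze i b) = opair (j d) (opair (opair (j ze) (j i)) (j b))) by (intros; unfold e; rewrite !jopair; auto).
  assert (b01 : emp <> one). { intros E. apply (@in_emp V emp). rewrite E at 2. apply in_succ; auto. }
  apply inj_intro with (fun ze : gN X => sep (j d) (fun i : gN X => exists p : gN X, p ∊ Gam X /\ opair (j d) (opair (opair ze i) (j one)) ∊ p)). df.
  { intros ze _. apply in_pow. intros i I. rewrite in_sep in I by df. tauto. }
  intros u w U W E. apply jI in U as (z & Z & ->). apply jI in W as (z' & Z' & ->). apply NNPP. intros N.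
  assert (Nz : z <> z') by (intros ->; auto).
  destruct (@G_meet (fun t => exists i, i ∊ d /\ e z i one ∊ t /\ e z' i emp ∊ t) emp) as (t & T1 & _ & i & I & K1 & K2). df. apply G_emp.
  { intros p Hp _.
    (* [snd (fst (snd w))] is the position of the bit [w]. Fewer than [d] bits are fixed up to [d],
       so some position [i] exceeds all of theirs and is free for both new subsets. *)
    destruct (@small_class V d (low d p) (fun w => snd (fst (snd w)))) as (i & I & B). df. apply (PP_small Hp Rd).
    { intros w W. apply in_low in W as [W1 W2]. apply (PP_XX Hp) in W1. apply in_XX in W1 as (de & ze & i & b & -> & _ & _ & _ & _ & _ & _ & Hi).
      rewrite fst_opair in W2. rewrite !snd_opair, fst_opair, snd_opair. apply in_succ in W2 as [W2| ->]; auto. apply (Ord_trans (Reg_Ord Rd) Hi W2). }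
    assert (fresh : forall w ze b, w ∊ p -> crd (e ze i b) <> crd w).
    { intros w ze b W Q. unfold e in Q. rewrite crd_opair in Q. unfold crd in Q. apply opair_inj in Q as [Q1 Q2].
      assert (L : w ∊ low d p) by (apply in_low; split; auto; rewrite <- Q1; apply in_succ; auto).
      specialize (B w L). rewrite <- Q2, snd_opair in B. apply (not_in_self B). }
    assert (O1 : e z i one ∊ XX kap) by (apply eX; auto; apply in_two; auto).
    assert (O2 : e z' i emp ∊ XX kap) by (apply eX; auto; apply in_two; auto).
    assert (C1 : cup (sing (e z i one)) (sing (e z' i emp)) ∊ P).
    { apply PP_cup; try apply PP_sing; auto. intros x y Hx Hy Q. apply in_sing in Hx, Hy. subst x y. unfold e in Q. rewrite !crd_opair in Q.
      apply opair_inj in Q as [_ Q]. apply opair_inj in Q as [Q _]. tauto. }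
    exists (cup (cup (sing (e z i one)) (sing (e z' i emp))) p). split; [|split].
    - apply PP_cup; auto. intros x y Hx Hy Q. exfalso. apply in_cup in Hx as [Hx|Hx]; apply in_sing in Hx; subst x; eapply fresh; eauto.
    - intros x Hx; apply in_cup; auto.
    - exists i. split; auto. rewrite !in_cup, !in_sing. auto. }
  assert (Q : j i ∊ sep (j d) (fun i : gN X => exists p : gN X, p ∊ Gam X /\ opair (j d) (opair (opair (j z) i) (j one)) ∊ p)).
  { rewrite in_sep by df. split. apply jmem; auto. exists (j t). rewrite gj_Gam, <- je, jmem. auto. }
  rewrite E, in_sep in Q by df. destruct Q as (_ & p & Hp & Q). apply in_Gam in Hp as (p' & Gp & ->). rewrite <- je, jmem in Q.
  destruct (G_dir T1 Gp) as (r & R1 & R2 & R3). assert (F : e z' i emp = e z' i one).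
  { apply (PP_fun (G_P R1)); auto. unfold e. rewrite !crd_opair. auto. }
  unfold e in F. apply opair_inj in F as [_ F]. apply opair_inj in F as [_ F]. tauto.
Qed.
End Preserve.

(** * Weak compactness: combinatorics *)

(** A two-colouring is an arbitrary set [c], consulted on increasing pairs only. *)
Definition Part {V : model} (k : V) : Prop := forall c : V, exists H, H ⊆ k /\ inj k H /\
  ((forall a b, a ∊ H -> b ∊ H -> a ∊ b -> opair a b ∊ c) \/
   (forall a b, a ∊ H -> b ∊ H -> a ∊ b -> ~ opair a b ∊ c)).
Definition WC {V : model} (k : V) : Prop := Card k /\ om ∊ k /\ Part k.

Section WeaklyCompact.
Context {V : model} {ac : AC V}.
Variable ka : V.
Hypothesis wc : WC ka.
Implicit Types (a b c d f g h k p q r s t u w x y z H : V).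

Lemma ka_om : om ⊆ ka.
Proof. destruct wc as ((O & _) & K & _). apply (proj1 O), K. Qed.
Lemma ka_Limit : Limit ka.
Proof. apply Card_Limit. apply wc. apply ka_om. Qed.
Lemma ka_Ord : Ord ka.
Proof. apply ka_Limit. Qed.

(** An unbounded map on [a] splits [ka] into [a] many bounded pieces. Colour a pair by whether both
    members lie in one piece: a homogeneous set either stays in one piece or injects into [a], too
    small in both cases. *)
Lemma WC_Reg : Reg ka.
Proof.
  pose proof ka_Limit as L. pose proof ka_Ord as O. split; auto. intros a A f (F1 & F2). apply NNPP. intros N.
  set (bl := fun be => mu (fun i => i ∊ a /\ be ∊ succ (app f i))).
  assert (Db : DT (fun v => bl (v 0))) by (unfold bl; df).
  assert (bs : forall be, be ∊ ka -> bl be ∊ a /\ be ∊ succ (app f (bl be))).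
  { intros be B. apply (@mu_spec V (fun i => i ∊ a /\ be ∊ succ (app f i))). df.
    apply NNPP. intros Q. apply N. exists be. split; auto. intros i I.
    pose proof (Ord_in O (F2 i I)) as Oi. pose proof (Ord_in O B) as Ob.
    destruct (Ord_trich Oi Ob) as [K|[K|K]]; auto; destruct Q; exists i; (split; [apply (Ord_in (Ord_in O A) I)|]); split; auto; apply in_succ; auto. }
  destruct (proj2 (proj2 wc) (sep (prod ka ka) (fun z => bl (fst z) = bl (snd z)))) as (H & H1 & H2 & [H3|H3]).
  - destruct (emp_or H) as [->|(x & X)].
    { destruct H2 as (e & (_ & E) & _). apply (@in_emp V (app e emp)). apply E. apply Limit_emp, L. }
    apply (proj2 (proj1 wc) (succ (app f (bl x)))). apply Limit_succ; auto. apply F2, bs, H1, X.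
    apply (inj_trans H2), inj_sub. intros y Y. assert (E : bl y = bl x).
    { assert (K : forall u w, u ∊ H -> w ∊ H -> u ∊ w -> bl u = bl w).
      { intros u w U W Q. pose proof (H3 u w U W Q) as Z. rewrite in_sep in Z by df. rewrite fst_opair, snd_opair in Z. tauto. }
      destruct (Ord_trich (Ord_in O (H1 _ Y)) (Ord_in O (H1 _ X))) as [Q|[Q|Q]]. auto. congruence. symmetry; auto. }
    rewrite <- E. apply bs, H1, Y.
  - apply (proj2 (proj1 wc) a A). apply (inj_trans H2). apply inj_intro with bl; auto. intros x X; apply bs, H1, X.
    intros x y X Y E.
    assert (K : forall u w, u ∊ H -> w ∊ H -> u ∊ w -> bl u <> bl w).
    { intros u w U W Q E'. apply (H3 u w U W Q). rewrite in_sep by df. rewrite opair_in_prod, fst_opair, snd_opair. auto. }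
    destruct (Ord_trich (Ord_in O (H1 _ X)) (Ord_in O (H1 _ Y))) as [Q|[Q|Q]]; auto. destruct (K _ _ X Y Q E). destruct (K _ _ Y X Q); auto.
Qed.

Definition unb H : Prop := H ⊆ ka /\ forall a, a ∊ ka -> exists b, b ∊ H /\ ~ b ∊ a.
(** The sets holding eventually along [H] form a filter that is complete for fewer than [ka] sets
    ([ev_all]); on the sets decided by [H] it acts like an ultrafilter. *)
Definition ev H (phi : V -> Prop) : Prop := exists ga, ga ∊ ka /\ forall be, be ∊ H -> ~ be ∊ ga -> phi be.

Lemma Df_ev H (phi : V -> (nat -> V) -> Prop) : Df (fun v => phi (v 0) (tl v)) -> Df (fun v => ev H (fun be => phi be v)).
Proof.
  intros D. unfold ev. apply Df_ex, Df_and; [df|]. apply Df_all, Df_imp; [df|]. apply Df_imp; [df|].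
  apply (Df_ren (fun n => match n with 0 => 0 | S n => S (S n) end) D).
Qed.
Hint Resolve Df_ev : df.

Lemma ev_mono H (phi psi : V -> Prop) : ev H phi -> (forall be, be ∊ H -> phi be -> psi be) -> ev H psi.
Proof. intros (g & A & B) K. exists g. split; auto. Qed.
Lemma ev_and H (phi psi : V -> Prop) : ev H phi -> ev H psi -> ev H (fun be => phi be /\ psi be).
Proof.
  intros (g & A & B) (g' & A' & B'). pose proof ka_Ord as O.
  destruct (Ord_le (Ord_in O A) (Ord_in O A')) as [Q|Q].
  - exists g'. split; auto. intros be X Y; split; auto.
  - exists g. split; auto. intros be X Y. split; auto. apply B'; auto. intros Z. apply Y. apply (Ord_trans (Ord_in O A) Z Q).
Qed.
Lemma ev_all H a (phi : V -> V -> Prop) : small ka a -> Df (fun v => phi (v 0) (v 1)) ->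
  (forall i, i ∊ a -> ev H (phi i)) -> ev H (fun be => forall i, i ∊ a -> phi i be).
Proof.
  intros S D K. pose proof ka_Ord as O.
  assert (ms : forall i, i ∊ a -> mu (fun ga => ga ∊ ka /\ forall be, be ∊ H -> ~ be ∊ ga -> phi i be) ∊ ka /\
    forall be, be ∊ H -> ~ be ∊ mu (fun ga => ga ∊ ka /\ forall be, be ∊ H -> ~ be ∊ ga -> phi i be) -> phi i be).
  { intros i I. apply (@mu_spec V (fun ga => ga ∊ ka /\ forall be, be ∊ H -> ~ be ∊ ga -> phi i be)). df.
    destruct (K i I) as (g & A & B). exists g. split; auto. apply (Ord_in O A). }
  destruct (@small_class V ka a (fun i => mu (fun ga => ga ∊ ka /\ forall be, be ∊ H -> ~ be ∊ ga -> phi i be))) as (b & B1 & B2); auto. df.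
  { intros i I; apply ms; auto. }
  exists b. split; auto. intros be X Y i I. apply ms; auto. intros Z. apply Y. apply (Ord_trans (Ord_in O B1) Z (B2 i I)).
Qed.
Lemma ev_ex H (phi : V -> Prop) a : unb H -> ev H phi -> a ∊ ka -> exists be, be ∊ H /\ phi be /\ ~ be ∊ a.
Proof.
  intros (U1 & U2) (g & A & B) Ha. pose proof ka_Ord as O.
  destruct (Ord_le (Ord_in O A) (Ord_in O Ha)) as [Q|Q].
  - destruct (U2 a Ha) as (be & X & Y). exists be. split; auto.  split; auto.
  - destruct (U2 g A) as (be & X & Y). exists be. split; auto. split; auto. intros Z. apply Y. apply (Ord_trans (Ord_in O A) Z Q).
Qed.

(* Colour pairs according to whether they agree with the lexicographic order of the sequences of truth values. *)
Lemma decide_sets X : exists H, unb H /\ forall xi, xi ∊ ka ->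
  ev H (fun be => opair xi be ∊ X) \/ ev H (fun be => ~ opair xi be ∊ X).
Proof.
  pose proof ka_Ord as O. pose proof ka_Limit as L. pose proof WC_Reg as R.
  set (agree := fun xi al be => forall eta, eta ∊ xi -> (opair eta al ∊ X <-> opair eta be ∊ X)).
  assert (Da : Df (fun v => agree (v 0) (v 1) (v 2))) by (unfold agree; df).
  set (lex := fun al be => agree ka al be \/ exists xi, xi ∊ ka /\ agree xi al be /\ ~ opair xi al ∊ X /\ opair xi be ∊ X).
  assert (Dl : Df (fun v => lex (v 0) (v 1))) by (unfold lex; df).
  destruct (proj2 (proj2 wc) (sep (prod ka ka) (fun z => lex (fst z) (snd z)))) as (H & H1 & H2 & H3).
  assert (U : unb H).
  { split; auto. intros a A. apply NNPP. intros N. apply (proj2 (proj1 wc) a A). apply (inj_trans H2), inj_sub.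
    intros b B. apply NNPP. intros Q. apply N; eauto. }
  exists H. split; auto.
  assert (Hc : (forall a b, a ∊ H -> b ∊ H -> a ∊ b -> lex a b) \/ (forall a b, a ∊ H -> b ∊ H -> a ∊ b -> ~ lex a b)).
  { destruct H3 as [H3|H3]; [left|right]; intros a b A B K; specialize (H3 a b A B K); rewrite in_sep in H3 by df;
    rewrite opair_in_prod, fst_opair, snd_opair in H3. tauto. intros Q; apply H3; auto. }
  (* Late elements of [H] have the same trace below [xi], so comparing them lexicographically
     compares their bits at [xi]. Homogeneity makes these bits monotone along [H], hence eventually
     constant. *)
  intros xi. revert xi. apply (@mem_ind V (fun xi => xi ∊ ka -> ev H (fun be => opair xi be ∊ X) \/ ev H (fun be => ~ opair xi be ∊ X))). df.
  intros xi IH Hxi.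
  assert (Ag : exists ga, ga ∊ ka /\ forall al be, al ∊ H -> be ∊ H -> ~ al ∊ ga -> ~ be ∊ ga -> agree xi al be).
  { assert (E : ev H (fun be => forall eta, eta ∊ xi -> (opair eta be ∊ X <-> ev H (fun be => opair eta be ∊ X)))).
    { apply (@ev_all H xi (fun eta be => opair eta be ∊ X <-> ev H (fun be => opair eta be ∊ X))). apply R, Hxi. df.
      intros eta E. assert (Ek : eta ∊ ka) by apply (Ord_trans O E Hxi).
      destruct (IH eta E Ek) as [Q|Q].
      - eapply ev_mono; [exact Q|]. intros be _ K. tauto.
      - eapply ev_mono; [exact Q|]. intros be _ K. cbv beta in K. split; [tauto|]. intros Q'. exfalso.
        destruct (ev_ex U (ev_and Q Q') Ek) as (b & _ & B & _). tauto. }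
    destruct E as (ga & G1 & G2). exists ga. split; auto. intros al be A B NA NB eta E.
    rewrite (G2 al A NA eta E), (G2 be B NB eta E). tauto. }
  destruct Ag as (ga & G1 & G2).
  assert (later : forall al be, al ∊ H -> be ∊ H -> ~ al ∊ ga -> al ∊ be -> ~ be ∊ ga).
  { intros al be A B N K Q. apply N. apply (Ord_trans (Ord_in O G1) K Q). }
  assert (cmp : forall al be, al ∊ H -> ~ be ∊ succ al -> be ∊ H -> al ∊ be).
  { intros al be A N B. rewrite in_succ in N. destruct (Ord_trich (Ord_in O (H1 _ A)) (Ord_in O (H1 _ B))) as [Q|[Q|Q]]; auto; destruct N; auto. }
  destruct Hc as [Hc|Hc].
  - destruct (classic (exists al, al ∊ H /\ ~ al ∊ ga /\ opair xi al ∊ X)) as [(al & A1 & A2 & A3)|N].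
    + left. exists (succ al). split. apply Limit_succ; auto. intros be B NB. pose proof (cmp al be A1 NB B) as K.
      pose proof (later al be A1 B A2 K) as Nb. destruct (Hc al be A1 B K) as [Q|(xi' & X1 & X2 & X3 & X4)].
      * apply (Q xi Hxi); auto.
      * destruct (Ord_trich (Ord_in O X1) (Ord_in O Hxi)) as [Q|[->|Q]]; [|tauto|].
        -- exfalso. apply X3. apply (G2 al be A1 B A2 Nb xi' Q). auto.
        -- apply (X2 xi Q); auto.
    + right. exists ga. split; auto. intros be B NB Q. apply N; eauto.
  - destruct (classic (exists al, al ∊ H /\ ~ al ∊ ga /\ ~ opair xi al ∊ X)) as [(al & A1 & A2 & A3)|N].
    + right. exists (succ al). split. apply Limit_succ; auto. intros be B NB Q. pose proof (cmp al be A1 NB B) as K.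
      pose proof (later al be A1 B A2 K) as Nb. apply (Hc al be A1 B K). right. exists xi. split; auto.
    + left. exists ga. split; auto. intros be B NB. apply NNPP. intros Q. apply N; eauto.
Qed.

Lemma decide_class I (R : V -> V -> Prop) : Df (fun v => R (v 0) (v 1)) -> inj I ka ->
  exists H, unb H /\ forall i, i ∊ I -> ev H (fun be => R i be) \/ ev H (fun be => ~ R i be).
Proof.
  intros D (e & He). pose proof He as ((E1 & E2) & E3).
  destruct (decide_sets (sep (prod ka ka) (fun z => exists i, i ∊ I /\ fst z = app e i /\ R i (snd z)))) as (H & U & K).
  exists H. split; auto. intros i Hi.
  assert (Q : forall be, be ∊ H -> (opair (app e i) be ∊ sep (prod ka ka) (fun z => exists i, i ∊ I /\ fst z = app e i /\ R i (snd z)) <-> R i be)).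
  { intros be B. rewrite in_sep by df. rewrite opair_in_prod, fst_opair, snd_opair. split.
    - intros (_ & i' & I' & E & Q). apply E3 in E; auto. subst; auto.
    - intros Q. split; eauto. split; auto. apply U, B. }
  destruct (K (app e i)) as [Z|Z]; auto; [left|right]; (eapply ev_mono; [exact Z|]); intros be B W; simpl in W.
  apply Q; auto. intros W'. apply W, Q; auto.
Qed.

(** Were [ka] many subsets of [a] listed without repetition by [e], deciding all statements
    [xi ∊ app e be] for [xi] in [a] would make [app e be] eventually constant on an unbounded
    set. *)
Lemma strong_limit a : a ∊ ka -> small ka (pow a).
Proof.
  intros A. pose proof WC_Reg as R. pose proof ka_Ord as O.
  assert (N : ~ inj ka (pow a)).
  { intros (e & (E1 & E2) & E3). destruct (@decide_class a (fun xi be => xi ∊ app e be)) as (H & U & K). df.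
    apply inj_sub, (proj1 O a A).
    assert (E : ev H (fun be => forall xi, xi ∊ a -> (xi ∊ app e be <-> ev H (fun be => xi ∊ app e be)))).
    { apply (@ev_all H a (fun xi be => xi ∊ app e be <-> ev H (fun be => xi ∊ app e be))). apply R, A. df.
      intros xi X. destruct (K xi X) as [Q|Q]; (eapply ev_mono; [exact Q|]); intros be _ W; simpl in W. tauto. split; [tauto|].
      intros Q'. destruct (ev_ex U (ev_and Q Q') A) as (b & _ & B & _). tauto. }
    destruct (ev_ex U E A) as (b & B1 & B2 & _). assert (Sb : succ b ∊ ka) by (apply Limit_succ; [apply ka_Limit|apply U, B1]).
    destruct (ev_ex U E Sb) as (b' & B1' & B2' & N').
    assert (Q : b = b').
    { apply E3; try apply U; auto. apply set_ext. intros z.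
      pose proof (E2 b (proj1 U _ B1)) as P1. pose proof (E2 b' (proj1 U _ B1')) as P2. apply in_pow in P1, P2.
      split; intros Z. apply B2'; auto. apply B2; auto. apply B2; auto. apply B2'; auto. }
    subst b'. apply N'. apply in_succ; auto. }
  destruct (@card_exists V ac (pow a)) as (k & C & K1 & K2). apply small_inj with k; auto. apply R.
  apply R. apply NNPP. intros Q. apply N. apply inj_trans with k; auto. apply inj_sub, Ord_not_in; auto. apply C.
Qed.

Lemma cs_lt a : a ∊ ka -> cs a ∊ ka.
Proof.
  intros A. pose proof WC_Reg as R. pose proof ka_Ord as O. pose proof (Ord_in O A) as Oa.
  destruct (small_lt ka_Limit (strong_limit A)) as (k & K1 & K2).
  destruct (@card_exists V ac (pow a)) as (m & C & M1 & M2).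
  assert (mk : m ⊆ k) by (apply Card_le; auto; [apply (Ord_in O K1)|apply (inj_trans M2 K2)]).
  assert (am : a ∊ m).
  { apply NNPP. intros Q. apply (@cantor V a). apply (inj_trans M1), inj_sub, Ord_not_in; auto. apply C. }
  destruct (cs_spec Oa) as (C1 & C2 & C3). apply Ord_sub_in with k; auto. apply C1. intros z Z. apply mk, (C3 m); auto.
Qed.

(** * A normality principle *)

Section Normal.
Hypothesis gch : @GCHm V.
Variables (I i0 : V) (h : V -> V -> V).
Hypothesis Dh : DT (fun v => h (v 0) (v 1)).
Hypothesis HI : inj I ka.
Hypothesis Hi0 : i0 ∊ I.
Hypothesis h_ka : forall be i, be ∊ ka -> i ∊ I -> h be i ∊ ka.
Hypothesis h_reg : forall i, i ∊ I -> exists ga, ga ∊ ka /\ forall be, be ∊ ka -> ga ∊ be -> h be i ∊ be.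

(* [U s be n] applies [h], regressive in its first argument, [n] times to [be] with second
   arguments [s 0], [s 1], ...; it plays the role of an ordinal represented in an ultrapower. *)
Definition U s be n := rec (fun n g => ite (n = emp) be (h (app g (union n)) (app s (union n)))) n.
Lemma DT_U (s t u : (nat -> V) -> V) : DT s -> DT t -> DT u -> DT (fun v => U (s v) (t v) (u v)).
Proof.
  intros A B C. unfold U. apply DT_rec with (F := fun n g v => ite (n = emp) (t v) (h (app g (union n)) (app (s v) (union n)))); auto.
  pose proof (DT_ren (fun n => S (S n)) A) as A'. pose proof (DT_ren (fun n => S (S n)) B) as B'. unfold tl. df.
Qed.
Hint Resolve DT_U : df.

Lemma U_DF s be : DT (fun v => ite (v 0 = emp) be (h (app (v 1) (union (v 0))) (app s (union (v 0))))).
Proof. df. Qed.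
Lemma U0 s be : U s be emp = be.
Proof. unfold U. rewrite rec_eq by apply U_DF. rewrite ite_true; auto. Qed.
Lemma US s be n : n ∊ om -> U s be (succ n) = h (U s be n) (app s n).
Proof.
  intros Hn. unfold U at 1. rewrite rec_eq by apply U_DF. rewrite ite_false.
  - assert (E : union (succ n) = n).
    { apply set_ext. intros z. rewrite in_union. split.
      - intros (y & A & B). apply in_succ in B as [B| ->]; auto. apply (Ord_trans (Ord_in Ord_om Hn) A B).
      - intros Z. exists n. rewrite in_succ. auto. }
    rewrite E, app_lam; auto. df. apply in_succ; auto.
  - intros E. apply (@in_emp V n). rewrite <- E. apply in_succ; auto.
Qed.
Lemma U_ext s s' be n : n ∊ om -> (forall k, k ∊ n -> app s k = app s' k) -> U s be n = U s' be n.
Proof.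
  intros Hn. revert n Hn. apply (@om_ind V (fun n => (forall k, k ∊ n -> app s k = app s' k) -> U s be n = U s' be n)). df.
  - intros _. rewrite !U0. auto.
  - intros n Hn IH K. rewrite !US by auto. rewrite IH, K; auto. apply in_succ; auto. intros k Q. apply K, in_succ; auto.
Qed.

Definition SQ := sep (pow (prod om I)) (fun s => Maps s om I).
Lemma in_SQ s : s ∊ SQ <-> Maps s om I.
Proof.
  unfold SQ. rewrite in_sep by df. split; [tauto|]. intros M. split; auto. apply in_pow. intros z Z.
  apply (Fn_in z (proj1 M)) in Z as (x & X & ->). apply opair_in_prod. split; auto. apply M; auto.
Qed.
Lemma U_ka s be n : Maps s om I -> be ∊ ka -> n ∊ om -> U s be n ∊ ka.
Proof.
  intros M B. revert n. apply om_ind. df. rewrite U0; auto. intros n Hn IH. rewrite US; auto. apply h_ka; auto. apply M, Hn.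
Qed.
(** The case κ^ω = κ of κ^{<κ} = κ; it keeps the number of statements to be decided at [ka]. *)
Lemma SQ_inj : inj SQ ka.
Proof.
  pose proof WC_Reg as R. apply inj_trans with (sep (pow (prod om I)) (fun x => small ka x)).
  - apply inj_sub. intros s S. pose proof S as S'. apply in_SQ in S'. unfold SQ in S. rewrite in_sep in S by df.
    rewrite in_sep by df. split. tauto. destruct S' as [F _]. unfold Fn in F. rewrite F. unfold lam. apply small_repl. df.
    apply R, wc.
  - apply small_subsets_inj; auto. apply inj_trans with (prod ka ka).
    apply prod_inj; auto. apply inj_sub, ka_om. apply pairing. apply wc. apply ka_om.
Qed.

(* Otherwise every eventually non-constant iterate could be pushed down once more, and the
   resulting sequence of length ω would be a descending sequence of ordinals. *)
Theorem normality : exists H s n, unb H /\ Maps s om I /\ n ∊ om /\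
  (forall ga, ga ∊ ka -> ev H (fun be => ga ∊ U s be n)) /\
  (forall i, i ∊ I -> exists c, c ∊ ka /\ ev H (fun be => h (U s be n) i = c)).
Proof.
  pose proof WC_Reg as R. pose proof ka_Ord as O. pose proof ka_Limit as L.
  (* A single [H] decides all equations [U s be n = ga] at once. *)
  destruct (@decide_class (prod SQ (prod om ka)) (fun x be => U (fst x) be (fst (snd x)) = snd (snd x))) as (H & UH & dH). df.
  { apply inj_trans with (prod ka (prod ka ka)).
    - apply prod_inj. apply SQ_inj. apply prod_inj; apply inj_sub. apply ka_om. intros z; auto.
    - assert (J : inj (prod ka ka) ka) by (apply pairing; [apply wc|apply ka_om]).
      apply inj_trans with (prod ka ka); auto. apply prod_inj; auto. apply inj_sub; intros z; auto. }
  set (cst := fun s n => exists ga, ga ∊ ka /\ ev H (fun be => U s be n = ga)).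
  assert (Dc : Df (fun v => cst (v 0) (v 1))) by (unfold cst; df).
  (* An iterate that avoids each constant eventually also avoids all values up to [ga] eventually,
     by completeness; so it exceeds [ga], like an ordinal of an ultrapower above the constants. *)
  assert (grow : forall s n, Maps s om I -> n ∊ om -> ~ cst s n -> forall ga, ga ∊ ka -> ev H (fun be => ga ∊ U s be n)).
  { intros s n Ms Hn N ga Hg.
    assert (E : ev H (fun be => forall g, g ∊ succ ga -> U s be n <> g)).
    { apply (@ev_all H (succ ga) (fun g be => U s be n <> g)). apply R, Limit_succ; auto. df.
      intros g Hgg. assert (Hgk : g ∊ ka) by (apply (succ_sub O Hg); auto).
      destruct (dH (opair s (opair n g))) as [Q|Q].
      - rewrite !opair_in_prod, in_SQ. auto.
      - exfalso. apply N. exists g. split; auto. eapply ev_mono; [exact Q|]. intros be _ W. simpl in W.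
        rewrite !snd_opair, !fst_opair in W. auto.
      - eapply ev_mono; [exact Q|]. intros be _ W. simpl in W. rewrite !snd_opair, !fst_opair in W. auto. }
    eapply ev_mono; [exact E|]. intros be B W. simpl in W.
    assert (Uk : U s be n ∊ ka) by (apply U_ka; auto; apply UH, B).
    destruct (Ord_trich (Ord_in O Hg) (Ord_in O Uk)) as [Q|[Q|Q]]; auto; destruct (W (U s be n)); auto; apply in_succ; auto. }
  assert (cext : forall s s' n, n ∊ om -> (forall k, k ∊ n -> app s k = app s' k) -> cst s n -> cst s' n).
  { intros s s' n Hn E (ga & G1 & G2). exists ga. split; auto. eapply ev_mono; [exact G2|]. intros be B W. simpl in *.
    rewrite <- (U_ext be Hn E). auto. }
  (* [s] below [n], then [x] forever: iterates up to [succ n] see only the entries up to [n], and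
     the padding keeps all sequences of length [om]. *)
  set (T := fun s n x => lam om (fun k => ite (k ∊ n) (app s k) x)).
  assert (DTT : forall s t u : (nat -> V) -> V, DT s -> DT t -> DT u -> DT (fun v => T (s v) (t v) (u v))).
  { intros s t u A B C. unfold T. apply DT_lam with (F := fun k v => ite (k ∊ t v) (app (s v) k) (u v)). df.
    apply DT_tl in A, B, C. df. }
  assert (TM : forall s n x, n ∊ om -> Maps s n I -> x ∊ I -> Maps (T s n x) om I).
  { intros s n x Hn M X. apply Maps_lam. df. intros k K. destruct (classic (k ∊ n)). rewrite ite_true by auto. apply M; auto. rewrite ite_false; auto. }
  assert (Tl : forall s n x k, n ∊ om -> k ∊ n -> app (T s n x) k = app s k).
  { intros s n x k Hn K. unfold T. rewrite app_lam; [|df|]. rewrite ite_true; auto. apply (Ord_trans Ord_om K Hn). }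
  assert (Tn : forall s n x, n ∊ om -> app (T s n x) n = x).
  { intros s n x Hn. unfold T. rewrite app_lam by (auto; df). rewrite ite_false; auto. apply not_in_self. }
  destruct (classic (exists s n, Maps s om I /\ n ∊ om /\ ~ cst s n /\ forall i, i ∊ I -> cst (T s n i) (succ n))) as [(s & n & Ms & Hn & N & K)|N].
  - exists H, s, n. split; auto. split; auto. split; auto. split. apply grow; auto.
    intros i Ii. destruct (K i Ii) as (c & C1 & C2). exists c. split; auto. eapply ev_mono; [exact C2|]. intros be B W. simpl in W.
    rewrite US, Tn in W by auto. rewrite <- W. f_equal. symmetry. apply U_ext; auto.
  - exfalso.
    assert (step : forall s n, Maps s om I -> n ∊ om -> ~ cst s n -> exists i, i ∊ I /\ ~ cst (T s n i) (succ n)).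
    { intros s n Ms Hn Nc. apply NNPP. intros Q. apply N. exists s, n. split; auto. split; auto. split; auto.
      intros i Ii. apply NNPP. intros Q'. apply Q; eauto. }
    assert (c0 : forall s, ~ cst s emp).
    { intros s (ga & G1 & G2). destruct (ev_ex UH G2 (Limit_succ L G1)) as (be & B1 & B2 & B3). rewrite U0 in B2. subst.
      apply B3, in_succ; auto. }
    assert (Som : forall n : V, n ∊ om -> succ n ∊ om) by (intros; apply Limit_succ; auto; apply Limit_om).
    destruct (@dep_choice V ac om I (fun n s x => ~ cst (T s n x) (succ n))) as (s & Ms & Hs). df. apply Ord_om.
    { intros n s Hn Ms Hs. pose proof (Ord_in Ord_om Hn) as On.
      assert (Nc : ~ cst (T s n i0) n).
      { destruct (Ord_cases On) as [->|[(k & K & ->)|Ln]]; auto; [|exfalso; apply (proj2 om_spec n Hn Ln)].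
        intros Q. apply (Hs k K). assert (Hk : k ∊ om) by apply (Ord_trans Ord_om K Hn). revert Q. apply cext; auto.
        intros e E. rewrite Tl by auto. apply in_succ in E as [E| ->].
        - rewrite Tl by auto. rewrite app_lam; auto. df.
        - rewrite Tn; auto. }
      destruct (step (T s n i0) n) as (i & Ii & Q); auto. exists i. split; auto. intros Q'. apply Q. revert Q'. apply cext; auto.
      intros k K. apply in_succ in K as [K| ->]; [rewrite !Tl by auto|rewrite !Tn by auto]; auto. }
    assert (Nc : forall n, n ∊ om -> ~ cst s n).
    { intros n Hn. destruct (Ord_cases (Ord_in Ord_om Hn)) as [->|[(k & K & ->)|Ln]]; auto; [|exfalso; apply (proj2 om_spec n Hn Ln)].
      assert (Hk : k ∊ om) by apply (Ord_trans Ord_om K Hn).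
      intros Q. apply (Hs k Hk). revert Q. apply cext; auto. intros e E. apply in_succ in E as [E| ->].
      rewrite Tl by auto. rewrite app_lam; auto. df. rewrite Tn; auto. }
    assert (E : ev H (fun be => forall n, n ∊ om -> U s be (succ n) ∊ U s be n)).
    { apply (@ev_all H om (fun n be => U s be (succ n) ∊ U s be n)). apply R, wc. df. intros n Hn.
      destruct (h_reg (i := app s n)) as (ga & G1 & G2). apply Ms, Hn.
      eapply ev_mono; [exact (grow s n Ms Hn (Nc n Hn) ga G1)|]. intros be B W. rewrite US by auto. apply G2; auto.
      apply U_ka; auto. apply UH, B. }
    destruct (ev_ex UH E (Limit_emp L)) as (be & B1 & B2 & _).
    destruct (@found V (repl om (fun n => U s be n))) as (y & Y1 & Y2).
    { exists (U s be emp). rewrite in_repl by df. exists emp. split; auto. apply Limit_emp, Limit_om. }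
    rewrite in_repl in Y1 by df. destruct Y1 as (n & Hn & ->). apply (Y2 (U s be (succ n))); auto.
    rewrite in_repl by df. eauto.
Qed.
End Normal.
End WeaklyCompact.

#[global] Hint Resolve Df_dec DT_U Df_ev : df.

(** * Preservation of weak compactness *)

Section Guide.
Context {V : model} {ac : AC V}.
Variable kap : V.
Hypothesis wc : WC kap.
Hypothesis gch : @GCHm V.
Variable t : V.
Implicit Types (a b c d f g h k p q r s u w x y z : V).
Notation P := (PP kap).
Notation Fmem := (forces_mem (@mem V) (PP kap) (LE kap)).
Let Rk := WC_Reg wc.
Let Ok := ka_Ord wc.
Let Lk := ka_Limit wc.

Definition LoE be := sep P (fun p => forall z, z ∊ p -> fst z ∊ be).
Definition lo be p := sep p (fun z => fst z ∊ be).
Definition hi be p := sep p (fun z => ~ fst z ∊ be).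
Lemma DT_LoE (s : (nat -> V) -> V) : DT s -> DT (fun v => LoE (s v)).
Proof. apply DT_fun1. change (DT (fun v : nat -> V => LoE (v 0))). unfold LoE; df. Qed.
Lemma DT_lo (s u : (nat -> V) -> V) : DT s -> DT u -> DT (fun v => lo (s v) (u v)).
Proof. apply DT_fun2. change (DT (fun v : nat -> V => lo (v 0) (v 1))). unfold lo; df. Qed.
Lemma DT_hi (s u : (nat -> V) -> V) : DT s -> DT u -> DT (fun v => hi (s v) (u v)).
Proof. apply DT_fun2. change (DT (fun v : nat -> V => hi (v 0) (v 1))). unfold hi; df. Qed.
Hint Resolve DT_LoE DT_lo DT_hi : df.
Lemma in_LoE be p : p ∊ LoE be <-> p ∊ P /\ forall z, z ∊ p -> fst z ∊ be.
Proof. unfold LoE. rewrite in_sep by df. tauto. Qed.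
Lemma in_lo be p z : z ∊ lo be p <-> z ∊ p /\ fst z ∊ be.
Proof. unfold lo. rewrite in_sep by df. tauto. Qed.
Lemma in_hi be p z : z ∊ hi be p <-> z ∊ p /\ ~ fst z ∊ be.
Proof. unfold hi. rewrite in_sep by df. tauto. Qed.
Lemma LoHi_cup be a r : a ∊ P -> r ∊ P -> (forall z, z ∊ a -> fst z ∊ be) -> (forall z, z ∊ r -> ~ fst z ∊ be) -> cup a r ∊ P.
Proof.
  intros A B C D. apply PP_cup; auto. intros z w Z W E. exfalso. unfold crd in E. apply opair_inj in E as [E _].
  apply (D w W). rewrite <- E. auto.
Qed.

Lemma PP_small_ka p : p ∊ P -> small kap p.
Proof.
  intros H. apply small_sub with (low kap p). apply Lk. intros z Z. apply in_low. split; auto. apply in_succ. left.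
  apply (XX_Ord (PP_XX H Z)). apply (PP_small H Rk).
Qed.
Lemma PP_bounded p : p ∊ P -> exists ga, ga ∊ kap /\ forall z, z ∊ p -> fst z ∊ ga.
Proof.
  intros H. apply small_class. df. apply PP_small_ka; auto. intros z Z. apply (XX_Ord (PP_XX H Z)).
Qed.
Lemma two_ka : two ⊆ kap.
Proof.
  intros z Z. apply in_two in Z as [->| ->]. apply Limit_emp, Lk. apply Limit_succ. apply Lk. apply Limit_emp, Lk.
Qed.
Lemma pair_ka : inj (prod kap kap) kap.
Proof. apply pairing. apply wc. apply (ka_om wc). Qed.
Lemma XX_inj : inj (XX kap) kap.
Proof.
  apply inj_trans with (prod kap (prod (prod kap kap) two)).
  { apply inj_sub. intros z Z. unfold XX in Z. rewrite in_sep in Z by df. tauto. }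
  assert (I : inj kap kap) by (apply inj_sub; intros z; auto).
  apply inj_trans with (prod kap kap); [|apply pair_ka]. apply prod_inj; auto.
  apply inj_trans with (prod kap kap); [|apply pair_ka]. apply prod_inj. apply pair_ka. apply inj_sub, two_ka.
Qed.
Lemma PP_inj : inj P kap.
Proof.
  apply inj_trans with (sep (pow (XX kap)) (fun x => small kap x)).
  - apply inj_sub. intros p H. rewrite in_sep by df. split. apply in_pow, (PP_XX H). apply PP_small_ka; auto.
  - apply small_subsets_inj; auto. apply XX_inj.
Qed.

(** Coordinates below [ga] allow fewer than [kap] bits, and [kap] is a strong limit. *)
Lemma small_lower ga : ga ∊ kap -> small kap (LoE ga).
Proof.
  intros Hg.
  destruct (@small_class V kap ga (fun d => cs (cs d))) as (sg & S1 & S2). df. apply Rk, Hg.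
  { intros d D. apply (cs_lt wc), (cs_lt wc). apply (Ord_trans Ok D Hg). }
  set (B := prod ga (prod (prod sg ga) two)).
  assert (SB : small kap B).
  { apply small_prod. apply Ok. apply Rk, Hg. apply small_prod. apply Ok. apply small_prod. apply Ok. apply Rk, S1. apply Rk, Hg.
    apply om_small. apply Lk. apply Limit_succ. apply Limit_om. apply Limit_succ. apply Limit_om. apply Limit_emp, Limit_om. }
  destruct (small_lt Lk SB) as (k & K1 & K2). apply small_inj with (pow k). apply Lk. 2: apply (strong_limit wc K1).
  apply inj_trans with (pow B); [|apply pow_inj, K2]. apply inj_sub. intros p H. apply in_LoE in H as [H1 H2]. apply in_pow.
  intros z Z. pose proof (H2 z Z) as F. apply (PP_XX H1) in Z. apply in_XX in Z as (de & ze & i & b & -> & Z1 & Z2 & Z3 & Z4 & Z5 & Z6 & Z7).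
  rewrite fst_opair in F. unfold B. rewrite !opair_in_prod. pose proof (Ord_in Ok S1) as Os. pose proof (Ord_in Ok Hg) as Og.
  split; auto. split; auto. split. apply (Ord_trans Os Z6 (S2 _ F)). apply (Ord_trans Og Z7 F).
Qed.

Variable e : V.
Hypothesis He : Inj e (prod P kap) kap.
Variable cc : V.
Hypothesis Hcc : Inj cc (prod P two) kap.

(** The inverse of [e], with the empty condition and the ordinal 0 as default off its range. *)
Definition tsk xi := ite (exists z, z ∊ prod P kap /\ app e z = xi) (pre e (prod P kap) xi) (opair emp emp).
Lemma DT_tsk (s : (nat -> V) -> V) : DT s -> DT (fun v => tsk (s v)).
Proof. apply DT_fun1. change (DT (fun v : nat -> V => tsk (v 0))). unfold tsk; df. Qed.
Hint Resolve DT_tsk : df.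
Lemma tsk_surj p al : p ∊ P -> al ∊ kap -> exists xi, xi ∊ kap /\ tsk xi = opair p al.
Proof.
  intros A B. assert (Z : opair p al ∊ prod P kap) by (apply opair_in_prod; auto). exists (app e (opair p al)). split.
  apply He; auto. unfold tsk. rewrite ite_true by eauto. apply (pre_app He Z).
Qed.

Definition qq be s xi := union (repl xi (fun eta => hi be (app s eta))).
(** Only the parts from coordinate [be] on accumulate along the sequence. Below [be] each stage
    starts afresh from the condition of its own task, so these lower parts may contradict one
    another. *)
Definition Step be xi s x := qq be s xi ⊆ x /\ (fst (tsk xi) ∊ LoE be -> fst (tsk xi) ⊆ x) /\
  dec kap (ck emp (opair (snd (tsk xi)) be)) t x.
Lemma DT_qq (s u w : (nat -> V) -> V) : DT s -> DT u -> DT w -> DT (fun v => qq (s v) (u v) (w v)).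
Proof.
  intros A B C. unfold qq. apply DT_union. apply DT_repl with (F := fun eta v => hi (s v) (app (u v) eta)); auto.
  apply DT_tl in A, B. df.
Qed.
Hint Resolve DT_qq : df.
Lemma Df_Step (s u w o : (nat -> V) -> V) : DT s -> DT u -> DT w -> DT o -> Df (fun v => Step (s v) (u v) (w v) (o v)).
Proof. intros. unfold Step. df. Qed.
Hint Resolve Df_Step : df.
Lemma in_qq be s xi z : z ∊ qq be s xi <-> exists eta, eta ∊ xi /\ z ∊ app s eta /\ ~ fst z ∊ be.
Proof.
  unfold qq. rewrite in_union. split.
  - intros (y & A & B). rewrite in_repl in B by df. destruct B as (eta & E & ->). apply in_hi in A. eauto.
  - intros (eta & E & A). exists (hi be (app s eta)). rewrite in_hi, in_repl by df. eauto.
Qed.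

(** The factor at coordinates from [be] on is closed under increasing sequences shorter than [be]: a
    regular [nu] at or above [be] finds the sequence short, a smaller one finds nothing at its
    coordinates. *)
Lemma qq_P be s xi : Reg be -> xi ∊ be -> (forall eta, eta ∊ xi -> app s eta ∊ P /\ qq be s eta ⊆ app s eta) -> qq be s xi ∊ P.
Proof.
  intros R X K. pose proof (Reg_Ord R) as O. pose proof (Ord_in O X) as Ox. unfold qq. apply PP_union.
  - intros p Hp. rewrite in_repl in Hp by df. destruct Hp as (eta & E & ->). apply PP_sub with (app s eta). apply K; auto.
    intros z Z. apply in_hi in Z; tauto.
  - assert (inc : forall e1 e2, e1 ∊ e2 -> e2 ∊ xi -> hi be (app s e1) ⊆ hi be (app s e2)).
    { intros e1 e2 E1 E2 z Z. apply in_hi in Z as [Z1 Z2]. apply in_hi. split; auto. apply (K e2 E2). apply in_qq; eauto. }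
    intros p q Hp Hq. rewrite in_repl in Hp, Hq by df. destruct Hp as (e1 & E1 & ->), Hq as (e2 & E2 & ->).
    destruct (Ord_trich (Ord_in Ox E1) (Ord_in Ox E2)) as [Q|[->|Q]]; auto. left; intros z; auto.
  - intros nu Rn. destruct (Ord_le O (Reg_Ord Rn)) as [Q|Q].
    + left. apply small_repl. df. apply Rn. auto.
    + right. intros p z Hp Z W. rewrite in_repl in Hp by df. destruct Hp as (eta & E & ->). apply in_hi in Z as [_ Z]. apply Z.
      apply in_succ in W as [W| ->]; auto. apply (Ord_trans O W Q).
Qed.

Lemma seq_exists be : Reg be -> exists s, Maps s be P /\ forall xi, xi ∊ be -> Step be xi s (app s xi).
Proof.
  intros R. pose proof (Reg_Ord R) as O.
  assert (conv : forall s xi x, Step be xi (lam xi (app s)) x -> Step be xi s x).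
  { intros s xi x (A & B & C). split; auto. intros z Z. apply A. apply in_qq in Z as (eta & E & Z). apply in_qq. exists eta.
    split; auto. rewrite app_lam; auto. df. }
  destruct (@dep_choice V ac be P (fun xi s x => Step be xi s x)) as (s & Ms & Hs); auto. df.
  { intros xi s X Ms Hs.
    assert (QP : qq be s xi ∊ P).
    { apply qq_P; auto. intros eta E. split. apply Ms; auto. apply conv; auto. }
    assert (qh : forall z, z ∊ qq be s xi -> ~ fst z ∊ be) by (intros z Z; apply in_qq in Z as (? & ? & ? & ?); auto).
    assert (base : exists y, y ∊ P /\ qq be s xi ⊆ y /\ (fst (tsk xi) ∊ LoE be -> fst (tsk xi) ⊆ y)).
    { destruct (classic (fst (tsk xi) ∊ LoE be)) as [Q|Q].
      - exists (cup (fst (tsk xi)) (qq be s xi)). pose proof Q as Q'. apply in_LoE in Q' as [Q1 Q2]. split. apply (LoHi_cup Q1 QP Q2 qh).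
        split; [|intros _]; intros z Z; apply in_cup; auto.
      - exists (qq be s xi). split; auto. split; [intros z; auto|tauto]. }
    destruct base as (y & Y1 & Y2 & Y3). destruct (@dec_dense V kap (ck emp (opair (snd (tsk xi)) be)) t y Y1) as (x & X1 & X2 & X3).
    exists x. split; auto. split; [|split]; auto. intros z Z; auto. intros Q z Z. apply X2, Y3; auto. }
  exists s. split; auto.
Qed.

Definition one := succ (emp : V).
Definition bit be xi s := ite (Fmem (ck emp (opair (snd (tsk xi)) be)) t (app s xi)) one emp.
(** An ordinal for the lower part together with the decided colour: the data that have to
    stabilise. *)
Definition code be xi s := app cc (opair (lo be (app s xi)) (bit be xi s)).
Lemma DT_code (s u w : (nat -> V) -> V) : DT s -> DT u -> DT w -> DT (fun v => code (s v) (u v) (w v)).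
Proof. intros. unfold code, bit. df. Qed.
Hint Resolve DT_code : df.
Lemma bit_two be xi s : bit be xi s ∊ two.
Proof. unfold bit, ite. destruct excluded_middle_informative; apply in_two; auto. Qed.

Definition bb ga := mu (fun b => b ∊ kap /\ ga ∊ b /\ forall a i, a ∊ LoE ga -> i ∊ two -> app cc (opair a i) ∊ b).
Lemma DT_bb (s : (nat -> V) -> V) : DT s -> DT (fun v => bb (s v)).
Proof. apply DT_fun1. change (DT (fun v : nat -> V => bb (v 0))). unfold bb; df. Qed.
Hint Resolve DT_bb : df.
Lemma bb_spec ga : ga ∊ kap -> bb ga ∊ kap /\ ga ∊ bb ga /\ forall a i, a ∊ LoE ga -> i ∊ two -> app cc (opair a i) ∊ bb ga.
Proof.
  intros Hg. apply (@mu_spec V (fun b => b ∊ kap /\ ga ∊ b /\ forall a i, a ∊ LoE ga -> i ∊ two -> app cc (opair a i) ∊ b)). df.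
  destruct (@small_class V kap (prod (LoE ga) two) (fun z => app cc z)) as (b & B1 & B2). df.
  { apply small_prod. apply Ok. apply small_lower; auto.
    apply om_small. apply Lk. apply Limit_succ. apply Limit_om. apply Limit_succ. apply Limit_om. apply Limit_emp, Limit_om. }
  { intros z Z. apply in_prod in Z as (x & y & A & B & ->). apply in_LoE in A. apply Hcc. apply opair_in_prod; tauto. }
  pose proof (Ord_in Ok B1) as Ob. pose proof (Ord_in Ok Hg) as Og.
  destruct (Ord_le Ob Og) as [Q|Q].
  - exists (succ ga). split. apply Ord_succ; auto. split. apply Limit_succ; auto. split. apply in_succ; auto.
    intros a i A I. apply in_succ. left. apply Q, B2, opair_in_prod; auto.
  - exists b. split; auto. split; auto. split; auto. intros a i A I. apply B2, opair_in_prod; auto.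
Qed.

(** For regular [be] the part of a condition below [be] is bounded below [be]; closure under [cc]
    then puts its code below [be]. So [code] is regressive at such [be]. *)
Definition OK be := Reg be /\ forall ga a i, ga ∊ be -> a ∊ LoE ga -> i ∊ two -> app cc (opair a i) ∊ be.
Lemma Df_OK (s : (nat -> V) -> V) : DT s -> Df (fun v => OK (s v)).
Proof. apply (Df_rel1 OK). unfold OK. df. Qed.
Hint Resolve Df_OK : df.

(** A [be] that is not [OK] carries regressive evidence: a map on a smaller ordinal into [be] whose
    values, enlarged by [bb], reach beyond every element of [be]. For successors and for failures of
    closure a constant map on [one] suffices; for singular limits it is cofinal. *)
Lemma not_OK be : be ∊ kap -> one ∊ be -> ~ OK be -> exists a f, a ∊ be /\ Maps f a be /\ forall y, y ∊ be -> exists x, x ∊ a /\ y ∊ bb (app f x).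
Proof.
  intros B O1 N. pose proof (Ord_in Ok B) as O.
  assert (le_bb : forall ga y, ga ∊ be -> Ord y -> ~ ga ∊ y -> y ∊ bb ga).
  { intros ga y G Oy Q. assert (Gk : ga ∊ kap) by apply (Ord_trans Ok G B). destruct (bb_spec Gk) as (B1 & B2 & _).
    apply Ord_sub_in with ga; auto. apply (Ord_in Ok B1). apply Ord_not_in; auto. apply (Ord_in O G). }
  destruct (Ord_cases O) as [->|[(y & Y & ->)|L]].
  - destruct (in_emp O1).
  - exists one, (lam one (fun _ => y)). split; auto. split. apply Maps_lam; auto. df.
    intros z Z. exists emp. assert (E : emp ∊ one) by (apply in_succ; auto). split; auto. rewrite app_lam by (auto; df).
    apply le_bb; auto. apply (Ord_in O Z). apply in_succ in Z as [Z| ->]. apply (not_in_2 Z). apply not_in_self.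
  - destruct (classic (Reg be)) as [R|R].
    + assert (K : exists ga a i, ga ∊ be /\ a ∊ LoE ga /\ i ∊ two /\ ~ app cc (opair a i) ∊ be).
      { apply NNPP. intros Q. apply N. split; auto. intros ga a i A1 A2 A3. apply NNPP. intros Q'. apply Q. eauto 8. }
      destruct K as (ga & a & i & G & A & I & Q). exists one, (lam one (fun _ => ga)). split; auto. split. apply Maps_lam; auto. df.
      intros z Z. exists emp. assert (E : emp ∊ one) by (apply in_succ; auto). split; auto. rewrite app_lam by (auto; df).
      assert (Gk : ga ∊ kap) by apply (Ord_trans Ok G B). destruct (bb_spec Gk) as (B1 & B2 & B3).
      assert (Ck : app cc (opair a i) ∊ kap). { apply in_LoE in A. apply Hcc. apply opair_in_prod; tauto. }
      apply Ord_sub_in with (app cc (opair a i)); auto. apply (Ord_in O Z). apply (Ord_in Ok B1).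
      apply Ord_not_in in Q; auto. intros w Hw. apply Q. apply (Ord_trans O Hw Z). apply (Ord_in Ok Ck).
    + assert (K : exists a, a ∊ be /\ ~ small be a).
      { apply NNPP. intros Q. apply R. split; auto. intros a A. apply NNPP. intros Q'. apply Q; eauto. }
      destruct K as (a & A & S). apply not_all_ex_not in S as (f & F). apply imply_to_and in F as [F1 F2].
      exists a, f. split; auto. split; auto. intros y Y. apply NNPP. intros Q. apply F2. exists y. split; auto.
      intros x X. apply NNPP. intros Q'. apply Q. exists x. split; auto. apply le_bb; auto. apply F1; auto. apply (Ord_in O Y).
Qed.

(* The task [tsk eta] is a pair (condition, α); [Af eta] extends its condition, and together
   with [q] it decides whether the colouring named [t] contains [(α, be)]: yes iff [If eta] is 1. *)
Definition good_task Af If be q eta : Prop :=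
  app Af eta ∊ P /\ (fst (tsk eta) ∊ LoE be -> fst (tsk eta) ⊆ app Af eta) /\ cup (app Af eta) q ∊ P /\
  (app If eta = one -> Fmem (ck emp (opair (snd (tsk eta)) be)) t (cup (app Af eta) q)) /\
  (app If eta <> one -> forall r, r ∊ P -> cup (app Af eta) q ⊆ r -> ~ Fmem (ck emp (opair (snd (tsk eta)) be)) t r).

Lemma Df_good_task (s u w o i : (nat -> V) -> V) : DT s -> DT u -> DT w -> DT o -> DT i ->
  Df (fun v => good_task (s v) (u v) (w v) (o v) (i v)).
Proof.
  intros A B C D E. unfold good_task.
  assert (D1 := DT_tl A). assert (D2 := DT_tl D). assert (D3 := DT_tl E). assert (D4 := DT_tl C).
  df.
Qed.

(* [Af] and [If] do not depend on [be]: by normality the choices made at the regular [be]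
   stabilise along an unbounded set, as they would below the critical point of an embedding. *)
Theorem guide : exists Af If, Fn Af kap /\ Fn If kap /\ forall xs ga, xs ∊ kap -> ga ∊ kap -> exists be q, be ∊ kap /\ q ∊ P /\ ga ∊ be /\ xs ∊ be /\
  (forall z, z ∊ q -> ~ fst z ∊ be) /\ forall eta, eta ∊ xs -> good_task Af If be q eta.
Proof.
  destruct (@ac_fn V ac kap (fun be s => Reg be -> Maps s be P /\ forall xi, xi ∊ be -> Step be xi s (app s xi))) as (Sg & _ & HS). df.
  { intros be B. destruct (classic (Reg be)) as [R|R]. destruct (seq_exists R) as (s & S). exists s; auto. exists emp; tauto. }
  destruct (@ac_fn V ac kap (fun be w => one ∊ be -> ~ OK be -> fst w ∊ be /\ Maps (snd w) (fst w) be /\ forall y, y ∊ be -> exists x, x ∊ fst w /\ y ∊ bb (app (snd w) x))) as (W & _ & HW). df.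
  { intros be B. destruct (classic (one ∊ be /\ ~ OK be)) as [[R1 R2]|R]; [|exists emp; tauto].
    destruct (not_OK B R1 R2) as (a & f & K). exists (opair a f). rewrite fst_opair, snd_opair. auto. }
  set (three := succ (two : V)).
  (* Four regressive families in one, selected by [snd i]: at 0 the codes, at 1 whether [be] is
     [OK], at 2 and 3 the length and the values of the evidence against it. *)
  set (h := fun be i => ite (snd i = emp) (ite (OK be /\ fst i ∊ be) (code be (fst i) (app Sg be)) emp)
    (ite (snd i = one) (ite (OK be) one emp)
    (ite (snd i = two) (ite (~ OK be /\ one ∊ be) (fst (app W be)) emp)
      (ite (~ OK be /\ one ∊ be /\ fst i ∊ fst (app W be)) (app (snd (app W be)) (fst i)) emp)))).
  assert (Dh : DT (fun v => h (v 0) (v 1))) by (unfold h; df).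
  assert (n01 : one <> emp). { intros E. apply (@in_emp V emp). rewrite <- E at 2. apply in_succ; auto. }
  assert (n12 : (two : V) <> one). { intros E. apply (@not_in_self V one). rewrite <- E at 2. apply in_succ; auto. }
  assert (n02 : (two : V) <> emp). { intros E. apply (@in_emp V one). rewrite <- E. apply in_succ; auto. }
  assert (n32 : three <> two). { intros E. apply (@not_in_self V two). rewrite <- E at 2. apply in_succ; auto. }
  assert (n31 : three <> one). { intros E. apply (@not_in_2 V two one). rewrite <- E. apply in_succ; auto. apply in_succ; auto. }
  assert (n30 : three <> emp). { intros E. apply (@in_emp V two). rewrite <- E. apply in_succ; auto. }
  assert (omS : forall n : V, n ∊ om -> succ n ∊ om) by (intros; apply Limit_succ; auto; apply Limit_om).
  assert (om0 : (emp : V) ∊ om) by apply (Limit_emp Limit_om).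
  assert (onek : one ∊ kap) by (apply Limit_succ; auto; apply Limit_emp; auto).
  assert (h_small : forall be i, be ∊ kap -> one ∊ be -> h be i ∊ be).
  { intros be i B O1. pose proof (Ord_in Ok B) as O.
    assert (E0 : emp ∊ be). { apply Ord_trans with one; auto. apply in_succ; auto. }
    unfold h. unfold ite at 1. destruct excluded_middle_informative as [Q|Q].
    - unfold ite. destruct excluded_middle_informative as [[Q1 Q2]|Q1]; auto. pose proof Q1 as (R & Q3).
      destruct (HS be B R) as (M & _). pose proof (proj2 M _ Q2) as SP.
      destruct (@small_class V be (lo be (app (app Sg be) (fst i))) (fun z => fst z)) as (ga & G1 & G2). df.
      + apply small_sub with (low be (app (app Sg be) (fst i))). apply R. intros z Z. apply in_lo in Z as [Z1 Z2]. apply in_low. split; auto. apply in_succ; auto.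
        apply (PP_small SP R).
      + intros z Z. apply in_lo in Z; tauto.
      + unfold code. apply (Q3 ga); auto. 2: apply bit_two. apply in_LoE. split; auto. apply PP_sub with (app (app Sg be) (fst i)); auto.
        intros z Z; apply in_lo in Z; tauto.
    - unfold ite. repeat destruct excluded_middle_informative; auto.
      + apply HW; tauto.
      + destruct a as (N & _ & K). destruct (HW be B O1 N) as (_ & M & _). apply M, K. }
  assert (h_zero : forall be i, ~ one ∊ be -> h be i = emp).
  { intros be i N. assert (NO : ~ OK be).
    { intros (R & _). apply N. apply Limit_succ. apply R. apply Limit_emp, R. }
    unfold h, ite. repeat destruct excluded_middle_informative; auto; tauto. }
  destruct (@normality V ac kap wc gch (prod kap om) (opair emp emp) h Dh) as (H & s0 & n & UH & Ms0 & Hn & gr & cn).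
  { apply inj_trans with (prod kap kap); [|apply pair_ka]. apply prod_inj; apply inj_sub. intros z; auto. apply (ka_om wc). }
  { apply opair_in_prod. split; auto. apply Limit_emp, Lk. }
  { intros be i B _. destruct (classic (one ∊ be)) as [Q|Q]. apply (Ord_trans Ok (h_small be i B Q) B). rewrite h_zero by auto. apply Limit_emp, Lk. }
  { intros i _. exists one. split; auto. }
  set (g := fun be => U h s0 be n).
  assert (Dg : DT (fun v => g (v 0))) by (unfold g; df).
  assert (gk : forall be, be ∊ H -> g be ∊ kap).
  { intros be B. unfold g. eapply U_ka; eauto; [|apply UH, B].
    intros be' i B' _. destruct (classic (one ∊ be')) as [Q|Q]. apply (Ord_trans Ok (h_small be' i B' Q) B'). rewrite h_zero by auto. apply Limit_emp, Lk. }
  set (C := fun i => mu (fun c => c ∊ kap /\ ev kap H (fun be => h (g be) i = c))).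
  assert (DC : DT (fun v => C (v 0))) by (unfold C; df).
  assert (Cs : forall xi k, xi ∊ kap -> k ∊ om -> C (opair xi k) ∊ kap /\ ev kap H (fun be => h (g be) (opair xi k) = C (opair xi k))).
  { intros xi k X K. apply (@mu_spec V (fun c => c ∊ kap /\ ev kap H (fun be => h (g be) (opair xi k) = c))). df.
    destruct (cn (opair xi k)) as (c & C1 & C2). apply opair_in_prod; auto. exists c. split; auto. apply (Ord_in Ok C1). }
  assert (ke : emp ∊ kap) by (apply Limit_emp, Lk).
  assert (h1 : forall be xi, h be (opair xi one) = ite (OK be) one emp).
  { intros be xi. unfold h. rewrite snd_opair. rewrite ite_false by auto. rewrite ite_true; auto. }
  assert (h2 : forall be xi, one ∊ be -> ~ OK be -> h be (opair xi two) = fst (app W be)).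
  { intros be xi A B. unfold h. rewrite snd_opair. rewrite !ite_false by auto. rewrite !ite_true; auto. }
  assert (h3 : forall be xi, one ∊ be -> ~ OK be -> xi ∊ fst (app W be) -> h be (opair xi three) = app (snd (app W be)) xi).
  { intros be xi A B D. unfold h. rewrite snd_opair, fst_opair. rewrite !ite_false by auto. rewrite !ite_true; auto. }
  assert (h0 : forall be xi, OK be -> xi ∊ be -> h be (opair xi emp) = code be xi (app Sg be)).
  { intros be xi A B. unfold h. rewrite snd_opair, fst_opair. rewrite !ite_true; auto. }
  (* Otherwise the evidence against [g be] stabilises to a fixed map on some [a0] below [kap]. The
     [bb] bounds of its values lie below some [sg], but they must reach beyond every element of
     [g be], which eventually contains [sg]. *)
  assert (evOK : ev kap H (fun be => OK (g be))).
  { destruct (Cs emp one ke (omS _ om0)) as (C1 & C2).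
    destruct (classic (C (opair emp one) = one)) as [E|E].
    - eapply ev_mono; [exact C2|]. intros be B Q. cbv beta in Q. rewrite h1, E in Q. apply NNPP. intros N. rewrite ite_false in Q by auto. congruence.
    - exfalso.
      assert (NO : ev kap H (fun be => ~ OK (g be))).
      { eapply ev_mono; [exact C2|]. intros be B Q N. cbv beta in Q. rewrite h1, ite_true in Q by auto. congruence. }
      destruct (Cs emp two ke (omS _ (omS _ om0))) as (A1 & A2). set (a0 := C (opair emp two)) in *.
      assert (E3 : ev kap H (fun be => forall xi, xi ∊ a0 -> h (g be) (opair xi three) = C (opair xi three))).
      { apply (@ev_all V kap wc H a0 (fun xi be => h (g be) (opair xi three) = C (opair xi three))). apply Rk, A1. df.
        intros xi X. apply Cs. apply (Ord_trans Ok X A1). apply omS, omS, omS, om0. }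
      destruct (@small_class V kap a0 (fun xi => bb (C (opair xi three)))) as (sg & S1 & S2). df. apply Rk, A1.
      { intros xi X. apply bb_spec. apply Cs. apply (Ord_trans Ok X A1). apply omS, omS, omS, om0. }
      destruct (ev_ex wc UH (ev_and wc (ev_and wc NO (ev_and wc A2 E3)) (ev_and wc (gr sg S1) (gr one onek))) ke) as (be & B1 & ((B2 & B3 & B4) & B5 & B6) & _).
      fold (g be) in B5, B6. clear E. assert (E : fst (app W (g be)) = a0) by (rewrite <- B3, h2; auto).
      destruct (HW (g be) (gk be B1) B6 B2) as (_ & _ & K). destruct (K sg B5) as (x & X1 & X2).
      pose proof (h3 (g be) x B6 B2 X1) as E'. rewrite E in X1. rewrite B4 in E' by auto. rewrite <- E' in X2.
      apply (not_in_2 X2). apply S2; auto. }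
  (* The stable codes, decoded into a lower part and a colour. *)
  exists (lam kap (fun xi => fst (pre cc (prod P two) (C (opair xi emp))))), (lam kap (fun xi => snd (pre cc (prod P two) (C (opair xi emp))))).
  split. apply Fn_lam; df. split. apply Fn_lam; df.
  intros xs ga Xs Ga.
  assert (E0 : ev kap H (fun be => forall xi, xi ∊ xs -> h (g be) (opair xi emp) = C (opair xi emp))).
  { apply (@ev_all V kap wc H xs (fun xi be => h (g be) (opair xi emp) = C (opair xi emp))). apply Rk, Xs. df.
    intros xi X. apply Cs; auto. apply (Ord_trans Ok X Xs). }
  destruct (ev_ex wc UH (ev_and wc (ev_and wc evOK E0) (ev_and wc (gr xs Xs) (gr ga Ga))) ke) as (be0 & B1 & ((B2 & B3) & B4 & B5) & _).
  fold (g be0) in B4, B5. pose proof (gk be0 B1) as Bk. set (be := g be0) in *. pose proof B2 as (R & _). pose proof (Reg_Ord R) as O.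
  set (s := app Sg be). destruct (HS be Bk R) as (M & Hs). fold s in M, Hs.
  assert (inb : forall eta, eta ∊ xs -> eta ∊ be) by (intros eta E; apply (Ord_trans O E B4)).
  assert (QP : qq be s xs ∊ P). { apply qq_P; auto. intros eta E. split. apply M; auto. apply Hs; auto. }
  assert (qh : forall z, z ∊ qq be s xs -> ~ fst z ∊ be) by (intros z Z; apply in_qq in Z as (? & ? & ? & ?); auto).
  (* The upper parts increase, so the one collected before stage [xs] serves all tasks below [xs] at
     once. *)
  exists be, (qq be s xs). split; auto. split; auto. split; auto. split; auto. split; auto. intros eta E.
  pose proof (B3 eta E) as Q. rewrite h0 in Q by auto. fold s in Q. unfold code in Q.
  pose proof (proj2 M eta (inb eta E)) as SP.
  assert (LP : lo be (app s eta) ∊ P) by (apply PP_sub with (app s eta); auto; intros z Z; apply in_lo in Z; tauto).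
  assert (ek : eta ∊ kap) by apply (Ord_trans Ok E Xs).
  assert (PI : opair (lo be (app s eta)) (bit be eta s) ∊ prod P two) by (apply opair_in_prod; split; auto; apply bit_two).
  unfold good_task. rewrite !app_lam by (auto; df). rewrite <- Q, (pre_app Hcc PI), fst_opair, snd_opair.
  assert (CP : cup (lo be (app s eta)) (qq be s xs) ∊ P). { apply (LoHi_cup (be := be) LP QP); auto. intros z Z; apply in_lo in Z; tauto. }
  assert (SC : app s eta ⊆ cup (lo be (app s eta)) (qq be s xs)).
  { intros z Z. apply in_cup. destruct (classic (fst z ∊ be)). left; apply in_lo; auto. right. apply in_qq; eauto. }
  destruct (Hs eta (inb eta E)) as (S1 & S2 & S3).
  split; auto. split. { intros Z z Hz. apply in_lo. split. apply S2; auto. apply in_LoE in Z. apply Z; auto. }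
  split; auto. unfold bit, ite. destruct excluded_middle_informative as [F|F].
  - split; [|congruence]. intros _. apply (Fm_up SP CP SC F).
  - split; [congruence|]. intros _ r Rr Sr Q'. destruct S3 as [S3|S3]; [tauto|]. apply (S3 r); auto. intros z Z; auto.
Qed.
End Guide.
#[global] Hint Resolve DT_LoE DT_lo DT_hi DT_tsk Df_good_task : df.

(** * Homogeneous sets from a guess of the colours *)

Section Homogeneous.
Context {V : model} {ac : AC V}.
Implicit Types (a b c d f g h k p q r s u w x y z : V).

(** Each new point is taken beyond the earlier ones and with the guessed colours towards them, so
    the colour of a pair depends on its smaller member alone. Of the two classes of points given by
    [dd], one has size [ka]. *)
Lemma homogeneous_of_guess ka c (dd : V -> Prop) : Reg ka -> Df (fun v => dd (v 0)) ->
  (forall a, a ∊ ka -> exists be, be ∊ ka /\ ~ be ∊ a /\ forall al, al ∊ a -> (opair al be ∊ c <-> dd al)) ->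
  exists H, H ⊆ ka /\ inj ka H /\
  ((forall a b, a ∊ H -> b ∊ H -> a ∊ b -> opair a b ∊ c) \/
   (forall a b, a ∊ H -> b ∊ H -> a ∊ b -> ~ opair a b ∊ c)).
Proof.
  intros R D K. pose proof (Reg_Ord R) as O. pose proof (Reg_Limit R) as L.
  set (A := fun nu s => union (repl nu (fun e => succ (app s e)))).
  assert (DA : DT (fun v => A (v 0) (v 1))) by (unfold A; df).
  assert (inA : forall nu s z, z ∊ A nu s <-> exists e, e ∊ nu /\ z ∊ succ (app s e)).
  { intros nu s z. unfold A. rewrite in_union. split.
    - intros (y & Y & B). rewrite in_repl in B by df. destruct B as (e & E & ->). eauto.
    - intros (e & E & B). exists (succ (app s e)). rewrite in_repl by df. eauto. }
  set (Phi := fun nu s x => ~ x ∊ A nu s /\ forall al, al ∊ A nu s -> (opair al x ∊ c <-> dd al)).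
  assert (DP : Df (fun v => Phi (v 0) (v 1) (v 2))) by (unfold Phi; df).
  assert (Ain : forall nu s, nu ∊ ka -> (forall e, e ∊ nu -> app s e ∊ ka) -> A nu s ∊ ka).
  { intros nu s N M. destruct (@small_class V ka nu (fun e => succ (app s e))) as (b & B1 & B2). df. apply R, N.
    intros e E. apply Limit_succ; auto. apply Ord_sub_in with b; auto.
    - apply Ord_union. intros x X. rewrite in_repl in X by df. destruct X as (e & E & ->). apply Ord_succ, (Ord_in O (M e E)).
    - intros z Z. apply inA in Z as (e & E & Z). apply (Ord_trans (Ord_in O B1) Z (B2 e E)). }
  destruct (@dep_choice V ac ka ka Phi DP O) as (s & Ms & Hs).
  { intros nu s N M _. destruct (K (A nu s)) as (be & B1 & B2 & B3). apply Ain; auto. apply M. exists be. split; auto. split; auto. }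
  assert (Hs' : forall nu, nu ∊ ka -> Phi nu s (app s nu)).
  { intros nu N. specialize (Hs nu N). replace (A nu (lam nu (app s))) with (A nu s) in Hs; [|].
    - unfold Phi in *. replace (A nu s) with (A nu (lam nu (app s))); auto.
      apply set_ext. intros z. rewrite !inA. split; intros (e & E & Z); exists e; split; auto; rewrite app_lam in *; auto; df.
    - apply set_ext. intros z. rewrite !inA. split; intros (e & E & Z); exists e; split; auto; rewrite app_lam in *; auto; df. }
  assert (Aok : forall e nu, e ∊ nu -> app s e ∊ A nu s) by (intros e nu E; apply inA; exists e; split; auto; apply in_succ; auto).
  assert (inc : forall e nu, e ∊ nu -> nu ∊ ka -> app s e ∊ app s nu).
  { intros e nu E N. destruct (Hs' nu N) as [Q _]. assert (Ak : A nu s ∊ ka). { apply Ain; auto. intros e' E'. apply Ms. apply (Ord_trans O E' N). }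
    apply Ord_not_in in Q; [|apply (Ord_in O), Ms, N|apply (Ord_in O Ak)]. apply Q, Aok, E. }
  assert (sinj : forall x y, x ∊ ka -> y ∊ ka -> app s x = app s y -> x = y).
  { intros x y X Y E. destruct (Ord_trich (Ord_in O X) (Ord_in O Y)) as [Q|[Q|Q]]; auto; exfalso; pose proof (inc _ _ Q) as Z.
    rewrite E in Z. apply (not_in_self (Z Y)). rewrite E in Z. apply (not_in_self (Z X)). }
  assert (key : forall e nu, e ∊ ka -> nu ∊ ka -> app s e ∊ app s nu -> (opair (app s e) (app s nu) ∊ c <-> dd (app s e))).
  { intros e nu E N Q. apply Hs'; auto. apply Aok. destruct (Ord_trich (Ord_in O E) (Ord_in O N)) as [Z|[Z|Z]]; auto.
    subst. destruct (not_in_self Q). destruct (not_in_2 Q (inc _ _ Z E)). }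
  set (I1 := sep ka (fun nu => dd (app s nu))). set (I0 := sep ka (fun nu => ~ dd (app s nu))).
  assert (big : forall I, I ⊆ ka -> ~ small ka I -> inj ka (repl I (app s))).
  { intros I Ik N. destruct (@card_exists V ac I) as (k & C & K1 & K2). apply inj_trans with k.
    - apply inj_sub, Ord_not_in; auto. apply C. intros Q. apply N. apply small_inj with k; auto. apply R, Q.
    - apply (inj_trans K2). apply inj_intro with (app s). df. intros x X. rewrite in_repl by df; eauto. intros; apply sinj; auto. }
  assert (S1 : I1 ⊆ ka) by (intros z Z; unfold I1 in Z; rewrite in_sep in Z by df; tauto).
  assert (S0 : I0 ⊆ ka) by (intros z Z; unfold I0 in Z; rewrite in_sep in Z by df; tauto).
  assert (sub : forall I, I ⊆ ka -> repl I (app s) ⊆ ka).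
  { intros I Ik z Z. rewrite in_repl in Z by df. destruct Z as (x & X & ->). apply Ms; auto. }
  destruct (classic (small ka I1)) as [Q|Q].
  - exists (repl I0 (app s)). split; auto. split.
    + apply big; auto. intros Q'. apply (small_not_inj L (small_cup L Q Q')). apply inj_sub. intros z Z. apply in_cup.
      unfold I1, I0. rewrite !in_sep by df. destruct (classic (dd (app s z))); auto.
    + right. intros a b A1 B1 AB. rewrite in_repl in A1, B1 by df. destruct A1 as (x & X & ->), B1 as (y & Y & ->).
      intros Z. apply key in Z; auto. unfold I0 in X. rewrite in_sep in X by df. tauto.
  - exists (repl I1 (app s)). split; auto. split; auto. left.
    intros a b A1 B1 AB. rewrite in_repl in A1, B1 by df. destruct A1 as (x & X & ->), B1 as (y & Y & ->).
    apply key; auto. unfold I1 in X. rewrite in_sep in X by df. tauto.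
Qed.
End Homogeneous.

(** * The partition property in the extension *)

Section PreserveWC.
Context {V : model} {ac : AC V}.
Variable kap : V.
Hypothesis wc : WC kap.
Hypothesis gch : @GCHm V.
Variable X : gext (PP kap) (LE kap) emp.
Implicit Types (a b c d f g h k p q r s t u w x y z : V).
Notation P := (PP kap).
Notation G := (gG X).
Notation j := (gj X).
Notation Fmem := (forces_mem (@mem V) (PP kap) (LE kap)).
Notation jmem := (j_mem (@jI V kap X) (@jJ V kap X)).
Notation jopair := (j_opair (@jI V kap X)).
Let Rk := WC_Reg wc.
Let Ok := ka_Ord wc.
Let Lk := ka_Limit wc.

Theorem WC_preserved : WC (j kap).
Proof.
  pose proof (@jI V kap X) as jI'. pose proof (@jJ V kap X) as jJ'.
  pose proof (Reg_preserved gch X Rk) as Rj. pose proof (Reg_Ord Rj) as Oj.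
  split; [apply Reg_Card, Rj|]. split. { rewrite <- (j_om jI' jJ'). apply jmem, wc. }
  intros c.
  destruct (gv_surj c) as (t & Et).
  assert (Ie : exists e, Inj e (prod P kap) kap).
  { apply inj_trans with (prod kap kap); [|apply (pair_ka wc)]. apply prod_inj. apply (PP_inj wc gch). apply inj_sub; intros z; auto. }
  assert (Ic : exists e, Inj e (prod P two) kap).
  { apply inj_trans with (prod kap kap); [|apply (pair_ka wc)]. apply prod_inj. apply (PP_inj wc gch). apply inj_sub, (two_ka wc). }
  destruct Ie as (e & He), Ic as (cc & Hcc).
  destruct (guide wc gch t e Hcc) as (Af & If & FA & FI & gd).
  (* The second components of the tasks are made into a set, so that the extension has access to
     them through [j]. *)
  set (TK := lam kap (fun xi => snd (tsk kap e xi))).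
  assert (FT : Fn TK kap) by (apply Fn_lam; df).
  assert (TKa : forall xi, xi ∊ kap -> app TK xi = snd (tsk kap e xi)) by (intros xi Hx; unfold TK; rewrite app_lam; auto; df).
  (* The least task about [al] whose stable lower part lies in the generic filter; its recorded
     colour is the guess at [al]. It exists by density, as every condition occurs in a task about
     [al] and is extended by that task's stable part. *)
  set (et := fun al : gN X => mu (fun e : gN X => e ∊ j kap /\ app (j TK) e = al /\ app (j Af) e ∊ Gam X)).
  assert (Det : DT (fun v => et (v 0))) by (unfold et; df).
  assert (ets : forall al, al ∊ kap -> exists eta, eta ∊ kap /\ et (j al) = j eta /\ snd (tsk kap e eta) = al /\ G (app Af eta)).
  { intros al A.
    destruct (@mu_spec (gN X) (fun e : gN X => e ∊ j kap /\ app (j TK) e = j al /\ app (j Af) e ∊ Gam X)) as (_ & (M1 & M2 & M3) & _). df.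
    - destruct (@G_meet V kap X (fun s => exists eta, eta ∊ kap /\ snd (tsk kap e eta) = al /\ app Af eta ⊆ s /\ app Af eta ∊ P) emp) as (s & S1 & _ & eta & E1 & E2 & E3 & E4). df. apply G_emp.
      { intros p Hp _. destruct (tsk_surj He Hp A) as (eta & E1 & E2). destruct (PP_bounded wc Hp) as (ga & G1 & G2).
        destruct (gd (succ eta) ga) as (be & q & B1 & B2 & B3 & B4 & B5 & B6); auto. apply Limit_succ; auto.
        destruct (B6 eta) as (C1 & C2 & _). apply in_succ; auto. exists (app Af eta). split; auto. rewrite E2, fst_opair in C2. split.
        - apply C2. apply in_LoE. split; auto. intros z Z. apply (Ord_trans (Ord_in Ok B1) (G2 z Z) B3).
        - exists eta. rewrite E2, snd_opair. split; auto. split; auto. split; auto. intros z; auto. }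
      exists (j eta). split. apply (j_Ord jI' jJ'), (Ord_in Ok E1). split. apply jmem; auto.
      rewrite (j_app jI' jJ' FT E1), (j_app jI' jJ' FA E1), TKa by auto. split. congruence. apply gj_Gam. apply (G_sub S1 E3).
    - fold (et (j al)) in M1, M2, M3. apply jI' in M1 as (eta & E1 & E2). rewrite E2 in M2, M3.
      rewrite (j_app jI' jJ' FT E1), TKa in M2 by auto. rewrite (j_app jI' jJ' FA E1), gj_Gam in M3. apply jJ' in M2. eauto 6. }
  apply (@homogeneous_of_guess (gN X) _ (j kap) c (fun al => app (j If) (et al) = j (one (V := V)))); auto. df.
  intros a Ha. apply jI' in Ha as (a0 & A0 & ->).
  (* Since [kap] stays regular, the tasks selected for all [al] below [a0] lie below one [xs], so a
     single upper part [q] in [G] settles all their colours. *)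
  destruct (@small_class (gN X) (j kap) (j a0) et) as (b & B1 & B2); auto. apply Rj, jmem, A0.
  { intros al Hal. apply jI' in Hal as (al0 & A1 & ->). destruct (ets al0) as (eta & E1 & E2 & _). apply (Ord_trans Ok A1 A0). rewrite E2. apply jmem; auto. }
  apply jI' in B1 as (xs & Xs & ->).
  destruct (@G_meet V kap X (fun s => exists be q, be ∊ kap /\ q ⊆ s /\ a0 ∊ be /\ forall eta, eta ∊ xs -> good_task kap t e Af If be q eta) emp) as (s & S1 & _ & be & q & Q1 & Q2 & Q3 & Q5). df. apply G_emp.
  { intros p Hp _. destruct (PP_bounded wc Hp) as (g1 & P1 & P2).
    assert (mx : forall x y, x ∊ kap -> y ∊ kap -> exists w, w ∊ kap /\ x ∊ w /\ y ∊ w).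
    { intros x y Hx Hy. destruct (Ord_le (Ord_in Ok Hx) (Ord_in Ok Hy)) as [Q|Q].
      - exists (succ y). split. apply Limit_succ; auto. split; [|apply in_succ; auto]. apply Ord_sub_in with y; auto. apply (Ord_in Ok Hx). apply Ord_succ, (Ord_in Ok Hy). apply in_succ; auto.
      - exists (succ x). split. apply Limit_succ; auto. split; apply in_succ; auto. }
    destruct (mx g1 a0 P1 A0) as (g3 & N1 & N2 & N3).
    destruct (gd xs g3 Xs N1) as (be & q & B1 & C2 & C3 & C4 & C5 & C6). pose proof (Ord_in Ok B1) as Ob.
    assert (up : forall x, x ∊ g3 -> x ∊ be) by (intros x Hx; apply (Ord_trans Ob Hx C3)).
    exists (cup p q). split. apply (LoHi_cup (be := be) Hp C2); auto. { intros z Z. apply (Ord_trans Ob (P2 z Z)). auto. }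
    split. intros z Z; apply in_cup; auto. exists be, q. split; auto. split. intros z Z; apply in_cup; auto. split; auto. }
  assert (Gq : G q) by apply (G_sub S1 Q2).
  exists (j be). split. apply jmem; auto. split. { rewrite jmem. apply (not_in_2 Q3). }
  intros al Hal. pose proof (B2 al Hal) as Hb. apply jI' in Hal as (al0 & A1 & ->).
  destruct (ets al0) as (eta & E1 & E2 & E3 & E4). apply (Ord_trans Ok A1 A0). rewrite E2 in Hb |- *. rewrite jmem in Hb.
  destruct (Q5 eta Hb) as (_ & _ & C3 & C4 & C5). rewrite (j_app jI' jJ' FI E1). rewrite <- jopair, Et, in_gv. rewrite E3 in C4, C5.
  pose proof (G_cup E4 Gq) as Gc. split.
  - intros (p & P1 & P2). f_equal. apply NNPP. intros N. destruct (G_dir Gc P1) as (r & R1 & R2 & R3).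
    apply (C5 N r); auto. apply (G_P R1). apply (Fm_up (G_P P1) (G_P R1) R3 P2).
  - intros Q. apply jJ' in Q. eauto.
Qed.
End PreserveWC.

(** * Set-theoretic notions read in a model *)

Section Bridge2.
Context {V : model}.
Implicit Types (a b c d f g h k l m p q r s t u w x y z : V).
Let T := truth (@mem V).

Lemma omega_iff w : @is_omega T w <-> w = om.
Proof.
  split.
  - intros [L N]. apply sub_antisym; [|apply om_least, L]. apply Ord_not_in. apply Ord_om. apply L. intros K. apply (N om K), Limit_om.
  - intros ->. apply om_spec.
Qed.
Lemma function_iff f a b : @is_function T f a b <-> Maps f a b.
Proof.
  split.
  - intros [A B]. assert (F : Fn f a).
    { apply Fn_intro.
      - intros z Z. destruct (A z Z) as (x & y & X & Y & E). apply opair_iff in E. exists x, y. auto.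
      - intros x X. destruct (B x X) as (y & Y & U). apply opair_in_iff in Y. exists y. split; auto. intros y' Y'. symmetry. apply U, opair_in_iff, Y'. }
    split; auto. intros x X. assert (Z : opair x (app f x) ∊ f) by (apply (Fn_opair _ _ F); auto).
    destruct (A _ Z) as (x' & y & X' & Y & E). apply opair_iff, opair_inj in E as [_ ->]. auto.
  - intros [F M]. split.
    + intros z Z. apply (Fn_in z F) in Z as (x & X & ->). exists x, (app f x). simpl. split; auto. split; [apply M; auto|]. apply opair_iff; auto.
    + intros x X. exists (app f x). split. apply opair_in_iff, (Fn_opair _ _ F); auto. intros y' Y. apply opair_in_iff, (Fn_opair _ _ F) in Y. apply Y.
Qed.
Lemma bijection_iff f a b : @is_bijection T f a b <-> Bij f a b.
Proof.
  unfold is_bijection. split.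
  - intros (A & B & C). apply function_iff in A. pose proof (proj1 A) as F. split; [split; auto|].
    + intros x y X Y E. apply (B x y (app f x)); apply opair_in_iff, (Fn_opair _ _ F); auto.
    + intros y Y. destruct (C y Y) as (x & X). apply opair_in_iff, (Fn_opair _ _ F) in X as [X ->]. eauto.
  - intros ((A & B) & C). pose proof (proj1 A) as F. split. apply function_iff; auto. split.
    + intros x x' y X Y. apply opair_in_iff, (Fn_opair _ _ F) in X as [X E], Y as [Y E']. apply B; auto; congruence.
    + intros y Y. destruct (C y Y) as (x & X & <-). exists x. apply opair_in_iff, (Fn_opair _ _ F). auto.
Qed.
Lemma equinum_iff a b : @equinumerous T a b <-> inj a b /\ inj b a.
Proof.
  split.
  - intros (f & F). apply bijection_iff in F as (I & S). split; [exists f; auto|]. apply inj_intro with (pre f a). df.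
    + intros y Y. destruct (S y Y) as (x & X & <-). rewrite (pre_app I X); auto.
    + intros x y X Y. destruct (S x X) as (x' & X' & <-), (S y Y) as (y' & Y' & <-). rewrite (pre_app I X'), (pre_app I Y'). congruence.
  - intros [A B]. destruct (cantor_bernstein A B) as (f & F). exists f. apply bijection_iff, F.
Qed.
Lemma cardinal_iff k : @cardinal T k <-> Card k.
Proof.
  split.
  - intros [O H]. split; auto. intros a A K. apply (H a A). apply equinum_iff. split; auto. apply inj_sub, (proj1 O a A).
  - intros [O H]. split; auto. intros a A K. apply equinum_iff in K. apply (H a A). tauto.
Qed.
Lemma infinite_iff k : @infinite_cardinal T k <-> Card k /\ om ⊆ k.
Proof.
  unfold infinite_cardinal. split.
  - intros (C & w & W & K). apply cardinal_iff in C. apply omega_iff in W as ->. split; auto. apply Ord_sub. apply Ord_om. apply C. simpl in K. intuition.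
  - intros (C & K). apply Ord_sub in K; [|apply Ord_om|apply C]. split. apply cardinal_iff, C. exists om. split. apply omega_iff; auto. simpl; intuition.
Qed.
Lemma uncountable_iff k : @uncountable_cardinal T k <-> Card k /\ om ∊ k.
Proof.
  unfold uncountable_cardinal. split.
  - intros (C & w & W & K). apply cardinal_iff in C. apply omega_iff in W as ->. auto.
  - intros (C & K). split. apply cardinal_iff, C. exists om. split; auto. apply omega_iff; auto.
Qed.
Lemma powerset_iff p x : @is_powerset T p x <-> p = pow x.
Proof.
  split.
  - intros H. apply set_ext. intros z. rewrite in_pow. apply H.
  - intros -> z. simpl. rewrite in_pow. unfold subset, sub; simpl; tauto.
Qed.
Lemma card_pow2_iff m k : @is_card_pow2 T m k <-> Card m /\ inj (pow k) m /\ inj m (pow k).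
Proof.
  unfold is_card_pow2. split.
  - intros (C & p & A & B). apply cardinal_iff in C. apply powerset_iff in A as ->. apply equinum_iff in B. auto.
  - intros (C & A). split. apply cardinal_iff, C. exists (pow k). split. apply powerset_iff; auto. apply equinum_iff; auto.
Qed.
Lemma cofinal_iff f l a : Ord a -> (@is_cofinal_map T f l a <-> Maps f l a /\ ~ exists c, c ∊ a /\ forall x, x ∊ l -> app f x ∊ c).
Proof.
  intros O. unfold is_cofinal_map. split.
  - intros [A B]. apply function_iff in A. split; auto. intros (c & C & K). destruct (B c C) as (y & z & Z & E).
    apply opair_in_iff, (Fn_opair _ _ (proj1 A)) in Z as [Y ->]. specialize (K y Y). simpl in E. destruct E as [E|E].
    rewrite <- E in K. apply (not_in_self K). apply (not_in_2 K E).
  - intros [A B]. split. apply function_iff, A. intros x X. apply NNPP. intros N. apply B. exists x. split; auto. intros y Y.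
    destruct (Ord_trich (Ord_in O (proj2 A y Y)) (Ord_in O X)) as [Q|[Q|Q]]; auto; destruct N; exists y, (app f y);
    (split; [apply opair_in_iff, (Fn_opair _ _ (proj1 A)); auto|simpl; auto]).
Qed.
(** A cofinal map is a counterexample to smallness, so cofinality is expressed by the notion for
    which preservation has been proved. *)
Lemma cof_iff l a : Ord a -> (@is_cof T l a <-> Ord l /\ ~ small a l /\ forall b, b ∊ l -> small a b).
Proof.
  intros O. assert (K : forall b, (exists f, @is_cofinal_map T f b a) <-> ~ small a b).
  { intros b. split.
    - intros (f & F) S. apply cofinal_iff in F as [M N]; auto.
    - intros N. apply not_all_ex_not in N as (f & F). apply imply_to_and in F as [F1 F2]. exists f. apply cofinal_iff; auto. }
  unfold is_cof. split.
  - intros (A & B & C). split; auto. split. apply K, B. intros b Hb. apply NNPP. intros N. apply (C b Hb), K, N.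
  - intros (A & B & C). split; auto. split. apply K, B. intros b Hb N. apply K in N. apply N, C, Hb.
Qed.
Lemma regular_iff k : @regular_cardinal T k <-> Reg k.
Proof.
  unfold regular_cardinal. split.
  - intros (A & B). apply infinite_iff in A as (C & I). apply cof_iff in B; [|apply C]. split. apply Card_Limit; auto. apply B.
  - intros R. split. apply infinite_iff. split. apply Reg_Card, R. apply Reg_om_sub, R. apply cof_iff. apply R. split. apply R. split; [|apply R].
    intros S. apply (small_not_inj (proj1 R) S). apply inj_sub. intros z; auto.
Qed.
Lemma empty_iff x : @is_empty T x <-> x = emp.
Proof.
  split. intros H. destruct (emp_or x) as [->|(y & Y)]; auto. destruct (H y Y). intros -> z Z. apply (in_emp Z).
Qed.
Lemma succ_iff s x : @is_succ T s x <-> s = succ x.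
Proof.
  split. intros H. apply set_ext. intros z. rewrite in_succ. apply H. intros -> z. simpl. rewrite in_succ. tauto.
Qed.
Lemma two_iff t : @is_two T t <-> t = two.
Proof.
  split.
  - intros (e & o & A & B & C). apply empty_iff in A as ->. apply succ_iff in B as ->. apply succ_iff in C as ->. reflexivity.
  - intros ->. exists emp, (succ emp). rewrite empty_iff, !succ_iff. simpl. auto.
Qed.

Definition dbl k := sep (pow k) (fun z => exists a b, a ∊ k /\ b ∊ k /\ a <> b /\ z = upair a b).
Lemma in_dbl k z : z ∊ dbl k <-> exists a b, a ∊ k /\ b ∊ k /\ a <> b /\ z = upair a b.
Proof.
  unfold dbl. rewrite in_sep by df. split; [tauto|]. intros H. split; auto. destruct H as (a & b & A & B & _ & ->). apply in_pow.
  intros w W. apply in_upair in W as [->| ->]; auto.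
Qed.
Lemma doubletons_iff s k : @is_doubletons T s k <-> s = dbl k.
Proof.
  split.
  - intros H. apply set_ext. intros z. rewrite in_dbl. split.
    + intros Z. apply H in Z as (a & b & A & B & C & D). apply upair_iff in D. eauto 8.
    + intros (a & b & A & B & C & ->). apply H. exists a, b. simpl. split; auto. split; auto. split; auto. apply upair_iff; auto.
  - intros -> z. simpl. rewrite in_dbl. split.
    + intros (a & b & A & B & C & ->). exists a, b. split; auto. split; auto. split; auto. apply upair_iff; auto.
    + intros (a & b & A & B & C & D). apply upair_iff in D. eauto 8.
Qed.
Lemma upair_sym a b : upair a b = upair b a.
Proof. apply set_ext. intros z. rewrite !in_upair. tauto. Qed.
Lemma one_neq_emp : one <> (emp : V).
Proof. intros E. apply (@in_emp V emp). rewrite <- E at 2. apply in_succ; auto. Qed.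

Lemma weakly_compact_WC k : @weakly_compact T k -> WC k.
Proof.
  intros [A B]. apply uncountable_iff in A as [C I]. split; auto. split; auto. intros c.
  set (f := lam (dbl k) (fun z => ite (exists a b, a ∊ b /\ z = upair a b /\ opair a b ∊ c) one emp)).
  assert (Ff : Fn f (dbl k)) by (apply Fn_lam; df).
  assert (fE : forall z, z ∊ dbl k -> app f z = ite (exists a b, a ∊ b /\ z = upair a b /\ opair a b ∊ c) one emp) by (intros z Z; unfold f; rewrite app_lam; auto; df).
  destruct (B (dbl k) two f) as (H & H1 & H2 & i & Hi & H3). apply doubletons_iff; auto. apply two_iff; auto.
  { apply function_iff. split; auto. intros z Z. rewrite fE by auto. unfold ite. destruct excluded_middle_informative; apply in_two; auto. }
  exists H. split. exact H1. split. { apply equinum_iff in H2. tauto. }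
  assert (K : forall a b, a ∊ H -> b ∊ H -> a ∊ b -> app f (upair a b) = i /\ upair a b ∊ dbl k).
  { intros a b X Y Z. assert (N : a <> b) by (intros ->; apply (not_in_self Z)).
    pose proof (H3 a b (upair a b) X Y N (proj2 (upair_iff _ _ _) eq_refl)) as Q. apply opair_in_iff, (Fn_opair _ _ Ff) in Q as [Q1 Q2]. auto. }
  apply in_two in Hi as [->| ->].
  - right. intros a b X Y Z Q. destruct (K a b X Y Z) as [K1 K2]. rewrite fE, ite_true in K1 by eauto 6. apply (one_neq_emp K1).
  - left. intros a b X Y Z. destruct (K a b X Y Z) as [K1 K2]. rewrite fE in K1 by auto. unfold ite in K1. destruct excluded_middle_informative as [E|E].
    + destruct E as (a' & b' & A' & E & Q). apply upair_inj in E as [[-> ->]|[-> ->]]; auto. destruct (not_in_2 Z A').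
    + symmetry in K1. destruct (one_neq_emp K1).
Qed.

Lemma WC_weakly_compact k : WC k -> @weakly_compact T k.
Proof.
  intros (C & I & B). split. apply uncountable_iff; auto. intros s t f A1 A2 A3.
  apply doubletons_iff in A1 as ->. apply two_iff in A2 as ->. apply function_iff in A3. pose proof (proj1 A3) as Ff.
  destruct (B (sep (prod k k) (fun z => app f (upair (fst z) (snd z)) = one))) as (H & H1 & H2 & H3).
  exists H. split; [exact H1|]. split. { apply equinum_iff. split; auto. apply inj_sub, H1. }
  assert (D : forall a b, a ∊ H -> b ∊ H -> a <> b -> upair a b ∊ dbl k) by (intros a b X Y N; apply in_dbl; eauto 8).
  assert (Q : forall a b, a ∊ H -> b ∊ H -> (opair a b ∊ sep (prod k k) (fun z => app f (upair (fst z) (snd z)) = one) <-> app f (upair a b) = one)).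
  { intros a b X Y. rewrite in_sep by df. rewrite opair_in_prod, fst_opair, snd_opair. split; [tauto|]. auto. }
  assert (W : forall i, (forall a b, a ∊ H -> b ∊ H -> a ∊ b -> app f (upair a b) = i) -> forall a b z, a ∊ H -> b ∊ H -> a <> b -> @is_upair T z a b -> @opair_in T z i f).
  { intros i K a b z X Y N E. apply upair_iff in E as ->. apply opair_in_iff, (Fn_opair _ _ Ff). split; auto.
    destruct (Ord_trich (Ord_in (proj1 C) (H1 _ X)) (Ord_in (proj1 C) (H1 _ Y))) as [Z|[Z|Z]]; [|tauto|].
    symmetry; auto. rewrite upair_sym. symmetry; auto. }
  destruct H3 as [H3|H3].
  - exists one. split. apply in_two; auto. exact (W one (fun a b X Y Z => proj1 (Q a b X Y) (H3 a b X Y Z))).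
  - exists emp. split. apply in_two; auto. refine (W emp _). intros a b X Y Z. assert (N : a <> b) by (intros ->; apply (not_in_self Z)).
    pose proof (proj2 A3 _ (D a b X Y N)) as J. apply in_two in J as [J|J]; auto. exfalso. apply (H3 a b X Y Z). apply Q; auto.
Qed.
End Bridge2.

Section Bridge3.
Context {V : model} {ac : AC V}.
Implicit Types (a b c d f g h k l m p q r s t u w x y z : V).
Let T := truth (@mem V).
Lemma card_succ_iff m k : @is_card_succ T m k <-> Ord k /\ m = cs k.
Proof.
  unfold is_card_succ. split.
  - intros (A & B & C). apply cardinal_iff in A. split. apply (Ord_in (proj1 A) B). apply cs_unique; auto.
    intros n Cn K. apply (C n); auto. apply cardinal_iff, Cn.
  - intros (O & ->). destruct (cs_spec O) as (C1 & C2 & C3). split. apply cardinal_iff, C1. split; auto.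
    intros n Cn K. apply cardinal_iff in Cn. apply (C3 n Cn K).
Qed.
Lemma cs_le_pow k : Ord k -> inj (cs k) (pow k).
Proof.
  intros O. destruct (@card_exists V ac (pow k)) as (m & C & K1 & K2). apply inj_trans with m; auto. apply inj_sub.
  apply cs_spec; auto. apply NNPP. intros Q. apply (@cantor V k). apply (inj_trans K1), inj_sub, Ord_not_in; auto. apply C.
Qed.
Lemma gch_at_iff k : Ord k -> (@gch_at T k <-> inj (pow k) (cs k)).
Proof.
  intros O. unfold gch_at. split.
  - intros (m & A & B). apply card_succ_iff in A as [_ ->]. apply card_pow2_iff in B. tauto.
  - intros H. exists (cs k). split. apply card_succ_iff; auto. apply card_pow2_iff. split. apply cs_spec; auto. split; auto. apply cs_le_pow; auto.
Qed.
Lemma GCH_GCHm : @GCH T -> @GCHm V.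
Proof.
  intros H k C I. apply gch_at_iff. apply C. apply H. apply infinite_iff; auto.
Qed.
Lemma cs_mono x y : Ord x -> Ord y -> x ⊆ y -> cs x ⊆ cs y.
Proof.
  intros Ox Oy S. destruct (cs_spec Ox) as (_ & _ & X). destruct (cs_spec Oy) as (Y1 & Y2 & _). apply X; auto.
  apply Ord_sub_in with y; auto. apply Y1.
Qed.
End Bridge3.

(** * The required properties in the extension *)

Section Final.
Context {V : model} {ac : AC V}.
Variable kap : V.
Hypothesis wc : WC kap.
Hypothesis gch : @GCHm V.
Variable X : gext (PP kap) (LE kap) emp.
Notation j := (gj X).
Notation jmem := (j_mem (@jI V kap X) (@jJ V kap X)).
Let Rk := WC_Reg wc.
Let Ok := ka_Ord wc.
Let Lk := ka_Limit wc.
Let TN := truth (@mem (gN X)).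

Lemma Reg_gN (d : gN X) : Reg d -> exists d0, Reg d0 /\ d = j d0.
Proof.
  intros R. destruct (gN_Ord (Easton_forcing kap) (Reg_Ord R)) as (d0 & O & ->). exists d0. split; auto.
  apply (j_Reg_inv (@jI V kap X) (@jJ V kap X) R).
Qed.

(** There are only [kap] many bits altogether, so at and above [kap] the count of nice names gives
    the same bound as in the ground model. *)
Lemma gch_above d : Reg d -> d = kap \/ kap ∊ d -> inj (pow (j d)) (cs (j d)).
Proof.
  intros R K. pose proof (Reg_Ord R) as O. destruct (cs_spec O) as (C1 & C2 & C3).
  assert (kd : kap ⊆ d) by (destruct K as [->|K]; [intros z; auto|apply (proj1 O kap K)]).
  rewrite <- (cs_preserved gch X R). apply pow_bounded; auto. apply Reg_cs. apply Reg_Card, R. apply Reg_om_sub, R.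
  apply inj_trans with (XX kap). apply inj_sub. intros z Z. apply in_low in Z; tauto.
  apply inj_trans with kap. apply (XX_inj wc). apply inj_sub. intros z Z. apply (Ord_trans (proj1 C1) (kd z Z) C2).
Qed.

(** The number of bits at coordinates up to [d] is at most [cs (cs d)], which bounds the nice names;
    the new subsets at coordinate [d] attain it. They exist because [kap] is a limit of cardinals,
    so that [cs (cs d)] fits inside [kap]. *)
Lemma pow_below d : Reg d -> d ∊ kap -> inj (pow (j d)) (cs (cs (j d))) /\ inj (cs (cs (j d))) (pow (j d)).
Proof.
  intros R K. pose proof (Reg_Ord R) as O.
  assert (R1 : Reg (cs d)) by (apply Reg_cs; [apply Reg_Card|apply Reg_om_sub]; auto).
  assert (R2 : Reg (cs (cs d))) by (apply Reg_cs; [apply Reg_Card|apply Reg_om_sub]; auto).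
  destruct (cs_spec O) as (_ & C2 & _). destruct (cs_spec (Reg_Ord R1)) as (_ & C3 & _).
  assert (dl : d ∊ cs (cs d)) by apply (Ord_trans (Reg_Ord R2) C2 C3).
  rewrite <- (cs_preserved gch X R), <- (cs_preserved gch X R1). split.
  - apply pow_bounded; auto. set (la := cs (cs d)) in *. pose proof (Reg_Ord R2) as O2.
    assert (pl : inj (prod la la) la) by (apply pairing; [apply Reg_Card|apply Reg_om_sub]; auto).
    assert (il : inj la la) by (apply inj_sub; intros z; auto).
    apply inj_trans with (prod la (prod (prod la la) two)).
    + apply inj_sub. intros z Z. apply in_low in Z as [Z1 Z2]. apply in_XX in Z1 as (de & ze & i & b & -> & _ & _ & _ & B & Rd & Zz & Hi).
      rewrite fst_opair in Z2. rewrite !opair_in_prod. pose proof (Reg_Ord Rd) as Od.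
      assert (dd : de ⊆ d) by (apply Ord_sub; auto; apply in_succ in Z2; auto).
      assert (da : de ∊ la) by (apply Ord_sub_in with d; auto).
      split; auto. split; auto. split; [|apply (Ord_trans O2 Hi da)].
      apply (cs_mono (x := cs de) (y := cs d)); auto. apply cs_spec; auto. apply (Reg_Ord R1). apply cs_mono; auto.
    + apply inj_trans with (prod la la); auto. apply prod_inj; auto. apply inj_trans with (prod la la); auto. apply prod_inj; auto.
      apply inj_sub. intros z Z. apply in_two in Z as [->| ->]. apply Limit_emp, R2. apply Limit_succ. apply R2. apply Limit_emp, R2.
  - apply new_subsets; auto. apply (proj1 Ok). apply (cs_lt wc), (cs_lt wc), K.
Qed.

Theorem N_strict_levinski : @strict_levinski TN (j kap).
Proof.
  assert (low : forall d : gN X, d ∊ j kap -> Reg d -> inj (pow d) (cs (cs d)) /\ inj (cs (cs d)) (pow d)).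
  { intros d D R. destruct (Reg_gN R) as (d0 & R0 & ->). apply pow_below; auto. apply jmem, D. }
  split; [split; [|split]|split].
  - apply regular_iff, (Reg_preserved gch X Rk).
  - apply gch_at_iff. apply (Reg_Ord (Reg_preserved gch X Rk)). apply gch_above; auto.
  - intros d D R Q. apply regular_iff in R. pose proof (Reg_Ord R) as O. apply gch_at_iff in Q; auto. destruct (low d D R) as [_ L].
    destruct (cs_spec O) as (C1 & C2 & _). destruct (cs_spec (proj1 C1)) as (D1 & D2 & _).
    apply (proj2 D1 _ D2). apply (inj_trans L Q).
  - intros d D R. apply regular_iff in R. pose proof (Reg_Ord R) as O. exists (cs d), (cs (cs d)).
    destruct (cs_spec O) as (C1 & C2 & _). destruct (cs_spec (proj1 C1)) as (D1 & D2 & _).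
    split. apply card_succ_iff; auto. split. apply card_succ_iff. split; auto. apply C1. apply card_pow2_iff. split; auto.
  - intros d D R. apply regular_iff in R. destruct (Reg_gN R) as (d0 & R0 & ->). apply gch_at_iff. apply (Reg_Ord R). apply gch_above; auto.
    simpl in D. destruct D as [D|D]; [left; apply (@jJ V kap X), D|right; apply jmem, D].
Qed.

Theorem N_weakly_compact : @weakly_compact TN (j kap).
Proof. apply WC_weakly_compact, WC_preserved; auto. Qed.

(** The cofinality [l] is regular and stays so, and an old cofinal map [g] stays cofinal. For a map
    [f] on a shorter ordinal, the least indices at which [g] catches up with [f] are bounded by some
    [i0] below [l], and [g] on [i0] is bounded in the ground model. *)
Theorem N_cof l a : Limit a -> @is_cof (truth (@mem V)) l a -> @is_cof TN (j l) (j a).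
Proof.
  intros La H. pose proof (proj1 La) as Oa. apply cof_iff in H as (Ol & H1 & H2); auto.
  pose proof (@jI V kap X) as jI'. pose proof (@jJ V kap X) as jJ'.
  assert (Rl : Reg l) by (apply least_not_small_Reg with a; auto).
  pose proof (Reg_preserved gch X Rl) as Rj.
  pose proof (j_Ord jI' jJ' Oa) as Oja.
  apply not_all_ex_not in H1 as (g & Hg). apply imply_to_and in Hg as [Mg Ng]. pose proof (proj1 Mg) as Fg.
  apply cof_iff; auto. split. apply (Reg_Ord Rj). split.
  - intros S. destruct (S (j g) (j_Maps jI' jJ' Mg)) as (b & B & K). apply jI' in B as (c & C & ->). apply Ng. exists c. split; auto.
    intros x Hx. apply jmem. rewrite <- (j_app jI' jJ' Fg Hx). apply K, jmem, Hx.
  - intros b B f (F1 & F2). apply jI' in B as (b0 & B & ->).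
    set (h := fun x : gN X => mu (fun i : gN X => i ∊ j l /\ ~ app (j g) i ∊ app f x)).
    assert (Dh : DT (fun v => h (v 0))) by (unfold h; df).
    assert (hs : forall x, x ∊ j b0 -> h x ∊ j l /\ ~ app (j g) (h x) ∊ app f x).
    { intros x Hx. apply (@mu_spec (gN X) (fun i : gN X => i ∊ j l /\ ~ app (j g) i ∊ app f x)). df.
      pose proof (F2 x Hx) as Fx. apply jI' in Fx as (y & Y & E). rewrite E.
      apply NNPP. intros N. apply Ng. exists y. split; auto. intros i I. apply NNPP. intros Q. apply N. exists (j i).
      split. apply (j_Ord jI' jJ'), (Ord_in Ol I). split. apply jmem, I. rewrite (j_app jI' jJ' Fg I), jmem. auto. }
    destruct (@small_class (gN X) (j l) (j b0) h) as (i & I & K); auto. apply Rj, jmem, B. intros x Hx; apply hs; auto.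
    apply jI' in I as (i0 & I & ->).
    destruct (@small_class V a i0 (app g)) as (c & C & K'). df. apply H2, I. { intros x Hx. apply Mg. apply (Ord_trans Ol Hx I). }
    exists (j c). split. apply jmem, C. intros x Hx. destruct (hs x Hx) as (_ & N). pose proof (K x Hx) as Kx. apply jI' in Kx as (e & E & Eq).
    rewrite Eq, (j_app jI' jJ' Fg (Ord_trans Ol E I)) in N.
    pose proof (Ord_in Oja (F2 x Hx)) as Of. assert (Oc : Ord (j c)) by (apply (j_Ord jI' jJ'), (Ord_in Oa C)).
    assert (Gc : j (app g e) ∊ j c) by (apply jmem, K', E).
    apply Ord_sub_in with (j (app g e)); auto. apply Ord_not_in; auto. apply (Ord_in Oc Gc).
Qed.
End Final.

(** * Polymorphic notions as formulas *)

Inductive pform : Type :=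
  | pmem (i j : nat)
  | peq (i j : nat)
  | pfalse
  | pimp (f g : pform)
  | pand (f g : pform)
  | por (f g : pform)
  | pall (f : pform)
  | pex (f : pform).

Fixpoint psem (I : interp) (v : nat -> dom I) (f : pform) : tv I :=
  match f with
  | pmem i j => vmem (v i) (v j)
  | peq i j => veq (v i) (v j)
  | pfalse => vfalse
  | pimp f g => vimp (psem v f) (psem v g)
  | pand f g => vand (psem v f) (psem v g)
  | por f g => vor (psem v f) (psem v g)
  | pall f => vall (fun x => psem (push x v) f)
  | pex f => vex (fun x => psem (push x v) f)
  end.

(** One formula serves all interpretations, which makes a polymorphic notion accessible to the
    syntactic truth lemma and to elementarity. *)
Definition Poly (phi : forall I : interp, (nat -> dom I) -> tv I) : Prop :=
  exists f, forall I v, phi I v = psem v f.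

Lemma Poly_mem i j : Poly (fun I v => vmem (v i) (v j)).
Proof. exists (pmem i j); auto. Qed.
Lemma Poly_eq i j : Poly (fun I v => veq (v i) (v j)).
Proof. exists (peq i j); auto. Qed.
Lemma Poly_false : Poly (fun I v => vfalse).
Proof. exists pfalse; auto. Qed.
Lemma Poly_imp phi psi : Poly phi -> Poly psi -> Poly (fun I v => vimp (phi I v) (psi I v)).
Proof. intros (f & F) (g & G). exists (pimp f g). intros. rewrite F, G. auto. Qed.
Lemma Poly_and phi psi : Poly phi -> Poly psi -> Poly (fun I v => vand (phi I v) (psi I v)).
Proof. intros (f & F) (g & G). exists (pand f g). intros. rewrite F, G. auto. Qed.
Lemma Poly_or phi psi : Poly phi -> Poly psi -> Poly (fun I v => vor (phi I v) (psi I v)).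
Proof. intros (f & F) (g & G). exists (por f g). intros. rewrite F, G. auto. Qed.
Lemma Poly_all (phi : forall I : interp, dom I -> (nat -> dom I) -> tv I) :
  Poly (fun I v => phi I (v 0) (tl v)) -> Poly (fun I v => vall (fun x => phi I x v)).
Proof. intros (f & F). exists (pall f). intros. simpl. f_equal. extensionality x. apply (F I (push x v)). Qed.
Lemma Poly_ex (phi : forall I : interp, dom I -> (nat -> dom I) -> tv I) :
  Poly (fun I v => phi I (v 0) (tl v)) -> Poly (fun I v => vex (fun x => phi I x v)).
Proof. intros (f & F). exists (pex f). intros. simpl. f_equal. extensionality x. apply (F I (push x v)). Qed.

Create HintDb poly.
#[global] Hint Resolve Poly_mem Poly_eq Poly_false : poly.
Ltac poly := repeat (cbv beta delta [tl];
  first [ solve [auto with poly nocore] | simple apply Poly_imp | simple apply Poly_and | simple apply Poly_or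
        | simple apply Poly_all | simple apply Poly_ex ]).

Lemma Poly_subset i j : Poly (fun I v => subset (v i) (v j)).
Proof. unfold subset. poly. Qed.
Lemma Poly_is_empty i : Poly (fun I v => is_empty (v i)).
Proof. unfold is_empty. poly. Qed.
Lemma Poly_is_upair i j k : Poly (fun I v => is_upair (v i) (v j) (v k)).
Proof. unfold is_upair. poly. Qed.
#[global] Hint Resolve Poly_subset Poly_is_empty Poly_is_upair : poly.
Lemma Poly_is_opair i j k : Poly (fun I v => is_opair (v i) (v j) (v k)).
Proof. unfold is_opair. poly. Qed.
#[global] Hint Resolve Poly_is_opair : poly.
Lemma Poly_opair_in i j k : Poly (fun I v => opair_in (v i) (v j) (v k)).
Proof. unfold opair_in. poly. Qed.
#[global] Hint Resolve Poly_opair_in : poly.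
Lemma Poly_triple_in i j k l : Poly (fun I v => triple_in (v i) (v j) (v k) (v l)).
Proof. unfold triple_in. poly. Qed.
Lemma Poly_is_succ i j : Poly (fun I v => is_succ (v i) (v j)).
Proof. unfold is_succ. poly. Qed.
Lemma Poly_is_powerset i j : Poly (fun I v => is_powerset (v i) (v j)).
Proof. unfold is_powerset. poly. Qed.
Lemma Poly_is_function i j k : Poly (fun I v => is_function (v i) (v j) (v k)).
Proof. unfold is_function. poly. Qed.
#[global] Hint Resolve Poly_triple_in Poly_is_succ Poly_is_powerset Poly_is_function : poly.
Lemma Poly_equinumerous i j : Poly (fun I v => equinumerous (v i) (v j)).
Proof. unfold equinumerous, is_bijection. poly. Qed.
Lemma Poly_transitive i : Poly (fun I v => transitive (v i)).
Proof. unfold transitive. poly. Qed.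
#[global] Hint Resolve Poly_equinumerous Poly_transitive : poly.
Lemma Poly_ordinal i : Poly (fun I v => ordinal (v i)).
Proof. unfold ordinal. poly. Qed.
#[global] Hint Resolve Poly_ordinal : poly.
Lemma Poly_limit_ordinal i : Poly (fun I v => limit_ordinal (v i)).
Proof. unfold limit_ordinal. poly. Qed.
Lemma Poly_cardinal i : Poly (fun I v => cardinal (v i)).
Proof. unfold cardinal. poly. Qed.
#[global] Hint Resolve Poly_limit_ordinal Poly_cardinal : poly.
Lemma Poly_is_omega i : Poly (fun I v => is_omega (v i)).
Proof. unfold is_omega. poly. Qed.
#[global] Hint Resolve Poly_is_omega : poly.
Lemma Poly_infinite_cardinal i : Poly (fun I v => infinite_cardinal (v i)).
Proof. unfold infinite_cardinal. poly. Qed.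
Lemma Poly_uncountable_cardinal i : Poly (fun I v => uncountable_cardinal (v i)).
Proof. unfold uncountable_cardinal. poly. Qed.
Lemma Poly_is_card_succ i j : Poly (fun I v => is_card_succ (v i) (v j)).
Proof. unfold is_card_succ. poly. Qed.
Lemma Poly_is_card_pow2 i j : Poly (fun I v => is_card_pow2 (v i) (v j)).
Proof. unfold is_card_pow2. poly. Qed.
Lemma Poly_is_cofinal_map i j k : Poly (fun I v => is_cofinal_map (v i) (v j) (v k)).
Proof. unfold is_cofinal_map. poly. Qed.
#[global] Hint Resolve Poly_infinite_cardinal Poly_uncountable_cardinal Poly_is_card_succ Poly_is_card_pow2 Poly_is_cofinal_map : poly.
Lemma Poly_is_cof i j : Poly (fun I v => is_cof (v i) (v j)).
Proof. unfold is_cof. poly. Qed.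
#[global] Hint Resolve Poly_is_cof : poly.
Lemma Poly_regular_cardinal i : Poly (fun I v => regular_cardinal (v i)).
Proof. unfold regular_cardinal. poly. Qed.
Lemma Poly_gch_at i : Poly (fun I v => gch_at (v i)).
Proof. unfold gch_at. poly. Qed.
#[global] Hint Resolve Poly_regular_cardinal Poly_gch_at : poly.
Lemma Poly_GCH : Poly (fun I v => GCH).
Proof. unfold GCH. poly. Qed.
Lemma Poly_is_doubletons i j : Poly (fun I v => is_doubletons (v i) (v j)).
Proof. unfold is_doubletons. poly. Qed.
Lemma Poly_is_two i : Poly (fun I v => is_two (v i)).
Proof. unfold is_two. poly. Qed.
#[global] Hint Resolve Poly_is_doubletons Poly_is_two : poly.
Lemma Poly_weakly_compact i : Poly (fun I v => weakly_compact (v i)).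
Proof. unfold weakly_compact. poly. Qed.
Lemma Poly_strict_levinski i : Poly (fun I v => strict_levinski (v i)).
Proof. unfold strict_levinski, levinski. poly. Qed.
#[global] Hint Resolve Poly_GCH Poly_weakly_compact Poly_strict_levinski : poly.

Definition fnot f := fimp f ffalse.
Fixpoint tr (f : pform) : formula :=
  match f with
  | pmem i j => fmem i j
  | peq i j => feq i j
  | pfalse => ffalse
  | pimp f g => fimp (tr f) (tr g)
  | pand f g => fnot (fimp (tr f) (fnot (tr g)))
  | por f g => fimp (fnot (tr f)) (tr g)
  | pall f => fall (tr f)
  | pex f => fnot (fall (fnot (tr f)))
  end.

Lemma psem_truth M (E : M -> M -> Prop) f :
  forall v, @psem (truth E) v f <-> sat E v (tr f).
Proof.
  induction f; intros v; simpl; try tauto;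
    try (specialize (IHf1 v); specialize (IHf2 v); tauto).
  - split; intros H x; apply IHf, H.
  - split.
    + intros (x & H) K. apply (K x), IHf, H.
    + intros H. apply NNPP. intros K. apply H. intros x Hx. apply K. exists x. apply IHf, Hx.
Qed.

(** * Forced statements from truth in all generic extensions *)

Section PolyForcing.
Context {V : model} (P le one : V) (FN : forcing_notion (@mem V) P le one).
Notation ext := (extends (@mem V) P le).

(** The clauses of [forcing] for ∧, ∨ and ∃ agree with the negative translation [tr], because what
    is forced densely below a condition is forced by it. *)
Lemma psem_forcing f : forall v p, p ∊ P ->
  (@psem (forcing (@mem V) P le) v f p <-> fs P le v (tr f) p).
Proof.
  induction f; intros v p Hp; simpl; try tauto.
  - split; intros H q Hq K; apply IHf2; try apply Hq; apply H; auto; apply IHf1; auto; apply Hq.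
  - rewrite IHf1, IHf2 by auto. split.
    + intros (A & B) q Hq K. apply (K q (ext_refl FN (proj1 Hq)) (fs_mono FN Hq A) q (ext_refl FN (proj1 Hq))).
      apply (fs_mono FN Hq B).
    + intros H.
      assert (D : forall q, ext q p -> exists r, ext r q /\ fs P le v (tr f1) r /\ fs P le v (tr f2) r).
      { intros q Hq. apply NNPP. intros N. apply (H q Hq). intros r Hr A s Hs B. apply N. exists s.
        split. apply (ext_trans FN Hs Hr). split; auto. apply (fs_mono FN Hs A). }
      split; apply (fs_dense FN); auto; intros q Hq; destruct (D q Hq) as (r & A & B & C); eauto.
  - split.
    + intros H q Hq K. apply (fs_dense FN). apply Hq. intros r Hr. destruct (H r (ext_trans FN Hr Hq)) as (s & Hs & [A|A]).
      * destruct (K s). apply (ext_trans FN Hs Hr). apply IHf1; auto. apply Hs.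
      * exists s. split; auto. apply IHf2; auto. apply Hs.
    + intros H q Hq. destruct (classic (exists r, ext r q /\ fs P le v (tr f1) r)) as [(r & A & B)|N].
      * exists r. split; auto. left. apply IHf1; auto. apply A.
      * exists q. split. apply (ext_refl FN), Hq. right. apply IHf2. apply Hq. apply H; auto. intros r A B. apply N. eauto.
  - split; intros H x; apply IHf, H; auto.
  - split.
    + intros H q Hq K. destruct (H q Hq) as (r & Hr & x & A). apply (K x r Hr). apply IHf; auto. apply Hr.
    + intros H q Hq. apply NNPP. intros N. apply (H q Hq). intros x r Hr A. apply N. exists r. split; auto.
      exists x. apply IHf; auto. apply Hr.
Qed.

(** Below any condition [q] some condition forces the statement: take a generic filter through [q],
    where the statement is true, and a common extension of [q] and the condition supplied by the
    truth lemma. *)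
Lemma forced_of_generic {ac : AC V} (en : nat -> V) phi v :
  (forall x, exists n, en n = x) -> Poly phi ->
  (forall X : gext P le one, phi (truth (@mem (gN X))) (fun n => gv X (v n))) ->
  phi (forcing (@mem V) P le) v one.
Proof.
  intros Hen (f & F) H. rewrite F. pose proof (proj1 FN) as H1. apply psem_forcing; auto.
  apply (fs_dense FN); auto. intros q Hq. destruct (gext_exists ac FN Hen (proj1 Hq)) as (X & GX).
  specialize (H X). rewrite F in H. apply psem_truth, g_truth in H as (p & Gp & K).
  destruct (gen_dir (g_gen X) GX Gp) as (r & _ & R1 & R2). exists r. split; auto. apply (fs_mono FN R2 K).
Qed.
End PolyForcing.

Lemma ck_is_check (V : model) (one x : V) : is_check (@mem V) one (ck one x) x.
Proof.
  destruct (tc_spec (sing x)) as (T1 & T2 & _). set (T := tc (sing x)) in *.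
  assert (D : DT (fun v : nat -> V => ck one (v 0))) by df.
  exists T, (lam T (ck one)). split; [|split; [|split; [|split]]].
  - exact T1.
  - apply T2, in_sing; auto.
  - apply opair_in_iff, opair_in_lam; auto. split; auto. apply T2, in_sing; auto.
  - intros y Hy. exists (ck one y). apply opair_in_iff, opair_in_lam; auto.
  - intros y m Hy H z. apply opair_in_iff, opair_in_lam in H as [_ ->]; auto. rewrite in_ck. split.
    + intros (u & Hu & ->). exists u, (ck one u). rewrite opair_in_iff, opair_iff, opair_in_lam by auto.
      split; auto. split; auto. split; auto. apply (T1 y Hy u Hu).
    + intros (u & w & Hu & W & ->%opair_iff). apply opair_in_iff, opair_in_lam in W as [_ ->]; auto. eauto.
Qed.

(** The conclusion as one property of a structure and a point, so that elementarity can carry it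
    back from the countable submodel. *)
Definition has_levinski_extension (M : Type) (E : M -> M -> Prop) (kappa : M) : Prop :=
  exists P le one : M,
    forcing_notion E P le one /\
    cofinality_preserving E P le one /\
    exists kappa' : M,
      is_check E one kappa' kappa /\
      @strict_levinski (forcing E P le) kappa' one /\
      @weakly_compact (forcing E P le) kappa' one.

Lemma countable_case (V : model) (ac : AC V) (en : nat -> V) (kap : V) :
  (forall x, exists n, en n = x) -> WC kap -> @GCHm V -> has_levinski_extension (@mem V) kap.
Proof.
  intros Hen wc gch. exists (PP kap), (LE kap), emp. pose proof (Easton_forcing kap) as FN.
  split; [exact FN|]. split; [|exists (ck emp kap); split; [apply ck_is_check|split]].
  - intros a l La H. exists (ck emp a), (ck emp l). split; [apply ck_is_check|]. split; [apply ck_is_check|].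
    apply (forced_of_generic FN (v := push (ck emp l) (fun _ => ck emp a)) Hen (Poly_is_cof 0 1)).
    intros X. apply (N_cof gch X); auto.
  - apply (forced_of_generic FN (v := fun _ => ck emp kap) Hen (Poly_strict_levinski 0)).
    intros X. apply (N_strict_levinski wc gch X).
  - apply (forced_of_generic FN (v := fun _ => ck emp kap) Hen (Poly_weakly_compact 0)).
    intros X. apply (N_weakly_compact wc gch X).
Qed.

(** * Transfer to a countable elementary submodel *)

(** Unlike [Df], one formula for all structures at once; elementarity needs this uniformity. *)
Definition Udef (phi : forall M : Type, (M -> M -> Prop) -> (nat -> M) -> Prop) : Prop :=
  exists f, forall M E v, phi M E v <-> sat E v f.

Lemma Udef_mem i j : Udef (fun M E v => E (v i) (v j)).
Proof. exists (fmem i j). simpl; tauto. Qed.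
Lemma Udef_eq i j : Udef (fun M E v => v i = v j).
Proof. exists (feq i j). simpl; tauto. Qed.
Lemma Udef_false : Udef (fun M E v => False).
Proof. exists ffalse. simpl; tauto. Qed.
Lemma Udef_imp phi psi : Udef phi -> Udef psi -> Udef (fun M E v => phi M E v -> psi M E v).
Proof. intros (f & F) (g & G). exists (fimp f g). intros. simpl. rewrite F, G. tauto. Qed.
Lemma Udef_all (phi : forall M : Type, (M -> M -> Prop) -> M -> (nat -> M) -> Prop) :
  Udef (fun M E v => phi M E (v 0) (tl v)) -> Udef (fun M E v => forall x, phi M E x v).
Proof.
  intros (f & F). exists (fall f). intros. simpl. split; intros H x.
  - apply F, (H x).
  - apply (F M E (push x v)), H.
Qed.
Lemma Udef_iff phi psi : (forall M E v, phi M E v <-> psi M E v) -> Udef phi -> Udef psi.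
Proof. intros H (f & F). exists f. intros. rewrite <- H. apply F. Qed.
Lemma Udef_and phi psi : Udef phi -> Udef psi -> Udef (fun M E v => phi M E v /\ psi M E v).
Proof.
  intros A B. apply Udef_iff with (fun M E v => (phi M E v -> psi M E v -> False) -> False).
  intros; tauto. repeat apply Udef_imp; auto using Udef_false.
Qed.
Lemma Udef_or phi psi : Udef phi -> Udef psi -> Udef (fun M E v => phi M E v \/ psi M E v).
Proof.
  intros A B. apply Udef_iff with (fun M E v => (phi M E v -> False) -> psi M E v).
  intros; tauto. repeat apply Udef_imp; auto using Udef_false.
Qed.
Lemma Udef_ex (phi : forall M : Type, (M -> M -> Prop) -> M -> (nat -> M) -> Prop) :
  Udef (fun M E v => phi M E (v 0) (tl v)) -> Udef (fun M E v => exists x, phi M E x v).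
Proof.
  intros H. apply Udef_iff with (fun M E v => (forall x, phi M E x v -> False) -> False).
  - intros M E v. split; [|firstorder]. intros A. apply NNPP. intros N. apply A. intros x Hx. eauto.
  - apply Udef_imp; [|apply Udef_false]. apply Udef_all, Udef_imp; [exact H|apply Udef_false].
Qed.
Lemma Udef_sat f (r : nat -> nat) (e : forall M, (nat -> M) -> nat -> M) :
  (forall M v n, e M v n = v (r n)) -> Udef (fun M E v => sat E (e M v) f).
Proof.
  intros H. exists (ren r f). intros M E v. rewrite sat_ren.
  replace (fun n => v (r n)) with (e M v). tauto. extensionality n; apply H.
Qed.
Lemma Udef_truth phi (r : nat -> nat) : Poly phi -> Udef (fun M E v => phi (truth E) (fun n => v (r n))).
Proof.
  intros (f & F). exists (ren r (tr f)). intros M E v. rewrite F, sat_ren. apply psem_truth.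
Qed.

Create HintDb ud.
#[global] Hint Resolve Udef_mem Udef_eq Udef_false : ud.
Ltac ud := repeat (cbv beta delta [tl iff not unique];
  first [ solve [auto with ud nocore] | simple apply Udef_and | simple apply Udef_or | simple apply Udef_ex | simple apply Udef_all | simple apply Udef_imp ]).

Definition sel2 (i j n : nat) : nat := match n with 0 => i | _ => j end.
Definition sel3 (i j k n : nat) : nat := match n with 0 => i | 1 => j | _ => k end.
Definition sel4 (i j k l n : nat) : nat := match n with 0 => i | 1 => j | 2 => k | _ => l end.

Lemma Udef_opair_in i j k : Udef (fun M E v => @opair_in (truth E) (v i) (v j) (v k)).
Proof. apply (Udef_truth (sel3 i j k) (Poly_opair_in 0 1 2)). Qed.
Lemma Udef_is_opair i j k : Udef (fun M E v => @is_opair (truth E) (v i) (v j) (v k)).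
Proof. apply (Udef_truth (sel3 i j k) (Poly_is_opair 0 1 2)). Qed.
Lemma Udef_triple_in i j k l : Udef (fun M E v => @triple_in (truth E) (v i) (v j) (v k) (v l)).
Proof. apply (Udef_truth (sel4 i j k l) (Poly_triple_in 0 1 2 3)). Qed.
Lemma Udef_transitive i : Udef (fun M E v => @transitive (truth E) (v i)).
Proof. apply (Udef_truth (fun _ => i) (Poly_transitive 0)). Qed.
Lemma Udef_limit_ordinal i : Udef (fun M E v => @limit_ordinal (truth E) (v i)).
Proof. apply (Udef_truth (fun _ => i) (Poly_limit_ordinal 0)). Qed.
Lemma Udef_is_omega i : Udef (fun M E v => @is_omega (truth E) (v i)).
Proof. apply (Udef_truth (fun _ => i) (Poly_is_omega 0)). Qed.
Lemma Udef_weakly_compact i : Udef (fun M E v => @weakly_compact (truth E) (v i)).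
Proof. apply (Udef_truth (fun _ => i) (Poly_weakly_compact 0)). Qed.
Lemma Udef_is_cof i j : Udef (fun M E v => @is_cof (truth E) (v i) (v j)).
Proof. apply (Udef_truth (sel2 i j) (Poly_is_cof 0 1)). Qed.
Lemma Udef_GCH : Udef (fun M E v => @GCH (truth E)).
Proof. apply (Udef_truth (fun n => n) Poly_GCH). Qed.
#[global] Hint Resolve Udef_opair_in Udef_is_opair Udef_triple_in Udef_transitive Udef_limit_ordinal Udef_is_omega Udef_weakly_compact Udef_is_cof Udef_GCH : ud.

Lemma Udef_extends i j k l : Udef (fun M E v => extends E (v i) (v j) (v k) (v l)).
Proof. unfold extends. ud. Qed.
#[global] Hint Resolve Udef_extends : ud.
Lemma Udef_name_elem i j k l : Udef (fun M E v => name_elem E (v i) (v j) (v k) (v l)).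
Proof. unfold name_elem. ud. Qed.
#[global] Hint Resolve Udef_name_elem : ud.
Lemma Udef_forces_covers i j k l m n : Udef (fun M E v => forces_covers E (v i) (v j) (v k) (v l) (v m) (v n)).
Proof. unfold forces_covers, dense_below. ud. Qed.
#[global] Hint Resolve Udef_forces_covers : ud.
Lemma Udef_forces_eq i j k l m : Udef (fun M E v => forces_eq E (v i) (v j) (v k) (v l) (v m)).
Proof. unfold forces_eq, forces_eq_graph. ud. Qed.
#[global] Hint Resolve Udef_forces_eq : ud.
Lemma Udef_forces_mem i j k l m : Udef (fun M E v => forces_mem E (v i) (v j) (v k) (v l) (v m)).
Proof. unfold forces_mem, dense_below. ud. Qed.
#[global] Hint Resolve Udef_forces_mem : ud.

(** Definability of the forcing relation, uniformly in the structure. The positions of the poset and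
    of the condition shift at every quantifier over conditions, hence their generality in the
    induction. *)
Lemma Udef_forcing phi (r : nat -> nat) i j k : Poly phi ->
  Udef (fun M E v => phi (forcing E (v i) (v j)) (fun n => v (r n)) (v k)).
Proof.
  intros (f & F). apply Udef_iff with (fun M E v => @psem (forcing E (v i) (v j)) (fun n => v (r n)) f (v k)).
  { intros M E v. rewrite F. tauto. }
  assert (PU : forall M (x : M) v r, push x (fun n => v (r n)) = (fun n => push x v (up r n))).
  { intros. symmetry. apply push_up. }
  clear F phi. revert r i j k. induction f; intros r a b c; simpl.
  - ud.
  - ud.
  - ud.
  - apply Udef_all, Udef_imp; [ud|]. apply Udef_imp.
    apply (IHf1 (fun n => S (r n)) (S a) (S b) 0). apply (IHf2 (fun n => S (r n)) (S a) (S b) 0).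
  - apply Udef_and; auto.
  - unfold dense_below. apply Udef_all, Udef_imp; [ud|]. apply Udef_ex, Udef_and; [ud|]. apply Udef_or. apply (IHf1 (fun n => S (S (r n))) (S (S a)) (S (S b)) 0).
    apply (IHf2 (fun n => S (S (r n))) (S (S a)) (S (S b)) 0).
  - apply Udef_all. eapply Udef_iff; [|apply (IHf (up r) (S a) (S b) (S c))].
    intros M E v. cbv beta. replace (fun n => v (up r n)) with (push (v 0) (fun n => tl v (r n))). reflexivity.
    extensionality n; destruct n; reflexivity.
  - unfold dense_below. apply Udef_all, Udef_imp; [ud|]. apply Udef_ex, Udef_and; [ud|]. apply Udef_ex.
    eapply Udef_iff; [|apply (IHf (up (fun n => S (S (r n)))) (S (S (S a))) (S (S (S b))) 1)].
    intros M E v. cbv beta. replace (fun n => v (up (fun n => S (S (r n))) n)) with (push (v 0) (fun n => tl (tl (tl v)) (r n))). reflexivity.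
    extensionality n; destruct n; reflexivity.
Qed.
Lemma Udef_is_check i j k : Udef (fun M E v => is_check E (v i) (v j) (v k)).
Proof. unfold is_check. ud. Qed.
#[global] Hint Resolve Udef_is_check : ud.
Lemma Udef_has_levinski_extension i : Udef (fun M E v => has_levinski_extension E (v i)).
Proof.
  unfold has_levinski_extension, forcing_notion, cofinality_preserving. ud.
  - apply (Udef_forcing (sel2 0 1) 6 5 4 (Poly_is_cof 0 1)).
  - apply (Udef_forcing (fun _ => 0) 3 2 1 (Poly_strict_levinski 0)).
  - apply (Udef_forcing (fun _ => 0) 3 2 1 (Poly_weakly_compact 0)).
Qed.

(** * A countable Skolem hull and its enumeration *)

Section SkolemHull.
Variables (M : Type) (E : M -> M -> Prop) (m0 : M).

Fixpoint bd (f : formula) : nat :=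
  match f with
  | fmem i j | feq i j => S (max i j)
  | ffalse => 0
  | fimp f g => max (bd f) (bd g)
  | fall f => bd f
  end.
Lemma sat_bd f : forall v w, (forall n, n < bd f -> v n = w n) -> (sat E v f <-> sat E w f).
Proof.
  induction f; intros v w H; simpl in *.
  - rewrite !H by lia. tauto.
  - rewrite !H by lia. tauto.
  - tauto.
  - rewrite (IHf1 v w), (IHf2 v w). tauto. intros; apply H; lia. intros; apply H; lia.
  - split; intros K x; apply (IHf (push x v) (push x w)); auto; intros [|n] Hn; simpl; auto; apply H; lia.
Qed.

Inductive tree := Leaf | Node (a b : tree).

(** [k] is fuel. The first component of the pair tells leaf from node, the second packs the codes of
    both subtrees. *)
Fixpoint tree_dec (k n : nat) : tree :=
  match k with
  | 0 => Leaf
  | S k => match Cantor.of_nat n with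
    | (0, _) => Leaf
    | (S _, m) => let (a, b) := Cantor.of_nat m in Node (tree_dec k a) (tree_dec k b)
    end
  end.
Lemma tree_dec_surj t : exists k, forall k', k <= k' -> exists n, tree_dec k' n = t.
Proof.
  induction t as [|a (k1 & A) b (k2 & B)].
  - exists 0. intros [|k] _. exists 0; auto. exists 0. reflexivity.
  - exists (S (max k1 k2)). intros [|k] Hk. lia. destruct (A k) as (n & Hn). lia. destruct (B k) as (m & Hm). lia.
    exists (Cantor.to_nat (1, Cantor.to_nat (n, m))). cbn [tree_dec]. rewrite !Cantor.cancel_of_to. subst; auto.
Qed.
Definition tree_of (n : nat) : tree := let (k, m) := Cantor.of_nat n in tree_dec k m.
Lemma tree_of_surj t : exists n, tree_of n = t.
Proof.
  destruct (tree_dec_surj t) as (k & H). destruct (H k) as (n & Hn). lia.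
  exists (Cantor.to_nat (k, n)). unfold tree_of. rewrite Cantor.cancel_of_to. auto.
Qed.

Fixpoint tnat (t : tree) : nat := match t with Leaf => 0 | Node _ b => S (tnat b) end.
Lemma tnat_surj n : exists t, tnat t = n.
Proof. induction n as [|n (t & <-)]. exists Leaf; auto. exists (Node Leaf t); auto. Qed.
(** A total decoding in which ill-formed trees yield arbitrary formulas. Trees thus code numbers,
    formulas and hull elements alike, and one enumeration suffices. *)
Fixpoint tform (t : tree) : formula :=
  match t with
  | Leaf => ffalse
  | Node _ Leaf => ffalse
  | Node c (Node a b) => match tnat c with
    | 0 => fmem (tnat a) (tnat b)
    | 1 => feq (tnat a) (tnat b)
    | 2 => fimp (tform a) (tform b)
    | _ => fall (tform a)
    end
  end.
Lemma tform_surj f : exists t, tform t = f.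
Proof.
  induction f as [i j|i j| |f (a & <-) g (b & <-)|f (a & <-)].
  - destruct (tnat_surj i) as (a & <-), (tnat_surj j) as (b & <-), (tnat_surj 0) as (c & Hc).
    exists (Node c (Node a b)). simpl. rewrite Hc. auto.
  - destruct (tnat_surj i) as (a & <-), (tnat_surj j) as (b & <-), (tnat_surj 1) as (c & Hc).
    exists (Node c (Node a b)). simpl. rewrite Hc. auto.
  - exists Leaf. auto.
  - destruct (tnat_surj 2) as (c & Hc). exists (Node c (Node a b)). simpl. rewrite Hc. auto.
  - destruct (tnat_surj 3) as (c & Hc). exists (Node c (Node a Leaf)). simpl. rewrite Hc. auto.
Qed.

(* A tree codes at once an element of the hull and a finite sequence of such elements. *)
Fixpoint hull (t : tree) : M * (nat -> M) :=
  match t with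
  | Leaf => (m0, fun _ => m0)
  | Node a b => (epsilon (inhabits m0) (fun x => ~ sat E (push x (Datatypes.snd (hull b))) (tform a)),
                 push (Datatypes.fst (hull a)) (Datatypes.snd (hull b)))
  end.

Definition HN : Type := {x : M | exists t, x = Datatypes.fst (hull t)}.
Definition HE (x y : HN) : Prop := E (proj1_sig x) (proj1_sig y).
Definition hen (n : nat) : HN := exist _ (Datatypes.fst (hull (tree_of n))) (ex_intro _ (tree_of n) eq_refl).
Lemma HN_eq (x y : HN) : proj1_sig x = proj1_sig y -> x = y.
Proof. destruct x as [x p], y as [y q]; simpl; intros ->; f_equal; apply proof_irrelevance. Qed.
Lemma hen_surj x : exists n, hen n = x.
Proof.
  destruct x as [x (t & Ht)]. destruct (tree_of_surj t) as (n & Hn). exists n. apply HN_eq. simpl. rewrite Hn; auto.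
Qed.
Lemma hull_seq (v : nat -> HN) k : exists b, forall n, n < k -> Datatypes.snd (hull b) n = proj1_sig (v n).
Proof.
  revert v. induction k; intros v.
  - exists Leaf. lia.
  - destruct (IHk (tl v)) as (b & B). destruct (v 0) as [x (t & Ht)] eqn:E0. exists (Node t b).
    intros [|n] Hn; simpl. rewrite E0; simpl; auto. rewrite B by lia. auto.
Qed.
(** The Tarski-Vaught criterion for ∀: a universal statement false in [M] has its chosen
    counterexample in the hull. Only the finitely many parameters below [bd f] matter, and a tree
    can list these. *)
Lemma hull_elementary f : forall v, sat HE v f <-> sat E (fun n => proj1_sig (v n)) f.
Proof.
  assert (PS : forall x (v : nat -> HN), (fun n => proj1_sig (push x v n)) = push (proj1_sig x) (fun n => proj1_sig (v n))).
  { intros x v. extensionality n. destruct n; auto. }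
  induction f; intros v; simpl.
  - reflexivity.
  - split; [intros ->; auto|apply HN_eq].
  - tauto.
  - rewrite IHf1, IHf2. tauto.
  - split.
    + intros H. destruct (hull_seq v (bd f)) as (b & B). destruct (tform_surj f) as (a & A).
      assert (J : forall x, sat E (push x (fun n => proj1_sig (v n))) f <-> sat E (push x (Datatypes.snd (hull b))) f).
      { intros x. apply sat_bd. intros [|n] Hn; simpl; auto. symmetry; apply B; lia. }
      apply NNPP. intros N. apply not_all_ex_not in N as (x & N).
      assert (K : ~ sat E (push (Datatypes.fst (hull (Node a b))) (Datatypes.snd (hull b))) f).
      { simpl. rewrite A. apply (epsilon_spec (inhabits m0) (fun x => ~ sat E (push x (Datatypes.snd (hull b))) f)).
        exists x. rewrite <- J. auto. }
      apply K. apply J. specialize (H (exist _ (Datatypes.fst (hull (Node a b))) (ex_intro _ (Node a b) eq_refl))).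
      apply IHf in H. rewrite PS in H. exact H.
    + intros H x. apply IHf. rewrite PS. apply H.
Qed.
Lemma hull_Udef phi v : Udef phi -> (phi HN HE v <-> phi M E (fun n => proj1_sig (v n))).
Proof. intros (f & F). rewrite !F. apply hull_elementary. Qed.

Definition h0 : HN := exist _ m0 (ex_intro _ Leaf eq_refl).

(** Single axioms transfer as sentences, the schemes instance by instance with the environment of
    the hull as parameters. *)
Lemma hull_ZFC : ZFC E -> ZFC HE.
Proof.
  intros Z.
  assert (tr : forall phi, Udef phi -> phi M E (fun _ => m0) -> phi HN HE (fun _ => h0)).
  { intros phi H K. apply hull_Udef; auto. }
  split.
  - refine (tr (fun M E v => forall x y, (forall z, E z x <-> E z y) -> x = y) _ (@Defs.extensionality _ _ Z)). ud.
  - refine (tr (fun M E v => forall x, (exists y, E y x) -> exists y, E y x /\ forall z, E z y -> ~ E z x) _ (@Defs.foundation _ _ Z)). ud.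
  - refine (tr (fun M E v => forall x y, exists z, forall w, E w z <-> w = x \/ w = y) _ (@Defs.pairing _ _ Z)). ud.
  - refine (tr (fun M E v => forall x, exists u, forall z, E z u <-> exists y, E z y /\ E y x) _ (@Defs.union _ _ Z)). ud.
  - refine (tr (fun M E v => forall x, exists p, forall z, E z p <-> forall w, E w z -> E w x) _ (@Defs.power_set _ _ Z)). ud.
  - refine (tr (fun M E v => exists w, @is_omega (truth E) w) _ (@Defs.infinity _ _ Z)). ud.
  - intros f v. apply (@hull_Udef (fun M E v => forall a, exists b, forall x, E x b <-> E x a /\ sat E (push x v) f)).
    ud; apply (Udef_sat f (r := up (fun n => 2 + n))); intros ? ? [|n]; reflexivity.
    intros a. apply (@Defs.separation _ _ Z).
  - intros f v. apply (@hull_Udef (fun M E v => forall a, (forall x, E x a -> exists! y, sat E (push x (push y v)) f) ->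
      exists b, forall y, E y b <-> exists x, E x a /\ sat E (push x (push y v)) f)).
    ud.
    + apply (Udef_sat f (r := fun n => match n with 0 => 1 | 1 => 0 | S (S n) => 3 + n end)); intros ? ? [|[|n]]; reflexivity.
    + apply (Udef_sat f (r := fun n => match n with 0 => 2 | 1 => 0 | S (S n) => 4 + n end)); intros ? ? [|[|n]]; reflexivity.
    + apply (Udef_sat f (r := fun n => match n with 0 => 0 | 1 => 1 | S (S n) => 4 + n end)); intros ? ? [|[|n]]; reflexivity.
    + apply (Udef_sat f (r := fun n => match n with 0 => 0 | 1 => 1 | S (S n) => 4 + n end)); intros ? ? [|[|n]]; reflexivity.
    + intros a. apply (@Defs.replacement _ _ Z).
  - refine (tr (fun M E v => forall a, (forall x, E x a -> exists y, E y x) ->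
      (forall x y z, E x a -> E y a -> E z x -> E z y -> x = y) -> exists c, forall x, E x a -> exists! y, E y x /\ E y c) _ (@Defs.choice _ _ Z)).
    ud.
Qed.
End SkolemHull.

Theorem theorem5p6 (M : Type) (E : M -> M -> Prop) (kappa : M) :
  ZFC E ->
  @weakly_compact (truth E) kappa ->
  @GCH (truth E) ->
  exists P le one : M,
    forcing_notion E P le one /\
    cofinality_preserving E P le one /\
    exists kappa' : M,
      is_check E one kappa' kappa /\
      @strict_levinski (forcing E P le) kappa' one /\
      @weakly_compact (forcing E P le) kappa' one.
Proof.
  intros Z wc gch. change (has_levinski_extension E kappa).
  (* The hull is generated from [kappa], so [h0] is [kappa] itself and the statements about it can
     be moved down and the conclusion back up. *)
  apply (@hull_Udef M E kappa _ (fun _ => h0 E kappa) (Udef_has_levinski_extension 0)).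
  apply (@hull_ZFC M E kappa) in Z.
  apply (@hull_Udef M E kappa _ (fun _ => h0 E kappa) (Udef_weakly_compact 0)) in wc.
  apply (@hull_Udef M E kappa _ (fun _ => h0 E kappa) Udef_GCH) in gch.
  assert (ZF' : ZF (@HE M E kappa)) by (split; apply Z).
  set (V := Model ZF').
  assert (ac : AC V) by exact (@Defs.choice _ _ Z).
  apply (@countable_case V ac (@hen M E kappa) (h0 E kappa)).
  - apply hen_surj.
  - apply weakly_compact_WC; auto.
  - apply GCH_GCHm; auto.
Qed.
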